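(* Let $B$ be a ball centered on $\Gamma$. Let $u\in W_r(2B)$ be a non-negative subsolution in $2B\setminus\Gamma$ such that $Tu=0$ $\sigma$-a.e. on $\Gamma\cap2B$. Then $$\sup_Bu\ \le\ C\Big(\frac1{m(2B)}\int_{2B}u^2\,dm\Big)^{1/2},$$ where $C$ depends only on the dimensions $d$ and $n$ and the constants $C_0$ and $C_1$.
   Context: Let $n\ge2$ and let $0<d<n-1$ be a real number. $\Gamma\subset\mathbb R^n$ is a nonempty closed set which is Ahlfors regular of dimension $d$: there is $C_0\ge1$ with $C_0^{-1}r^d\le\mathcal H^d(\Gamma\cap B(x,r))\le C_0r^d$ for all $x\in\Gamma$, $r>0$. Set $\Omega=\mathbb R^n\setminus\Gamma$, $\sigma=\mathcal H^d|_\Gamma$, $\delta(z)=\operatorname{dist}(z,\Gamma)$, $w(z)=\delta(z)^{d+1-n}$, $dm=w\,dz$ and $m(E)=\int_Ew\,dz$. $\lambda B$ is the ball with the same center as $B$ and $\lambda$ times its radius. $\sup$ means essential supremum. $W=\{u\in L^1_{loc}(\Omega):\nabla u\in L^2(\Omega,w)\}$ (distributional gradient in $\Omega$; $L^2(\Omega,w)=L^2(\Omega,w\,dz)$); every $u\in W$ lies in $L^1_{loc}(\mathbb R^n)$. For an open set $E\subset\mathbb R^n$, $W_r(E)=\{f\in L^1_{loc}(E):\varphi f\in W\text{ for all }\varphi\in C_0^\infty(E)\}$, with $\varphi f$ extended by $0$. For $u\in W_r(E)$ the trace on $\Gamma\cap E$ is $Tu(x)=\lim_{r\to0}\frac1{|B(x,r)|}\int_{B(x,r)}u\,dz$,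 which exists for $\sigma$-a.e. $x\in\Gamma\cap E$. $A:\Omega\to M_n(\mathbb R)$ is measurable and satisfies, for some $C_1\ge1$, $|A(x)\xi\cdot\zeta|\le C_1w(x)|\xi||\zeta|$ and $A(x)\xi\cdot\xi\ge C_1^{-1}w(x)|\xi|^2$ for all $x\in\Omega$, $\xi,\zeta\in\mathbb R^n$; $L=-\operatorname{div}A\nabla$. For an open set $E\subset\Omega$, $u\in W_r(E)$ is a subsolution in $E$ if $\int_\Omega A\nabla u\cdot\nabla\varphi\,dz\le0$ for all $\varphi\in C_0^\infty(E)$ with $\varphi\ge0$. *)

(* Defs.v *)
From HB Require Import structures.
From mathcomp Require Import all_boot all_order all_algebra.
From mathcomp Require Import all_classical all_reals all_analysis.

Set Implicit Arguments.
Unset Strict Implicit.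
Unset Printing Implicit Defensive.

Import Order.TTheory GRing.Theory Num.Theory.
Import numFieldNormedType.Exports.

Local Open Scope classical_set_scope.
Local Open Scope ring_scope.

(* Lebesgue measure on R^n; the library only has the case n = 1.  It is first
   built on n-tuples as an iterated product of [lebesgue_measure], then completed
   and carried over to the row vectors ['rV[R]_n], on which the library defines
   topology, norm and derivatives. *)

Section lebesgue_tuple.
Context {R : realType}.
Local Notation mR := (measurableTypeR R).

Definition consT n (x : mR * n.-tuple mR) : n.+1.-tuple mR :=
  [tuple of x.1 :: x.2].

Lemma measurable_consT n : measurable_fun [set: mR * n.-tuple mR] (@consT n).
Proof. exact: (measurable_cons measurable_fst measurable_snd). Qed.

Section step.
Variables (n : nat) (mu : {sigma_finite_measure set (n.-tuple mR) -> \bar R}).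

Definition leb_step : set (n.+1.-tuple mR) -> \bar R :=
  pushforward (@lebesgue_measure R \x mu)%E (@consT n).

Let leb_step0 : leb_step set0 = 0%E.
Proof. by rewrite /leb_step /pushforward preimage_set0 measure0. Qed.

Let leb_step_ge0 A : (0 <= leb_step A)%E.
Proof. by rewrite /leb_step /pushforward; apply: measure_ge0. Qed.

Let leb_step_sigma_additive : semi_sigma_additive leb_step.
Proof.
move=> F mF tF mUF; rewrite /leb_step /pushforward preimage_bigcup.
have mpre A : measurable A -> measurable (@consT n @^-1` A).
  by move=> mA; rewrite -[X in measurable X]setTI; exact: measurable_consT.
apply: measure_semi_sigma_additive.
- by move=> k; exact: mpre.
- apply/trivIsetP => i j _ _ ij; rewrite -preimage_setI.
  by move/trivIsetP : tF => /(_ _ _ _ _ ij) ->//; rewrite preimage_set0.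
- by rewrite -preimage_bigcup; exact: mpre.
Qed.

HB.instance Definition _ := isMeasure.Build _ _ _ leb_step
  leb_step0 leb_step_ge0 leb_step_sigma_additive.

Let leb_step_sigma_finite : sigma_finite setT leb_step.
Proof.
have /sigma_finiteP[F [FT ndF Foo]] := sigma_finiteT (@lebesgue_measure R).
have /sigma_finiteP[G [GT ndG Goo]] := sigma_finiteT mu.
pose g (t : n.+1.-tuple mR) : n.-tuple mR := [tuple of behead t].
have mthead : measurable_fun setT (fun t : n.+1.-tuple mR => tnth t ord0).
  exact: (@measurable_tnth _ mR n.+1 ord0).
have mg : measurable_fun setT g by exact: (@measurable_behead _ mR n).
exists (fun k => (fun t => tnth t ord0) @^-1` F k `&` g @^-1` G k).
  rewrite predeqE => t; split=> // _.
  have [i _ Fi] : (\bigcup_i F i) (tnth t ord0) by rewrite -FT.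
  have [j _ Gj] : (\bigcup_i G i) (g t) by rewrite -GT.
  exists (maxn i j) => //; split.
  - by have /subsetPset : (F i <= F (maxn i j))%O;
      [exact/ndF/leq_maxl|apply].
  - by have /subsetPset : (G j <= G (maxn i j))%O;
      [exact/ndG/leq_maxr|apply].
move=> k; have [mF Fk] := Foo k; have [mG Gk] := Goo k; split.
  apply: measurableI.
  - by rewrite -[X in measurable X]setTI; exact: mthead.
  - by rewrite -[X in measurable X]setTI; exact: mg.
rewrite /leb_step /pushforward.
rewrite (_ : _ @^-1` _ = F k `*` G k); last first.
  rewrite predeqE => -[a t].
  have gt : g (consT (a, t)) = t by exact/val_inj.
  change (F k a /\ G k (g (consT (a, t))) <-> F k a /\ G k t).
  by rewrite gt.
by rewrite product_measure1E// lte_mul_pinfty// ge0_fin_numE.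
Qed.

HB.instance Definition _ := Measure_isSigmaFinite.Build _ _ _ leb_step
  leb_step_sigma_finite.

End step.

Fixpoint leb_tuple n : {sigma_finite_measure set (n.-tuple mR) -> \bar R} :=
  match n with
  | 0 => [the {sigma_finite_measure set (0.-tuple mR) -> \bar R} of
           @dirac _ (0.-tuple mR) [tuple] R]
  | n'.+1 => [the {sigma_finite_measure set (n'.+1.-tuple mR) -> \bar R} of
           leb_step (leb_tuple n')]
  end.

End lebesgue_tuple.

Section lebesgue_rV.
Variables (R : realType) (n : nat).

Definition rV_of_tuple (t : n.-tuple (measurableTypeR R)) : 'rV[R]_n :=
  \row_i tnth t i.

Definition leb_outer (A : set 'rV[R]_n) : \bar R :=
  ((leb_tuple n)^*)%mu (rV_of_tuple @^-1` A).

Let leb_outer0 : leb_outer set0 = 0%E.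
Proof. by rewrite /leb_outer preimage_set0 outer_measure0. Qed.

Let leb_outer_ge0 A : (0 <= leb_outer A)%E.
Proof. exact: outer_measure_ge0. Qed.

Let le_leb_outer : {homo leb_outer : A B / A `<=` B >-> (A <= B)%E}.
Proof. by move=> A B AB; apply: le_outer_measure => t; exact: AB. Qed.

Let leb_outer_sigma_subadditive : sigma_subadditive leb_outer.
Proof.
by move=> F; rewrite /leb_outer preimage_bigcup;
  exact: outer_measure_sigma_subadditive.
Qed.

HB.instance Definition _ := isOuterMeasure.Build R 'rV[R]_n leb_outer
  leb_outer0 leb_outer_ge0 le_leb_outer leb_outer_sigma_subadditive.

Definition leb_outer_measure : {outer_measure set 'rV[R]_n -> \bar R} :=
  leb_outer.

(* ['rV[R]_n] with the sigma-algebra of Lebesgue measurable sets *)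
Definition lebT := caratheodory_type leb_outer_measure.

HB.instance Definition _ := Measurable.on lebT.

Definition leb : {measure set lebT -> \bar R} :=
  [the {measure set (caratheodory_type leb_outer_measure) -> \bar R} of
     (leb_outer_measure : set (caratheodory_type leb_outer_measure) -> \bar R)].

End lebesgue_rV.

Section euclidean.
Context {R : realType} {n : nat}.
Implicit Types (x y z : 'rV[R]_n) (E U : set 'rV[R]_n).

(* The library norm of ['rV[R]_n] is the sup norm; it induces the same
   topology as the Euclidean norm [enorm]. *)
Definition dot x y : R := \sum_i x 0 i * y 0 i.

Definition enorm x : R := Num.sqrt (dot x x).

Definition eball x (r : R) : set 'rV[R]_n := [set y | enorm (y - x) < r].

(* the row-vector form of the matrix-vector product [M v] *)
Definition mxapp (M : 'M[R]_n) (v : 'rV[R]_n) : 'rV[R]_n := v *m M^T.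

Definition ediam U : \bar R :=
  ereal_sup [set z | exists x y, [/\ U x, U y & z = (enorm (x - y))%:E]].

(* Here [d] is positive, so that the empty set contributes
   [ediam set0 `^ d = -oo `^ d = 0] to the sums. *)
Definition hausdorff_pre (d delta : R) E : \bar R :=
  ereal_inf [set (\sum_(0 <= k <oo) (ediam (U k) `^ d))%E
    | U in [set U : (set 'rV[R]_n)^nat |
        E `<=` \bigcup_k U k /\ forall k, (ediam (U k) <= delta%:E)%E]].

Definition hausdorff (d : R) E : \bar R :=
  ereal_sup [set hausdorff_pre d delta E | delta in [set delta | 0 < delta]].

Definition dist (Gamma : set 'rV[R]_n) z : R :=
  inf [set enorm (z - y) | y in Gamma].

Definition ahlfors_regular (d C0 : R) (Gamma : set 'rV[R]_n) : Prop :=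
  forall x r, Gamma x -> 0 < r ->
    ((C0^-1 * r `^ d)%:E <= hausdorff d (Gamma `&` eball x r))%E /\
    (hausdorff d (Gamma `&` eball x r) <= (C0 * r `^ d)%:E)%E.

Definition partial (i : 'I_n) (f : 'rV[R]_n -> R) : 'rV[R]_n -> R :=
  fun z => 'D_(delta_mx 0 i) f z.

Definition grad (f : 'rV[R]_n -> R) z : 'rV[R]_n := \row_i partial i f z.

Fixpoint Ck (k : nat) (f : 'rV[R]_n -> R) : Prop :=
  match k with
  | 0 => continuous f
  | k'.+1 => continuous f /\
      forall i, (forall z, derivable f z (delta_mx 0 i)) /\ Ck k' (partial i f)
  end.

(* [C_0^infty(E)], its members being extended by 0 to the whole space *)
Definition test_fun E (phi : 'rV[R]_n -> R) : Prop :=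
  [/\ forall k, Ck k phi,
      compact (closure [set z | phi z != 0]) &
      closure [set z | phi z != 0] `<=` E].

Definition L1loc E (f : 'rV[R]_n -> R) : Prop :=
  forall K : set 'rV[R]_n, compact K -> K `<=` E ->
    (@leb R n).-integrable K (fun z => (f z)%:E).

Definition weak_grad E (u : 'rV[R]_n -> R) (g : 'rV[R]_n -> 'rV[R]_n) : Prop :=
  [/\ L1loc E u,
      forall i, L1loc E (fun z => g z 0 i) &
      forall phi, test_fun E phi -> forall i,
        \int[@leb R n]_(z in E) (u z * partial i phi z) =
        - \int[@leb R n]_(z in E) (g z 0 i * phi z)].

Definition ess_sup_on E (u : 'rV[R]_n -> R) : \bar R :=
  ereal_inf [set y : \bar R | \forall z \ae @leb R n, E z -> ((u z)%:E <= y)%E].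

Definition avg (u : 'rV[R]_n -> R) E : R :=
  (fine (@leb R n E))^-1 * \int[@leb R n]_(z in E) u z.

Definition has_trace (u : 'rV[R]_n -> R) x (l : R) : Prop :=
  avg u (eball x r) @[r --> 0^'+] --> l.

End euclidean.

Section degenerate_elliptic.
Context {R : realType} {n : nat}.
Variables (d : R) (Gamma : set 'rV[R]_n).
Implicit Types (E : set 'rV[R]_n) (u : 'rV[R]_n -> R).

Definition sigma E : \bar R := hausdorff d (Gamma `&` E).

Definition weight (z : 'rV[R]_n) : R := dist Gamma z `^ (d + 1 - n%:R).

Definition wmeas E : \bar R := (\int[@leb R n]_(z in E) (weight z)%:E)%E.

Definition W u : Prop :=
  exists g, weak_grad (~` Gamma) u g /\
    (@leb R n).-integrable (~` Gamma)
      (fun z => (enorm (g z) ^+ 2 * weight z)%:E).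

Definition Wr E u : Prop :=
  L1loc E u /\ forall phi, test_fun E phi -> W (fun z => phi z * u z).

(* [Tu = 0] sigma-a.e. on [Gamma `&` E]; [sigma] is an outer measure, so that
   every subset of a null set is null. *)
Definition zero_trace E u : Prop :=
  sigma [set x | E x /\ ~ has_trace u x 0] = 0%E.

Definition elliptic (C1 : R) (A : 'rV[R]_n -> 'M[R]_n) : Prop :=
  [/\ forall i j, measurable_fun (~` Gamma : set (lebT R n)) (fun z => A z i j),
      forall z xi zeta, ~ Gamma z ->
        `|dot (mxapp (A z) xi) zeta| <= C1 * weight z * enorm xi * enorm zeta &
      forall z xi, ~ Gamma z ->
        C1^-1 * weight z * enorm xi ^+ 2 <= dot (mxapp (A z) xi) xi].

(* [u] determines [g] almost everywhere in [E], and [grad phi] vanishes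
   outside [E], so the integral does not depend on the choice of [g]. *)
Definition subsolution (A : 'rV[R]_n -> 'M[R]_n) E u : Prop :=
  Wr E u /\
  exists g, weak_grad E u g /\
    forall phi, test_fun E phi -> (forall z, 0 <= phi z) ->
      \int[@leb R n]_(z in ~` Gamma) dot (mxapp (A z) (g z)) (grad phi z) <= 0.

End degenerate_elliptic.

(* Main.v *)
From HB Require Import structures.
Require Import Defs.
From mathcomp Require Import all_boot all_order all_algebra.
From mathcomp Require Import all_classical all_reals all_analysis.
From mathcomp Require Import measurable_realfun ring lra.
Set Implicit Arguments.
Unset Strict Implicit.
Unset Printing Implicit Defensive.
Import Order.TTheory GRing.Theory Num.Theory.
Import numFieldNormedType.Exports.
Local Open Scope classical_set_scope.
Local Open Scope ring_scope.

(**
De Giorgi iteration, run directly on balls centered on [Gamma].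

Since the [e]-neighbourhood of [Gamma] has volume [O(e ^ (n - d))] with [n - d > 1], bounded
functions of [u] have a weak gradient across [Gamma]. For functions [v] of zero trace one has the
Hardy inequality [int v^2 delta^-2 w <= C int |grad v|^2 w]: in each dyadic layer around [Gamma],
[v] is compared, along averages over shrinking balls, with its trace at a point of [Gamma] near
which the energy is small at every scale, and a covering argument shows that most points of
[Gamma] have this property. Hardy's inequality near [Gamma] and the translation estimate
[int (v(z + h) - v(z))^2 <= C |h|^2 int |grad v|^2] away from it give the Faber-Krahn inequality
[int v^2 w <= C |{v <> 0}|^(2/n) int |grad v|^2 w], which takes the place of the Sobolev inequality.
Hardy's inequality also lets the cut-offs near [Gamma] disappear in the Caccioppoli inequality,
which therefore holds up to [Gamma].
*)

(** * Lebesgue measure on the Borel sets of row vectors *)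

(** Two exponents shape the argument. A covering of [Gamma] controls energies only with a weight
    delta^(-kappa), kappa > 0, because on a small ball centred on [Gamma] delta is bounded above,
    not below; the available energy carries w = delta^(d+1-n). The factorisation w = delta^(-kappa)
    delta^(-(1-theta)) with 0 < theta < 1 reconciles the two: the gain l^theta makes the sum over
    the scales below l converge, the loss 1 - theta makes the sum over the layers around [Gamma]
    converge. Such a theta exists exactly because d < n - 1. Sizes of superlevel sets are Lebesgue
    volumes: inside 2B the weight is at least (2 r)^(d+1-n), so Chebyshev's inequality bounds these
    volumes by the weighted L^2 norm. The analysis is done with Borel functions on [bT], where [mu]
    is sigma-finite and Fubini is available; [u], its gradient and [A], which are only Lebesgue
    measurable, are replaced by Borel versions off one null set at the very end. Derivatives of
    convolutions come from quadratic error bounds, not from exchanging limits and integrals. *)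

Lemma measurable_preim d1 d2 (T1 : measurableType d1) (T2 : measurableType d2)
    (f : T1 -> T2) (A : set T2) :
  measurable_fun setT f -> measurable A -> measurable (f @^-1` A).
Proof. by move=> mf mA; rewrite -[X in measurable X]setTI; exact: mf. Qed.

Section lebesgue_tuple_theory.
Context {R : realType}.
Local Notation mR := (measurableTypeR R).
Local Notation leb1 := (@lebesgue_measure R).

Lemma lebesgue_measure_shift (h : R) (A : set mR) : measurable A ->
  leb1 ((fun x => x + h) @^-1` A) = leb1 A.
Proof.
have ms : measurable_fun [set: mR] ((fun x : R => x + h) : mR -> mR).
  exact: measurable_funD.
move=> mA; apply/esym.
apply: (@lebesgue_measure_unique _ (pushforward leb1 ((fun x : R => x + h) : mR -> mR))) => //.
move=> _ [[a b]] _ <-.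
have E : (fun x => x + h) @^-1` `](a, b).1, (a, b).2] = `]a - h, b - h]%classic.
  by apply/seteqP; split => x /=; rewrite !in_itv/= ltrBlDr lerBrDr.
change (leb1 `]a, b]%classic = leb1 ((fun x => x + h) @^-1` `](a, b).1, (a, b).2]%classic));
  rewrite E.
by rewrite !lebesgue_measure_itv/= !lte_fin ltrD2r; case: ifP => // _; rewrite -!EFinD;
  congr (_%:E); ring.
Qed.

Lemma ge0_integral_lebesgue_shift (h : R) (f : mR -> \bar R) :
  measurable_fun setT f -> (forall x, 0 <= f x)%E ->
  (\int[leb1]_x f (x + h)%R = \int[leb1]_x f x)%E.
Proof.
have ms : measurable_fun [set: mR] ((fun x : R => x + h) : mR -> mR).
  exact: measurable_funD.
move=> mf f0.
rewrite [RHS](@eq_measure_integral _ mR R setT (pushforward leb1 ((fun x : R => x + h) : mR ->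
  mR))).
  by rewrite ge0_integral_pushforward.
by move=> A mA _ /=; rewrite /pushforward; exact/esym/lebesgue_measure_shift.
Qed.

(** The shift is a sequence indexed by [nat], not a tuple, so that an induction on [n] can drop its
    first entry by passing to [h \o S]. *)
Definition tshift n (h : nat -> R) (t : n.-tuple mR) : n.-tuple mR :=
  [tuple tnth t i + h i | i < n].

(** By induction on [n]: the section of the shifted set over [x] is the shift of the section over
    [x + h 0]. The induction hypothesis removes the shift in the tail, invariance of the
    one-dimensional integral the one in the head. *)
Lemma leb_tuple_shift n (h : nat -> R) (A : set (n.-tuple mR)) : measurable A ->
  leb_tuple n (@tshift n h @^-1` A) = leb_tuple n A.
Proof.
elim: n h A => [|n IH] h A mA.
  by congr (_ _); apply/seteqP; split => t; rewrite /preimage/= (tuple0 (tshift h t)) (tuple0 t).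
have mc B : measurable B -> measurable (@consT R n @^-1` B).
  by move=> mB; rewrite -[X in measurable X]setTI; exact: measurable_consT.
rewrite /= /leb_step /pushforward.
have -> : @consT R n @^-1` (tshift h @^-1` A) =
   (fun p : mR * n.-tuple mR => (p.1 + h 0%N, tshift (h \o S) p.2)) @^-1` (@consT R n @^-1` A).
  apply/seteqP; split => -[x t]; rewrite /preimage/=;
  (have -> : tshift h (consT (x, t)) = consT (x + h 0%N, tshift (h \o S) t)); try done.
    apply: eq_from_tnth => i; rewrite tnth_mktuple.
    case: (unliftP ord0 i) => [j ->|->]; last by [].
    by rewrite !tnthS tnth_mktuple.
  apply: eq_from_tnth => i; rewrite tnth_mktuple.
  case: (unliftP ord0 i) => [j ->|->]; last by [].
  by rewrite !tnthS tnth_mktuple.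
set B := _ @^-1` A.
have mB : measurable B by exact: mc.
rewrite /product_measure1 /=.
transitivity (\int[leb1]_x (leb_tuple n (xsection B (x + h 0%N)%R)))%E.
  apply: eq_integral => x _ /=.
  have mX y : measurable (xsection B y) by exact: measurable_xsection.
  rewrite -[RHS](IH (h \o S))//.
apply: (@ge0_integral_lebesgue_shift (h 0%N) (fun x => leb_tuple n (xsection B x))) => //.
exact: measurable_fun_xsection.
Qed.

Definition tbox n (A : nat -> set R) : set (n.-tuple mR) :=
  [set t | forall i : 'I_n, A i (tnth t i)].

Lemma measurable_tbox n A : (forall i, measurable (A i : set mR)) ->
  measurable (tbox (n := n) A).
Proof.
move=> mA; rewrite (_ : tbox A = \bigcap_(i : 'I_n) ((fun t => tnth t i) @^-1` (A i))).
  apply: fin_bigcap_measurable => // i _.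
  by rewrite -[X in measurable X]setTI; exact: measurable_tnth.
by apply/seteqP; split => t /= H i; [move=> _|]; exact: H.
Qed.

Lemma leb_tuple_tbox n A : (forall i, measurable (A i : set mR)) ->
  leb_tuple n (tbox A) = (\prod_(i < n) leb1 (A i))%E.
Proof.
elim: n A => [|n IH] A mA.
  by rewrite big_ord0 /= diracE mem_set// => -[].
rewrite big_ord_recl -(IH (A \o S))//= /leb_step /pushforward.
rewrite (_ : _ @^-1` _ = A 0%N `*` tbox (A \o S)); last first.
  apply/seteqP; split => -[x t] /=.
    by move=> H; split; [exact: (H ord0)|move=> i /=; have := H (lift ord0 i);
      rewrite /consT tnthS].
  by move=> [H0 H] i; case: (unliftP ord0 i) => [j ->|-> //]; rewrite /consT tnthS; exact: H.
by rewrite product_measure1E//; apply: measurable_tbox => i; exact: mA.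
Qed.

End lebesgue_tuple_theory.

Section borel_rV.
Variables (R : realType) (n : nat).
Local Notation mR := (measurableTypeR R).
Local Notation leb1 := (@lebesgue_measure R).

Definition bT := 'rV[R]_n.
HB.instance Definition _ := Pointed.on bT.

(** Transported from tuples and, unlike the sigma-algebra of [lebT], not completed. It is generated
    by the coordinates, so that maps into it are measurable coordinatewise and functions such as f
    (x + y) are measurable on products, as Fubini requires. *)
Definition borel_rV : set (set bT) :=
  [set A | measurable (@rV_of_tuple R n @^-1` A)].

Let borel_rV0 : borel_rV set0.
Proof. by rewrite /borel_rV/= preimage_set0. Qed.

Let borel_rVC A : borel_rV A -> borel_rV (~` A).
Proof. by rewrite /borel_rV/= preimage_setC; exact: measurableC. Qed.

Let borel_rVU (F : (set bT)^nat) : (forall i, borel_rV (F i)) ->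
  borel_rV (\bigcup_i F i).
Proof. by move=> mF; rewrite /borel_rV/= preimage_bigcup; exact: bigcupT_measurable. Qed.

HB.instance Definition _ := isMeasurable.Build
  (measure_tuple_display default_measure_display) bT borel_rV0 borel_rVC borel_rVU.

Definition mu : set bT -> \bar R := pushforward (leb_tuple n) (@rV_of_tuple R n : _ -> bT).

Let mu0 : mu set0 = 0%E.
Proof. by rewrite /mu /pushforward preimage_set0 measure0. Qed.
Let mu_ge0 A : (0 <= mu A)%E.
Proof. exact: (measure_ge0 (leb_tuple n)). Qed.
Let mu_sigma_additive : semi_sigma_additive mu.
Proof.
move=> F mF tF mUF; rewrite /mu /pushforward preimage_bigcup.
apply: measure_semi_sigma_additive => //.
- apply/trivIsetP => /= i j _ _ ij; rewrite -preimage_setI.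
  by move/trivIsetP : tF => /(_ _ _ _ _ ij) ->//; rewrite preimage_set0.
Qed.
HB.instance Definition _ := isMeasure.Build _ _ _ mu mu0 mu_ge0 mu_sigma_additive.

Definition tuple_of_rV (z : bT) : n.-tuple mR := [tuple z 0 i | i < n].

Lemma rV_of_tupleK : cancel (@rV_of_tuple R n) tuple_of_rV.
Proof. by move=> t; apply: eq_from_tnth => i; rewrite tnth_mktuple mxE. Qed.

Lemma tuple_of_rVK : cancel tuple_of_rV (@rV_of_tuple R n).
Proof. by move=> z; apply/rowP => i; rewrite mxE tnth_mktuple. Qed.

Lemma measurable_fun_rV d (T : measurableType d) (f : T -> bT) :
  (forall i, measurable_fun setT (fun t => f t 0 i)) -> measurable_fun setT f.
Proof.
move=> mf _ A mA.
have mg : measurable_fun setT (tuple_of_rV \o f).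
  apply/measurable_fun_tnthP => i; apply: eq_measurable_fun (mf i) => t _ /=.
  by rewrite tnth_mktuple.
have := mg measurableT _ mA; rewrite !setTI.
by congr measurable; apply/seteqP; split => t; rewrite /preimage/= tuple_of_rVK.
Qed.

Lemma measurable_coord (i : 'I_n) : measurable_fun setT (fun z : bT => z 0 i).
Proof.
move=> _ A mA; rewrite setTI /measurable/= /borel_rV/= -comp_preimage.
rewrite (_ : _ \o _ = fun t => tnth t i); last by apply/funext => t /=; rewrite mxE.
by rewrite -[X in measurable X]setTI; exact: measurable_tnth.
Qed.

Lemma measurable_rV_comp d (T : measurableType d) (f : T -> bT) (i : 'I_n) :
  measurable_fun setT f -> measurable_fun setT (fun t => f t 0 i).
Proof. by move=> mf; exact: (measurableT_comp (measurable_coord i) mf). Qed.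

Lemma measurable_rVD d (T : measurableType d) (f g : T -> bT) :
  measurable_fun setT f -> measurable_fun setT g ->
  measurable_fun setT (fun t => f t + g t : bT).
Proof.
move=> mf mg; apply: measurable_fun_rV => i; under eq_fun do rewrite mxE.
by apply: measurable_funD; exact: measurable_rV_comp.
Qed.

Lemma measurable_rVN d (T : measurableType d) (f : T -> bT) :
  measurable_fun setT f -> measurable_fun setT (fun t => - f t : bT).
Proof.
move=> mf; apply: measurable_fun_rV => i; under eq_fun do rewrite mxE.
by apply: measurableT_comp => //; exact: measurable_rV_comp.
Qed.

Lemma measurable_shift (h : 'rV[R]_n) : measurable_fun setT (fun z : bT => z + h : bT).
Proof. by apply: measurable_rVD. Qed.

Lemma mu_shift (h : 'rV[R]_n) (A : set bT) : measurable A ->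
  mu ((fun z : bT => z + h : bT) @^-1` A) = mu A.
Proof.
move=> mA; rewrite /mu /pushforward.
pose h' k := if insub k is Some i then h 0 (i : 'I_n) else 0.
rewrite -[RHS](@leb_tuple_shift R n h')//; congr (leb_tuple n _).
apply/seteqP; split => t; rewrite /preimage/=;
  suff -> : rV_of_tuple t + h = rV_of_tuple (tshift h' t) by [];
  by apply/rowP => i; rewrite !mxE tnth_mktuple /h' valK.
Qed.

Lemma ge0_integral_shift (h : 'rV[R]_n) (f : bT -> \bar R) :
  measurable_fun setT f -> (forall x, 0 <= f x)%E ->
  (\int[mu]_x f (x + h)%R = \int[mu]_x f x)%E.
Proof.
move=> mf f0; have ms := measurable_shift h.
rewrite [RHS](@eq_measure_integral _ bT R setT (pushforward mu (fun z : bT => z + h : bT))) => //.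
  by rewrite (ge0_integral_pushforward ms).
by move=> A mA _ /=; rewrite /pushforward; exact/esym/mu_shift.
Qed.

Definition rbox (A : 'I_n -> set R) : set 'rV[R]_n := [set z | forall i, A i (z 0 i)].

Lemma measurable_rbox A : (forall i, measurable (A i : set mR)) -> measurable (rbox A : set bT).
Proof.
move=> mA; rewrite (_ : rbox A = \bigcap_(i : 'I_n) ((fun z : bT => z 0 i) @^-1` (A i))).
  apply: fin_bigcap_measurable => // i _.
  by apply: (measurable_preim (measurable_coord i)); exact: mA.
by apply/seteqP; split => t /= H i; [move=> _|]; exact: H.
Qed.

Lemma mu_rbox A : (forall i, measurable (A i : set mR)) ->
  mu (rbox A) = (\prod_(i < n) leb1 (A i))%E.
Proof.
move=> mA; pose A' k := if insub k is Some i then A (i : 'I_n) else setT.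
have mA' k : measurable (A' k : set mR) by rewrite /A'; case: insubP.
transitivity (leb_tuple n (tbox A')).
  rewrite /mu /pushforward; congr (_ _); apply/seteqP; split => t H i; have := H i;
    by rewrite mxE /A' valK.
by rewrite leb_tuple_tbox//; apply: eq_bigr => i _; rewrite /A' valK.
Qed.

Definition cube (x : 'rV[R]_n) (r : R) : set 'rV[R]_n :=
  rbox (fun i => `]x 0 i - r, x 0 i + r[%classic).

Lemma measurable_cube x r : measurable (cube x r : set bT).
Proof. by apply: measurable_rbox => i; exact: measurable_itv. Qed.

Lemma mu_cube x r : 0 <= r -> mu (cube x r) = ((2 * r) ^+ n)%:E.
Proof.
move=> r0; rewrite mu_rbox; last by move=> i; exact: measurable_itv.
rewrite (eq_bigr (fun=> (2 * r)%:E)).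
  by rewrite prodEFin big_const_ord iter_mulr_1.
move=> i _; rewrite lebesgue_measure_itv/= lte_fin.
have [->|r0'] := eqVneq r 0; first by rewrite subr0 addr0 ltxx mulr0.
by rewrite ltrD2l gt0_cp ?lt0r ?r0' ?r0// -EFinD; congr (_%:E); ring.
Qed.

Let mu_sigma_finite : sigma_finite setT mu.
Proof.
exists (fun k => cube 0 k.+1%:R).
  apply/esym; rewrite -subTset => z _.
  exists (Num.trunc (\sum_i `|z 0 i|)) => //= i /=; rewrite mxE in_itv/= sub0r add0r.
  rewrite -ltr_norml; apply: le_lt_trans (truncnS_gt _).
  by rewrite (bigD1 i)//= lerDl sumr_ge0.
by move=> k; split; [exact: measurable_cube|rewrite mu_cube// ltry].
Qed.
HB.instance Definition _ := Measure_isSigmaFinite.Build _ _ _ mu mu_sigma_finite.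

End borel_rV.

(** * The Euclidean norm *)

Section euclidean_norm.
Context {R : realType} {n : nat}.
Implicit Types (x y z h : 'rV[R]_n).

Lemma dotC x y : dot x y = dot y x.
Proof. by apply: eq_bigr => i _; rewrite mulrC. Qed.

Lemma dotDl x y z : dot (x + y) z = dot x z + dot y z.
Proof. by rewrite /dot -big_split; apply: eq_bigr => i _; rewrite mxE mulrDl. Qed.

Lemma dotZl (a : R) x y : dot (a *: x) y = a * dot x y.
Proof. by rewrite /dot mulr_sumr; apply: eq_bigr => i _; rewrite mxE mulrA. Qed.

Lemma dotDr x y z : dot x (y + z) = dot x y + dot x z.
Proof. by rewrite dotC dotDl !(dotC x). Qed.

Lemma dotZr (a : R) x y : dot x (a *: y) = a * dot x y.
Proof. by rewrite dotC dotZl dotC. Qed.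

Lemma dot_ge0 x : 0 <= dot x x.
Proof. by apply: sumr_ge0 => i _; rewrite -expr2 sqr_ge0. Qed.

Lemma enorm_ge0 x : 0 <= enorm x. Proof. exact: sqrtr_ge0. Qed.

Lemma enorm_sqr x : enorm x ^+ 2 = dot x x.
Proof. by rewrite sqr_sqrtr// dot_ge0. Qed.

Lemma coord_sqr_le x i : x 0 i ^+ 2 <= dot x x.
Proof. by rewrite /dot (bigD1 i)//= expr2 lerDl sumr_ge0// => j _; rewrite -expr2 sqr_ge0. Qed.

Lemma coord_le_enorm x i : `|x 0 i| <= enorm x.
Proof. by rewrite -sqrtr_sqr ler_sqrt ?dot_ge0// coord_sqr_le. Qed.

Lemma enorm_eq0 x : enorm x = 0 -> x = 0.
Proof.
move=> x0; apply/rowP => i; rewrite mxE; apply/eqP; rewrite -normr_eq0.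
by rewrite eq_le normr_ge0 -x0 coord_le_enorm.
Qed.

Lemma cauchy_schwarz x y : `|dot x y| <= enorm x * enorm y.
Proof.
rewrite -(@ler_pXn2r _ 2)// ?nnegrE ?mulr_ge0 ?enorm_ge0// exprMn !enorm_sqr real_normK ?num_real//.
have [y0|] := eqVneq (dot y y) 0.
  have -> : y = 0 by apply: enorm_eq0; rewrite /enorm y0 sqrtr0.
  by rewrite (_ : dot x 0 = 0) ?expr0n/= ?mulr_ge0 ?dot_ge0// /dot big1// => i _; rewrite mxE mulr0.
move=> y0; have yp : 0 < dot y y by rewrite lt0r y0 dot_ge0.
have := dot_ge0 (dot y y *: x + (- dot x y) *: y).
rewrite !dotDl !dotDr !dotZl !dotZr (dotC y x).
rewrite (_ : _ + _ = dot y y * (dot x x * dot y y - dot x y ^+ 2)); last by ring.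
by rewrite pmulr_rge0// subr_ge0.
Qed.

Lemma enormD x y : enorm (x + y) <= enorm x + enorm y.
Proof.
rewrite -(@ler_pXn2r _ 2)// ?nnegrE ?addr_ge0 ?enorm_ge0// enorm_sqr sqrrD !enorm_sqr.
rewrite dotDl !dotDr (dotC y x); have := cauchy_schwarz x y; have := ler_norm (dot x y).
lra.
Qed.

Lemma enormZ (a : R) x : enorm (a *: x) = `|a| * enorm x.
Proof. by rewrite /enorm dotZl dotZr mulrA -expr2 sqrtrM ?sqr_ge0// sqrtr_sqr. Qed.

Lemma enormN x : enorm (- x) = enorm x.
Proof. by rewrite -scaleN1r enormZ normrN1 mul1r. Qed.

Lemma enorm0 : enorm (0 : 'rV[R]_n) = 0.
Proof. by rewrite -(scale0r 0) enormZ normr0 mul0r. Qed.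

Lemma enorm_distC x y : enorm (x - y) = enorm (y - x).
Proof. by rewrite -enormN opprB. Qed.

Lemma enorm_tri x y z : enorm (x - z) <= enorm (x - y) + enorm (y - z).
Proof. by rewrite (le_trans _ (enormD _ _))// addrA subrK. Qed.

Lemma enorm_le_sum x : enorm x <= \sum_i `|x 0 i|.
Proof.
rewrite -(@ler_pXn2r _ 2)// ?nnegrE ?enorm_ge0 ?sumr_ge0// enorm_sqr expr2 mulr_suml.
apply: ler_sum => i _; rewrite -expr2 -real_normK ?num_real// expr2 ler_wpM2l//.
by rewrite (bigD1 i)//= lerDl sumr_ge0.
Qed.

Lemma enorm_le_bound x (e : R) : (forall i, `|x 0 i| <= e) -> enorm x <= n%:R * e.
Proof.
move=> xe; rewrite (le_trans (enorm_le_sum _))// (le_trans (ler_sum _ (fun i _ => xe i)))//.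
by rewrite big_const_ord iter_addr addr0 mulr_natl.
Qed.

Lemma nbhs_eball x (U : set 'rV[R]_n) : nbhs x U -> exists2 e : R, 0 < e & eball x e `<=` U.
Proof.
move=> /nbhs_ballP[e /= e0 xU]; exists e => // y xy; apply: xU; split => // i j.
rewrite /ball/= (ord1 i); apply: le_lt_trans xy.
by have := coord_le_enorm (x - y) j; rewrite !mxE enorm_distC.
Qed.

Lemma eball_nbhs x (e : R) : 0 < e -> nbhs x (eball x e).
Proof.
(* A sup-norm radius for which [n] coordinates sum to less than [e]; the divisor is nonzero for
   [n = 0] as well. *)
move=> e0; apply/nbhs_ballP; exists (e / n.+1%:R) => /=; first by rewrite divr_gt0.
move=> y xy; rewrite /eball/=.
apply: (@le_lt_trans _ _ (n%:R * (e / n.+1%:R))).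
  apply: enorm_le_bound => i; have := xy.2 0 i; rewrite /ball/= => /ltW.
  by rewrite !mxE distrC.
by rewrite mulrCA gtr_pMr// ltr_pdivrMr// mul1r ltr_nat.
Qed.

Lemma open_eballP (U : set 'rV[R]_n) :
  open U <-> forall x, U x -> exists2 e : R, 0 < e & eball x e `<=` U.
Proof.
split=> [oU x Ux|H]; first by apply: nbhs_eball; exact: open_nbhs_nbhs.
rewrite openE => x /H[e e0 xU]; apply: filterS (eball_nbhs x e0) => //.
Qed.

Lemma open_eball x (r : R) : open (eball x r).
Proof.
apply/open_eballP => y xy; exists (r - enorm (y - x)); first by rewrite subr_gt0.
move=> z; rewrite /eball/= => yz; apply: le_lt_trans (enorm_tri z y x) _.
by rewrite -ltrBrDr.
Qed.

Lemma enorm_lipschitz_continuous (f : 'rV[R]_n -> R) (L : R) :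
  (forall x y, `|f x - f y| <= L * enorm (x - y)) -> continuous f.
Proof.
move=> fL x; apply/(@cvgrPdist_lt _ _ _ (nbhs x) (nbhs_filter x)) => e e0.
have L0 : 0 < `|L| + 1 by rewrite ltr_wpDl.
apply: filterS (eball_nbhs x (divr_gt0 e0 L0)) => y; rewrite /eball/= ltr_pdivlMr// => xy.
apply: le_lt_trans (fL x y) _; apply: le_lt_trans xy; rewrite enorm_distC mulrC ler_wpM2l
  ?enorm_ge0//.
by rewrite (le_trans (ler_norm _))// lerDl.
Qed.

Lemma enorm_lip x y : `|enorm x - enorm y| <= enorm (x - y).
Proof.
have h1 := enormD (x - y) y; have h2 := enormD (y - x) x; rewrite !subrK in h1 h2.
rewrite ler_norml; rewrite (enorm_distC y x) in h2.
apply/andP; split; lra.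
Qed.

Lemma continuous_enorm : continuous (@enorm R n).
Proof. by apply: (@enorm_lipschitz_continuous _ 1) => x y; rewrite mul1r enorm_lip. Qed.

Lemma continuous_edist x : continuous (fun y => enorm (y - x)).
Proof.
apply: (@enorm_lipschitz_continuous _ 1) => y z; rewrite mul1r.
by rewrite (le_trans (enorm_lip _ _))// opprB addrA subrK.
Qed.

Lemma closed_cball x (r : R) : closed [set y | enorm (y - x) <= r].
Proof.
by apply: (@preimage_closed _ _ (fun y => enorm (y - x)) [set s | s <= r]);
  [move=> y _; exact: continuous_edist|exact: closed_le].
Qed.

Lemma compact_sub_cball x (r : R) (A : set 'rV[R]_n) :
  closed A -> A `<=` [set y | enorm (y - x) <= r] -> compact A.
Proof.
move=> cA Ar; apply: bounded_closed_compact => //.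
exists (r + enorm x); split; first exact: num_real.
move=> M rM y /Ar /= yr; change (mx_norm y <= M); rewrite mx_normrE; apply: bigmax_le => //.
  by rewrite (le_trans _ (ltW rM))// addr_ge0// ?enorm_ge0// (le_trans _ yr)// enorm_ge0.
move=> [i j] _ /=; rewrite (ord1 i) (le_trans (coord_le_enorm y j))// (le_trans _ (ltW rM))//.
by rewrite (le_trans _ (lerD yr (lexx _)))// -{1}(subrK x y) enormD.
Qed.

Lemma compact_cball x (r : R) : compact [set y | enorm (y - x) <= r].
Proof. by apply: (@compact_sub_cball x r) => //; exact: closed_cball. Qed.

Lemma eball_cube x (r : R) : eball x r `<=` cube x r.
Proof.
move=> y xy i; rewrite /= in_itv/= -ltr_distl.
by apply: le_lt_trans xy; have := coord_le_enorm (y - x) i; rewrite !mxE.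
Qed.

Lemma cube_eball x (r : R) : (0 < n)%N -> cube x (r / n%:R) `<=` eball x r.
Proof.
move=> n0 y xy; rewrite /eball/=.
have n0' : 0 < n%:R :> R by rewrite ltr0n.
have lti i : `|(y - x) 0 i| < r / n%:R.
  by have := xy i; rewrite /= in_itv/= -ltr_distl !mxE.
apply: le_lt_trans (enorm_le_sum _) _.
rewrite (_ : r = \sum_(i < n) (r / n%:R)); last first.
  by rewrite big_const_ord iter_addr addr0 -[RHS]mulr_natr divfK// gt_eqF.
by apply: ltr_sum => //; apply/hasP; exists (Ordinal n0) => //; rewrite mem_index_enum.
Qed.

(** Every point of [U] lies in a cube contained in [U] with rational centre and radius 1/(k+1).
    There are countably many such cubes, and they are measurable by construction. *)
Lemma measurable_open (U : set 'rV[R]_n) : open U -> measurable (U : set (bT R n)).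
Proof.
move=> /open_eballP oU.
pose I := ({ffun 'I_n -> rat} * nat)%type.
pose q (p : I) : 'rV[R]_n := \row_i ratr (p.1 i).
pose F (p : I) : set (bT R n) := if `[< cube (q p) p.2.+1%:R^-1 `<=` U >] then cube (q p)
  p.2.+1%:R^-1 else set0.
rewrite (_ : U = \bigcup_p F p); last first.
  apply/seteqP; split => [x Ux|x [p _]]; last first.
    by rewrite /F; case: asboolP => // pU; exact: pU.
  have [e e0 xe] := oU x Ux.
  have n1 : 0 < n.+1%:R :> R by rewrite ltr0n.
  (* The factor 2: both [x] and a point [y] of the cube may be 1/(k+1) away from the rational centre
     in each coordinate. *)
  have [k ke] : exists k, k.+1%:R^-1 < e / n.+1%:R / 2.
    have := near_infty_natSinv_lt (PosNum (divr_gt0 (divr_gt0 e0 n1) (@ltr0Sn R 1))).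
    by move=> [k _ /(_ k (leqnn k))/= ?]; exists k.
  have ex i : exists a : rat, x 0 i - k.+1%:R^-1 < ratr a < x 0 i + k.+1%:R^-1.
    have lt : x 0 i - k.+1%:R^-1 < x 0 i + k.+1%:R^-1.
      by rewrite ltrD2l gt0_cp// invr_gt0.
    by have [a ] := rat_in_itvoo lt; rewrite in_itv/= => ?; exists a.
  have [a ha] := choice ex.
  exists ([ffun i => a i], k) => //; rewrite /F.
  case: asboolP => [_|].
    move=> i; rewrite /= in_itv/= mxE/= ffunE; have := ha i; move: (ratr _) (_^-1)
      => b c /andP[h1 h2]; apply/andP; split; lra.
  case=> y yq; apply: xe; rewrite /eball/=.
  have : enorm (y - x) <= n%:R * (k.+1%:R^-1 * 2).
    apply: enorm_le_bound => i; have := yq i; rewrite /= in_itv/= !mxE/= !ffunE.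
    have := ha i; move: (ratr _) (_^-1) => b c /andP[h1 h2] /andP[h3 h4]; rewrite ler_norml;
      apply/andP; split; lra.
  move/le_lt_trans; apply; move: ke; rewrite ltr_pdivlMr// ltr_pdivlMr// => ke.
  apply: le_lt_trans ke; rewrite mulrC ler_wpM2l ?mulr_ge0 ?invr_ge0// ler_nat//.
apply: countable_bigcupT_measurable; first exact: countableP.
by move=> p; rewrite /F; case: asboolP => // _; exact: measurable_cube.
Qed.

Lemma measurable_closed (U : set 'rV[R]_n) : closed U -> measurable (U : set (bT R n)).
Proof. by move=> cU; rewrite -(setCK U); apply: measurableC; apply: measurable_open;
  exact: closed_openC. Qed.

Lemma measurable_eball x (r : R) : measurable (eball x r : set (bT R n)).
Proof. by apply: measurable_open; exact: open_eball. Qed.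

Lemma continuous_measurable_rV (f : 'rV[R]_n -> R) : continuous f ->
  measurable_fun setT (f : bT R n -> R).
Proof.
move=> cf; apply: (measurability _ (@RGenOInfty.measurableE R)) => //.
move=> _ [_ [a ->] <-]; rewrite setTI; apply: measurable_open.
apply: open_comp => [x _|]; first exact: cf.
by rewrite set_itvoy; exact: open_gt.
Qed.

Lemma mu_eball_le x (r : R) : 0 <= r -> (mu (eball x r) <= ((2 * r) ^+ n)%:E)%E.
Proof.
move=> r0; rewrite -(mu_cube x r0); apply: le_measure; rewrite ?inE.
- exact: measurable_eball.
- exact: measurable_cube.
- exact: eball_cube.
Qed.

Lemma mu_eball_ge x (r : R) : (0 < n)%N -> 0 <= r -> (((2 * (r / n%:R))
  ^+ n)%:E <= mu (eball x r))%E.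
Proof.
move=> n0 r0; rewrite -(mu_cube x) ?divr_ge0//; apply: le_measure; rewrite ?inE.
- exact: measurable_cube.
- exact: measurable_eball.
- exact: cube_eball.
Qed.

End euclidean_norm.

(** * Smooth functions *)

Section smooth.
Context {R : realType} {n : nat}.
Implicit Types (f g : 'rV[R]_n -> R) (x y z : 'rV[R]_n).
Local Notation e_ i := (delta_mx 0 i : 'rV[R]_n).

Definition smooth f := forall k, Ck k f.

Lemma smooth_continuous f : smooth f -> continuous f.
Proof. by move=> /(_ 0%N). Qed.

Lemma smooth_derivable f z i : smooth f -> derivable f z (e_ i).
Proof. by move=> /(_ 1%N)[_ /(_ i)[]]. Qed.

Lemma smooth_is_derive f z i : smooth f -> is_derive z (e_ i) f (partial i f z).
Proof. by move=> sf; apply/derivableP/smooth_derivable. Qed.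

Lemma smooth_partial f i : smooth f -> smooth (partial i f).
Proof. by move=> sf k; have [_ /(_ i)[]] := sf k.+1. Qed.

Lemma CkS k f : Ck k.+1 f -> Ck k f.
Proof.
elim: k f => [|k IH] f; first by case.
by move=> [cf df]; split => // i; have [d1 d2] := df i; split => //; exact: IH.
Qed.

Lemma Ck_continuous k f : Ck k f -> continuous f.
Proof. by case: k => [|k] //= []. Qed.

(** Introduction rule for the recursive [Ck]: candidates for the partial derivatives are enough, and
    [partial] need not be computed beforehand. *)
Lemma CkSI k f (g : 'I_n -> 'rV[R]_n -> R) : continuous f ->
  (forall i z, is_derive z (e_ i) f (g i z)) -> (forall i, Ck k (g i)) -> Ck k.+1 f.
Proof.
move=> cf dg Cg; split => // i; split; first by move=> z; exact: (@ex_derive _ _ _ _ _ _ _ (dg i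
  z)).
rewrite (_ : partial i f = g i)//; apply/funext => z; exact: derive_val.
Qed.

Lemma CkS_is_derive k f z i : Ck k.+1 f -> is_derive z (e_ i) f (partial i f z).
Proof. by move=> [_ /(_ i)[df _]]; exact/derivableP. Qed.

Lemma CkS_partial k f i : Ck k.+1 f -> Ck k (partial i f).
Proof. by move=> [_ /(_ i)[_ ]]. Qed.

Lemma is_derive_add f g x v (a b : R) : is_derive x v f a -> is_derive x v g b ->
  is_derive x v (fun z => f z + g z) (a + b).
Proof. exact: is_deriveD. Qed.

Lemma is_derive_mul f g x v (a b : R) : is_derive x v f a -> is_derive x v g b ->
  is_derive x v (fun z => f z * g z) (f x * b + g x * a).
Proof. exact: is_deriveM. Qed.

Lemma is_derive_const (c : R) x v : is_derive x v (fun=> c) 0.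
Proof. exact: is_derive_cst. Qed.

Lemma Ck_cst k (c : R) : Ck k (fun _ : 'rV[R]_n => c).
Proof.
elim: k c => [|k IH] c /=; first exact: cst_continuous.
apply: (@CkSI k _ (fun _ _ => 0)) => //; first exact: cst_continuous.
Qed.

Lemma Ck_add k f g : Ck k f -> Ck k g -> Ck k (fun z => f z + g z).
Proof.
elim: k f g => [|k IH] f g /= Cf Cg; first by move=> z; exact: (cvgD (Cf z) (Cg z)).
have [cf cg] := (Ck_continuous (k := k.+1) Cf, Ck_continuous (k := k.+1) Cg).
apply: (@CkSI k _ (fun i z => partial i f z + partial i g z)).
- by move=> z; exact: (cvgD (cf z) (cg z)).
- by move=> i z; apply: is_derive_add; apply: CkS_is_derive; eassumption.
- by move=> i; apply: IH; exact: CkS_partial.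
Qed.

Lemma Ck_mul k f g : Ck k f -> Ck k g -> Ck k (fun z => f z * g z).
Proof.
elim: k f g => [|k IH] f g /= Cf Cg; first by move=> z; exact: (cvgM (Cf z) (Cg z)).
have [cf cg] := (Ck_continuous (k := k.+1) Cf, Ck_continuous (k := k.+1) Cg).
apply: (@CkSI k _ (fun i z => f z * partial i g z + g z * partial i f z)).
- by move=> z; exact: (cvgM (cf z) (cg z)).
- by move=> i z; apply: is_derive_mul; apply: CkS_is_derive; eassumption.
- by move=> i; apply: Ck_add; apply: IH; [exact: (CkS (k := k))|exact: CkS_partial|exact: (CkS (k
  := k))|exact: CkS_partial].
Qed.

Lemma smooth_cst (c : R) : smooth (fun=> c). Proof. by move=> k; exact: Ck_cst. Qed.
Lemma smooth_add f g : smooth f -> smooth g -> smooth (fun z => f z + g z).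
Proof. by move=> sf sg k; exact: Ck_add. Qed.
Lemma smooth_mul f g : smooth f -> smooth g -> smooth (fun z => f z * g z).
Proof. by move=> sf sg k; exact: Ck_mul. Qed.
Lemma smooth_opp f : smooth f -> smooth (fun z => - f z).
Proof.
move=> sf; rewrite (_ : (fun z => - f z) = (fun z => (-1) * f z)).
  by apply: smooth_mul => //; exact: smooth_cst.
by apply/funext => z; rewrite mulN1r.
Qed.
Lemma smooth_sum (F : 'I_n -> 'rV[R]_n -> R) : (forall i, smooth (F i)) ->
  smooth (fun z => \sum_i F i z).
Proof.
move=> sF; rewrite /index_enum; elim: (Finite.enum _) => [|i s IH].
  by under eq_fun do rewrite big_nil; exact: smooth_cst.
by under eq_fun do rewrite big_cons; exact: smooth_add.
Qed.

Lemma partial_mul i f g z : smooth f -> smooth g ->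
  partial i (fun z => f z * g z) z = f z * partial i g z + g z * partial i f z.
Proof.
move=> sf sg; apply: (@derive_val _ _ _ _ _ _ _ _).
by apply: is_derive_mul; exact: smooth_is_derive.
Qed.

(** An error C h^2 forces the difference quotient to converge at rate C |h|. Explicit bounds of this
    kind pass through integrals, which is how convolutions are differentiated. *)
Lemma is_derive_quad (V : normedModType R) (f : V -> R) (x v : V) (l C : R) :
  (forall h : R, `|f (h *: v + x) - f x - h * l| <= C * h ^+ 2) -> is_derive x v f l.
Proof.
move=> H; have cv : h^-1 *: ((f \o shift x) (h *: v) - f x) @[h --> 0^'] --> l.
  apply/cvgrPdist_le => e e0; have C0 : 0 < `|C| + 1 by rewrite ltr_wpDl.
  near=> h; have h0 : h != 0 by near: h; exact: nbhs_dnbhs_neq.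
  rewrite /= -(@ler_pM2l _ `|h|) ?normr_gt0// -normrM /GRing.scale/= mulrBr mulrA divff// mul1r.
  rewrite -normrN opprB (le_trans (H h))//.
  have he : `|h| <= e / (`|C| + 1).
    near: h; apply: nbhs_dnbhs; apply: filterS (nbhsx_ballx 0 (e / (`|C| + 1)) _);
      last by rewrite divr_gt0.
    by move=> y /=; rewrite /ball/= sub0r normrN => /ltW.
  rewrite -real_normK ?num_real// expr2 mulrCA ler_wpM2l//.
  rewrite (le_trans _ (_ : (`|C| + 1) * `|h| <= e))//; last by rewrite mulrC -ler_pdivlMr.
  by rewrite ler_wpM2r// (le_trans (ler_norm _))// lerDl.
split; first by apply/cvg_ex; exists l.
exact: cvg_lim.
Unshelve. all: by end_near. Qed.

Lemma is_derive_line (f : 'rV[R]_n -> R) (a v : 'rV[R]_n) (t df : R) :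
  is_derive (t *: v + a) v f df -> is_derive t 1 (fun s : R => f (s *: v + a)) df.
Proof.
move=> fd.
have E : (fun h : R => h^-1 *: (((fun s : R => f (s *: v + a)) \o shift t) (h *: 1)
  - f (t *: v + a))) =
         (fun h : R => h^-1 *: ((f \o shift (t *: v + a)) (h *: v) - f (t *: v + a))).
  apply/funext => h /=; congr (_ *: (f _ - _)).
  by rewrite scalerDl addrA /GRing.scale/= mulr1.
split; first by rewrite /derivable E; exact: ex_derive.
by rewrite /derive E; exact: (@derive_val _ _ _ _ _ _ _ fd).
Qed.

Lemma smooth_line f i z (t : R) : smooth f ->
  is_derive t 1 (fun s : R => f (s *: e_ i + z)) (partial i f (t *: e_ i + z)).
Proof. by move=> sf; apply: is_derive_line; exact: smooth_is_derive. Qed.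

(** The intermediate point is located only by its modulus; this treats both signs of [h] at once and
    is what the Lipschitz and Taylor bounds use. *)
Lemma smooth_MVT f i z (h : R) : smooth f ->
  exists2 t, `|t| <= `|h| & f (h *: e_ i + z) - f z = h * partial i f (t *: e_ i + z).
Proof.
move=> sf; have dl s := @smooth_line f i z s sf.
have cl : continuous (fun s : R => f (s *: e_ i + z)).
  by move=> s; apply: differentiable_continuous; apply/derivable1_diffP; exact: ex_derive.
have mvt a b : a <= b -> exists2 c, c \in `[a, b] &
    f (b *: e_ i + z) - f (a *: e_ i + z) = partial i f (c *: e_ i + z) * (b - a).
  move=> ab; apply: (@MVT_segment _ (fun s => f (s *: e_ i + z))
    (fun s => partial i f (s *: e_ i + z)) a b ab) => //.
  by apply: continuous_subspaceT => s; exact: cl.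
have [h0|h0|->] := ltgtP h 0.
- have [c ch] := mvt _ _ (ltW h0); rewrite scale0r add0r sub0r => E.
  exists c; last by apply/eqP; rewrite -eqr_opp opprB E mulrN mulrC.
  by move: ch; rewrite in_itv/= => /andP[h1 h2]; rewrite !ler0_norm ?lerN2// ltW.
- have [c ch] := mvt _ _ (ltW h0); rewrite scale0r add0r subr0 => E.
  exists c; last by rewrite E mulrC.
  by move: ch; rewrite in_itv/= => /andP[h1 h2]; rewrite !ger0_norm// ltW.
- by exists 0; rewrite ?normr0// scale0r add0r subrr mul0r.
Qed.

Lemma smooth_lip f i (M : R) z h : smooth f -> (forall y, `|partial i f y| <= M) ->
  `|f (h *: e_ i + z) - f z| <= M * `|h|.
Proof.
move=> sf fM; have [t _ ->] := smooth_MVT i z h sf.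
by rewrite normrM mulrC ler_wpM2r.
Qed.

(** Mean value theorem for [f], then the Lipschitz bound for its partial derivative; hence [M] in
    place of the sharp [M / 2]. *)
Lemma smooth_taylor f i (M : R) z h : smooth f ->
  (forall y, `|partial i (partial i f) y| <= M) ->
  `|f (h *: e_ i + z) - f z - h * partial i f z| <= M * h ^+ 2.
Proof.
move=> sf fM; have [t th ->] := smooth_MVT i z h sf.
have M0 : 0 <= M by exact: le_trans (fM 0).
rewrite -mulrBr normrM -[h ^+ 2]real_normK ?num_real// expr2 mulrCA ler_wpM2l//.
rewrite (le_trans (smooth_lip z t (smooth_partial i sf) fM))//.
by rewrite ler_wpM2l.
Qed.

(** The points [z + prefix_rV k h] form a staircase from [z] to [z + h] along the axes, so that
    increments involve one partial derivative at a time. *)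
Definition prefix_rV k (h : 'rV[R]_n) : 'rV[R]_n := \row_j (if (j < k)%N then h 0 j else 0).

Lemma prefix_rV0 h : prefix_rV 0 h = 0.
Proof. by apply/rowP => j; rewrite !mxE ltn0. Qed.

Lemma prefix_rVn h : prefix_rV n h = h.
Proof. by apply/rowP => j; rewrite !mxE ltn_ord. Qed.

Lemma prefix_rVS (i : 'I_n) h : prefix_rV i.+1 h = h 0 i *: e_ i + prefix_rV i h.
Proof.
apply/rowP => j; rewrite !mxE eqxx/= ltnS leq_eqVlt (val_eqE j i).
by case: eqVneq => [->|_]; rewrite ?ltnn ?mulr1 ?addr0//= mulr0 add0r.
Qed.

Lemma enorm_mono x y : (forall i, `|x 0 i| <= `|y 0 i|) -> enorm x <= enorm y.
Proof.
move=> xy; rewrite ler_sqrt ?dot_ge0//; apply: ler_sum => i _.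
by rewrite -!expr2 -real_normK ?num_real// -[leRHS]real_normK ?num_real// ler_sqr ?nnegrE.
Qed.

Lemma prefix_telescope f z h : f (z + h) - f z =
  \sum_(i < n) (f (z + prefix_rV i.+1 h) - f (z + prefix_rV i h)).
Proof.
rewrite -(big_mkord xpredT (fun i => f (z + prefix_rV i.+1 h) - f (z + prefix_rV i h))).
by rewrite telescope_sumr// prefix_rVn prefix_rV0 addr0.
Qed.

Lemma smooth_lipschitz f (M : R) : smooth f -> (forall i y, `|partial i f y| <= M) ->
  forall z h, `|f (z + h) - f z| <= n%:R * M * enorm h.
Proof.
move=> sf fM z h; rewrite prefix_telescope (le_trans (ler_norm_sum _ _ _))//.
rewrite (le_trans (_ : _ <= \sum_(i < n) M * enorm h))//; last first.
  by rewrite big_const_ord iter_addr addr0 -mulrA mulr_natl.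
apply: ler_sum => i _; rewrite prefix_rVS addrCA.
rewrite (le_trans (smooth_lip _ _ sf (fM i)))// ler_wpM2l ?coord_le_enorm//.
exact: le_trans (fM i 0).
Qed.

(** Compact support is encoded as vanishing outside a ball centred at 0, a form that products,
    shifts and derivatives preserve without any closure being taken. *)
Definition cc f := smooth f /\ exists r, forall z, r < enorm z -> f z = 0.

Lemma open_enorm_gt (r : R) : open [set z : 'rV[R]_n | r < enorm z].
Proof.
apply: (@open_comp _ _ (@enorm R n) [set s | r < s]) => [x _|]; last exact: open_gt.
exact: continuous_enorm.
Qed.

Lemma partial_open0 f i (U : set 'rV[R]_n) : open U -> (forall z, U z -> f z = 0) ->
  forall z, U z -> partial i f z = 0.
Proof.
move=> oU f0 z Uz; rewrite /partial (@near_eq_derive _ _ _ f (cst 0)) ?derive_cst//.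
apply: filterS (open_nbhs_nbhs (conj oU Uz)) => y; exact: f0.
Qed.

Lemma cc_partial f i : cc f -> cc (partial i f).
Proof.
move=> [sf [r f0]]; split; first exact: smooth_partial.
have P := @partial_open0 f i [set z | r < enorm z] (@open_enorm_gt r) f0.
by exists r => z rz; apply: P.
Qed.

Lemma continuous_bounded_supp f (r : R) : continuous f -> (forall z, r < enorm z -> f z = 0) ->
  exists2 M, 0 <= M & forall z, `|f z| <= M.
Proof.
move=> cf f0.
have cnf : continuous (fun z => `|f z|) by move=> z; exact: (cvg_norm (cf z)).
have K0 : [set y : 'rV[R]_n | enorm (y - 0) <= `|r|] !=set0.
  by exists 0; rewrite /= subr0 enorm0.
have [c _ cM] := EVT_max_rV K0 (@compact_cball _ _ 0 `|r|) (continuous_subspaceT cnf).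
exists `|f c| => // z; have [zr|zr] := leP (enorm z) `|r|.
  by apply: cM; rewrite inE/= subr0.
by rewrite f0 ?normr0// (le_lt_trans _ zr)// ler_norm.
Qed.

Lemma cc_bounded f : cc f -> exists2 M, 0 <= M & forall z, `|f z| <= M.
Proof. by move=> [sf [r f0]]; apply: continuous_bounded_supp f0; exact: smooth_continuous. Qed.

Lemma cc_partial_bounded f : cc f -> exists2 M, 0 <= M & forall i z, `|partial i f z| <= M.
Proof.
move=> cf; have /choice[M HM] i : exists M, 0 <= M /\ forall z, `|partial i f z| <= M.
  by have [M M0 H] := cc_bounded (cc_partial i cf); exists M.
exists (\sum_i M i); first by apply: sumr_ge0 => i _; have [] := HM i.
move=> i z; rewrite (le_trans ((HM i).2 z))// (bigD1 i)//= lerDl.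
by apply: sumr_ge0 => j _; have [] := HM j.
Qed.

Lemma cc_mul f g : smooth f -> cc g -> cc (fun z => f z * g z).
Proof.
move=> sf [sg [r g0]]; split; first exact: smooth_mul.
by exists r => z rz; rewrite g0// mulr0.
Qed.

Lemma test_fun_cc E f : test_fun E f -> cc f.
Proof.
move=> [sf /compact_bounded[M [_ HM]] _]; split => //.
exists (n%:R * (M + 1)) => z zM; apply: contrapT => /eqP fz.
have : `|z| <= M + 1 by apply: HM; [rewrite ltrDl|exact: subset_closure].
move=> zM'; move: zM; rewrite ltNge => /negP; apply; apply: enorm_le_bound => i.
apply: le_trans zM'; change (`|z 0 i| <= mx_norm z); rewrite mx_normrE.
exact: (le_bigmax _ (fun k : 'I_1 * 'I_n => `|z k.1 k.2|) (0, i)).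
Qed.

Lemma test_funI E f (K : set 'rV[R]_n) (r : R) : smooth f -> closed K -> K `<=` E ->
  K `<=` [set z | enorm z <= r] -> (forall z, ~ K z -> f z = 0) -> test_fun E f.
Proof.
move=> sf cK KE Kr f0.
have cl : closure [set z | f z != 0] `<=` K.
  rewrite [X in _ `<=` X](closure_id K).1//; apply: closureS => z /= fz;
    apply: contrapT => /f0 /eqP.
  by rewrite (negbTE fz).
split => //; last exact: subset_trans cl KE.
apply: (@compact_sub_cball _ _ 0 r); first exact: closed_closure.
by move=> z /cl /Kr /=; rewrite subr0.
Qed.

Lemma test_fun_cont E f : test_fun E f -> forall z, ~ E z -> f z = 0.
Proof.
move=> [_ _ fE] z Ez; apply: contrapT => /eqP fz; apply: Ez; apply: fE.
exact: subset_closure.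
Qed.

Lemma test_funM E f g : smooth f -> test_fun E g -> test_fun E (fun z => f z * g z).
Proof.
move=> sf tg; have [sg cg gE] := tg; have [_ [r gr]] := test_fun_cc tg.
apply: (@test_funI _ _ (closure [set z | g z != 0]) r) => //.
- exact: smooth_mul.
- exact: closed_closure.
- have -> : [set z : 'rV[R]_n | enorm z <= r] = [set z | enorm (z - 0) <= r].
    by apply/seteqP; split => z /=; rewrite subr0.
  rewrite (closure_id [set z | enorm (z - 0) <= r]).1; last exact: closed_cball.
  apply: closureS => z /=; rewrite subr0 => gz; rewrite leNgt; apply/negP => /gr/eqP.
  by rewrite (negbTE gz).
- move=> z gz; have -> : g z = 0; last by rewrite mulr0.
  by apply: contrapT => /eqP g0; apply: gz; exact: subset_closure.
Qed.

Lemma test_funW (E E' : set 'rV[R]_n) f : E `<=` E' -> test_fun E f -> test_fun E' f.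
Proof. by move=> EE [sf cf fE]; split => //; exact: subset_trans EE. Qed.

Lemma test_fun_partial0 E f i z : test_fun E f -> ~ E z -> partial i f z = 0.
Proof.
move=> [sf cf fE] Ez; apply: (@partial_open0 _ i (~` closure [set z | f z != 0])).
- by apply: closed_openC; exact: closed_closure.
- by move=> y cy; apply: contrapT => /eqP fy; apply: cy; exact: subset_closure.
- by move=> cz; apply: Ez; exact: fE.
Qed.

End smooth.

(** * Bump functions *)

Section psi.
Context {R : realType}.

(** For [m = 0] this is the classical exp(-1/t) glued to 0. The extra powers of 1/t make the family
    closed under derivation: the derivative of [psi m] is [psi m.+2 - m * psi m.+1], so that one
    induction proves all members smooth. *)
Definition psi m (t : R) : R := if 0 < t then t^-1 ^+ m * expR (- t^-1) else 0.

Lemma psi_ge0 m t : 0 <= psi m t.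
Proof. by rewrite /psi; case: ifP => // t0; rewrite mulr_ge0 ?expR_ge0// exprn_ge0// invr_ge0 ltW.
  Qed.

Lemma exprn_le_expR (s : R) N : 0 <= s -> s ^+ N <= N%:R ^+ N * expR s.
Proof.
move=> s0; case: N => [|N]; first by rewrite !expr0 mul1r -expR0 ler_expR.
have N0 : 0 < N.+1%:R :> R by [].
have : (s / N.+1%:R) ^+ N.+1 <= expR s.
  have -> : expR s = expR (s / N.+1%:R) ^+ N.+1.
    by rewrite -expRM_natl mulrC divfK// gt_eqF.
  rewrite lerXn2r ?nnegrE ?expR_ge0 ?divr_ge0// (le_trans _ (expR_ge1Dx _))//.
  by rewrite lerDr.
by rewrite expr_div_n ler_pdivrMr ?exprn_gt0// mulrC.
Qed.

(** Exponential decay beats every power of 1/t. The quadratic form is what [is_derive_quad] asks for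
    at the gluing point [t = 0], where the derivative is 0. *)
Lemma psi_le_sqr m : exists2 C, 0 <= C & forall t, `|psi m t| <= C * t ^+ 2.
Proof.
exists (m.+2%:R ^+ m.+2); first by rewrite exprn_ge0.
move=> t; rewrite ger0_norm ?psi_ge0// /psi; case: ifPn => t0; last by apply: mulr_ge0;
  [exact: exprn_ge0|exact: sqr_ge0].
rewrite expRN ler_pdivrMr ?expR_gt0// -mulrA [t ^+ 2 * _]mulrC mulrA -ler_pdivrMr ?exprn_gt0//.
have -> : t^-1 ^+ m / t ^+ 2 = t^-1 ^+ m.+2 by rewrite -exprVn -exprD addn2.
by apply: exprn_le_expR; rewrite invr_ge0 ltW.
Qed.

Lemma is_derive_psi m (t : R) : is_derive t 1 (psi m) (psi m.+2 t - m%:R * psi m.+1 t).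
Proof.
have [t0|t0|->] := ltgtP t 0.
- rewrite (_ : _ - _ = 0); last by rewrite /psi ltNge (ltW t0) mulr0 subr0.
  apply: (@near_eq_is_derive _ _ _ (cst 0 : R -> R)).
  by apply: filterS (lt_nbhsl t0) => s s0; rewrite /psi ltNge (ltW s0).
- rewrite /psi t0; apply: (@near_eq_is_derive _ _ _ ((fun s => s ^+ m * expR (- s))
  \o (fun s => s^-1))).
  + by apply: filterS (lt_nbhsr t0) => s s0; rewrite /= s0.
  + have dV : is_derive t 1 (fun s : R => s^-1) (- t ^- 2).
      have := @is_deriveV R id t 1 1 (lt0r_neq0 t0) (is_derive_id _ _).
      by rewrite /GRing.scale/= mulr1.
    have dE : is_derive t^-1 1 (fun s : R => s ^+ m * expR (- s)) (t^-1 ^+ m * - expR (- t^-1)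
      + expR (- t^-1) * (m%:R * t^-1 ^+ m.-1)).
      apply: is_deriveM.
        have E : (id : R -> R) ^+ m = (fun s => s ^+ m).
          by elim: (m) => [|k IH]; apply/funext => s; rewrite ?expr0// !exprS IH.
        by have := @is_deriveX _ _ (id : R -> R) m t^-1 1 1 (is_derive_id _ _);
          rewrite E /GRing.scale/= mulr1.
      have := @is_derive1_comp _ expR (fun s => - s) (t^-1) _ _ (is_derive_expR _)
        (is_deriveN (is_derive_id _ _)).
      by rewrite mulrN1.
    have := @is_derive1_comp _ _ (fun s => s^-1) t _ _ dE dV.
    move=> H; apply: (is_derive_eq H).
    case: m {dE H} => [|m]; rewrite ?mul0r ?mulr0 ?addr0 /= -exprVn !exprS; ring.
- have [C C0 HC] := psi_le_sqr m.
  rewrite (_ : _ - _ = 0); last by rewrite /psi ltxx mulr0 subr0.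
  apply: (@is_derive_quad _ _ _ _ _ _ C) => h; rewrite /GRing.scale/= mulr1 addr0 mulr0 subr0.
  by rewrite {2}/psi ltxx subr0.
Qed.

End psi.

Section mollifier.
Context {R : realType} {n : nat}.
Implicit Types (f g : 'rV[R]_n -> R) (x y z : 'rV[R]_n).
Local Notation e_ i := (delta_mx 0 i : 'rV[R]_n).

Lemma is_derive_comp_line (S : R -> R) f x v (a b : R) :
  is_derive (f x) 1 S a -> is_derive x v f b -> is_derive x v (S \o f) (a * b).
Proof.
move=> dS df.
have dl : is_derive (0:R) 1 (fun s : R => f (s *: v + x)) b.
  by apply: is_derive_line; rewrite scale0r add0r.
have dS' : is_derive (f (0 *: v + x)) 1 S a by rewrite scale0r add0r.
have := @is_derive1_comp _ S (fun s : R => f (s *: v + x)) 0 a b dS' dl.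
move=> dSl.
have E : (fun h : R => h^-1 *: (((S \o (fun s : R => f (s *: v + x))) \o shift 0) (h *: 1)
  - (S \o (fun s : R => f (s *: v + x))) 0)) =
         (fun h : R => h^-1 *: (((S \o f) \o shift x) (h *: v) - (S \o f) x)).
  by apply/funext => h /=; rewrite scale0r add0r addr0 /GRing.scale/= mulr1.
split; first by rewrite /derivable -E; exact: ex_derive.
by rewrite /derive -E; exact: (@derive_val _ _ _ _ _ _ _ dSl).
Qed.

Lemma Ck_psi k m f : Ck k f -> Ck k (fun z => psi m (f z)).
Proof.
have cpsi j : continuous (@psi R j).
  by move=> t; apply: differentiable_continuous; apply/derivable1_diffP;
    exact: (@ex_derive _ _ _ _ _ _ _ (is_derive_psi j t)).
elim: k m f => [|k IH] m f Cf.
  by move=> z; apply: continuous_comp; [exact: Cf|exact: cpsi].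
apply: (@CkSI _ _ k _ (fun i z => (psi m.+2 (f z) + (- m%:R) * psi m.+1 (f z)) * partial i f z)).
- by move=> z; apply: continuous_comp; [exact: (Ck_continuous Cf)|exact: cpsi].
- move=> i z; rewrite mulNr; apply: is_derive_comp_line; first exact: is_derive_psi.
  exact: CkS_is_derive Cf.
- move=> i; apply: Ck_mul; last exact: CkS_partial.
  apply: Ck_add; first by apply: IH; exact: CkS.
  by apply: Ck_mul; [exact: Ck_cst|apply: IH; exact: CkS].
Qed.

Lemma smooth_psi m f : smooth f -> smooth (fun z => psi m (f z)).
Proof. by move=> sf k; exact: Ck_psi. Qed.

Lemma is_derive_coord i j z : is_derive z (e_ i) (fun z => z 0 j) ((i == j)%:R).
Proof.
apply: (@is_derive_quad _ _ _ _ _ _ 0) => h.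
by rewrite !mxE eqxx/= eq_sym mul0r addrK subrr normr0.
Qed.

Lemma smooth_coord j : smooth (fun z : 'rV[R]_n => z 0 j).
Proof.
case=> [|k]; first exact: coord_continuous.
apply: (@CkSI _ _ k _ (fun i _ => (i == j)%:R)).
- exact: coord_continuous.
- by move=> i z; exact: is_derive_coord.
- by move=> i; exact: Ck_cst.
Qed.

Lemma smooth_dot : smooth (fun z : 'rV[R]_n => dot z z).
Proof. by apply: smooth_sum => i; apply: smooth_mul; exact: smooth_coord. Qed.

Lemma is_derive_dot i z : is_derive z (e_ i) (fun z => dot z z) (2 * z 0 i).
Proof.
apply: (@is_derive_quad _ _ _ _ _ _ 1) => h.
rewrite !dotDl !dotDr !dotZl !dotZr.
have E y : dot (e_ i) y = y 0 i.
  rewrite /dot (bigD1 i)//= mxE !eqxx mul1r big1 ?addr0// => j ji.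
  by rewrite mxE (negbTE ji) andbF mul0r.
rewrite (dotC z) !E mxE !eqxx/= (_ : _ - _ = h ^+ 2); last by ring.
by rewrite mul1r normrX real_normK ?num_real.
Qed.

Definition bump (e : R) z : R := psi 0 (1 - e ^- 2 * dot z z).

Lemma smooth_bump e : smooth (bump e).
Proof.
apply: smooth_psi; apply: smooth_add; first exact: smooth_cst.
by apply: smooth_opp; apply: smooth_mul; [exact: smooth_cst|exact: smooth_dot].
Qed.

Lemma bump_ge0 e z : 0 <= bump e z. Proof. exact: psi_ge0. Qed.

Lemma bump0 e z : 0 < e -> e <= enorm z -> bump e z = 0.
Proof.
move=> e0 ez; rewrite /bump /psi ltNge subr_le0 ler_pdivlMl ?exprn_gt0// mulr1 -enorm_sqr.
by rewrite ler_sqr ?nnegrE ?enorm_ge0 ?(ltW e0)// ez.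
Qed.

Lemma cc_bump e : 0 < e -> cc (bump e).
Proof. by move=> e0; split; [exact: smooth_bump|exists e => z /ltW; exact: bump0]. Qed.

(** On the half-size ball [1 - e ^- 2 * dot z z] is at least 3/4, so its inverse is at most 2. The
    constant is uniform in [e] because all bumps are dilates of one function. *)
Lemma bump_lb : exists2 c : R, 0 < c & forall e z, 0 < e -> enorm z <= e / 2 -> c <= bump e z.
Proof.
exists (expR (-2)); first exact: expR_gt0.
move=> e z e0 ze.
have h : e ^- 2 * dot z z <= 4^-1.
  rewrite ler_pdivrMl ?exprn_gt0// -enorm_sqr (_ : _ * _ = (e / 2) ^+ 2); last by field.
  by rewrite ler_sqr ?nnegrE ?enorm_ge0 ?divr_ge0 ?(ltW e0).
have p : 2^-1 <= 1 - e ^- 2 * dot z z by lra.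
have p0 : 0 < 1 - e ^- 2 * dot z z by lra.
rewrite /bump /psi p0 expr0 mul1r ler_expR lerN2.
by rewrite -[leRHS]invrK lef_pV2 ?posrE ?invr_gt0.
Qed.

(** The factor 1/e comes from differentiating e^(-2) |z|^2 where |z| < e; there the argument of
    [psi 2] lies in [0, 1], on which [psi 2] is bounded. *)
Lemma bump_partial_ub : exists2 C : R, 0 < C & forall e i z, 0 < e -> `|partial i (bump e) z|
  <= C / e.
Proof.
have [C C0 HC] := @psi_le_sqr R 2.
exists (2 * C + 1); first by rewrite ltr_wpDl ?mulr_ge0.
move=> e i z e0; have e20 : 0 < e ^+ 2 by rewrite exprn_gt0.
have -> : partial i (bump e) z = psi 2 (1 - e ^- 2 * dot z z) * (- (e ^- 2 * (2 * z 0 i))).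
  apply: (@derive_val _ _ _ _ _ _ _ _); apply: is_derive_comp_line.
    by have := is_derive_psi 0 (1 - e ^- 2 * dot z z); rewrite mul0r subr0.
  have := is_derive_add (is_derive_const 1 z (e_ i)) (is_deriveN (is_deriveZ (e ^- 2)
    (is_derive_dot i z))).
  by rewrite add0r.
have [ez|ze] := leP e (enorm z).
  have -> : psi 2 (1 - e ^- 2 * dot z z) = 0.
    rewrite /psi ltNge subr_le0 ler_pdivlMl// mulr1 -enorm_sqr.
    by rewrite ler_sqr ?nnegrE ?enorm_ge0 ?(ltW e0)// ez.
  by rewrite mul0r normr0 divr_ge0 ?(ltW e0)// addr_ge0 ?mulr_ge0.
have zs : 0 <= e ^- 2 * dot z z <= 1.
  by rewrite mulr_ge0 ?invr_ge0 ?(ltW e20) ?dot_ge0//= ler_pdivrMl// mulr1 -enorm_sqr ler_sqr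
    ?nnegrE ?enorm_ge0 ?ltW.
rewrite normrM normrN normrM (ger0_norm (_ : 0 <= e ^- 2)) ?invr_ge0 ?(ltW e20)//.
rewrite normrM (ger0_norm (_ : 0 <= 2))//.
have p1 : `|psi 2 (1 - e ^- 2 * dot z z)| <= C.
  rewrite (le_trans (HC _))// -[leRHS]mulr1 ler_wpM2l// expr_le1//; case/andP: zs => ? ?; lra.
have zi : `|z 0 i| <= e by rewrite (le_trans (coord_le_enorm z i))// ltW.
rewrite (le_trans (_ : _ <= C * (e ^- 2 * (2 * e))))//.
  by apply: ler_pM => //; [rewrite ?mulr_ge0 ?invr_ge0 ?(ltW e20)|rewrite ler_wpM2l ?invr_ge0
    ?(ltW e20)// ler_wpM2l].
rewrite (_ : C * _ = 2 * C / e); last by field; rewrite gt_eqF.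
by rewrite ler_wpM2r ?invr_ge0 ?(ltW e0)// lerDl.
Qed.

End mollifier.

(** * Integration of Borel functions *)

Section real_integrals.
Context {R : realType} {n : nat}.
Local Notation X := (bT R n).
Local Notation mu := (@mu R n).
Implicit Types (f g h : 'rV[R]_n -> R).

Definition mf f := measurable_fun setT (f : X -> R).
(** Two integrals in parallel: [II] is extended-valued and serves nonnegative integrands before
    finiteness is known; [RI] is real-valued and serves signed integrands under [Iable]. *)
Definition II f : \bar R := (\int[mu]_(z in (setT : set X)) (f z)%:E)%E.
Definition Iable f := mu.-integrable setT (fun z : X => (f z)%:E).
Definition RI f : R := \int[mu]_(z in (setT : set X)) f z.

#[global] Instance ae_filter_mu : Filter (nbhs (almost_everywhere mu)) :=
  ae_filter_ringOfSetsType [the {measure set X -> \bar R} of mu].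

Lemma mf_EFin f : mf f -> measurable_fun setT (fun z : X => (f z)%:E).
Proof. by move=> H; apply/measurable_EFinP. Qed.

Lemma mfD f g : mf f -> mf g -> mf (fun z => f z + g z).
Proof. exact: measurable_funD. Qed.
Lemma mfB f g : mf f -> mf g -> mf (fun z => f z - g z).
Proof. exact: measurable_funB. Qed.
Lemma mfM f g : mf f -> mf g -> mf (fun z => f z * g z).
Proof. exact: measurable_funM. Qed.
Lemma mfN f : mf f -> mf (fun z => - f z).
Proof. by move=> H; apply: measurableT_comp. Qed.
Lemma mfX f k : mf f -> mf (fun z => f z ^+ k).
Proof. exact: measurable_funX. Qed.
Lemma mfnorm f : mf f -> mf (fun z => `|f z|).
Proof. by move=> H; apply: measurableT_comp. Qed.
Lemma mfC (c : R) : mf (fun=> c).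
Proof. exact: measurable_cst. Qed.
Lemma mf_indic (A : set X) : measurable A -> mf (\1_A).
Proof. by move=> mA; exact: measurable_indic. Qed.
Lemma mf_cont f : continuous f -> mf f.
Proof. exact: continuous_measurable_rV. Qed.
Lemma mf_smooth f : smooth f -> mf f.
Proof. by move=> sf; apply: mf_cont; exact: smooth_continuous. Qed.
Lemma mf_shift f (a : 'rV[R]_n) : mf f -> mf (fun z => f (z + a)).
Proof. by move=> H; apply: (measurableT_comp H); exact: measurable_shift. Qed.
Lemma mf_sum (I : Type) (s : seq I) (F : I -> 'rV[R]_n -> R) : (forall i, mf (F i)) ->
  mf (fun z => \sum_(i <- s) F i z).
Proof. by move=> H; apply: measurable_sum. Qed.
Lemma mf_comp (S : R -> R) f : measurable_fun setT S -> mf f -> mf (fun z => S (f z)).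
Proof. by move=> mS H; exact: (measurableT_comp mS H). Qed.
Lemma mf_pow f (a : R) : mf f -> mf (fun z => f z `^ a).
Proof. by move=> H; exact: (mf_comp (measurable_powR a) H). Qed.

Lemma mf_setlt f (a : R) : mf f -> measurable ([set z | f z < a] : set X).
Proof.
move=> H; rewrite (_ : [set z | f z < a] = f @^-1` `]-oo, a[%classic).
  by apply: (measurable_preim H); exact: measurable_itv.
by apply/seteqP; split => z; rewrite /= in_itv.
Qed.
Lemma mf_setgt f (a : R) : mf f -> measurable ([set z | a < f z] : set X).
Proof.
move=> H; rewrite (_ : [set z | a < f z] = f @^-1` `]a, +oo[%classic).
  by apply: (measurable_preim H); exact: measurable_itv.
by apply/seteqP; split => z; rewrite /= in_itv/= andbT.
Qed.
Lemma mf_setle f (a : R) : mf f -> measurable ([set z | f z <= a] : set X).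
Proof.
move=> H; rewrite (_ : [set z | f z <= a] = ~` [set z | a < f z]).
  by apply: measurableC; exact: mf_setgt.
by apply/seteqP; split => z /=; [move=> ?; apply/negP; rewrite -leNgt|move=> /negP; rewrite -leNgt].
Qed.
Lemma mf_setge f (a : R) : mf f -> measurable ([set z | a <= f z] : set X).
Proof.
move=> H; rewrite (_ : [set z | a <= f z] = ~` [set z | f z < a]).
  by apply: measurableC; exact: mf_setlt.
by apply/seteqP; split => z /=; [move=> ?; apply/negP; rewrite -leNgt|move=> /negP; rewrite -leNgt].
Qed.
Lemma mf_setneq0 f : mf f -> measurable ([set z | f z != 0] : set X).
Proof.
move=> H; rewrite (_ : [set z | f z != 0] = f @^-1` (~` [set 0])).
  by apply: (measurable_preim H); exact: measurableC.
by apply/seteqP; split => z /= /eqP.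
Qed.

Lemma II_ge0 f : (forall z, 0 <= f z) -> (0 <= II f)%E.
Proof. by move=> f0; apply: integral_ge0 => z _; rewrite lee_fin. Qed.

Lemma II_le f g : mf f -> mf g -> (forall z, 0 <= f z) -> (forall z, f z <= g z) ->
  (II f <= II g)%E.
Proof.
move=> Hf Hg f0 fg; apply: ge0_le_integral => //; try exact: mf_EFin.
- by move=> z _; rewrite lee_fin.
- by move=> z _; rewrite lee_fin.
Qed.

Lemma II_add f g : mf f -> mf g -> (forall z, 0 <= f z) -> (forall z, 0 <= g z) ->
  II (fun z => f z + g z) = (II f + II g)%E.
Proof.
move=> Hf Hg f0 g0; rewrite /II -ge0_integralD//; try exact: mf_EFin;
  by move=> z _; rewrite lee_fin.
Qed.

Lemma II_scale (c : R) f : mf f -> (forall z, 0 <= f z) -> 0 <= c ->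
  II (fun z => c * f z) = (c%:E * II f)%E.
Proof.
move=> Hf f0 c0; rewrite /II -ge0_integralZl_EFin//; last exact: mf_EFin.
by move=> z _; rewrite lee_fin.
Qed.

Lemma II_sum (I : Type) (s : seq I) (F : I -> 'rV[R]_n -> R) : (forall i, mf (F i)) ->
  (forall i z, 0 <= F i z) -> II (fun z => \sum_(i <- s) F i z) = (\sum_(i <- s) II (F i))%E.
Proof.
move=> mF F0; rewrite /II -ge0_integral_sum//.
- by apply: eq_integral => z _; rewrite -sumEFin.
- by move=> i; exact: mf_EFin.
- by move=> i z _; rewrite lee_fin.
Qed.

Lemma II_shift f (a : 'rV[R]_n) : mf f -> (forall z, 0 <= f z) ->
  II (fun z => f (z + a)) = II f.
Proof.
move=> Hf f0; apply: (@ge0_integral_shift R n a (fun z => (f z)%:E)); first exact: mf_EFin.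
by move=> z; rewrite lee_fin.
Qed.

Lemma II_indic (A : set X) : measurable A -> II (\1_A) = mu A.
Proof. by move=> mA; rewrite /II integral_indic// setIT. Qed.

Lemma II_eq f g : f =1 g -> II f = II g.
Proof. by move=> fg; congr II; apply/funext. Qed.

(** Fatou's lemma as stability of a uniform bound under pointwise limits; it removes every
    approximation used later (Riemann sums, dyadic layers, truncations, cut-offs). *)
Lemma II_fatou (F : nat -> 'rV[R]_n -> R) f (b : \bar R) :
  (forall k, mf (F k)) -> (forall k z, 0 <= F k z) ->
  (forall z, F ^~ z @ \oo --> f z) -> (forall k, (II (F k) <= b)%E) -> (II f <= b)%E.
Proof.
move=> mF F0 Ff Fb; rewrite /II.
rewrite (@eq_integral _ _ _ mu _ (fun z : X => limn_einf (fun k => (F k z)%:E))); last first.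
  by move=> z _; apply/esym; apply: (cvg_limn_einf_sup _).1; apply: cvg_EFin;
    [exact: nearW|exact: Ff].
apply: le_trans (@fatou _ _ _ mu _ _ (fun k (z : X) => (F k z)%:E) _ _) _ => //.
- by move=> k; exact: mf_EFin.
- by move=> k z _; rewrite lee_fin.
- rewrite limn_einf_lim; apply: lime_le; first exact: is_cvg_einfs.
  by apply: nearW => k; apply: le_trans (Fb k); apply: ereal_inf_lbound; exists k => /=.
Qed.

Lemma Iable_mf f : Iable f -> mf f.
Proof. by move=> /measurable_int/measurable_EFinP. Qed.

Lemma IableP f : Iable f <-> mf f /\ (II (fun z => `|f z|)%R < +oo)%E.
Proof.
split; first by move=> If; split; [exact: Iable_mf|case/integrableP : If].
by move=> [Hf fo]; apply/integrableP; split => //; exact: mf_EFin.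
Qed.

Lemma Iable_le f g : mf f -> (forall z, `|f z| <= g z) -> Iable g -> Iable f.
Proof.
move=> Hf fg Ig; apply: (le_integrable measurableT _ _ Ig); first exact: mf_EFin.
by move=> z _; rewrite /= lee_fin (le_trans (fg z))// ler_norm.
Qed.

Lemma IableD f g : Iable f -> Iable g -> Iable (fun z => f z + g z).
Proof. by move=> If Ig; exact: (integrableD measurableT If Ig). Qed.
Lemma IableZ (c : R) f : Iable f -> Iable (fun z => c * f z).
Proof. by move=> If; exact: (integrableZl measurableT c If). Qed.
Lemma IableN f : Iable f -> Iable (fun z => - f z).
Proof.
move=> If; rewrite (_ : (fun z => - f z) = (fun z => (-1) * f z)); first exact: IableZ.
by apply/funext => z; rewrite mulN1r.
Qed.
Lemma IableB f g : Iable f -> Iable g -> Iable (fun z => f z - g z).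
Proof. by move=> If Ig; apply: IableD => //; exact: IableN. Qed.
Lemma Iable0 : Iable (fun=> 0).
Proof. by apply/IableP; split; [exact: mfC|rewrite /II; under eq_integral do rewrite normr0;
  rewrite integral0 ltry]. Qed.
Lemma Iable_sum (I : Type) (s : seq I) (F : I -> 'rV[R]_n -> R) : (forall i, Iable (F i)) ->
  Iable (fun z => \sum_(i <- s) F i z).
Proof.
move=> IF; elim: s => [|i s IH]; first by under eq_fun do rewrite big_nil; exact: Iable0.
by under eq_fun do rewrite big_cons; exact: IableD.
Qed.
Lemma Iable_norm f : Iable f -> Iable (fun z => `|f z|).
Proof. by move=> If; exact: (integrable_abse If). Qed.

Lemma Iable_mulb f g (M : R) : Iable f -> mf g -> (forall z, `|g z| <= M) ->
  Iable (fun z => f z * g z).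
Proof.
move=> If Hg gM; have M0 : 0 <= M by exact: le_trans (gM 0).
apply: (@Iable_le _ (fun z => M * `|f z|)).
- by apply: mfM => //; exact: Iable_mf.
- by move=> z; rewrite normrM mulrC ler_wpM2r.
- by apply: IableZ; exact: Iable_norm.
Qed.

Lemma RI_EFin f : Iable f -> (RI f)%:E = (\int[mu]_(z in (setT : set X)) (f z)%:E)%E.
Proof. by move=> If; rewrite /RI /Rintegral fineK//; exact: integrable_fin_num. Qed.
Lemma RID f g : Iable f -> Iable g -> RI (fun z => f z + g z) = RI f + RI g.
Proof. by move=> If Ig; rewrite /RI RintegralD. Qed.
Lemma RIZ (c : R) f : Iable f -> RI (fun z => c * f z) = c * RI f.
Proof. by move=> If; rewrite /RI RintegralZl. Qed.
Lemma RIN f : Iable f -> RI (fun z => - f z) = - RI f.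
Proof. by move=> If; rewrite -mulN1r -RIZ//; congr RI; apply/funext => z; rewrite mulN1r. Qed.
Lemma RIB f g : Iable f -> Iable g -> RI (fun z => f z - g z) = RI f - RI g.
Proof. by move=> If Ig; rewrite RID ?RIN//; exact: IableN. Qed.
Lemma RI_sum (I : Type) (s : seq I) (F : I -> 'rV[R]_n -> R) : (forall i, Iable (F i)) ->
  RI (fun z => \sum_(i <- s) F i z) = \sum_(i <- s) RI (F i).
Proof.
move=> IF; elim: s => [|i s IH].
  by under eq_fun do rewrite big_nil; rewrite big_nil /RI /Rintegral integral0.
by under eq_fun do rewrite big_cons; rewrite RID ?IH ?big_cons//; exact: Iable_sum.
Qed.
Lemma RI_le f g : Iable f -> Iable g -> (forall z, f z <= g z) -> RI f <= RI g.
Proof. by move=> If Ig fg; apply: le_Rintegral. Qed.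
Lemma RI_norm f : Iable f -> `|RI f| <= RI (fun z => `|f z|).
Proof. by move=> If; exact: le_normr_Rintegral. Qed.
Lemma RI_ge0 f : (forall z, 0 <= f z) -> 0 <= RI f.
Proof. by move=> f0; apply: Rintegral_ge0. Qed.

Lemma RI_mulb f g (M : R) : Iable f -> mf g -> (forall z, `|g z| <= M) ->
  `|RI (fun z => f z * g z)| <= M * RI (fun z => `|f z|).
Proof.
move=> If Hg gM; have I1 := Iable_mulb If Hg gM.
rewrite -RIZ; last exact: Iable_norm.
apply: le_trans (RI_norm I1) _; apply: RI_le.
- exact: Iable_norm.
- by apply: IableZ; exact: Iable_norm.
- by move=> z; rewrite normrM mulrC ler_wpM2r.
Qed.

Lemma RI_norm_le f (b : R) : Iable f -> (II (fun z => `|f z|)%R <= b%:E)%E -> `|RI f| <= b.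
Proof.
move=> If fb; rewrite (le_trans (RI_norm If))// -lee_fin RI_EFin//.
exact: Iable_norm.
Qed.

Lemma Iable_shift f (a : 'rV[R]_n) : Iable f -> Iable (fun z => f (z + a)).
Proof.
move=> /IableP[Hf fo]; apply/IableP; split; first exact: mf_shift.
by rewrite (@II_shift (fun z => `|f z|))//; exact: mfnorm.
Qed.

Lemma RI_shift f (a : 'rV[R]_n) : mf f -> RI (fun z => f (z + a)) = RI f.
Proof.
move=> Hf; rewrite /RI /Rintegral; congr fine; rewrite integralE [RHS]integralE.
have Hf' := mf_EFin Hf.
congr (_ - _)%E.
- apply: etrans (@ge0_integral_shift R n a _ (measurable_funepos Hf') (funepos_ge0 _)).
  by apply: eq_integral => x _; rewrite !funeposE.
- apply: etrans (@ge0_integral_shift R n a _ (measurable_funeneg Hf') (funeneg_ge0 _)).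
  by apply: eq_integral => x _; rewrite !funenegE.
Qed.

Lemma RI_dct (F : nat -> 'rV[R]_n -> R) f g : (forall k, mf (F k)) -> mf f -> Iable g ->
  (\forall z \ae mu, F ^~ z @ \oo --> f z) -> (forall k z, `|F k z| <= g z) ->
  RI (F k) @[k --> \oo] --> RI f.
Proof.
move=> mF Hf Ig Ff Fg.
have cvE : \forall z \ae mu, setT z -> (F k z)%:E @[k --> \oo] --> (f z)%:E.
  by apply: filterS Ff => z Fz _; apply: cvg_EFin; [exact: nearW|].
have dom : \forall z \ae mu, forall k, setT z -> (`|(F k z)%:E| <= (g z)%:E)%E.
  by apply: aeW => z k _; rewrite lee_fin.
have [If _ cv] := @dominated_convergence _ _ _ mu _ measurableT (fun k (z : X) => (F k z)%:E)
  (fun z : X => (f z)%:E) (fun z : X => (g z)%:E) (fun k => mf_EFin (mF k)) (mf_EFin Hf)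
  cvE Ig dom.
rewrite /RI /Rintegral; apply: fine_cvg; rewrite fineK//; exact: integrable_fin_num.
Qed.

Lemma Iable_bounded_supp f (M r : R) : mf f -> (forall z, `|f z| <= M) ->
  (forall z, r < enorm z -> f z = 0) -> Iable f.
Proof.
move=> Hf fM f0; have M0 : 0 <= M by exact: le_trans (fM 0).
have r0 : 0 <= `|r| + 1 by rewrite addr_ge0.
apply: (@Iable_le _ (fun z => M * \1_(cube 0 (`|r| + 1) : set X) z)) => //.
  move=> z; have [zc|zc] := pselect (cube 0 (`|r| + 1) z).
    by rewrite indicE mem_set// mulr1.
  rewrite f0 ?normr0 ?mulr_ge0//; apply: contrapT => /negP; rewrite -leNgt => zr.
  apply: zc; apply: eball_cube; rewrite /eball/= subr0 (le_lt_trans zr)//.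
  by rewrite ltr_pwDr// ler_norm.
apply: IableZ; apply/IableP; split; first by apply: mf_indic; exact: measurable_cube.
rewrite (_ : (fun z => _) = \1_(cube 0 (`|r| + 1) : set X)); last first.
  by apply/funext => z; rewrite ger0_norm.
rewrite II_indic; last exact: measurable_cube.
by rewrite mu_cube// ltry.
Qed.

Lemma cc_Iable f : cc f -> Iable f.
Proof.
move=> cf; have [sf [r f0]] := cf; have [M _ fM] := cc_bounded cf.
by apply: (Iable_bounded_supp (mf_smooth sf) fM f0).
Qed.

Lemma RI0 : RI (fun _ : 'rV[R]_n => 0) = 0.
Proof. by rewrite /RI /Rintegral integral0. Qed.

Definition mf2 (F : 'rV[R]_n -> 'rV[R]_n -> R) := measurable_fun setT (fun p : X * X => F p.1 p.2).

Lemma II_fubini (F : 'rV[R]_n -> 'rV[R]_n -> R) : mf2 F -> (forall x y, 0 <= F x y) ->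
  (\int[mu]_(x in (setT : set X)) II (F x) = \int[mu]_(y in (setT : set X)) II (F ^~ y))%E.
Proof.
move=> mF F0; apply: (@fubini_tonelli _ _ X X R mu mu (fun p => (F p.1 p.2)%:E)).
- exact/measurable_EFinP.
- by move=> p; rewrite lee_fin.
Qed.

Lemma mf2_II (F : 'rV[R]_n -> 'rV[R]_n -> R) : mf2 F -> (forall x y, 0 <= F x y) ->
  measurable_fun setT (fun x : X => II (F x)).
Proof.
move=> mF F0; apply: (@measurable_fun_fubini_tonelli_F _ _ X X R mu (fun p => (F p.1 p.2)%:E)).
- exact/measurable_EFinP.
- by move=> p; rewrite lee_fin.
Qed.

Lemma mf2_IIr (F : 'rV[R]_n -> 'rV[R]_n -> R) : mf2 F -> (forall x y, 0 <= F x y) ->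
  measurable_fun setT (fun y : X => II (F ^~ y)).
Proof.
move=> mF F0; apply: (@measurable_fun_fubini_tonelli_G _ _ X X R mu (fun p => (F p.1 p.2)%:E)).
- exact/measurable_EFinP.
- by move=> p; rewrite lee_fin.
Qed.

Lemma mf2_fst f : mf f -> mf2 (fun x _ => f x).
Proof. by move=> H; apply: (measurableT_comp H). Qed.
Lemma mf2_snd f : mf f -> mf2 (fun _ y => f y).
Proof. by move=> H; apply: (measurableT_comp H). Qed.
Lemma mf2_add f : mf f -> mf2 (fun x y => f (x + y)).
Proof.
move=> H; apply: (measurableT_comp H); exact: (measurable_rVD measurable_fst measurable_snd).
Qed.
Lemma mf2_sub f : mf f -> mf2 (fun x y => f (y - x)).
Proof.
move=> H; apply: (measurableT_comp H).
exact: (measurable_rVD measurable_snd (measurable_rVN measurable_fst)).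
Qed.
Lemma mf2D F G : mf2 F -> mf2 G -> mf2 (fun x y => F x y + G x y).
Proof. exact: measurable_funD. Qed.
Lemma mf2M F G : mf2 F -> mf2 G -> mf2 (fun x y => F x y * G x y).
Proof. exact: measurable_funM. Qed.
Lemma mf2N F : mf2 F -> mf2 (fun x y => - F x y).
Proof. by move=> H; apply: measurableT_comp. Qed.
Lemma mf2X F k : mf2 F -> mf2 (fun x y => F x y ^+ k).
Proof. exact: measurable_funX. Qed.
Lemma mf2norm F : mf2 F -> mf2 (fun x y => `|F x y|).
Proof. by move=> H; apply: measurableT_comp. Qed.

End real_integrals.

Ltac meas_simple := repeat first [assumption | exact: mfC | apply: mfnorm | apply: mfX | apply: mfD
  | apply: mfM | apply: mfN | apply: mf_pow | apply: mf_shift | apply: mf_sum => ?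
  | apply: mf_indic | apply: mf_smooth].
Ltac nonneg_simple := intros; repeat first [done | assumption | exact: normr_ge0 | exact: sqr_ge0
  | exact: powR_ge0 | exact: dot_ge0 | exact: enorm_ge0 | exact: ltW | apply: addr_ge0
  | apply: mulr_ge0 | apply: exprn_ge0 | rewrite invr_ge0 | apply: sumr_ge0 => ? _].

(** * Mollification *)

Section convolution.
Context {R : realType} {n : nat}.
Local Notation X := (bT R n).
Local Notation mu := (@mu R n).
Implicit Types (f g r : 'rV[R]_n -> R) (x y z : 'rV[R]_n).
Local Notation e_ i := (delta_mx 0 i : 'rV[R]_n).

(** The kernel is read at [y - z], as a translated test function of [y]. This fits the weak-gradient
    identity directly, at the price of the minus sign in [partial_conv]. *)
Definition conv f r z : R := RI (fun y => f y * r (y - z)).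

Lemma Iable_conv f r z : Iable f -> cc r -> Iable (fun y => f y * r (y - z)).
Proof.
move=> If cr; have [M M0 rM] := cc_bounded cr.
by apply: (Iable_mulb If (M := M)) => //; apply: mf_shift; apply: mf_smooth; case: cr.
Qed.

(** Taylor expansion of the kernel inside the integral: its error is M h^2 uniformly in [y], and
    integration against [f] costs the L^1 norm of [f]. *)
Lemma conv_quad f r i z : Iable f -> cc r ->
  exists C, forall h : R, `|conv f r (h *: e_ i + z) - conv f r z - h * (- conv f (partial i r)
    z)| <= C * h ^+ 2.
Proof.
move=> If cr; have [M M0 rM] := cc_bounded (cc_partial i (cc_partial i cr)).
exists (M * RI (fun z => `|f z|)) => h.
have I1 := Iable_conv (h *: e_ i + z) If cr; have I2 := Iable_conv z If cr.
have I3 := Iable_conv z If (cc_partial i cr).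
rewrite (_ : _ - _ = RI (fun y => f y * (r (y - (h *: e_ i + z)) - r (y - z)
  + h * partial i r (y - z)))).
  rewrite mulrAC; apply: RI_mulb => //.
    have [sr _] := cr; have sp := smooth_partial i sr.
    apply: mfD; first by apply: mfB; apply: mf_shift; exact: mf_smooth.
    by apply: mfM; [exact: mfC|apply: mf_shift; exact: mf_smooth].
  move=> y; have := smooth_taylor (y - z) (- h) cr.1 rM.
  have -> : - h *: e_ i + (y - z) = y - (h *: e_ i + z) by rewrite scaleNr opprD addrCA.
  by rewrite sqrrN mulNr opprK.
rewrite mulrN opprK /conv -RIB// -RIZ// -RID//; last exact: IableZ.
  by congr RI; apply/funext => y; ring.
exact: IableB.
Qed.

Lemma conv_is_derive f r i z : Iable f -> cc r ->
  is_derive z (e_ i) (conv f r) (- conv f (partial i r) z).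
Proof. by move=> If cr; have [C HC] := conv_quad i z If cr; exact: is_derive_quad HC. Qed.

Lemma conv_continuous f r : Iable f -> cc r -> continuous (conv f r).
Proof.
move=> If cr; have [M M0 rM] := cc_partial_bounded cr.
apply: (@enorm_lipschitz_continuous _ _ _ (n%:R * M * RI (fun z => `|f z|))) => x y.
have I1 := Iable_conv x If cr; have I2 := Iable_conv y If cr.
rewrite /conv -RIB//.
rewrite (_ : RI _ = RI (fun w => f w * (r (w - x) - r (w - y)))); last first.
  by congr RI; apply/funext => w; ring.
rewrite mulrAC; apply: RI_mulb => //.
  by have [sr _] := cr; apply: mfB; apply: mf_shift; exact: mf_smooth.
move=> w; have := smooth_lipschitz cr.1 rM (w - y) (y - x).
by rewrite addrA subrK enorm_distC.
Qed.

Lemma conv_smooth f r : Iable f -> cc r -> smooth (conv f r).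
Proof.
move=> If cr k; elim: k r cr => [|k IH] r cr; first exact: conv_continuous.
apply: (@CkSI _ _ k _ (fun i z => (-1) * conv f (partial i r) z)).
- exact: conv_continuous.
- by move=> i z; rewrite mulN1r; exact: conv_is_derive.
- by move=> i; apply: Ck_mul; [exact: Ck_cst|apply: IH; exact: cc_partial].
Qed.

Lemma partial_conv f r i z : Iable f -> cc r -> partial i (conv f r) z = - conv f (partial i r) z.
Proof. by move=> If cr; apply: (@derive_val _ _ _ _ _ _ _ (conv_is_derive i z If cr)). Qed.

Lemma convB f g r z : Iable f -> Iable g -> cc r ->
  conv (fun y => f y - g y) r z = conv f r z - conv g r z.
Proof.
move=> If Ig cr; rewrite /conv -RIB; try exact: Iable_conv.
by congr RI; apply/funext => y; rewrite mulrBl.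
Qed.

Definition ce (e : R) : R := RI (@bump R n e).
Definition rho (e : R) z : R := (ce e)^-1 * bump e z.

(** The bump is at least a constant on the ball of radius [e / 2], which contains a cube of side
    [e / n]. *)
Lemma ce_lb : (0 < n)%N -> exists2 c, 0 < c & forall e, 0 < e -> c * e ^+ n <= ce e.
Proof.
move=> n0; have [c c0 Hc] := @bump_lb R n.
exists (c * n%:R^-1 ^+ n); first by rewrite mulr_gt0// exprn_gt0// invr_gt0 ltr0n.
move=> e e0; have e2 : 0 <= e / 2 by rewrite divr_ge0// ltW.
rewrite -mulrA -exprMn -lee_fin /ce RI_EFin; last exact: cc_Iable (cc_bump e0).
have mB := @measurable_eball R n 0 (e / 2).
apply: (@le_trans _ _ (II (fun z => c * \1_(eball 0 (e / 2) : set X) z))); last first.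
  apply: II_le.
  - by apply: mfM; [exact: mfC|exact: mf_indic].
  - by apply: mf_smooth; exact: smooth_bump.
  - by move=> z; rewrite mulr_ge0// ltW.
  - move=> z; rewrite indicE; case: (asboolP (eball 0 (e / 2) z)) => zB.
      rewrite mem_set// mulr1; apply: Hc => //; apply: ltW.
      by move: zB; rewrite /eball/= subr0.
    by rewrite memNset// mulr0 bump_ge0.
rewrite II_scale ?(ltW c0)//; last exact: mf_indic.
rewrite II_indic// EFinM lee_wpmul2l ?lee_fin ?(ltW c0)//.
apply: le_trans (mu_eball_ge 0 n0 e2); rewrite lee_fin (_ : n%:R^-1 * e = 2 * (e / 2 / n%:R))//.
by field; rewrite pnatr_eq0 -lt0n.
Qed.

Hypothesis n0 : (0 < n)%N.

Lemma ce_gt0 e : 0 < e -> 0 < ce e.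
Proof.
move=> e0; have [c c0 Hc] := ce_lb n0; apply: lt_le_trans (Hc e e0).
by rewrite mulr_gt0// exprn_gt0.
Qed.

Lemma rho_ge0 e z : 0 < e -> 0 <= rho e z.
Proof. by move=> e0; rewrite mulr_ge0 ?bump_ge0// invr_ge0 ltW// ce_gt0. Qed.

Lemma cc_rho e : 0 < e -> cc (rho e).
Proof. by move=> e0; apply: cc_mul; [exact: smooth_cst|exact: cc_bump]. Qed.

Lemma mf_rho e : 0 < e -> mf (rho e).
Proof. by move=> e0; apply: mf_smooth; have [] := cc_rho e0. Qed.

Lemma rho0 e z : 0 < e -> e <= enorm z -> rho e z = 0.
Proof. by move=> e0 ez; rewrite /rho bump0// mulr0. Qed.

Lemma RI_rho e : 0 < e -> RI (rho e) = 1.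
Proof.
move=> e0; rewrite /rho RIZ ?mulVf ?gt_eqF ?ce_gt0//; exact: cc_Iable (cc_bump e0).
Qed.

Lemma RI_rho_shift e z : 0 < e -> RI (fun y => rho e (y - z)) = 1.
Proof. by move=> e0; rewrite (RI_shift (- z) (mf_rho e0)) RI_rho. Qed.

Lemma II_rho e : 0 < e -> II (rho e) = 1%E.
Proof. by move=> e0; rewrite /II -RI_EFin ?RI_rho//; exact: cc_Iable (cc_rho e0). Qed.

Lemma conv_rho_ge0 f e z : 0 < e -> (forall y, 0 <= f y) -> 0 <= conv f (rho e) z.
Proof. by move=> e0 f0; apply: RI_ge0 => y; rewrite mulr_ge0// rho_ge0. Qed.

Lemma conv_rho_supp f e z : 0 < e -> (forall y, enorm (y - z) < e -> f y = 0) -> conv f (rho e)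
  z = 0.
Proof.
move=> e0 f0; rewrite /conv (_ : (fun _ => _) = fun=> 0); last first.
  apply/funext => y; have [ye|ye] := ltP (enorm (y - z)) e; first by rewrite f0// mul0r.
  by rewrite rho0// mulr0.
by rewrite /RI /Rintegral integral0.
Qed.

(** The gradient of the bump is O(1/e) on a set of volume O(e^n), and the normalisation divides by
    at least a multiple of e^n; a single 1/e survives. *)
Lemma cutoff_cst : exists2 C, 0 < C & forall e z i, 0 < e ->
  RI (fun y => `|partial i (rho e) (y - z)|) <= C / e.
Proof.
have [c c0 Hc] := ce_lb n0; have [C C0 HC] := @bump_partial_ub R n.
exists (C * 4 ^+ n / c); first by rewrite divr_gt0// mulr_gt0// exprn_gt0.
move=> e z i e0; have ce0 := ce_gt0 e0; have sp := smooth_partial i (cc_rho e0).1.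
have en0 : 0 < e ^+ n by rewrite exprn_gt0.
have pE y : partial i (rho e) y = (ce e)^-1 * partial i (bump e) y.
  rewrite /rho partial_mul; [|exact: smooth_cst|exact: smooth_bump].
  by rewrite /partial derive_cst mulr0 addr0.
rewrite -lee_fin RI_EFin; last first.
  have Ip : Iable (partial i (rho e)) by apply: cc_Iable; apply: cc_partial; exact: cc_rho.
  exact: (Iable_norm (Iable_shift (- z) Ip)).
have mB := @measurable_eball R n z (2 * e).
have e20 : 0 <= 2 * e by rewrite mulr_ge0// ltW.
have Cc0 : 0 <= C / e / (c * e ^+ n) by rewrite !mulr_ge0 ?invr_ge0 ?mulr_ge0 ?ltW.
apply: (@le_trans _ _ (II (fun y => (C / e / (c * e ^+ n)) * \1_(eball z (2 * e) : set X) y))).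
  apply: II_le.
  - by apply: mfnorm; apply: mf_shift; exact: mf_smooth.
  - by apply: mfM; [exact: mfC|exact: mf_indic].
  - by move=> y.
  - move=> y; rewrite indicE; case: (asboolP (eball z (2 * e) y)) => yz.
      rewrite mem_set// mulr1 pE normrM (ger0_norm (_ : 0 <= (ce e)^-1)) ?invr_ge0 ?(ltW ce0)//.
      rewrite mulrC ler_pM ?invr_ge0 ?(ltW ce0)//; first exact: HC.
      by rewrite lef_pV2 ?posrE ?mulr_gt0//; exact: Hc.
    rewrite memNset// mulr0 (_ : partial i (rho e) (y - z) = 0) ?normr0//.
    apply: (partial_open0 i (@open_enorm_gt _ _ e)) => [w /ltW|]; first exact: rho0.
    move/negP : yz; rewrite /eball/= -leNgt; apply: lt_le_trans.
    by rewrite ltr_pMl// ltr1n.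
rewrite II_scale//; last exact: mf_indic.
rewrite II_indic//.
apply: le_trans (lee_wpmul2l _ (mu_eball_le z e20)) _; first by rewrite lee_fin.
rewrite -EFinM lee_fin mulrA -natrM exprMn (_ : C / e / (c * e ^+ n) * _ = C * 4 ^+ n / c / e)//.
by field; rewrite !gt_eqF.
Qed.

(** The cut-off is the mollified indicator of [F]. Its gradient is bounded by the L^1 norm of the
    gradient of the kernel, hence by a constant independent of [F]. *)
Lemma cutoff : exists2 C, 0 < C & forall (F : set 'rV[R]_n) (e M : R), 0 < e ->
  measurable (F : set X) ->
  F `<=` eball 0 M -> exists eta, [/\ smooth eta, forall z, 0 <= eta z <= 1,
    forall i z, `|partial i eta z| <= C / e, forall z, eball z e `<=` F -> eta z = 1 &
    forall z, (forall y, eball z e y -> ~ F y) -> eta z = 0].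
Proof.
have [C C0 HC] := cutoff_cst; exists C => // F e M e0 mF FM.
have I1 : Iable (\1_F : 'rV[R]_n -> R).
  apply: (@Iable_bounded_supp _ _ _ 1 M); first exact: mf_indic.
    by move=> z; rewrite indicE; case: (_ \in _); rewrite ?normr1 ?normr0.
  move=> z Mz; rewrite indicE memNset// => /FM; rewrite /eball/= subr0.
  by move/lt_trans => /(_ _ Mz); rewrite ltxx.
have F01 z : 0 <= (\1_F : 'rV[R]_n -> R) z <= 1 by rewrite indicE; case: (_ \in _);
  rewrite ?lexx ?ler01.
have Ir z : Iable (fun y => rho e (y - z)) by apply: (Iable_shift (- z)); apply: cc_Iable;
  exact: cc_rho.
exists (conv (\1_F) (rho e)); split.
- by apply: conv_smooth => //; exact: cc_rho.
- move=> z; apply/andP; split; first by apply: conv_rho_ge0 => // y; case/andP: (F01 y).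
  rewrite -(RI_rho_shift z e0); apply: RI_le => //; first by apply: Iable_conv => //; exact: cc_rho.
  by move=> y; rewrite -[leRHS]mul1r ler_wpM2r ?rho_ge0//; case/andP: (F01 y).
- move=> i z; rewrite partial_conv//; last exact: cc_rho.
  have cp := cc_partial i (cc_rho e0).
  rewrite normrN (le_trans _ (HC e z i e0))// (le_trans (RI_norm (Iable_conv z I1 cp)))//.
  apply: RI_le; first by apply: Iable_norm; exact: Iable_conv.
    exact: (Iable_norm (Iable_shift (- z) (cc_Iable cp))).
  move=> y; rewrite normrM -[leRHS]mul1r ler_wpM2r// ger0_norm//; by case/andP: (F01 y).
- move=> z zF; rewrite -(RI_rho_shift z e0); congr RI; apply/funext => y.
  have [ye|ye] := ltP (enorm (y - z)) e; last by rewrite rho0// mulr0.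
  by rewrite indicE mem_set ?mul1r//; exact: zF.
- move=> z zF; apply: conv_rho_supp => // y yz.
  by rewrite indicE memNset//; exact: zF.
Qed.

End convolution.

(** * Continuity of translations in measure and in L^1 *)

Section translation_continuity.
Context {R : realType} {n : nat}.
Local Notation X := (bT R n).
Local Notation mu := (@mu R n).
Implicit Types (f g r : 'rV[R]_n -> R) (x y z h : 'rV[R]_n).

Lemma mu_bigsetU_le (I : Type) (s : seq I) (A : I -> set X) : (forall i, measurable (A i)) ->
  (mu (\big[setU/set0]_(i <- s) A i) <= \sum_(i <- s) mu (A i))%E.
Proof.
move=> mA; elim: s => [|i s IH]; first by rewrite !big_nil measure0.
rewrite !big_cons; apply: (@le_trans _ _ (mu (A i) + mu (\big[setU/set0]_(j <- s) A j))%E).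
  by apply: measureU2 => //; exact: bigsetU_measurable.
exact: leeD.
Qed.

(** A generating system stable under intersection whose members have their boundary in [n]
    hyperplanes, so that for them continuity of translations is a computation. *)
Definition lower_orthants : set (set X) :=
  [set A | exists a : 'I_n -> R, A = rbox (fun i => `]-oo, a i[%classic)].

Lemma measurable_lower_orthants : @measurable _ X = <<s lower_orthants >>.
Proof.
apply/seteqP; split; last first.
  apply: smallest_sub; first exact: sigma_algebra_measurable.
  by move=> _ [a ->]; apply: measurable_rbox => i; exact: measurable_itv.
have sG := smallest_sigma_algebra [set: X] lower_orthants.
have sray (i : 'I_n) (a : R) : <<s lower_orthants >> [set z : X | z 0 i < a].
  rewrite (_ : [set z : X | z 0 i < a] = \bigcup_k rbox (fun j => `]-oo,
    (if j == i then a else k%:R)[%classic)).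
    apply: sigma_algebra_bigcup => k; apply: sub_sigma_algebra.
    by exists (fun j => if j == i then a else k%:R).
  apply/seteqP; split => [z /= za|z [k _ /(_ i)]]; last by rewrite /= in_itv/= eqxx.
  exists (Num.trunc (\sum_j `|z 0 j|)).+1 => // j; rewrite /= in_itv/=; case: eqVneq => [->//|_].
  rewrite (le_lt_trans (ler_norm _))//; apply: le_lt_trans (truncnS_gt _).
  by rewrite (bigD1 j)//= lerDl sumr_ge0.
have scoord (i : 'I_n) (Y : set (measurableTypeR R)) : measurable Y ->
  <<s lower_orthants >> [set z : X | Y (z 0 i)].
  rewrite RGenInftyO.measurableE; move: Y; apply: smallest_sub.
    split.
    - by rewrite (_ : [set z : X | set0 (z 0 i)] = set0)//; exact: sigma_algebra0.
    - by move=> Y HY; rewrite setTD; apply: (sigma_algebraC HY).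
    - by move=> F HF; apply: (sigma_algebra_bigcup HF).
  move=> _ [a ->]; rewrite (_ : [set z : X | `]-oo, a[%classic (z 0 i)] = [set z : X |
    z 0 i < a]); first exact: sray.
  by apply/seteqP; split => z; rewrite /= in_itv.
move=> A mA; rewrite /measurable/= /borel_rV/= in mA.
have H (B : set (n.-tuple (measurableTypeR R))) : measurable B ->
  <<s lower_orthants >> [set z : X | B (tuple_of_rV z)].
  move: B; apply: smallest_sub.
    split.
    - by rewrite (_ : [set z : X | set0 _] = set0)//; exact: sigma_algebra0.
    - by move=> Y HY; rewrite setTD; apply: (sigma_algebraC HY).
    - by move=> F HF; apply: (sigma_algebra_bigcup HF).
  move=> B; rewrite -bigcup_seq => -[i /= _ [Y mY <-]].
  rewrite setTI (_ : [set z : X | _] = [set z : X | Y (z 0 i)]); first exact: scoord.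
  by apply/seteqP; split => z; rewrite /= tnth_mktuple.
rewrite (_ : A = [set z : X | (@rV_of_tuple R n @^-1` A) (tuple_of_rV z)]); first exact: H.
by apply/seteqP; split => z; rewrite /= tuple_of_rVK.
Qed.

Definition sdiff (A : set X) h : set X :=
  [set z | (A z /\ ~ A (z + h)) \/ (~ A z /\ A (z + h))].

Lemma sdiffE A h : sdiff A h = (A `\` ((fun z : X => z + h : X) @^-1` A))
  `|` (((fun z : X => z + h : X) @^-1` A) `\` A).
Proof. by apply/seteqP; split => z; rewrite /sdiff/=; tauto. Qed.

Lemma measurable_sdiff A h : measurable A -> measurable (sdiff A h).
Proof.
move=> mA; have mS := measurable_preim (measurable_shift h) mA.
by rewrite sdiffE; apply: measurableU; exact: measurableD.
Qed.

(** The symmetric difference of a set and its translate may have infinite measure, as for a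
    half-space; hence the restriction to a cube. *)
Definition tcont_set (A : set X) := forall (N e : R), 0 < N -> 0 < e -> exists2 s, 0 < s &
  forall h, enorm h < s -> (mu (cube 0 N `&` sdiff A h) <= e%:E)%E.

Lemma mu_slab (i : 'I_n) (a N s : R) : 0 < N -> 0 < s ->
  (mu (cube 0 N `&` [set z : X | `|z 0 i - a| < s]%R) <= (2 * s * (2 * N) ^+ n.-1)%:E)%E.
Proof.
move=> N0 s0.
have mI (A : set X) (B : set X) : A `<=` B -> measurable A -> measurable B -> (mu A <= mu B)%E.
  by move=> AB mA mB; apply: le_measure; rewrite ?inE.
pose B j := if j == i then `]a - s, a + s[%classic else `]- N, N[%classic : set R.
have mB j : measurable (B j : set (measurableTypeR R)) by rewrite /B; case: ifP => _;
  exact: measurable_itv.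
have mS : measurable ([set z : X | `|z 0 i - a| < s]).
  rewrite (_ : [set z : X | _] = (fun z : X => z 0 i) @^-1` `]a - s, a + s[%classic).
    by apply: (measurable_preim (measurable_coord i)); exact: measurable_itv.
  by apply/seteqP; split => z; rewrite /= in_itv/= -ltr_distl.
apply: (@le_trans _ _ (mu (rbox B))).
  apply: mI; last exact: measurable_rbox.
    move=> z [zN /= zs] j; rewrite /B; case: eqVneq => [->|_];
      first by rewrite /= in_itv/= -ltr_distl.
    by have := zN j; rewrite /= mxE sub0r add0r.
  by apply: measurableI => //; exact: measurable_cube.
rewrite mu_rbox// (bigD1 i)//= {1}/B eqxx lebesgue_measure_itv/= lte_fin ltrD2l gt0_cp//.
rewrite (eq_bigr (fun=> (2 * N)%:E)); last first.
  move=> j ji; rewrite /B (negbTE ji) lebesgue_measure_itv/= lte_fin gt0_cp//.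
  by rewrite -EFinD; congr (_%:E); ring.
rewrite prodEFin prodr_const -EFinD -EFinM lee_fin cardC1 card_ord.
by rewrite (_ : a + s - (a - s) = 2 * s)//; ring.
Qed.

(** If exactly one of [z] and [z + h] lies in the orthant, some coordinate of [z] is within |h| of
    the bounding hyperplane. [K] is the total measure of the [n] slabs inside the cube per unit of
    width, rounded up to stay positive for [n = 0]. *)
Lemma tcont_lower_orthant a : tcont_set (rbox (fun i => `]-oo, a i[%classic)).
Proof.
move=> N e N0 e0; pose K := n.+1%:R * (2 * (2 * N) ^+ n.-1).
have K0 : 0 < K by rewrite !mulr_gt0// exprn_gt0// mulr_gt0.
exists (e / K); first by rewrite divr_gt0.
move=> h hs; have s0 : 0 < e / K by rewrite divr_gt0.
pose S (i : 'I_n) : set X := cube 0 N `&` [set z : X | `|z 0 i - a i| < e / K].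
have mA : measurable (rbox (fun i => `]-oo, a i[%classic) : set X).
  by apply: measurable_rbox => i; exact: measurable_itv.
have mS i : measurable (S i).
  apply: measurableI; first exact: measurable_cube.
  rewrite (_ : [set z : X | _] = (fun z : X => z 0 i) @^-1` `]a i - e / K, a i + e / K[%classic).
    by apply: (measurable_preim (measurable_coord i)); exact: measurable_itv.
  by apply/seteqP; split => z; rewrite /= in_itv/= -ltr_distl.
have hi i : `|h 0 i| < e / K by rewrite (le_lt_trans (coord_le_enorm h i)).
apply: (@le_trans _ _ (mu (\big[setU/set0]_(i < n) S i))).
  apply: le_measure; rewrite ?inE.
  - by apply: measurableI; [exact: measurable_cube|exact: measurable_sdiff].
  - exact: bigsetU_measurable.
  move=> z [zN zA]; rewrite -bigcup_seq.
  have [i ia] : exists i, `|z 0 i - a i| < e / K; last by exists i => /=; rewrite ?mem_index_enum.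
  apply: contrapT => /forallNP Hn; case: zA => -[zA1 zA2].
    apply: zA2 => i; have := zA1 i; rewrite /= !in_itv/= mxE => za.
    have := Hn i; have := hi i; move=> /ltr_normlW hi1 /negP;
      rewrite -leNgt ltr0_norm ?subr_lt0// opprB => H.
    by lra.
  apply: zA1 => i; have := zA2 i; rewrite /= !in_itv/= mxE => za.
  have := Hn i; have := hi i; rewrite ltNge => /negP hi1 /negP; rewrite -leNgt => H.
  rewrite ltNge; apply/negP => az; apply: hi1.
  move: H; rewrite ger0_norm ?subr_ge0// => H; rewrite (le_trans H)//.
  by have := ler_norm (- h 0 i); rewrite normrN; lra.
apply: (@le_trans _ _ (\sum_(i < n) mu (S i))%E); first exact: mu_bigsetU_le.
apply: (@le_trans _ _ (\sum_(i < n) (2 * (e / K) * (2 * N) ^+ n.-1)%:E)%E).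
  by apply: lee_sum => i _; exact: mu_slab.
rewrite sumEFin lee_fin big_const_ord iter_addr addr0.
rewrite -[leLHS]mulr_natr (_ : _ * n%:R = e * (n%:R / n.+1%:R)).
  by rewrite ler_piMr ?(ltW e0)// ler_pdivrMr// mul1r ler_nat.
have P0 : (2 * N) ^+ n.-1 != 0 by rewrite gt_eqF// exprn_gt0// mulr_gt0.
have P1 : n.+1%:R != 0 :> R by rewrite pnatr_eq0.
rewrite /K; move: (n.+1%:R : R) (_ ^+ n.-1) P1 P0 => m p P1 P0.
by field; rewrite P1 P0.
Qed.

End translation_continuity.

(** * Convergence of mollifications in L^1 and L^2 *)

Section mollification_convergence.
Context {R : realType} {n : nat}.
Local Notation X := (bT R n).
Local Notation mu := (@mu R n).
Implicit Types (f g r : 'rV[R]_n -> R) (x y z h : 'rV[R]_n).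

Lemma mu_le (A B : set X) : A `<=` B -> measurable A -> measurable B -> (mu A <= mu B)%E.
Proof. by move=> AB mA mB; apply: le_measure; rewrite ?inE. Qed.

Lemma mu_U2 (A B : set X) : measurable A -> measurable B -> (mu (A `|` B) <= mu A + mu B)%E.
Proof. by move=> mA mB; apply: measureU2. Qed.

Import HBSimple.

(** Up to a tail of measure at most [e / 3] the union is finite. The tail enters twice, at [z] and
    at [z + h], and is measured in the cube of half-side [N + 1], which contains [z + h] once |h| <
    1. *)
Lemma tcont_bigcup (F : (set X)^nat) : (forall k, measurable (F k)) -> trivIset setT F ->
  (forall k, tcont_set (F k)) -> tcont_set (\bigcup_k F k).
Proof.
move=> mF tF cF N e N0 e0; have e3 : 0 < e / 3 by rewrite divr_gt0.
pose C : set X := cube 0 (N + 1).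
have mC : measurable C by exact: measurable_cube.
have N1 : 0 <= N + 1 by rewrite addr_ge0 ?(ltW N0).
pose T k : set X := (\bigcup_(j >= k) F j) `&` C.
have mT k : measurable (T k) by apply: measurableI => //; apply: bigcup_measurable.
have [K HK] : exists K, (mu (T K) <= (e / 3)%:E)%E.
  have : mu (T k) @[k --> \oo] --> mu (\bigcap_k T k).
    apply: nonincreasing_cvg_mu => //.
    - rewrite (@le_lt_trans _ _ (mu C))//; last by rewrite mu_cube// ltry.
      by apply: mu_le => // z [].
    - exact: bigcap_measurable.
    - move=> i j ij; apply/subsetPset => z [[k /= jk Fk] Cz]; split => //.
      by exists k => //=; exact: leq_trans jk.
  rewrite (_ : \bigcap_k T k = set0); last first.
    rewrite -subset0 => z Tz; have [[k _ Fk] _] := Tz 0%N I.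
    have [[j /= lvl Fj] _] := Tz k.+1 I.
    have /trivIsetP/(_ k j I I) := tF; rewrite neq_ltn lvl => /(_ erefl);
      rewrite -subset0 => /(_ z); exact.
  rewrite measure0 => /fine_cvgP[fT /cvgrPdist_le /(_ _ e3) H].
  have [k _ /(_ k (leqnn k)) [/= fk]] := filterI fT H.
  rewrite sub0r normrN ger0_norm ?fine_ge0// => Hk; exists k.
  by rewrite -(fineK fk) lee_fin.
have [s s0 Hs] : exists2 s, 0 < s & forall h, enorm h < s ->
    (\sum_(k < K) mu (cube 0 N `&` sdiff (F k) h) <= (e / 3)%:E)%E.
  elim: K (e / 3) e3 {HK} => [|K IH] d d0; first by exists 1 => // h _;
    rewrite big_ord0 lee_fin ltW.
  have d2 : 0 < d / 2 by rewrite divr_gt0.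
  have [s1 s10 H1] := IH _ d2; have [s2 s20 H2] := cF K N _ N0 d2.
  exists (Num.min s1 s2); first by rewrite lt_min s10 s20.
  move=> h; rewrite lt_min => /andP[h1 h2]; rewrite big_ord_recr/=.
  by rewrite [in leRHS](_ : d = d / 2 + d / 2) ?EFinD ?leeD ?H1 ?H2//; lra.
exists (Num.min s 1); first by rewrite lt_min s0 ltr01.
move=> h; rewrite lt_min => /andP[hs h1].
pose S (k : 'I_K) : set X := cube 0 N `&` sdiff (F k) h.
have mS k : measurable (S k) by apply: measurableI; [exact: measurable_cube|exact:
  measurable_sdiff].
pose T' : set X := (fun z : X => z + h : X) @^-1` T K.
have mT' : measurable T' by exact: (measurable_preim (measurable_shift h)).
have mSS : measurable (\big[setU/set0]_(k < K) S k) by exact: bigsetU_measurable.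
apply: (@le_trans _ _ (mu (\big[setU/set0]_(k < K) S k `|` (T K `|` T')))).
  apply: mu_le.
  - move=> z [zN zd].
    have zC : C z by move=> i; have := zN i; rewrite /= !in_itv/= !mxE => /andP[? ?]; apply/andP;
      split; lra.
    have zhC : C (z + h).
      move=> i; have := zN i; have hi := coord_le_enorm h i;
        rewrite /= !in_itv/= !mxE => /andP[? ?].
      by have /ltr_normlP[? ?] := le_lt_trans hi h1; apply/andP; split; lra.
    have [[k kK zk]|Hn] := pselect (exists2 k, (k < K)%N & sdiff (F k) h z).
      by left; rewrite -bigcup_seq; exists (Ordinal kK) => /=; rewrite ?mem_index_enum.
    right; case: zd => -[zd1 zd2].
    + left; split => //; case: zd1 => k _ zk; exists k => //=; rewrite leqNgt; apply/negP => kK.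
      by apply: Hn; exists k => //; left; split => // zk'; apply: zd2; exists k.
    + right; split => //; case: zd2 => k _ zk; exists k => //=; rewrite leqNgt; apply/negP => kK.
      by apply: Hn; exists k => //; right; split => // zk'; apply: zd1; exists k.
  - by apply: measurableI; [exact: measurable_cube|apply: measurable_sdiff;
    exact: bigcupT_measurable].
  - by apply: measurableU => //; exact: measurableU.
apply: le_trans (mu_U2 mSS (measurableU _ _ (mT K) mT')) _.
rewrite (_ : e = e / 3 + (e / 3 + e / 3)); last by lra.
rewrite EFinD; apply: leeD.
  by apply: le_trans (Hs _ hs); exact: mu_bigsetU_le.
apply: le_trans (mu_U2 (mT K) mT') _; rewrite EFinD; apply: leeD => //.
by rewrite /T' mu_shift.
Qed.

(** Dynkin's theorem: complements have the same [sdiff], and disjoint unions are [tcont_bigcup]. *)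
Lemma tcont_measurable (A : set X) : measurable A -> tcont_set A.
Proof.
rewrite measurable_lower_orthants; move: A.
apply: (@dynkin_induction _ X lower_orthants (@tcont_set R n)).
- exact: measurable_lower_orthants.
- move=> _ _ [a ->] [b ->]; exists (fun i => Num.min (a i) (b i)).
  apply/seteqP; split => z.
    by move=> [H1 H2] i; have := H1 i; have := H2 i; rewrite /= !in_itv/= lt_min => -> ->.
  by move=> H; split => i; have := H i; rewrite /= !in_itv/= lt_min => /andP[].
- move=> N e N0 e0; exists 1 => // h _; rewrite (_ : _ `&` _ = set0) ?measure0 ?lee_fin ?(ltW e0)//.
  by apply/seteqP; split => z // [_]; rewrite /sdiff/=; tauto.
- move=> _ [a ->]; exact: tcont_lower_orthant.
- move=> S mS cS N e N0 e0; have [s s0 Hs] := cS N e N0 e0; exists s => // h hs.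
  rewrite (_ : sdiff (~` S) h = sdiff S h); first exact: Hs.
  by apply/seteqP; split => z; rewrite /sdiff/=; have [?|?] := pselect (S z);
    have [?|?] := pselect (S (z + h)); tauto.
- exact: tcont_bigcup.
Qed.

Lemma tcont_seq (l : seq (set X)) : (forall A, List.In A l -> measurable A) ->
  forall N e : R, 0 < N -> 0 < e -> exists2 s, 0 < s & forall h, enorm h < s ->
  (\sum_(A <- l) mu (cube 0 N `&` sdiff A h) <= e%:E)%E.
Proof.
elim: l => [|A l IH] ml N e N0 e0.
  by exists 1 => // h _; rewrite big_nil lee_fin ltW.
have e2 : 0 < e / 2 by rewrite divr_gt0.
have [s1 s10 H1] := IH (fun B HB => ml B (or_intror HB)) N _ N0 e2.
have [s2 s20 H2] := tcont_measurable (ml A (or_introl erefl)) N0 e2.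
exists (Num.min s1 s2); first by rewrite lt_min s10 s20.
move=> h; rewrite lt_min => /andP[h1 h2]; rewrite big_cons.
by rewrite [in leRHS](_ : e = e / 2 + e / 2) ?EFinD ?leeD ?H1 ?H2//; lra.
Qed.

Definition tcont f := forall e : R, 0 < e -> exists2 s, 0 < s & forall h, enorm h < s ->
  (II (fun z => `|f (z + h) - f z|)%R <= e%:E)%E.

(** [f] is close in L^1 to a simple function [g]. Where [g (z + h)] and [g z] differ, [z] lies in
    the symmetric difference of a level set of [g] and its translate, and there are finitely many
    level sets. *)
Lemma tcont_L1 f (r : R) : Iable f -> (forall z, r < enorm z -> f z = 0) -> tcont f.
Proof.
move=> If f0 e e0; have Hf := Iable_mf If.
have e4 : 0 < e / 4 by rewrite divr_gt0.
have [G [IG _ Gf]] := approximation_sfun_integrable measurableT If.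
have [k gk] : exists k, (II (fun z => `|f z - G k z|)%R <= (e / 4)%:E)%E.
  move/fine_cvgP : Gf => [fT /cvgrPdist_le /(_ _ e4) H].
  have [k _ /(_ k (leqnn k)) [/= fk]] := filterI fT H.
  rewrite sub0r normrN ger0_norm ?fine_ge0 ?integral_ge0// => Hk; exists k.
  by rewrite /II; rewrite -lee_fin fineK// in Hk.
have Hg : mf (G k) by exact: Iable_mf (IG k).
set g := G k in gk Hg.
have [M M0 gM] : exists2 M, 0 <= M & forall z, `|g z| <= M.
  have [M [_ HM]] := simple_bounded g; exists (`|M| + 1); first by rewrite addr_ge0.
  by move=> z; apply: HM => //; rewrite ltr_pwDr// ler_norm.
have /finite_seqP[s gs] := @fimfunP _ _ g.
pose l := [seq (g @^-1` [set a]) | a <- s] : seq (set X).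
pose N := `|r| + 2; have N0 : 0 < N by rewrite ltr_wpDl.
have ml A : List.In A l -> measurable A.
  by rewrite /l => /List.in_map_iff[a [<- _]]; apply: measurable_preim.
have eM : 0 < e / 2 / (2 * M + 1) by rewrite divr_gt0 ?divr_gt0// ltr_wpDl// mulr_ge0.
have [d d0 Hd] := tcont_seq ml N0 eM.
exists (Num.min d 1); first by rewrite lt_min d0 ltr01.
move=> h; rewrite lt_min => /andP[hd h1].
(* [q] counts the level sets that separate [z] from [z + h]: it is at least 1 wherever [g] changes,
   and the change is at most [2 * M]. *)
pose q z := \sum_(A <- l) (\1_(cube 0 N `&` sdiff A h : set X) z : R).
have mq A : List.In A l -> mf (\1_(cube 0 N `&` sdiff A h)).
  by move=> Al; apply: mf_indic; apply: measurableI; [exact: measurable_cube|apply: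
    measurable_sdiff; exact: ml].
have [Hq IIq] : mf q /\ II q = (\sum_(A <- l) mu (cube 0 N `&` sdiff A h))%E.
  rewrite /q; elim: (l) ml mq => [|A l' IH] ml mq.
    split; first by under eq_fun do rewrite big_nil; exact: mfC.
    by rewrite big_nil /II; under eq_integral do rewrite big_nil; rewrite integral0.
  have [IH1 IH2] := IH (fun B HB => ml B (or_intror HB)) (fun B HB => mq B (or_intror HB)).
  have mA := mq A (or_introl erefl).
  split; first by under eq_fun do rewrite big_cons; exact: mfD.
  rewrite big_cons -IH2 -II_indic; last by apply: measurableI;
    [exact: measurable_cube|apply: measurable_sdiff; apply: ml; left].
  rewrite -II_add//; last by move=> z; apply: sumr_ge0.
  by apply: II_eq => z; rewrite big_cons.
have q0 z : 0 <= q z by apply: sumr_ge0.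
have Hfg : mf (fun z => `|f z - g z|) by apply: mfnorm; exact: mfB.
have M1 : 0 <= 2 * M by rewrite mulr_ge0.
apply: (@le_trans _ _ (II (fun z => (`|f (z + h) - g (z + h)| + `|f z - g z|) + 2 * M * q z))).
  apply: II_le.
  - by apply: mfnorm; apply: mfB => //; exact: mf_shift.
  - apply: mfD; last by apply: mfM => //; exact: mfC.
    by apply: mfD => //; exact: (@mf_shift _ _ (fun z => `|f z - g z|)).
  - by [].
  move=> z; have [zN|zN] := pselect (cube 0 N z); last first.
    have rz : r + 1 < enorm z.
      rewrite ltNge; apply/negP => zr; apply: zN; apply: eball_cube;
        rewrite /eball/= subr0 (le_lt_trans zr)//.
      by rewrite /N; have := ler_norm r; lra.
    have rzh : r < enorm (z + h).
      have := enormD (z + h) (- h); rewrite addrK enormN; lra.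
    rewrite !f0//; last by lra.
    by rewrite subrr normr0 !addr_ge0// mulr_ge0.
  have [gE|gE] := eqVneq (g (z + h)) (g z).
    rewrite (_ : f (z + h) - f z = (f (z + h) - g (z + h)) - (f z - g z)); last by rewrite gE; ring.
    by rewrite (le_trans (ler_normB _ _))// lerDl mulr_ge0.
  have q1 : 1 <= q z.
    have gzs : [set` s] (g z) by rewrite -gs; exists z.
    rewrite /q /l big_map (big_rem (g z))//=.
    rewrite indicE mem_set ?lerDl; first by apply: sumr_ge0 => i _; rewrite indicE.
    by split => //; left; split => //= /eqP; rewrite (negbTE gE).
  rewrite (_ : f (z + h) - f z = (f (z + h) - g (z + h)) - (f z - g z) + (g (z + h) - g z));
    last by ring.
  rewrite (le_trans (ler_normD _ _))// lerD ?(le_trans (ler_normB _ _))//.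
  rewrite (le_trans _ (_ : 2 * M <= _))//; last by rewrite ler_peMr.
  by have := gM (z + h); have := gM z; lra.
have Hfgh : mf (fun z => `|f (z + h) - g (z + h)|) by exact: (@mf_shift _ _ (fun z => `|f z - g
  z|)).
rewrite II_add; [|by meas_simple|by meas_simple|by nonneg_simple|by nonneg_simple].
rewrite II_add// (@II_shift _ _ (fun z => `|f z - g z|) h)// II_scale// IIq.
rewrite [in leRHS](_ : e = (e / 4 + e / 4) + e / 2); last by lra.
rewrite !EFinD; apply: leeD; first exact: leeD.
apply: le_trans (lee_wpmul2l _ (Hd _ hd)) _; first by rewrite lee_fin.
rewrite -EFinM lee_fin mulrCA.
rewrite ler_piMr ?divr_ge0 ?(ltW e0)// ler_pdivrMr ?mul1r ?lerDl//.
by rewrite ltr_wpDl.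
Qed.

(** The pattern of the averaging arguments below: bound [A z] by an average over [y], exchange the
    integrals, bound every slice. *)
Lemma II_le_fubini (A B : 'rV[R]_n -> R) (F : 'rV[R]_n -> 'rV[R]_n -> R) :
  mf A -> mf B -> mf2 F -> (forall z, 0 <= A z) -> (forall z, 0 <= B z) ->
  (forall x y, 0 <= F x y) -> (forall z, ((A z)%:E <= II (F z))%E) ->
  (forall y, (II (F ^~ y) <= (B y)%:E)%E) -> (II A <= II B)%E.
Proof.
move=> mA mB mF A0 B0 F0 AF FB.
apply: (@le_trans _ _ (\int[mu]_(z in (setT : set X)) II (F z))%E).
  apply: ge0_le_integral => //.
  - by move=> z _; rewrite lee_fin.
  - exact: mf_EFin.
  - exact: mf2_II.
rewrite II_fubini//; apply: ge0_le_integral => //.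
- by move=> z _; exact: II_ge0.
- exact: mf2_IIr.
- exact: mf_EFin.
Qed.

(** Expand the integral of the nonnegative function (f - m)^2 q, where [m] is the mean of [f]. *)
Lemma jensen f (q : 'rV[R]_n -> R) : mf f -> (forall z, 0 <= q z) -> Iable q -> RI q = 1 ->
  Iable (fun z => f z * q z) ->
  (((RI (fun z => f z * q z)) ^+ 2)%:E <= II (fun z => f z ^+ 2 * q z)%R)%E.
Proof.
move=> Hf q0 Iq q1 Ifq; have Hq := Iable_mf Iq.
have Hfq : mf (fun z => f z ^+ 2 * q z) by apply: mfM => //; exact: mfX.
have fq0 z : 0 <= f z ^+ 2 * q z by rewrite mulr_ge0 ?sqr_ge0.
have [foo|] := ltP (II (fun z => f z ^+ 2 * q z)) +oo%E; last first.
  by rewrite leye_eq => /eqP ->; rewrite leey.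
have I2 : Iable (fun z => f z ^+ 2 * q z).
  by apply/IableP; split => //; under [X in II X]eq_fun do rewrite ger0_norm//.
rewrite [X in (_ <= X)%E]/II -RI_EFin// lee_fin; set m := RI _.
have : 0 <= RI (fun z => (f z ^+ 2 * q z + (- (2 * m)) * (f z * q z)) + m ^+ 2 * q z).
  apply: RI_ge0 => z; rewrite (_ : _ + _ = (f z - m) ^+ 2 * q z); last by ring.
  by rewrite mulr_ge0 ?sqr_ge0.
rewrite RID//; [|by apply: IableD => //; exact: IableZ|exact: IableZ].
rewrite RID//; last exact: IableZ.
rewrite !RIZ// q1 -/m; set a := RI _; lra.
Qed.

Hypothesis n0 : (0 < n)%N.

Lemma conv_L1_pt f d z : 0 < d -> Iable f ->
  ((`|conv f (rho d) z - f z|)%:E <= II (fun y => `|f (z + y) - f z| * rho d y)%R)%E.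
Proof.
move=> d0 If; have Hf := Iable_mf If; have cr := @cc_rho R n d d0.
have I1 := Iable_conv z If cr; have I2 := Iable_shift (- z) (cc_Iable cr).
have E : conv f (rho d) z - f z = RI (fun y => (f y - f z) * rho d (y - z)).
  rewrite -[f z in LHS]mulr1 -(RI_rho_shift n0 z d0) -RIZ// -RIB//; last exact: IableZ.
  by congr RI; apply/funext => y; ring.
have I3 : Iable (fun y => (f y - f z) * rho d (y - z)).
  have := IableB I1 (IableZ (f z) I2); congr Iable; apply/funext => y; ring.
rewrite E; apply: (@le_trans _ _ (RI (fun y => `|(f y - f z) * rho d (y - z)|))%:E).
  by rewrite lee_fin RI_norm.
rewrite RI_EFin; last exact: Iable_norm.
rewrite -/(II (fun y => `|(f y - f z) * rho d (y - z)|)).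
rewrite -(II_shift z); [|by apply: mfnorm; exact: Iable_mf|by []].
apply: II_le => //.
- apply: (@mf_shift _ _ (fun y => `|(f y - f z) * rho d (y - z)|)); apply: mfnorm; exact: Iable_mf.
- apply: mfM; last exact: mf_rho.
  apply: mfnorm; apply: mfB; last exact: mfC.
  by under eq_fun do rewrite addrC; exact: mf_shift.
- by move=> y; rewrite addrK normrM (ger0_norm (rho_ge0 n0 y d0)) (addrC y).
Qed.

Lemma conv_L1 f (r : R) : Iable f -> (forall z, r < enorm z -> f z = 0) ->
  forall e : R, 0 < e -> exists2 s, 0 < s & forall d, 0 < d -> d < s ->
  (II (fun z => `|conv f (rho d) z - f z|)%R <= e%:E)%E.
Proof.
move=> If f0 e e0; have [s s0 Hs] := tcont_L1 If f0 e0; exists s => // d d0 ds.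
have Hf := Iable_mf If; have cr := @cc_rho R n d d0; have mr := @mf_rho R n d d0.
(* Writing [e] as an integral against the kernel brings the claim into the form of [II_le_fubini],
   the slice at [y] being a translation error. *)
have -> : e%:E = II (fun z => e * rho d z).
  by rewrite II_scale ?(ltW e0) ?II_rho ?mule1// => z; exact: rho_ge0.
apply: (@II_le_fubini _ _ (fun z y => `|f (z + y) - f z| * rho d y)) => //.
- by apply: mfnorm; apply: mfB => //; apply: mf_smooth; exact: conv_smooth.
- by apply: mfM => //; exact: mfC.
- apply: mf2M; last exact: mf2_snd.
  apply: mf2norm; apply: mf2D; first exact: mf2_add.
  by apply: mf2N; exact: mf2_fst.
- by move=> z; rewrite mulr_ge0 ?rho_ge0// ltW.
- by move=> x y; rewrite mulr_ge0 ?rho_ge0.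
- by move=> z; exact: conv_L1_pt.
- move=> y; have [dy|yd] := leP d (enorm y).
    rewrite rho0// mulr0 /II; under eq_integral do rewrite mulr0.
    by rewrite integral0.
  under II_eq do rewrite mulrC.
  rewrite II_scale ?rho_ge0//; last by apply: mfnorm; apply: mfB => //; exact: mf_shift.
  rewrite [(e * rho d y)%R]mulrC (EFinM (rho d y)); apply: lee_wpmul2l;
    first by rewrite lee_fin rho_ge0.
  by apply: Hs; exact: lt_trans ds.
Qed.

Lemma conv_sqr_pt f d z : 0 < d -> Iable f ->
  ((conv f (rho d) z ^+ 2)%:E <= II (fun y => f (y + z) ^+ 2 * rho d y)%R)%E.
Proof.
move=> d0 If; have cr := @cc_rho R n d d0; have Hf := Iable_mf If.
have H := jensen Hf (fun y => rho_ge0 n0 (y - z) d0) (Iable_shift (- z) (cc_Iable cr))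
  (RI_rho_shift n0 z d0) (Iable_conv z If cr).
apply: le_trans H _.
have mG : mf (fun y => f y ^+ 2 * rho d (y - z)).
  by apply: mfM; [exact: mfX|apply: mf_shift; exact: mf_rho].
rewrite -(II_shift z mG); last by move=> y; rewrite mulr_ge0 ?sqr_ge0 ?rho_ge0.
apply: II_le.
- exact: (mf_shift z mG).
- apply: mfM; last exact: mf_rho.
  by apply: mfX; exact: mf_shift.
- by move=> y; rewrite mulr_ge0 ?sqr_ge0 ?rho_ge0.
- by move=> y; rewrite addrK.
Qed.

(* The slack [k z <= k' (z - y)] for small [y] replaces a limit [d -> 0]. *)
Lemma conv_sqr_le f (k k' : 'rV[R]_n -> R) d : 0 < d -> Iable f -> mf k -> mf k' ->
  (forall z, 0 <= k z) -> (forall z, 0 <= k' z) ->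
  (forall z y, enorm y < d -> k z <= k' (y + z)) ->
  (II (fun z => k z * conv f (rho d) z ^+ 2)%R <= II (fun z => k' z * f z ^+ 2)%R)%E.
Proof.
move=> d0 If mk mk' k0 k'0 kk; have cr := @cc_rho R n d d0; have Hf := Iable_mf If.
have [foo|] := ltP (II (fun z => k' z * f z ^+ 2)) +oo%E; last first.
  by rewrite leye_eq => /eqP ->; rewrite leey.
have mF : mf (fun z => k' z * f z ^+ 2) by apply: mfM => //; exact: mfX.
have F0 z : 0 <= k' z * f z ^+ 2 by rewrite mulr_ge0 ?sqr_ge0.
set a := fine (II (fun z => k' z * f z ^+ 2)).
have aE : II (fun z => k' z * f z ^+ 2) = a%:E by rewrite fineK// ge0_fin_numE// II_ge0.
have a0 : 0 <= a by rewrite fine_ge0// II_ge0.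
rewrite aE.
have -> : a%:E = II (fun z => a * rho d z).
  by rewrite II_scale ?II_rho ?mule1//; [exact: mf_rho|move=> z; exact: rho_ge0].
apply: (@II_le_fubini _ _ (fun z y => k z * (f (y + z) ^+ 2 * rho d y))).
- by apply: mfM => //; apply: mfX; apply: mf_smooth; exact: conv_smooth.
- by apply: mfM; [exact: mfC|exact: mf_rho].
- apply: mf2M; first exact: mf2_fst.
  apply: mf2M; last by apply: mf2_snd; exact: mf_rho.
  apply: mf2X; under eq_fun do under eq_fun do rewrite addrC.
  exact: mf2_add.
- by move=> z; rewrite mulr_ge0 ?sqr_ge0.
- by move=> z; rewrite mulr_ge0 ?rho_ge0.
- by move=> x y; rewrite mulr_ge0// mulr_ge0 ?sqr_ge0 ?rho_ge0.
- move=> z; rewrite II_scale//; last by move=> y; rewrite mulr_ge0 ?sqr_ge0 ?rho_ge0.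
    by rewrite EFinM lee_wpmul2l ?lee_fin//; exact: conv_sqr_pt.
  apply: mfM; last exact: mf_rho.
  by apply: mfX; exact: mf_shift.
- move=> y; have [dy|yd] := leP d (enorm y).
    rewrite rho0// mulr0 /II; under eq_integral do rewrite !mulr0.
    by rewrite integral0.
  under II_eq do rewrite mulrA mulrC.
  have mfy : mf (fun z => f (y + z) ^+ 2).
    by apply: mfX; under eq_fun do rewrite addrC; exact: mf_shift.
  rewrite II_scale ?rho_ge0//; [|by apply: mfM|by move=> z; rewrite mulr_ge0 ?sqr_ge0].
  rewrite [(a * rho d y)%R]mulrC (EFinM (rho d y)); apply: lee_wpmul2l;
    first by rewrite lee_fin rho_ge0.
  rewrite -aE -(II_shift y mF F0); apply: II_le.
  + exact: mfM.
  + exact: (mf_shift y mF).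
  + by move=> z; rewrite mulr_ge0 ?sqr_ge0.
  + by move=> z; rewrite (addrC z) ler_wpM2r ?sqr_ge0//; exact: kk.
Qed.

(** [f] is truncated at height [N]. For the truncation the error is bounded, so its square is
    controlled by [conv_L1]; the remainder is small in L^2, and mollification does not increase that
    norm. *)
Lemma conv_L2 f (r : R) : Iable f -> (forall z, r < enorm z -> f z = 0) ->
  Iable (fun z => f z ^+ 2) ->
  forall e : R, 0 < e -> exists2 s, 0 < s & forall d, 0 < d -> d < s ->
  (II (fun z => (conv f (rho d) z - f z) ^+ 2)%R <= e%:E)%E.
Proof.
move=> If f0 If2 e e0; have Hf := Iable_mf If; have Hf2 := Iable_mf If2.
pose A (N : nat) : set X := [set z | `|f z| <= N%:R].
have mA N : measurable (A N) by apply: mf_setle; exact: mfnorm.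
pose g (N : nat) z := f z * \1_(A N) z.
have mg N : mf (g N) by apply: mfM => //; exact: mf_indic.
have i1 N z : `|\1_(A N) z| <= 1 :> R by rewrite indicE; case: (_ \in _); rewrite ?normr1 ?normr0.
have Ig N : Iable (g N) by apply: (Iable_mulb If (M := 1)) => //; exact: mf_indic.
have gN N z : `|g N z| <= N%:R.
  rewrite /g indicE; case: (asboolP (A N z)) => zA; first by rewrite mem_set// mulr1.
  by rewrite memNset// mulr0 normr0.
have e12 : 0 < e / 12 by rewrite divr_gt0.
have [N HN] : exists N, (II (fun z => (f z - g N z) ^+ 2)%R <= (e / 12)%:E)%E.
  have : RI (fun z => (f z - g N z) ^+ 2) @[N --> \oo] --> RI (fun _ : 'rV[R]_n => 0).
    apply: (@RI_dct R n (fun N z => (f z - g N z) ^+ 2) (fun=> 0) (fun z => f z ^+ 2)) => //.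
    - by move=> N; apply: mfX; exact: mfB.
    - exact: mfC.
    - apply: aeW => z; apply: cvg_near_cst; exists (Num.trunc `|f z|).+1 => // N /= zN.
      rewrite /g indicE mem_set ?mulr1 ?subrr ?expr0n//=.
      by rewrite /A/= (le_trans (ltW (truncnS_gt _)))// ler_nat.
    - move=> N z; rewrite /g indicE; case: (_ \in _); rewrite ?mulr1 ?mulr0 ?subrr ?subr0.
        by rewrite expr0n normr0 sqr_ge0.
      by rewrite ger0_norm ?sqr_ge0.
  rewrite RI0.
  move=> /cvgrPdist_le /(_ _ e12) [N _ /(_ N (leqnn N))/=].
  rewrite sub0r normrN ger0_norm; last by apply: RI_ge0 => z; exact: sqr_ge0.
  move=> H; exists N; rewrite -lee_fin RI_EFin// in H.
  apply: (Iable_le _ _ If2); first by apply: mfX; exact: mfB.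
  move=> z; rewrite /g indicE; case: (_ \in _); rewrite ?mulr1 ?mulr0 ?subrr ?subr0.
    by rewrite expr0n normr0 sqr_ge0.
  by rewrite ger0_norm ?sqr_ge0.
have N10 : 0 < 6 * N%:R + 1 :> R by rewrite ltr_wpDl// mulr_ge0.
have eN : 0 < e / 2 / (6 * N%:R + 1) by rewrite !divr_gt0.
have [|s s0 Hs] := conv_L1 (Ig N) _ eN (r := r); first by move=> z rz; rewrite /g f0// mul0r.
exists s => // d d0 ds; have cr := @cc_rho R n d d0.
have Hd : mf (fun z => f z - g N z) by exact: mfB.
have Id : Iable (fun z => f z - g N z) by exact: IableB.
have msm (h : 'rV[R]_n -> R) : Iable h -> mf (conv h (rho d)) by move=> Ih; apply: mf_smooth;
  exact: conv_smooth.
have cN z : `|conv (g N) (rho d) z| <= N%:R.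
  rewrite /conv; under eq_fun do rewrite mulrC.
  rewrite (le_trans (RI_mulb (M := N%:R) _ _ _))//; last first.
    rewrite -[leRHS]mulr1 ler_wpM2l// -(RI_rho_shift n0 z d0).
    by apply: RI_le => [||y]; rewrite ?ger0_norm ?rho_ge0//; try apply: Iable_norm;
      exact: (Iable_shift (- z) (cc_Iable cr)).
  exact: (Iable_shift (- z) (cc_Iable cr)).
apply: (@le_trans _ _ (II (fun z => (3 * conv (fun z => f z - g N z) (rho d)
  z ^+ 2 + 3 * (f z - g N z) ^+ 2) + (6 * N%:R) * `|conv (g N) (rho d) z - g N z|))).
  apply: II_le.
  - by apply: mfX; apply: mfB => //; exact: msm.
  - apply: mfD; first apply: mfD.
    + by apply: mfM; [exact: mfC|apply: mfX; exact: msm].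
    + by apply: mfM; [exact: mfC|exact: mfX].
    + by apply: mfM; [exact: mfC|apply: mfnorm; apply: mfB => //; exact: msm].
  - by move=> z; exact: sqr_ge0.
  - move=> z; rewrite convB//.
    set a := conv f _ z; set b := conv (g N) _ z; set c := f z; set k := g N z.
    have bk : (b - k) ^+ 2 <= 2 * N%:R * `|b - k|.
      rewrite -real_normK ?num_real// expr2 ler_wpM2r//.
      by rewrite (le_trans (ler_normB _ _))// mulr_natl mulr2n lerD//; [exact: cN|exact: gN].
    rewrite (_ : a - c = (a - b) - (c - k) + (b - k)); last by ring.
    have := sqr_ge0 ((a - b) + (c - k)); have := sqr_ge0 ((a - b) - (b - k));
      have := sqr_ge0 ((c - k) + (b - k)).
    move: bk; move: (N%:R : R) => M.
    move: (a - b) (c - k) (b - k) => {}a {}b {}c; rewrite !expr2; nra.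
have p3 : 0 <= 3 :> R by [].
have q1 z : 0 <= (f z - g N z) ^+ 2 by exact: sqr_ge0.
have m1 : mf (fun z => conv (fun z => f z - g N z) (rho d) z ^+ 2) by apply: mfX; exact: msm.
have m2 : mf (fun z => (f z - g N z) ^+ 2) by exact: mfX.
have m3 : mf (fun z => `|conv (g N) (rho d) z - g N z|) by apply: mfnorm; apply: mfB => //;
  exact: msm.
have N6 : 0 <= 6 * N%:R :> R by rewrite mulr_ge0.
rewrite II_add; [|by meas_simple|by meas_simple|by nonneg_simple|by nonneg_simple].
rewrite II_add; [|by meas_simple|by meas_simple|by nonneg_simple|by nonneg_simple].
rewrite !II_scale//; last by move=> z; exact: sqr_ge0.
have C1 : (II (fun z => conv (fun z => f z - g N z) (rho d) z ^+ 2)%R <= (e / 12)%:E)%E.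
  apply: le_trans HN; have := @conv_sqr_le (fun z => f z - g N z) (fun=> 1) (fun=> 1)
    d d0 Id (mfC 1) (mfC 1) (fun=> ler01) (fun=> ler01) (fun _ _ _ => lexx _).
  by rewrite (II_eq (fun z => mul1r _)) (II_eq (fun z => mul1r _)).
apply: (@le_trans _ _ (3%:E * (e / 12)%:E + 3%:E * (e / 12)%:E + (6 * N%:R)%:E * (e / 2 / (6 *
  N%:R + 1))%:E)%E).
  apply: leeD; last by apply: lee_wpmul2l; [rewrite lee_fin|exact: Hs].
  by apply: leeD; apply: lee_wpmul2l; rewrite ?lee_fin.
rewrite -!EFinM -!EFinD lee_fin.
have : 6 * N%:R * (e / 2 / (6 * N%:R + 1)) <= e / 2.
  rewrite mulrCA ler_piMr ?divr_ge0 ?(ltW e0)// ler_pdivrMr// mul1r lerDl//.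
lra.
Qed.

End mollification_convergence.

(** * Hausdorff measure and Ahlfors regular sets *)

Section discrete_rV.
Variables (R : realType) (n : nat).
(* ['rV[R]_n] where every set is measurable: it lets [mu_ext] produce the
   subadditivity of the Hausdorff premeasures. *)
Definition discT := 'rV[R]_n.
HB.instance Definition _ := Pointed.on discT.
HB.instance Definition _ := isMeasurable.Build default_measure_display discT
  (measurable := fun=> True) I (fun _ _ => I) (fun _ _ => I).
End discrete_rV.

Section hausdorff_measure.
Context {R : realType} {n : nat}.
Variable d : R.
Hypothesis d0 : 0 < d.
Implicit Types (E F U : set 'rV[R]_n).

Lemma ediam0 : ediam (set0 : set 'rV[R]_n) = -oo%E.
Proof.
rewrite /ediam (_ : [set _ | _] = set0) ?ereal_sup0//.
by apply/seteqP; split => z // -[x [y []]].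
Qed.

Lemma ediam0_pow : (ediam (set0 : set 'rV[R]_n) `^ d = 0)%E.
Proof. by rewrite ediam0 poweRNyr// gt_eqF. Qed.

(** The diameter constraint on covers becomes part of the cost: sets that are too wide cost [+oo].
    The premeasure is then of the general form [mu_ext], which brings countable subadditivity. *)
Definition hgauge (e : R) (U : set (discT R n)) : \bar R :=
  if (ediam U <= e%:E)%E then (ediam U `^ d)%E else +oo%E.

Lemma hgauge0 e : hgauge e set0 = 0%E.
Proof. by rewrite /hgauge ediam0 leNye -ediam0 ediam0_pow. Qed.

Lemma hgauge_ge0 e U : (0 <= hgauge e U)%E.
Proof. by rewrite /hgauge; case: ifP => // _; exact: poweR_ge0. Qed.

Lemma hausdorff_pre_ext e E : hausdorff_pre d e E = mu_ext (hgauge e) E.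
Proof.
apply/eqP; rewrite eq_le; apply/andP; split; last first.
  apply: ereal_inf_le_tmp => _ [U [EU Ue] <-]; exists U; first by split.
  by apply: eq_eseriesr => k _; rewrite /hgauge Ue.
apply: le_ereal_inf_tmp => _ [U [_ EU] <-].
have [Ue|/existsNP[k Uk]] := pselect (forall k, (ediam (U k) <= e%:E)%E).
  apply: ereal_inf_lbound; exists U; first by split.
  by apply: eq_eseriesr => k _; rewrite /hgauge Ue.
rewrite (@eseries_pinfty _ _ xpredT k) ?leey//.
  by move=> m _; rewrite gt_eqF// (lt_le_trans _ (hgauge_ge0 _ _))// ltNy0.
by rewrite /hgauge; case: ifP => //.
Qed.

Lemma hausdorff_pre_ge0 e E : (0 <= hausdorff_pre d e E)%E.
Proof. by rewrite hausdorff_pre_ext; apply: mu_ext_ge0; exact: hgauge_ge0. Qed.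

Lemma hausdorff_pre_le e E : 0 < e -> (hausdorff_pre d e E <= hausdorff d E)%E.
Proof. by move=> e0; apply: ereal_sup_ubound; exists e. Qed.

Lemma hausdorff_ge0 E : (0 <= hausdorff d E)%E.
Proof. exact: le_trans (hausdorff_pre_ge0 1 E) (hausdorff_pre_le _ ltr01). Qed.

Lemma hausdorff_preS e E F : E `<=` F -> (hausdorff_pre d e E <= hausdorff_pre d e F)%E.
Proof. by move=> EF; rewrite !hausdorff_pre_ext; apply: le_mu_ext. Qed.

Lemma hausdorff_pre_anti e e' E : e <= e' -> (hausdorff_pre d e' E <= hausdorff_pre d e E)%E.
Proof.
move=> ee; apply: ereal_inf_le_tmp => _ [U [EU Ue] <-]; exists U => //; split => // k.
by apply: le_trans (Ue k) _; rewrite lee_fin.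
Qed.

Lemma hausdorff_le_ub E (b : \bar R) : (forall e, 0 < e -> (hausdorff_pre d e E <= b)%E) ->
  (hausdorff d E <= b)%E.
Proof. by move=> H; apply: ge_ereal_sup => _ [e e0 <-]; exact: H. Qed.

Lemma hausdorffS E F : E `<=` F -> (hausdorff d E <= hausdorff d F)%E.
Proof.
move=> EF; apply: hausdorff_le_ub => e e0.
exact: le_trans (hausdorff_preS e EF) (hausdorff_pre_le _ e0).
Qed.

Lemma hausdorff0 : hausdorff d (set0 : set 'rV[R]_n) = 0%E.
Proof.
apply/eqP; rewrite eq_le hausdorff_ge0 andbT; apply: hausdorff_le_ub => e e0.
by rewrite hausdorff_pre_ext mu_ext0//; [exact: hgauge0|exact: hgauge_ge0].
Qed.

Lemma hausdorff_bigcup (F : (set 'rV[R]_n)^nat) :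
  (hausdorff d (\bigcup_k F k) <= \sum_(k <oo) hausdorff d (F k))%E.
Proof.
apply: hausdorff_le_ub => e e0; rewrite hausdorff_pre_ext.
have := @mu_ext_sigma_subadditive _ (discT R n) R (hgauge e) (@hgauge_ge0 e) F.
move=> /le_trans; apply.
apply: lee_nneseries; [by move=> *; apply: mu_ext_ge0; exact: hgauge_ge0|move=> k *].
by rewrite -hausdorff_pre_ext; exact: hausdorff_pre_le.
Qed.

Lemma hausdorffU E F : (hausdorff d (E `|` F) <= hausdorff d E + hausdorff d F)%E.
Proof.
pose G k := if k is 0%N then E else if k is 1%N then F else set0.
rewrite (_ : E `|` F = \bigcup_k G k); last first.
  apply/seteqP; split => [z [Ez|Fz]|z [[|[|k]] _ //= Hz]]; [by exists 0%N|by exists 1%N|by left|by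
    right].
apply: le_trans (hausdorff_bigcup G) _.
rewrite (nneseries_split 0 2)/=; last by move=> k _; exact: hausdorff_ge0.
rewrite eseries0; last by move=> [|[|k]]//= _ _; exact: hausdorff0.
by rewrite adde0 big_mkord big_ord_recl big_ord1.
Qed.

(** A covering set of diameter less than [s] cannot meet both [E] and [F], so every fine cover of
    the union splits into a cover of each. *)
Lemma hausdorff_sep2 E F (s : R) : 0 < s ->
  (forall x y, E x -> F y -> s <= enorm (x - y)) ->
  (hausdorff d E + hausdorff d F <= hausdorff d (E `|` F))%E.
Proof.
move=> s0 EF; have [Hoo|] := ltP (hausdorff d (E `|` F)) +oo%E; last first.
  by rewrite leye_eq => /eqP ->; rewrite leey.
have fin A : A `<=` E `|` F -> hausdorff d A \is a fin_num.
  move=> AEF; rewrite ge0_fin_numE ?hausdorff_ge0//; apply: le_lt_trans Hoo; exact: hausdorffS.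
have finp e A : 0 < e -> A `<=` E `|` F -> hausdorff_pre d e A \is a fin_num.
  move=> e0 AEF; rewrite ge0_fin_numE ?hausdorff_pre_ge0//; apply: le_lt_trans Hoo.
  exact: le_trans (hausdorff_preS e AEF) (hausdorff_pre_le _ e0).
have key e : 0 < e -> e < s -> (hausdorff_pre d e E + hausdorff_pre d e F <= hausdorff_pre d e (E
  `|` F))%E.
  move=> e0 es; apply: le_ereal_inf_tmp => _ [U [EFU Ue] <-].
  pose V (A : set 'rV[R]_n) k := if `[< U k `&` A !=set0 >] then U k else set0.
  have VA A : A `<=` E `|` F -> (hausdorff_pre d e A <= \sum_(0 <= k <oo) (ediam (V A k) `^ d))%E.
    move=> AEF; apply: ereal_inf_lbound; exists (V A) => //; split.
      move=> x Ax; have [k _ Uk] := EFU _ (AEF _ Ax); exists k => //.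
      by rewrite /V; case: asboolP => // -[]; exists x.
    by move=> k; rewrite /V; case: asboolP => // _; rewrite ediam0 leNye.
  apply: le_trans (leeD (VA E (@subsetUl _ _ _)) (VA F (@subsetUr _ _ _))) _.
  rewrite -nneseriesD; [|by move=> k _ _; exact: poweR_ge0..].
  apply: lee_nneseries; [by move=> *; apply: adde_ge0; exact: poweR_ge0|move=> k *].
  rewrite {1}/V; case: asboolP => [[x [Ux Ex]]|_]; last first.
    rewrite ediam0_pow add0e /V; case: asboolP => // _.
    by rewrite ediam0_pow; exact: poweR_ge0.
  rewrite /V; case: asboolP => [[y [Uy Fy]]|_]; last by rewrite ediam0_pow adde0.
  have : (s%:E <= e%:E)%E.
    apply: le_trans (Ue k); apply: le_trans (_ : (enorm (x - y))%:E <= _)%E.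
      by rewrite lee_fin; exact: EF.
    by apply: ereal_sup_ubound; exists x, y.
  by rewrite lee_fin leNgt es.
have sub1 := @subsetUl _ E F; have sub2 := @subsetUr _ E F.
(* The two suprema are taken one after the other, each time with the other term moved to the
   right-hand side; the finiteness established above permits the subtraction. *)
rewrite -leeBrDr ?fin//; apply: hausdorff_le_ub => e1 e10.
rewrite leeBrDr ?fin// addeC -leeBrDr ?finp//; apply: hausdorff_le_ub => e2 e20.
rewrite leeBrDr ?finp// addeC.
pose e := Num.min (Num.min e1 e2) (s / 2).
have e0 : 0 < e by rewrite !lt_min e10 e20 divr_gt0.
have es : e < s by rewrite gt_min; apply/orP; right; rewrite ltr_pdivrMr// ltr_pMr// ltr1n.
apply: le_trans (_ : hausdorff_pre d e E + hausdorff_pre d e F <= _)%E.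
  by apply: leeD; apply: hausdorff_pre_anti; rewrite !ge_min lexx ?orbT.
by apply: le_trans (key e e0 es) _; exact: hausdorff_pre_le.
Qed.

Definition separated (s : R) (l : seq 'rV[R]_n) := pairwise (fun x y => s <= enorm (x - y)) l.

Lemma hausdorff_sep (s r b : R) (G : set 'rV[R]_n) (l : seq 'rV[R]_n) : 0 < s ->
  separated (s + 2 * r) l -> (forall x, x \in l -> (b%:E <= hausdorff d (G `&` eball x r))%E) ->
  (((size l)%:R * b)%:E <= hausdorff d (\bigcup_(x in [set` l]) (G `&` eball x r)))%E.
Proof.
move=> s0; elim: l => [|x l IH] /=; first by rewrite mul0r hausdorff_ge0.
move=> /andP[xl sl] Hb.
rewrite (_ : \bigcup_(y in _) _ = (G `&` eball x r) `|` \bigcup_(y in [set` l])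
  (G `&` eball y r)); last first.
  apply/seteqP; split => [z [y /=]|z [xz|[y /= yl yz]]].
  - by rewrite inE => /orP[/eqP -> ?|yl ?]; [left|right; exists y].
  - by exists x => //=; rewrite mem_head.
  - by exists y => //=; rewrite inE yl orbT.
apply: le_trans (@hausdorff_sep2 _ _ s s0 _); last first.
  move=> z w [_ zx] [y /= yl [_ wy]]; have := allP xl y yl.
  have := enorm_tri x z y; have := enorm_tri z w y.
  move: zx wy; rewrite /eball/= (enorm_distC z x) => zx wy; lra.
rewrite -natr1 mulrDl mul1r addrC EFinD; apply: leeD; first by apply: Hb; rewrite mem_head.
by apply: IH => // y yl; apply: Hb; rewrite inE yl orbT.
Qed.

(** A point left uncovered could be added to the family, whose size is bounded; the induction is on
    the number [k] of points that may still be added. *)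
Lemma maximal_net (s : R) (S : set 'rV[R]_n) (N : nat) :
  (forall l, separated s l -> (forall x, x \in l -> S x) -> (size l <= N)%N) ->
  exists l, [/\ separated s l, forall x, x \in l -> S x &
    forall y, S y -> exists2 x, x \in l & enorm (y - x) < s].
Proof.
move=> HN.
suff H k : forall l, separated s l -> (forall x, x \in l -> S x) -> (N <= size l + k)%N ->
    exists l, [/\ separated s l, forall x, x \in l -> S x &
    forall y, S y -> exists2 x, x \in l & enorm (y - x) < s].
  exact: (H N [::]).
elim: k => [|k IH] l sl lS lN.
  exists l; split => // y Sy; apply: contrapT => Hy.
  have sep : separated s (y :: l).
    rewrite /separated/= -/(separated s l) sl andbT.
    by apply/allP => x xl; rewrite leNgt; apply/negP => yx; apply: Hy; exists x.
  have inS x : x \in y :: l -> S x by rewrite inE => /orP[/eqP ->|/lS].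
  by have := HN _ sep inS; rewrite /= ltnNge -(addn0 (size l)) lN.
have [Hl|] := pselect (forall y, S y -> exists2 x, x \in l & enorm (y - x) < s); first by exists l.
move=> /existsNP[y /not_implyP[Sy Hy]].
apply: (IH (y :: l)); last by rewrite /= addSnnS.
  rewrite /separated/= -/(separated s l) sl andbT.
  by apply/allP => x xl; rewrite leNgt; apply/negP => yx; apply: Hy; exists x.
by move=> x; rewrite inE => /orP[/eqP ->|/lS].
Qed.

End hausdorff_measure.

Section distance.
Context {R : realType} {n : nat}.
Variable Gamma : set 'rV[R]_n.
Hypothesis G0 : Gamma !=set0.
Implicit Types x y z : 'rV[R]_n.

Let dset z := [set enorm (z - y) | y in Gamma].
Let dset_inf z : has_inf (dset z).
Proof.
split; first by have [y Gy] := G0; exists (enorm (z - y)), y.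
by exists 0 => _ [y _ <-]; exact: enorm_ge0.
Qed.

Lemma dist_ge0 z : 0 <= dist Gamma z.
Proof. by apply: lb_le_inf; [have [] := dset_inf z|move=> _ [y _ <-]; exact: enorm_ge0]. Qed.

Lemma dist_le z y : Gamma y -> dist Gamma z <= enorm (z - y).
Proof. by move=> Gy; apply: ge_inf; [have [] := dset_inf z|exists y]. Qed.

Lemma dist_lt z s : dist Gamma z < s -> exists2 y, Gamma y & enorm (z - y) < s.
Proof. by move=> /(inf_lt (dset_inf z).1)[_ [y Gy <-] ys]; exists y. Qed.

Lemma dist_lip z y : dist Gamma z <= dist Gamma y + enorm (z - y).
Proof.
apply/ler_addgt0Pr => e e0; have [w Gw yw] : exists2 w, Gamma w & enorm (y - w) < dist Gamma y + e.
  by apply: dist_lt; rewrite ltrDl.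
rewrite (le_trans (dist_le z Gw))// (le_trans (enorm_tri z y w))//; lra.
Qed.

Lemma continuous_dist : continuous (dist Gamma).
Proof.
apply: (@enorm_lipschitz_continuous _ _ _ 1) => x y; rewrite mul1r ler_norml.
have := dist_lip x y; have := dist_lip y x; rewrite (enorm_distC y x) => h1 h2.
by apply/andP; split; lra.
Qed.

Lemma dist_Gamma z : Gamma z -> dist Gamma z = 0.
Proof.
by move=> Gz; apply/eqP; rewrite eq_le dist_ge0 andbT (le_trans (dist_le z Gz))// subrr enorm0.
Qed.

Lemma dist_gt0 z : closed Gamma -> ~ Gamma z -> 0 < dist Gamma z.
Proof.
move=> cG Gz; have oG : open (~` Gamma) by exact: closed_openC.
have /open_eballP/(_ z Gz)[e e0 ze] := oG.
apply: (lt_le_trans e0); apply: lb_le_inf; first by have [] := dset_inf z.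
move=> _ [y Gy <-]; rewrite leNgt; apply/negP => zy; apply: (ze y) => //.
by rewrite /eball/= enorm_distC.
Qed.

End distance.

(** * Packing and volume bounds for Ahlfors regular sets *)

Section ahlfors.
Context {R : realType} {n : nat}.
Variables d C0 : R.
Hypotheses (n0 : (0 < n)%N) (d0 : 0 < d) (C01 : 1 <= C0).
Local Notation X := (bT R n).
Local Notation mu := (@mu R n).

Let C0p : 0 < C0. Proof. exact: lt_le_trans C01. Qed.

(** The balls of radius [e] around the points are at mutual distance at least [e], each carries mass
    at least C0^(-1) e^d, and all lie in the ball of radius [3 * r]. *)
Lemma ahlfors_packing (Gamma : set 'rV[R]_n) x (r e : R) (l : seq 'rV[R]_n) :
  ahlfors_regular d C0 Gamma -> Gamma x -> 0 < e -> e <= r ->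
  separated (3 * e) l -> (forall y, y \in l -> Gamma y /\ enorm (y - x) < 2 * r) ->
  (size l)%:R <= C0 ^+ 2 * (3 * r / e) `^ d.
Proof.
move=> AR Gx e0 er sl lG; have r0 : 0 < r by exact: lt_le_trans er.
have ed0 : 0 < e `^ d by rewrite powR_gt0.
have := @hausdorff_sep R n d d0 e e (C0^-1 * e `^ d) Gamma l e0.
rewrite (_ : e + 2 * e = 3 * e); last by ring.
move=> /(_ sl (fun y yl => (AR _ _ (lG y yl).1 e0).1)) H.
have r3 : 0 < 3 * r by rewrite mulr_gt0.
have /(le_trans H) : (hausdorff d (\bigcup_(y in [set` l]) (Gamma `&` eball y e)) <= (C0 * (3 * r)
  `^ d)%:E)%E.
  apply: le_trans (AR x (3 * r) Gx r3).2; apply: hausdorffS => // z [y /= yl [Gz zy]]; split => //.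
  have := enorm_tri z y x; have [_] := lG y yl; move: zy; rewrite /eball/= => zy; lra.
rewrite lee_fin => H'.
rewrite powRM ?invr_ge0 ?(ltW e0) ?(ltW r3)// -powR_inv1 ?(ltW e0)// -powRrM mulN1r powRN.
rewrite -ler_pdivlMr// in H'; last by rewrite mulr_gt0// invr_gt0.
rewrite (le_trans H')// invfM invrK expr2.
by rewrite le_eqVlt; apply/orP; left; apply/eqP; ring.
Qed.

(** A ball of radius 4 e lies in a cube of side 8 e; the second factor comes from the number of
    balls allowed by [ahlfors_packing]. *)
Definition vol_cst : R := 8 ^+ n * (C0 ^+ 2 * 3 `^ d).

Lemma vol_cst_gt0 : 0 < vol_cst.
Proof. by rewrite !mulr_gt0 ?exprn_gt0 ?powR_gt0. Qed.

(* The [e]-neighbourhood of [Gamma] is covered by at most [C (r / e) ^ d] balls. *)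
Lemma ahlfors_volume (Gamma : set 'rV[R]_n) x (r e : R) :
  Gamma !=set0 -> ahlfors_regular d C0 Gamma -> Gamma x -> 0 < e -> e <= r ->
  (mu (eball x r `&` [set z | (dist Gamma z < e)%R]) <= (vol_cst * (e ^+ n * (r / e) `^ d))%:E)%E.
Proof.
move=> G0 AR Gx e0 er; have r0 : 0 < r by exact: lt_le_trans er.
pose S : set 'rV[R]_n := [set y | Gamma y /\ enorm (y - x) < 2 * r].
pose b := C0 ^+ 2 * (3 * r / e) `^ d.
have Hb l : separated (3 * e) l -> (forall y, y \in l -> S y) -> (size l)%:R <= b.
  by move=> sl lS; exact: ahlfors_packing AR Gx e0 er sl lS.
have [l [sl lS lnet]] : exists l, [/\ separated (3 * e) l, forall y, y \in l -> S y &
    forall y, S y -> exists2 x, x \in l & enorm (y - x) < 3 * e].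
  apply: (@maximal_net R n (3 * e) S (Num.trunc b).+1) => l sl lS.
  rewrite -(ler_nat R) (le_trans (Hb l sl lS))// ltW// (lt_le_trans (truncnS_gt _))//.
have mD : measurable ([set z : X | (dist Gamma z < e)%R]).
  by apply: mf_setlt; apply: mf_cont; exact: continuous_dist.
apply: (@le_trans _ _ (mu (\big[setU/set0]_(y <- l) (eball y (4 * e) : set X)))).
  apply: mu_le.
  - move=> z [zx /= zd]; have [y Gy zy] := dist_lt G0 zd.
    have Sy : S y.
      split => //; have := enorm_tri y z x; move: zx; rewrite /eball/= (enorm_distC y z) => zx; lra.
    have [w wl yw] := lnet y Sy; rewrite -bigcup_seq; exists w => //=; rewrite /eball/=.
    have := enorm_tri z y w; lra.
  - by apply: measurableI => //; exact: measurable_eball.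
  - by apply: bigsetU_measurable => y _; exact: measurable_eball.
apply: le_trans (mu_bigsetU_le _ _) _; first by move=> y; exact: measurable_eball.
have e40 : 0 <= 4 * e by rewrite mulr_ge0// ltW.
apply: (@le_trans _ _ (\sum_(y <- l) ((2 * (4 * e)) ^+ n)%:E)%E).
  by apply: lee_sum => y _; exact: mu_eball_le.
rewrite sumEFin lee_fin big_const_seq iter_addr addr0 count_predT -[leLHS]mulr_natr mulrC.
apply: (@le_trans _ _ (b * (2 * (4 * e)) ^+ n)).
  by rewrite ler_wpM2r ?Hb// exprn_ge0// mulr_ge0.
rewrite /b /vol_cst mulrA (_ : 2 * 4 = 8); last by ring.
rewrite exprMn -(mulrA 3) powRM ?divr_ge0 ?(ltW e0) ?(ltW r0)//.
by rewrite le_eqVlt; apply/orP; left; apply/eqP; ring.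
Qed.

End ahlfors.

(** * The weight *)

Section powR_lemmas.
Context {R : realType}.
Implicit Types a b x y : R.

Lemma eq_ler x y : x = y -> x <= y.
Proof. by move=> ->. Qed.

Lemma powR_anti a x y : 0 < x -> x <= y -> a <= 0 -> y `^ a <= x `^ a.
Proof.
move=> x0 xy a0; have y0 : 0 < y by exact: lt_le_trans xy.
rewrite -[a]opprK 2!(powRN _ (- a)) lef_pV2 ?posrE ?powR_gt0//.
by apply: ge0_ler_powR; rewrite ?oppr_ge0// ?nnegrE ?ltW.
Qed.

Lemma powR_add a b x : 0 < x -> x `^ (a + b) = x `^ a * x `^ b.
Proof. by move=> x0; rewrite powRD// (gt_eqF x0) implybT. Qed.

Lemma powRV a x : 0 <= x -> (x^-1) `^ a = (x `^ a)^-1.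
Proof. by move=> x0; rewrite -(powR_inv1 x0) powRAC powR_inv1// powR_ge0. Qed.

Lemma powR_dyadic a x (i : nat) : 0 < x -> (x / 2 ^+ i) `^ a = x `^ a * (2 `^ (- a)) ^+ i.
Proof.
move=> x0; rewrite powRM ?(ltW x0) ?invr_ge0 ?exprn_ge0//; congr (_ * _).
rewrite -powR_mulrn ?powR_ge0// -powRrM mulNr mulrC powRN powRrM powR_mulrn//.
by rewrite powRV// exprn_ge0.
Qed.

Lemma powR2_gt1 a : 0 < a -> 1 < 2 `^ a.
Proof. by move=> a0; have := gt0_ltr_powR a0 (x := 1) (y := 2); rewrite powR1 !nnegrE; apply;
  rewrite ?ltr1n. Qed.

Lemma powR2_lt1 a : a < 0 -> 2 `^ a < 1.
Proof.
by move=> a0; rewrite -[a]opprK powRN invf_lt1 ?powR_gt0// powR2_gt1// oppr_gt0.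
Qed.

Lemma geo_sum_le (q : R) (N : nat) : 0 <= q -> q < 1 -> \sum_(i < N) q ^+ i <= (1 - q)^-1.
Proof.
move=> q0 q1; have p0 : 0 < 1 - q by rewrite subr_gt0.
suff : \sum_(i < N) q ^+ i = (1 - q ^+ N) / (1 - q).
  by move=> ->; rewrite ler_pdivrMr// mulVf ?gt_eqF// lerBlDl lerDr exprn_ge0.
elim: N => [|N IH]; first by rewrite big_ord0 expr0 subrr mul0r.
by rewrite big_ord_recr/= IH exprS; field; rewrite gt_eqF.
Qed.

(** Only terms below 1 count and the last of them dominates the sum, whence a bound independent of
    [a] and [N]. *)
Lemma geo_sum_trunc (a Q : R) (N : nat) : 0 <= a -> 1 < Q ->
  \sum_(i < N) (a * Q ^+ i * (a * Q ^+ i < 1)%R%:R) <= Q / (Q - 1).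
Proof.
move=> a0 Q1; have p0 : 0 < Q - 1 by rewrite subr_gt0.
have Q0 : 0 < Q by exact: lt_trans Q1.
(* The induction needs both bounds: [a * Q ^+ N] as long as all terms are below 1, and [Q]
   afterwards. *)
suff : \sum_(i < N) (a * Q ^+ i * (a * Q ^+ i < 1)%R%:R) <= Num.min (a * Q ^+ N) Q / (Q - 1).
  by move=> /le_trans; apply; rewrite ler_pM2r ?invr_gt0// ge_min lexx orbT.
elim: N => [|N IH].
  by rewrite big_ord0 expr0 mulr1 divr_ge0 ?(ltW p0)// le_min a0 ltW.
have aN : 0 <= a * Q ^+ N by rewrite mulr_ge0// exprn_ge0// ltW.
rewrite big_ord_recr/= exprSr mulrA ler_pdivlMr//; move: IH; rewrite ler_pdivlMr//.
set S := \sum_(i < N) _; set b := a * Q ^+ N; rewrite !le_min => /andP[h1 h2].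
case: (ltP b 1) => b1 /=; rewrite ?mulr1 ?mulr0 ?addr0.
  by apply/andP; split; nra.
by rewrite h2 andbT; nra.
Qed.

End powR_lemmas.

Section weight_lemmas.
Context {R : realType} {n : nat}.
Local Notation X := (bT R n).
Local Notation mu := (@mu R n).
Implicit Types f : 'rV[R]_n -> R.

Lemma mf_bool (P : 'rV[R]_n -> bool) : measurable ([set z | P z] : set X) ->
  mf (fun z => (P z)%:R : R).
Proof.
move=> mP; have := mf_indic mP; congr (mf _); apply/funext => z; rewrite indicE.
by rewrite (_ : (z \in _) = P z)//; apply/idP/idP; rewrite inE.
Qed.

Lemma mf_blt f g : mf f -> mf g -> mf (fun z => (f z < g z)%R%:R : R).
Proof.
move=> hf hg; apply: mf_bool.
rewrite (_ : [set _ | _] = [set z | 0 < g z - f z]); first by apply: mf_setgt; exact: mfB.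
by apply/seteqP; split => z /=; rewrite subr_gt0.
Qed.

Lemma mf_ble f g : mf f -> mf g -> mf (fun z => (f z <= g z)%R%:R : R).
Proof.
move=> hf hg; apply: mf_bool.
rewrite (_ : [set _ | _] = [set z | 0 <= g z - f z]); first by apply: mf_setge; exact: mfB.
by apply/seteqP; split => z /=; rewrite subr_ge0.
Qed.

Lemma mf_band (P Q : 'rV[R]_n -> bool) : mf (fun z => (P z)%:R : R) -> mf (fun z => (Q z)%:R : R) ->
  mf (fun z => (P z && Q z)%:R : R).
Proof.
move=> hP hQ; have := mfM hP hQ; congr (mf _); apply/funext => z.
by rewrite -natrM mulnb.
Qed.

Lemma II_bool (P : 'rV[R]_n -> bool) : measurable ([set z | P z] : set X) ->
  II (fun z => (P z)%:R)%R = mu [set z | P z].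
Proof.
move=> mP; rewrite -(II_indic mP); apply: II_eq => z; rewrite indicE.
by rewrite (_ : (z \in _) = P z)//; apply/idP/idP; rewrite inE.
Qed.

Lemma II_scale_le (c b : R) f : mf f -> (forall z, 0 <= f z) -> 0 <= c -> (II f <= b%:E)%E ->
  (II (fun z => c * f z)%R <= (c * b)%:E)%E.
Proof. by move=> hf f0 c0 fb; rewrite II_scale// EFinM lee_wpmul2l// lee_fin. Qed.

Variables (d : R) (Gamma : set 'rV[R]_n).
Hypotheses (G0 : Gamma !=set0) (cG : closed Gamma).
Local Notation delta := (dist Gamma).
Local Notation w := (weight d Gamma).

Lemma mf_dist : mf delta.
Proof. by apply: mf_cont; exact: continuous_dist. Qed.

Lemma mf_enorm (x : 'rV[R]_n) : mf (fun z => enorm (z - x)).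
Proof. by apply: mf_cont; exact: continuous_edist. Qed.

Lemma weight_ge0 z : 0 <= w z. Proof. exact: powR_ge0. Qed.

Lemma mf_weight : mf w.
Proof. by apply: mf_pow; exact: mf_dist. Qed.

Lemma dist_gt0P z : (0 < delta z) <-> ~ Gamma z.
Proof.
split; last exact: dist_gt0.
by move=> + /(dist_Gamma G0) zG; rewrite zG ltxx.
Qed.

Lemma weight_gt0 z : 0 < delta z -> 0 < w z.
Proof. by move=> ?; exact: powR_gt0. Qed.

Lemma mf_layer (a b : R) : mf (fun z => (a < delta z <= b)%R%:R : R).
Proof. by apply: mf_band; [apply: mf_blt|apply: mf_ble]; by [exact: mfC|exact: mf_dist]. Qed.

Lemma dyadic_ex (l s : R) : 0 < s -> s <= l -> exists i : nat, l / 2 ^+ i.+1 < s <= l / 2 ^+ i.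
Proof.
move=> s0 sl; have l0 : 0 < l by exact: lt_le_trans sl.
have [N HN] : exists N : nat, l / 2 ^+ N < s.
  exists (Num.trunc (l / s)).+1; rewrite ltr_pdivrMr ?exprn_gt0// mulrC -ltr_pdivrMr//.
  apply: (lt_trans (truncnS_gt _)); rewrite -natrX ltr_nat; exact: ltn_expl.
elim: N HN => [|N IH] HN; first by move: HN; rewrite expr0 divr1 ltNge sl.
by have [/IH//|sN] := ltP (l / 2 ^+ N) s; exists N; rewrite HN.
Qed.

(** The layers exhaust 0 < delta <= l, where [f] is supported, and Fatou's lemma passes from partial
    sums to the whole integral. *)
Lemma II_dyadic f (l b : R) : 0 < l -> mf f -> (forall z, 0 <= f z) ->
  (forall z, f z != 0 -> 0 < delta z <= l) ->
  (forall N : nat, (\sum_(i < N) II (fun z => f z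
    * (l / 2 ^+ i.+1 < delta z <= l / 2 ^+ i)%R%:R)%R <= b%:E)%E) ->
  (II f <= b%:E)%E.
Proof.
move=> l0 hf f0 fl Hb.
pose G (N : nat) z := f z * (l / 2 ^+ N < delta z <= l)%R%:R.
have mL (a c : R) : mf (fun z => f z * (a < delta z <= c)%R%:R) by apply: mfM => //;
  exact: mf_layer.
have L0 (a c : R) z : 0 <= f z * (a < delta z <= c)%R%:R by rewrite mulr_ge0.
apply: (@II_fatou _ _ G) => //.
- by move=> N; exact: mL.
- by move=> N z; exact: L0.
- move=> z; have [fz|fz] := eqVneq (f z) 0.
    rewrite fz (_ : (fun _ => _) = (fun=> 0)); first exact: cvg_cst.
    by apply/funext => N; rewrite /G fz mul0r.
  have /andP[z0 zl] := fl z fz; have [i /andP[iz _]] := dyadic_ex z0 zl.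
  apply/cvg_ballP => e e0; near=> N; rewrite /G.
  rewrite (_ : (_ < _ <= _) = true) ?mulr1; first exact: ballxx.
  rewrite zl andbT; apply: le_lt_trans iz; rewrite ler_pM2l// lef_pV2 ?posrE ?exprn_gt0//.
  by rewrite ler_eXn2l ?ltr1n//; near: N; exists i.+1.
- move=> N; apply: le_trans (Hb N).
  have mS : mf (fun z => \sum_(i < N) f z * (l / 2 ^+ i.+1 < delta z <= l / 2 ^+ i)%R%:R).
    by apply: mf_sum => i; exact: mL.
  rewrite -(@II_sum _ _ _ _ (fun (i : 'I_N) z => f z
    * (l / 2 ^+ i.+1 < delta z <= l / 2 ^+ i)%R%:R))//.
  apply: II_le => //; [exact: mL|by move=> z; exact: L0|].
  move=> z; have s0 : 0 <= \sum_(i < N) f z * (l / 2 ^+ i.+1 < delta z <= l / 2 ^+ i)%R%:R by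
    apply: sumr_ge0.
  rewrite /G; have [/andP[zN zl]|_] := boolP (_ < _ <= _); last by rewrite mulr0.
  have z0 : 0 < delta z by apply: le_lt_trans zN; rewrite divr_ge0 ?exprn_ge0// ltW.
  have [i iz] := dyadic_ex z0 zl.
  have iN : (i < N)%N.
    move: (lt_le_trans zN (andP iz).2); rewrite ltr_pM2l// ltf_pV2 ?posrE ?exprn_gt0//.
    by rewrite ltr_eXn2l ?ltr1n.
  by rewrite (bigD1 (Ordinal iN))//= iz lerDl sumr_ge0.
Unshelve. all: by end_near. Qed.

(** The scales that see [z] are those above delta(z) / c; their negative powers form a geometric sum
    dominated by the smallest such scale. *)
Lemma dyadic_sum (b c l : R) (N : nat) z : 0 < b -> 0 < c -> 0 < l ->
  \sum_(i < N) (l / 2 ^+ i) `^ (- b) * (0 < delta z < c * (l / 2 ^+ i))%R%:R <=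
  2 `^ b / (2 `^ b - 1) * c `^ b * (delta z) `^ (- b).
Proof.
move=> b0 c0 l0; have Q1 := powR2_gt1 b0.
have [z0|z0] := ltP 0 (delta z); last first.
  rewrite big1 => [|i _]; last by rewrite mulr0.
  by rewrite !mulr_ge0 ?powR_ge0// invr_ge0 subr_ge0 ltW.
(* After division by (c / delta)^b the admissible terms are exactly those below 1 in the geometric
   sequence of first term [a] and ratio 2^b. *)
pose a := (c * l / delta z) `^ (- b).
have a0 : 0 <= a by exact: powR_ge0.
have cz : 0 <= c / delta z by rewrite divr_ge0 ?ltW.
apply: (@le_trans _ _ ((c / delta z) `^ b * \sum_(i < N) a * (2 `^ b) ^+ i * (a * (2 `^ b)
  ^+ i < 1)%R%:R)).
  rewrite mulr_sumr; apply: ler_sum => i _.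
  have li : 0 < l / 2 ^+ i by rewrite divr_gt0// exprn_gt0.
  have aE : a * (2 `^ b) ^+ i = (c / delta z) `^ (- b) * (l / 2 ^+ i) `^ (- b).
    rewrite powR_dyadic// opprK mulrA -powRM ?(ltW l0)//; congr (_ `^ _ * _).
    by rewrite mulrAC.
  have key (s t : R) : (c / delta z) `^ b * ((c / delta z) `^ (- b) * s * t) = s * t.
    by rewrite !mulrA -powR_add ?divr_gt0// subrr powRr0 mul1r.
  rewrite aE key ler_wpM2l ?powR_ge0//.
  have [zc|] := ltP (delta z) (c * (l / 2 ^+ i)) => //=.
  rewrite -powRM ?(ltW li)// powRN invf_lt1 ?powR_gt0 ?mulr_gt0 ?divr_gt0 ?exprn_gt0//.
  have h1 : 1 < c / delta z * (l / 2 ^+ i) by rewrite mulrAC ltr_pdivlMr// mul1r.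
  have := @gt0_ltr_powR _ _ b0 1 (c / delta z * (l / 2 ^+ i)).
  by rewrite powR1 !nnegrE => -> //; rewrite mulr_ge0// ltW.
  by rewrite invr_gt0.
apply: (@le_trans _ _ ((c / delta z) `^ b * (2 `^ b / (2 `^ b - 1)))).
  by rewrite ler_wpM2l ?powR_ge0// geo_sum_trunc.
rewrite powRM ?invr_ge0 ?(ltW c0) ?(ltW z0)// powRV ?(ltW z0)// powRN.
by apply: eq_ler; ring.
Qed.

End weight_lemmas.

(** * Volume and weight of the neighbourhoods of [Gamma] *)

Section weight_integral.
Context {R : realType} {n : nat}.
Variables d C0 : R.
Hypotheses (n0 : (0 < n)%N) (d0 : 0 < d) (dn : d < n%:R - 1) (C01 : 1 <= C0).
Local Notation X := (bT R n).
Local Notation mu := (@mu R n).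
Variable Gamma : set 'rV[R]_n.
Hypotheses (G0 : Gamma !=set0) (cG : closed Gamma) (AR : ahlfors_regular d C0 Gamma).
Local Notation delta := (dist Gamma).
Local Notation w := (weight d Gamma).
Local Notation V := (@vol_cst R n d C0).

Lemma weight_Gamma z : Gamma z -> w z = 0.
Proof.
move=> Gz; rewrite /weight dist_Gamma// powR0// lt_eqF//.
by move: dn => ?; lra.
Qed.

Lemma weight_lb z s : 0 < delta z -> delta z <= s -> s `^ (d + 1 - n%:R) <= w z.
Proof. by move=> z0 zs; apply: powR_anti => //; move: dn => ?; lra. Qed.

Lemma weight_ub z s : 0 < s -> s <= delta z -> w z <= s `^ (d + 1 - n%:R).
Proof. by move=> s0 sz; apply: powR_anti => //; move: dn => ?; lra. Qed.

Lemma mu_layer_le x (r e : R) : Gamma x -> 0 < e -> e <= r ->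
  (mu (eball x r `&` [set z | (delta z < e)%R]) <= (V * (e `^ (n%:R - d) * r `^ d))%:E)%E.
Proof.
move=> Gx e0 er; have r0 := lt_le_trans e0 er.
have := ahlfors_volume d0 C01 G0 AR Gx e0 er; move=> /le_trans; apply; rewrite lee_fin.
rewrite ler_pM2l ?vol_cst_gt0//.
rewrite powR_add// powR_mulrn ?(ltW e0)// powRM ?invr_ge0 ?(ltW e0)
  ?(ltW r0)// powRV ?(ltW e0)// powRN.
by apply: eq_ler; ring.
Qed.

(** [Gamma] lies in each of its neighbourhoods, whose volume bound e^(n-d) r^d tends to 0 with e. *)
Lemma mu_Gamma_ball x (r : R) : Gamma x -> 0 < r -> mu (eball x r `&` Gamma) = 0%E.
Proof.
move=> Gx r0; apply/eqP; rewrite eq_le measure_ge0 andbT.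
have mGb : measurable (eball x r `&` Gamma : set X).
  by apply: measurableI; [exact: measurable_eball|exact: measurable_closed].
have H e : 0 < e -> e <= r -> (mu (eball x r `&` Gamma) <= (V * (e `^ (n%:R - d) * r `^ d))%:E)%E.
  move=> e0 er; apply: le_trans (mu_layer_le Gx e0 er); apply: mu_le => //.
    by move=> z [zx Gz]; split => //=; rewrite dist_Gamma.
  by apply: measurableI; [exact: measurable_eball|apply: mf_setlt; exact: mf_dist].
have lim : (V * (e `^ (n%:R - d) * r `^ d)) @[e --> 0^'+] --> V * (0 * r `^ d).
  by apply: cvgMl_tmp; apply: cvgMr_tmp; apply: powR_cvg0; move: dn => ?; lra.
rewrite mul0r mulr0 in lim.
have fin : mu (eball x r `&` Gamma) \is a fin_num.
  by rewrite ge0_fin_numE ?measure_ge0//; apply: le_lt_trans (H r r0 (lexx _)) _; exact: ltry.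
rewrite -(fineK fin) lee_fin; apply: (cvgr_to_ge lim); near=> e.
rewrite -lee_fin fineK//; apply: H; first by near: e; exact: nbhs_right_gt.
by near: e; apply: nbhs_right_le.
Unshelve. all: by end_near. Qed.

Lemma mu_Gamma : mu (Gamma : set X) = 0%E.
Proof.
have [x Gx] := G0; apply/eqP; rewrite eq_le measure_ge0 andbT.
have mG : measurable (Gamma : set X) by exact: measurable_closed.
have mk k : measurable (eball x k.+1%:R `&` Gamma : set X).
  by apply: measurableI => //; exact: measurable_eball.
have -> : (Gamma : set X) = \bigcup_k (eball x k.+1%:R `&` Gamma).
  apply/seteqP; split => [z Gz|z [k _ []//]]; exists (Num.trunc (enorm (z - x))) => //; split => //.
  by rewrite /eball/=; exact: truncnS_gt.
apply: le_trans (measure_sigma_subadditive _ mk _ (@subset_refl _ _)) _;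
  first exact: bigcup_measurable.
by rewrite eseries0// => k _ _; apply: mu_Gamma_ball.
Qed.

(** In order: the volume constant, the weight evaluated at delta = l / 2, the enlargements of l and
    r to 2 l and 2 r that make room for strict inequalities, and the sum of the geometric series. *)
Definition wint_cst := V * 2 `^ (n%:R - d - 1) * 2 `^ (n%:R - d) * 2 `^ d * 2.

Lemma wint_cst_gt0 : 0 < wint_cst.
Proof.
have V0 : 0 < V by exact: vol_cst_gt0.
by rewrite /wint_cst; do 4! apply: mulr_gt0 => //; exact: powR_gt0.
Qed.

(* Dyadic layers: where [l / 2 < dist <= l] the weight is at most
   [(l / 2) ^ (d+1-n)], and that set has volume [C l ^ (n-d) r ^ d]. *)
Lemma weight_integral x (r : R) : Gamma x -> 0 < r ->
  (II (fun z => (enorm (z - x)%R < r)%R%:R * w z)%R <= (wint_cst * r `^ (d + 1))%:E)%E.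
Proof.
move=> Gx r0; have r20 : 0 < 2 * r by rewrite mulr_gt0.
have V0 : 0 < V by exact: vol_cst_gt0.
have mB : mf (fun z => (enorm (z - x)%R < r)%R%:R : R).
  by apply: mf_blt; [exact: mf_enorm|exact: mfC].
apply: (@II_dyadic R n Gamma G0 _ r) => //.
- by apply: mfM => //; exact: mf_weight.
- by move=> z; rewrite mulr_ge0 ?weight_ge0.
- move=> z; rewrite mulf_eq0 negb_or => /andP[]; have [zr _ wz|_] := boolP (_ < _);
  last by rewrite eqxx.
  apply/andP; split; last by rewrite (le_trans (dist_le G0 z Gx))// ltW.
  by apply/(dist_gt0P G0 cG) => Gz; move: wz; rewrite weight_Gamma// eqxx.
move=> N; pose c := V * 2 `^ (n%:R - d - 1) * 2 `^ (n%:R - d) * 2 `^ d.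
apply: (@le_trans _ _ (\sum_(i < N) (c * r `^ (d + 1) * (2^-1) ^+ i)%:E)%E).
  apply: lee_sum => i _.
  have hL (l : R) : 0 < l -> l <= r ->
      (II (fun z => (enorm (z - x)%R < r)%R%:R * w z * (l / 2 < delta z <= l)%R%:R)%R <=
       (c * (l * r `^ d))%:E)%E.
    move=> l0 lr; pose P z := (enorm (z - x) < 2 * r) && (delta z < 2 * l).
    have mP : measurable [set z : X | P z].
      rewrite (_ : [set _ | _] = eball x (2 * r) `&` [set z | (delta z < 2 * l)%R]).
        by apply: measurableI; [exact: measurable_eball|apply: mf_setlt; exact: mf_dist].
      by apply/seteqP; split => z; [move=> /andP[]|move=> [? ?]; apply/andP].
    have l20 : 0 < l / 2 by rewrite divr_gt0.
    apply: (@le_trans _ _ (II (fun z => (l / 2) `^ (d + 1 - n%:R) * (P z)%:R)%R)).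
      apply: II_le.
      - by apply: mfM; [apply: mfM => //; exact: mf_weight|exact: mf_layer].
      - by apply: mfM; [exact: mfC|exact: mf_bool].
      - by move=> z; rewrite !mulr_ge0 ?weight_ge0.
      - move=> z; have [zr|_] := boolP (_ < r); last by rewrite !mul0r mulr_ge0 ?powR_ge0.
        have [/andP[lz zl]|_] := boolP (_ < _ <= _); last by rewrite mulr0 mulr_ge0 ?powR_ge0.
        rewrite (_ : P z = true) ?mulr1 ?mul1r; first by apply: weight_ub => //; exact: ltW.
        by apply/andP; split; [apply: (lt_trans zr)|apply: (le_lt_trans zl)];
          rewrite ltr_pMl// ltr1n.
    have l2 : 0 < 2 * l by rewrite mulr_gt0.
    have l2r : 2 * l <= 2 * r by rewrite ler_pM2l.
    have mb : (II (fun z => (P z)%:R)%R <= (V * ((2 * l) `^ (n%:R - d) * (2 * r) `^ d))%:E)%E.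
      rewrite II_bool//; apply: le_trans (mu_layer_le Gx l2 l2r); apply: mu_le => //.
      - by move=> z /andP[].
      - by apply: measurableI; [exact: measurable_eball|apply: mf_setlt; exact: mf_dist].
    have mPf : mf (fun z => (P z)%:R : R) by exact: mf_bool.
    apply: le_trans (II_scale_le mPf (fun z => ler0n _ _) (powR_ge0 _ _) mb) _.
    rewrite lee_fin /c powRM ?invr_ge0 ?(ltW l0)// powRV// -powRN.
    rewrite !powRM ?(ltW l0) ?(ltW r0)// (_ : - (d + 1 - n%:R) = n%:R - d - 1); last by ring.
    have ll : l `^ (d + 1 - n%:R) * l `^ (n%:R - d) = l.
      by rewrite -powR_add// (_ : _ + _ = 1) ?powRr1 ?(ltW l0)//; ring.
    by rewrite -[in leRHS]ll le_eqVlt; apply/orP; left; apply/eqP; ring.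
  have li : 0 < r / 2 ^+ i by rewrite divr_gt0// exprn_gt0.
  have lr : r / 2 ^+ i <= r by rewrite ler_pdivrMr ?exprn_gt0// ler_peMr ?(ltW r0)// exprn_ege1//
    ler1n.
  have := hL _ li lr; rewrite -mulrA -invfM -exprSr => /le_trans; apply.
  rewrite lee_fin /c powR_add// powRr1 ?(ltW r0)// exprVn.
  by apply: eq_ler; ring.
have c0 : 0 <= c by rewrite /c; do 3! (apply: mulr_ge0; last exact: powR_ge0); exact: ltW.
have cr0 : 0 <= c * r `^ (d + 1) by apply: mulr_ge0 => //; exact: powR_ge0.
rewrite sumEFin lee_fin -mulr_sumr /wint_cst -/c [leRHS]mulrAC ler_wpM2l//.
apply: (le_trans (geo_sum_le N _ _)); rewrite ?invr_ge0// ?invf_lt1 ?ltr1n//.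
by rewrite (_ : 1 - 2^-1 = 2^-1) ?invrK//; field.
Qed.

End weight_integral.

(** * Weak gradients *)

Ltac meas_auto := first [match goal with H : mf ?g |- mf ?f => constr_eq g f; exact H end |
  lazymatch goal with
  | |- mf (fun=> ?c) => exact (mfC c)
  | |- mf (fun z => @?f z + @?g z) => refine (@mfD _ _ f g _ _); cbv beta; meas_auto
  | |- mf (fun z => - @?f z) => refine (@mfN _ _ f _); cbv beta; meas_auto
  | |- mf (fun z => @?f z * @?g z) => refine (@mfM _ _ f g _ _); cbv beta; meas_auto
  | |- mf (fun z => @?f z ^+ ?k) => refine (@mfX _ _ f k _); cbv beta; meas_auto
  | |- mf (fun z => `|@?f z|) => refine (@mfnorm _ _ f _); cbv beta; meas_auto
  | |- mf (fun z => @?f z `^ ?a) => refine (@mf_pow _ _ f a _); cbv beta; meas_auto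
  | |- mf (fun z => 1 *+ nat_of_bool (@Order.lt _ _ (@?f z) (@?g z)))
    => refine (@mf_blt _ _ f g _ _); cbv beta; meas_auto
  | |- mf (fun z => 1 *+ nat_of_bool (@Order.le _ _ (@?f z) (@?g z)))
    => refine (@mf_ble _ _ f g _ _); cbv beta; meas_auto
  | |- mf (fun z => 1 *+ nat_of_bool (@?f z && @?g z)) => refine (@mf_band _ _ f g _ _); cbv beta;
    meas_auto
  | |- mf (fun z => weight _ _ z) => apply: mf_weight; assumption
  | |- mf (weight _ _) => apply: mf_weight; assumption
  | |- mf (fun z => dist _ z) => apply: mf_dist; assumption
  | |- mf (dist _) => apply: mf_dist; assumption
  | |- mf (fun z => enorm (z - ?x)) => exact (mf_enorm x)
  | |- mf (fun z => bigop _ _ _) => apply: mf_sum => ?; meas_auto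
  | |- mf (fun z => ?f z) => first [assumption | solve [auto] | exact: mf_smooth]
  | |- mf (fun z => ?f (z + ?a)) => refine (@mf_shift _ _ f a _); cbv beta; meas_auto
  | |- mf ?f => first [assumption | solve [auto]]
  | |- _ => idtac
  end].

Ltac nonneg := lazymatch goal with
  | |- is_true (0 <= ?a * ?b) => apply: mulr_ge0; nonneg
  | |- is_true (0 <= ?a + ?b) => apply: addr_ge0; nonneg
  | |- is_true (0 <= ?a ^+ 2) => exact: sqr_ge0
  | |- is_true (0 <= ?a ^+ _) => apply: exprn_ge0; nonneg
  | |- is_true (0 <= ?a ^-1) => rewrite invr_ge0; nonneg
  | |- is_true (0 <= `|_|) => exact: normr_ge0
  | |- is_true (0 <= enorm _) => exact: enorm_ge0
  | |- is_true (0 <= weight _ _ _) => exact: weight_ge0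
  | |- is_true (0 <= dist _ _) => exact: dist_ge0
  | |- is_true (0 <= _ `^ _) => exact: powR_ge0
  | |- is_true (0 <= _%:R) => exact: ler0n
  | |- is_true (0 <= bigop _ _ _) => apply: sumr_ge0 => ? _; nonneg
  | |- is_true (0 <= ?a) => first [assumption | exact: ltW | solve [auto] | idtac]
  | |- forall _, _ => intro; nonneg
  | |- _ => idtac
  end.

(** * The weighted L^2 estimate of translations by the gradient *)

Section translation_estimate.
Context {R : realType} {n : nat}.
Local Notation X := (bT R n).
Local Notation mu := (@mu R n).
Local Notation e_ i := (delta_mx 0 i : 'rV[R]_n).
Implicit Types (f v k : 'rV[R]_n -> R) (G : 'rV[R]_n -> 'rV[R]_n).

Lemma partial_shift f i a z : partial i (fun y => f (y + a)) z = partial i f (z + a).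
Proof.
rewrite /partial /derive.
suff -> : (fun h : R => h^-1 *: (((fun y => f (y + a)) \o shift z) (h *: e_ i) - f (z + a))) =
  (fun h : R => h^-1 *: ((f \o shift (z + a)) (h *: e_ i) - f (z + a))) by [].
by apply/funext => h /=; rewrite addrA.
Qed.

Lemma derivable_shift f a z u : derivable f (z + a) u -> derivable (fun y => f (y + a)) z u.
Proof.
rewrite /derivable.
suff -> : (fun h : R => h^-1 *: (((fun y => f (y + a)) \o shift z) (h *: u) - f (z + a))) =
  (fun h : R => h^-1 *: ((f \o shift (z + a)) (h *: u) - f (z + a))) by [].
by apply/funext => h /=; rewrite addrA.
Qed.

Lemma smooth_shift f a : smooth f -> smooth (fun y => f (y + a)).
Proof.
move=> sf k; elim: k f sf => [|k IH] f sf /=.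
  move=> z; have cf : {for z + a, continuous f} by exact: smooth_continuous.
  apply: (@continuous_comp _ _ _ (fun y : 'rV[R]_n => y + a) f z _ cf).
  exact: (@cvgD _ _ _ (nbhs z) _ id (cst a) z a cvg_id (cvg_cst a)).
split; first exact: Ck_continuous (IH f sf).
move=> i; split; first by move=> z; apply: derivable_shift; exact: smooth_derivable.
rewrite (_ : partial i _ = fun z => partial i f (z + a)); first by apply: IH; exact: smooth_partial.
by apply/funext => z; exact: partial_shift.
Qed.

Lemma cc_shift f a : cc f -> cc (fun y => f (y + a)).
Proof.
move=> [sf [r f0]]; split; first exact: smooth_shift.
exists (r + enorm a) => z rz; apply: f0; have := enorm_tri z (- a) 0.
by rewrite !subr0 opprK enormN; lra.
Qed.

Lemma sum_sqr_le (N : nat) (a : 'I_N -> R) : (\sum_i a i) ^+ 2 <= N%:R * \sum_i a i ^+ 2.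
Proof.
have := cauchy_schwarz (\row_i a i) (\row_(i < N) 1).
rewrite -(@ler_pXn2r _ 2)// ?nnegrE ?mulr_ge0 ?enorm_ge0// exprMn !enorm_sqr real_normK ?num_real//.
rewrite /dot (eq_bigr a) => [|i _]; last by rewrite !mxE mulr1.
rewrite [X in X * _](eq_bigr (fun i => a i ^+ 2)) => [|i _]; last by rewrite !mxE.
rewrite [X in _ * X](eq_bigr (fun=> 1)) => [|i _]; last by rewrite !mxE mulr1.
by rewrite sumr_const card_ord mulrC.
Qed.

Lemma conv_rho_le (n0 : (0 < n)%N) f (d M : R) z : 0 < d -> Iable f -> (forall y, `|f y| <= M) ->
  `|conv f (rho d) z| <= M.
Proof.
move=> d0 If fM; have cr := @cc_rho R n d d0; have M0 : 0 <= M by exact: le_trans (fM 0).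
have Ir : Iable (fun y => rho d (y - z)) by exact: (Iable_shift (- z) (cc_Iable cr)).
rewrite (le_trans (RI_norm (Iable_conv z If cr)))// (le_trans (_ : _ <= RI (fun y => M * rho d (y
  - z))))//.
  apply: RI_le; [exact: Iable_norm (Iable_conv z If cr)|exact: IableZ|] => y.
  by rewrite normrM ler_pM// ger0_norm// rho_ge0.
by rewrite RIZ// RI_rho_shift// mulr1.
Qed.

(** A Riemann sum replaces the integral of the partial derivative along the segment: each of the
    [N.+1] Taylor expansions errs by at most M (t / N.+1)^2. *)
Lemma smooth_line_sum f i z (t M : R) (N : nat) : smooth f -> (forall y, `|partial i (partial i f)
  y| <= M) ->
  `|f (t *: e_ i + z) - f z - t / N.+1%:R * \sum_(m < N.+1) partial i f (z + (m%:R * (t /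
    N.+1%:R)) *: e_ i)| <= M * t ^+ 2 / N.+1%:R.
Proof.
move=> sf fM; set tau := t / N.+1%:R.
pose g (m : nat) := f ((m%:R * tau) *: e_ i + z).
have N0 : N.+1%:R != 0 :> R by rewrite pnatr_eq0.
have -> : f (t *: e_ i + z) - f z = \sum_(m < N.+1) (g m.+1 - g m).
  rewrite -(big_mkord xpredT (fun m => g m.+1 - g m)) telescope_sumr// /g mul0r scale0r add0r.
  by rewrite /tau mulrCA divff ?mulr1.
rewrite mulr_sumr -sumrB (le_trans (ler_norm_sum _ _ _))//.
apply: (@le_trans _ _ (\sum_(m < N.+1) M * tau ^+ 2)).
  apply: ler_sum => m _; have := smooth_taylor (z + (m%:R * tau) *: e_ i) tau sf fM.
  rewrite /g -natr1 mulrDl mul1r scalerDl (addrC z) addrA.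
  by rewrite (addrC (_ *: _) (tau *: _)).
rewrite sumr_const card_ord -[X in X <= _]mulr_natl /tau exprMn exprVn.
apply: eq_ler; move: (N.+1%:R : R) N0 => c c0; field; exact: c0.
Qed.

(** Cauchy-Schwarz for the Riemann sum, then translation invariance term by term; [k'] dominates [k]
    along the whole segment, so that the weight can be moved together with the derivative. Fatou's
    lemma takes the limit. *)
Lemma axis_translation f i (M b t : R) k k' : smooth f -> (forall y, `|partial i (partial i f) y|
  <= M) ->
  mf k -> mf k' -> (forall z, 0 <= k z) -> (forall z, 0 <= k' z) ->
  (forall s z, 0 <= s <= 1 -> k z <= k' (z + (s * t) *: e_ i)) ->
  (II (fun z => k' z * partial i f z ^+ 2)%R <= b%:E)%E ->
  (II (fun z => k z * (f (t *: e_ i + z) - f z) ^+ 2)%R <= (t ^+ 2 * b)%:E)%E.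
Proof.
move=> sf fM mk mk' k0 k0' kk' Hb; have mp := mf_smooth (smooth_partial i sf).
pose S (N : nat) z := t / N.+1%:R * \sum_(m < N.+1) partial i f (z + (m%:R * (t / N.+1%:R))
  *: e_ i).
apply: (@II_fatou _ _ (fun N z => k z * S N z ^+ 2)).
- by move=> N; rewrite /S; meas_simple.
- by move=> N z; nonneg_simple.
- move=> z; apply: cvgMl_tmp; rewrite expr2; under eq_fun do rewrite expr2.
  have cS : S ^~ z @ \oo --> f (t *: e_ i + z) - f z; last exact: cvgM.
  apply/cvgrPdist_le => e e0; near=> N.
  apply: (le_trans (smooth_line_sum z t N sf fM)).
  rewrite ler_pdivrMr ?ltr0n// -ler_pdivrMl//.
  near: N; exists (Num.trunc (e^-1 * (M * t ^+ 2))) => // N /= HN.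
  by rewrite (le_trans (ltW (truncnS_gt _)))// ler_nat ltnS.
move=> N; rewrite /S; set tau := t / N.+1%:R.
have N0 : 0 < N.+1%:R :> R by rewrite ltr0n.
pose A (m : 'I_N.+1) z := k' (z + (m%:R * tau) *: e_ i) * partial i f (z + (m%:R * tau) *: e_ i)
  ^+ 2.
have mA m : mf (A m) by rewrite /A; meas_simple.
have A0 m z : 0 <= A m z by rewrite /A mulr_ge0 ?sqr_ge0.
apply: (@le_trans _ _ (II (fun z => (tau ^+ 2 * N.+1%:R) * \sum_m A m z)%R)).
  have mS : mf (S N) by rewrite /S; meas_simple.
  have mSA : mf (fun z => \sum_m A m z) by exact: mf_sum.
  apply: II_le; [by meas_auto|by apply: mfM => //; exact: mfC|by nonneg|].
  move=> z; rewrite exprMn mulrCA -mulrA ler_wpM2l ?sqr_ge0//.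
  rewrite (le_trans (ler_wpM2l (k0 z) (sum_sqr_le _)))// mulrCA ler_wpM2l ?ler0n//.
  rewrite mulr_sumr; apply: ler_sum => m _; rewrite ler_wpM2r ?sqr_ge0//.
  rewrite /tau (_ : m%:R * (t / N.+1%:R) = m%:R / N.+1%:R * t); last by rewrite mulrCA mulrC.
  by apply: kk'; rewrite divr_ge0//= ler_pdivrMr// mul1r ler_nat ltnW.
rewrite (_ : t ^+ 2 * b = (tau ^+ 2 * N.+1%:R) * (N.+1%:R * b)); last first.
  by rewrite /tau; move: (N.+1%:R : R) N0 => c c0; field; rewrite gt_eqF.
apply: II_scale_le; [by meas_auto|by move=> z; apply: sumr_ge0|by nonneg|].
rewrite II_sum//; apply: (@le_trans _ _ (\sum_(m < N.+1) b%:E)%E).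
  apply: lee_sum => m _; rewrite /A (II_shift (f := fun z => k' z * partial i f z ^+ 2))//;
    first by meas_auto.
  by nonneg.
by rewrite sumEFin sumr_const card_ord mulr_natl.
Unshelve. all: by end_near. Qed.

(** One coordinate at a time along the staircase [prefix_rV]; the factor [n] comes from the square
    of a sum of [n] increments. Each step stays within distance [enorm h], which is the range of the
    comparison of the weights. *)
Lemma smooth_translation f h (M : R) (b : 'I_n -> R) k k' : smooth f ->
  (forall i y, `|partial i (partial i f) y| <= M) ->
  mf k -> mf k' -> (forall z, 0 <= k z) -> (forall z, 0 <= k' z) ->
  (forall z y, enorm (y - z) <= enorm h -> k z <= k' y) ->
  (forall i, (II (fun z => k' z * partial i f z ^+ 2)%R <= (b i)%:E)%E) ->
  (II (fun z => k z * (f (z + h) - f z) ^+ 2)%R <= (n%:R * enorm h ^+ 2 * \sum_i b i)%:E)%E.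
Proof.
move=> sf fM mk mk' k0 k0' kk' Hb; have mF := mf_smooth sf.
have b0 i : 0 <= b i by rewrite -lee_fin; apply: le_trans (Hb i); apply: II_ge0 => z; nonneg_simple.
pose B (i : 'I_n) z := k z * (f (z + prefix_rV i.+1 h) - f (z + prefix_rV i h)) ^+ 2.
have mB i : mf (B i) by rewrite /B; meas_simple.
have B0 i z : 0 <= B i z by rewrite /B; nonneg_simple.
apply: (@le_trans _ _ (II (fun z => n%:R * \sum_i B i z)%R)).
  apply: II_le; [by meas_auto|by meas_auto|by nonneg|].
  move=> z; rewrite prefix_telescope (le_trans (ler_wpM2l (k0 z) (sum_sqr_le _)))// mulrCA.
  by rewrite ler_wpM2l ?ler0n// mulr_sumr.
rewrite -mulrA; apply: II_scale_le; [by meas_auto|by move=> z; apply: sumr_ge0|by nonneg|].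
rewrite II_sum// mulr_sumr -sumEFin; apply: lee_sum => i _.
have -> : II (B i) = II (fun z => k (z - prefix_rV i h) * (f (h 0 i *: e_ i + z) - f z) ^+ 2).
  rewrite -(@II_shift _ _ (B i) (- prefix_rV i h))//; apply: II_eq => z.
  by rewrite /B prefix_rVS addrCA !subrK.
apply: le_trans (@axis_translation f i M (b i) (h 0 i) _ k' sf (fM i) _ mk' _ k0' _ (Hb i)) _;
  [by meas_auto|by []| |].
  move=> s z /andP[s0 s1]; apply: kk'; apply: enorm_mono => j.
  rewrite opprB addrCA (addrAC z) subrr add0r addrC !mxE.
  rewrite eqxx/=; have [->|ij] := eqVneq j i.
    rewrite ltnn mulr1 addr0 normrM ger0_norm// ler_piMl//.
  by rewrite mulr0 add0r; case: ifP => // _; rewrite normr0.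
rewrite lee_fin ler_wpM2r// -real_normK ?num_real// ler_sqr ?nnegrE ?enorm_ge0//.
exact: coord_le_enorm.
Qed.

(* Unlike [weak_grad], the domain is the whole space, and [v] and [G] are integrable. *)
Definition WG v G := [/\ Iable v, forall i, Iable (fun z => G z 0 i) &
  forall psi, cc psi -> forall i, RI (fun z => v z * partial i psi z)
    = - RI (fun z => G z 0 i * psi z)].

(** The weak identity tested with the translated kernel; its two minus signs cancel. *)
Lemma wg_partial_conv v G i d z : WG v G -> 0 < d ->
  partial i (conv v (rho d)) z = conv (fun y => G y 0 i) (rho d) z.
Proof.
move=> [Iv _ vG] d0; have cr := @cc_rho R n d d0.
rewrite partial_conv// /conv; have /(_ i) := vG _ (cc_shift (- z) cr).
under [X in RI X = _]eq_fun do rewrite partial_shift.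
by move=> ->; rewrite opprK.
Qed.

Lemma wg_conv_smooth v G d : WG v G -> 0 < d -> smooth (conv v (rho d)).
Proof. by move=> [Iv _ _] d0; apply: conv_smooth => //; exact: cc_rho. Qed.

Lemma conv_bounded f r : Iable f -> cc r -> exists M, forall z, `|conv f r z| <= M.
Proof.
move=> If cr; have [M M0 rM] := cc_bounded cr; exists (M * RI (fun z => `|f z|)) => z.
have I1 := Iable_conv z If cr.
rewrite (le_trans (RI_norm I1))// -RIZ; last exact: Iable_norm.
apply: RI_le; [exact: Iable_norm|by apply: IableZ; exact: Iable_norm|] => y.
by rewrite normrM mulrC ler_wpM2r.
Qed.

Lemma sqr_enorm_coord (x : 'rV[R]_n) : enorm x ^+ 2 = \sum_i x 0 i ^+ 2.
Proof. by rewrite enorm_sqr /dot; apply: eq_bigr => i _; rewrite expr2. Qed.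

Lemma mf_conv f d : Iable f -> 0 < d -> mf (conv f (rho d)).
Proof. by move=> If d0; apply: mf_smooth; apply: conv_smooth => //; exact: cc_rho. Qed.

Lemma wg_conv_translation v G h d b (k k1 k2 : 'rV[R]_n -> R) : (0 < n)%N -> WG v G -> 0 < d ->
  mf k -> mf k1 -> mf k2 -> (forall z, 0 <= k z) -> (forall z, 0 <= k1 z) -> (forall z, 0 <= k2 z)
    ->
  (forall z y, enorm (y - z) <= enorm h -> k z <= k1 y) ->
  (forall z y, enorm y < d -> k1 z <= k2 (y + z)) ->
  (II (fun z => k2 z * enorm (G z) ^+ 2)%R <= b%:E)%E ->
  (II (fun z => k z * (conv v (rho d) (z + h) - conv v (rho d) z)
    ^+ 2)%R <= (n%:R * enorm h ^+ 2 * b)%:E)%E.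
Proof.
move=> n0 wg d0 mk mk1 mk2 k0 k10 k20 kk1 kk2 Hb; have [Iv IG vG] := wg.
have cr := @cc_rho R n d d0.
pose a i := fine (II (fun z => k2 z * G z 0 i ^+ 2)).
have mG i : mf (fun z => k2 z * G z 0 i ^+ 2) by apply: mfM => //; apply: mfX; exact: Iable_mf.
have G0 i z : 0 <= k2 z * G z 0 i ^+ 2 by rewrite mulr_ge0 ?sqr_ge0.
have Gs : (\sum_i II (fun z => k2 z * G z 0 i ^+ 2)%R <= b%:E)%E.
  rewrite -II_sum//; apply: le_trans Hb; rewrite le_eqVlt; apply/orP; left; apply/eqP.
  by apply: II_eq => z; rewrite sqr_enorm_coord mulr_sumr.
have Gfin i : II (fun z => k2 z * G z 0 i ^+ 2) = (a i)%:E.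
  rewrite fineK// ge0_fin_numE ?II_ge0//; apply: (le_lt_trans _ (ltry b)); apply: le_trans Gs.
  by rewrite (bigD1 i)//= leeDl// sume_ge0// => j _; exact: II_ge0.
have [M HM] : exists M, forall i y, `|partial i (partial i (conv v (rho d))) y| <= M.
  have HMi i : exists M, forall y, `|partial i (partial i (conv v (rho d))) y| <= M.
    have [M HM] := conv_bounded Iv (cc_partial i (cc_partial i cr)); exists M => y.
    suff -> : partial i (partial i (conv v (rho d))) y = conv v (partial i (partial i (rho d)))
      y by [].
    rewrite (_ : partial i (conv v (rho d)) = fun z => - conv v (partial i (rho d)) z); last first.
      by apply/funext => w; exact: partial_conv.
    have /smooth_derivable dc := conv_smooth Iv (cc_partial i cr).
    rewrite /partial deriveN; last exact: dc.
    by have := partial_conv i y Iv (cc_partial i cr); rewrite /partial => ->; rewrite opprK.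
  have [f Hf] := choice HMi; exists (\sum_i `|f i|) => i y.
  rewrite (le_trans (Hf i y))// (le_trans (ler_norm _))// (bigD1 i)//= lerDl.
  by apply: sumr_ge0.
apply: le_trans (smooth_translation (wg_conv_smooth wg d0) HM mk mk1 k0 k10 kk1 (b := a) _) _.
  move=> i; rewrite -Gfin; under II_eq do rewrite (wg_partial_conv _ _ wg d0).
  exact: conv_sqr_le.
rewrite lee_fin ler_wpM2l//; first by nonneg.
by rewrite -lee_fin -sumEFin; under eq_bigr do rewrite -Gfin.
Qed.

(** Two margins for the weights: [k1] absorbs the shift by [h], [k2] the mollification at scales
    below [s]. As [v] and its mollification are bounded by [M], their squared increments differ by
    at most [4 * M] times an L^1 error, so that [conv_L1] removes the mollification. *)
Lemma wg_translation v G h (b K M r s : R) (k k1 k2 : 'rV[R]_n -> R) : (0 < n)%N -> WG v G ->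
  (forall z, `|v z| <= M) -> (forall z, r < enorm z -> v z = 0) -> 0 < s ->
  mf k -> mf k1 -> mf k2 -> (forall z, 0 <= k z <= K) -> (forall z, 0 <= k1 z) -> (forall z,
    0 <= k2 z) ->
  (forall z y, enorm (y - z) <= enorm h -> k z <= k1 y) ->
  (forall z y, enorm y < s -> k1 z <= k2 (y + z)) ->
  (II (fun z => k2 z * enorm (G z) ^+ 2)%R <= b%:E)%E ->
  (II (fun z => k z * (v (z + h) - v z) ^+ 2)%R <= (n%:R * enorm h ^+ 2 * b)%:E)%E.
Proof.
move=> n0 wg vM vr s0 mk mk1 mk2 kK k10 k20 kk1 kk2 Hb; have [Iv IG vG] := wg.
have mv := Iable_mf Iv; have M0 : 0 <= M by exact: le_trans (vM 0).
have k0 z : 0 <= k z by have /andP[] := kK z.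
have K0 : 0 <= K by have /andP[/le_trans h1 /h1] := kK 0.
apply/lee_addgt0Pr => e e0; pose e' := e / (8 * K * M + 1).
have c0 : 0 < 8 * K * M + 1 by rewrite ltr_wpDl// !mulr_ge0.
have e'0 : 0 < e' by rewrite divr_gt0.
have [t t0 Ht] := conv_L1 n0 Iv vr e'0.
pose d := Num.min (t / 2) s.
have d0 : 0 < d by rewrite lt_min s0 divr_gt0.
have dt : d < t by rewrite gt_min ltr_pdivrMr// ltr_pMr// ltr1n.
have ds : d <= s by rewrite ge_min lexx orbT.
set vd := conv v (rho d); have mvd : mf vd by exact: mf_conv.
have vdM z : `|vd z| <= M by exact: conv_rho_le.
have Hd : (II (fun z => `|vd z - v z|)%R <= e'%:E)%E by exact: Ht.
have vdT : (II (fun z => k z * (vd (z + h) - vd z) ^+ 2)%R <= (n%:R * enorm h ^+ 2 * b)%:E)%E.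
  apply: wg_conv_translation kk1 _ Hb => // z y yd; apply: kk2; exact: lt_le_trans ds.
clear Ht; clearbody vd.
apply: (@le_trans _ _ (II (fun z => k z * (vd (z + h) - vd z) ^+ 2 +
    4 * K * M * (`|vd (z + h) - v (z + h)| + `|vd z - v z|))%R)).
  apply: II_le; [by meas_auto|by meas_auto|by nonneg|].
  move=> z; rewrite -lerBlDl -mulrBr subr_sqr.
  have : `|v (z + h) - v z - (vd (z + h) - vd z)| <= `|vd (z + h) - v (z + h)| + `|vd z - v z|.
    by rewrite (le_trans _ (ler_normB _ _))// -[leLHS]normrN; apply: eq_ler; congr (`|_|); ring.
  have : `|v (z + h) - v z + (vd (z + h) - vd z)| <= 4 * M.
    have := vM z; have := vM (z + h); have := vdM z; have := vdM (z + h).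
    rewrite !ler_norml => /andP[? ?] /andP[? ?] /andP[? ?] /andP[? ?].
    by apply/andP; split; lra.
  set A := _ - (_ - _); set B := _ + (_ - _); set S := `|_| + `|_| => B4 AS.
  rewrite (le_trans (ler_norm _))// normrM (ger0_norm (k0 z)) normrM.
  rewrite (_ : 4 * K * M * S = K * (S * (4 * M))); last by ring.
  have /andP[_ kz] := kK z.
  by rewrite ler_pM ?mulr_ge0// ler_pM.
have mE : mf (fun z => `|vd z - v z|) by meas_auto.
have E0 z : 0 <= `|vd z - v z| by [].
have c1 : 0 <= 4 * K * M by rewrite !mulr_ge0.
rewrite II_add; [|by meas_auto|by meas_auto|by nonneg|by nonneg].
apply: leeD.
  exact: vdT.
apply: (@le_trans _ _ (4 * K * M * (e' + e'))%:E).
  apply: II_scale_le => //; [by meas_auto|].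
  rewrite II_add//; [|by meas_auto]; rewrite EFinD; apply: leeD => //.
  by rewrite (II_shift h mE E0).
rewrite lee_fin (_ : _ * _ = e * (8 * K * M) / (8 * K * M + 1)); last first.
  by rewrite /e'; field; rewrite gt_eqF.
by rewrite ler_pdivrMr// ler_pM2l// lerDl.
Qed.
End translation_estimate.

(** * Product and chain rules for weak gradients *)

Section weak_gradient.
Context {R : realType} {n : nat}.
Local Notation X := (bT R n).
Local Notation mu := (@mu R n).
Local Notation e_ i := (delta_mx 0 i : 'rV[R]_n).
Implicit Types (f v k : 'rV[R]_n -> R) (G : 'rV[R]_n -> 'rV[R]_n).

(* [f'] is the [i]-th partial derivative of [f], uniformly and with quadratic error *)
Definition tay i f f' := exists C : R, [/\ 0 <= C, forall z, `|f z| <= C,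
  forall t z, `|f (t *: e_ i + z) - f z| <= C * `|t| &
  forall t z, `|f (t *: e_ i + z) - f z - t * f' z| <= C * t ^+ 2].

(** C^1 with bounded Lipschitz derivative, expressed by inequalities; the truncations used later
    belong to this class but are not C^2. [S 0 = 0] keeps the composition supported where the inner
    function is. *)
Definition C11 (M : R) (S S' : R -> R) := [/\ S 0 = 0, forall t, `|S' t| <= M,
  forall a b, `|S' b - S' a| <= M * `|b - a| &
  forall a b, `|S b - S a - S' a * (b - a)| <= M * (b - a) ^+ 2].

Lemma C11_ge0 M S S' : C11 M S S' -> 0 <= M.
Proof. by move=> [_ /(_ 0) h _ _]; exact: le_trans h. Qed.

Lemma tay_mul i f f' g g' : tay i f f' -> tay i g g' ->
  tay i (fun z => f z * g z) (fun z => f z * g' z + g z * f' z).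
Proof.
move=> [A [A0 fA fl ft]] [B [B0 gB gl gt]].
exists (3 * A * B); split => [||t z|t z]; first by rewrite !mulr_ge0.
- move=> z; rewrite normrM (le_trans (ler_pM _ _ (fA z) (gB z)))//.
  by rewrite -!mulrA ler_peMl ?mulr_ge0// ler1n.
- set F := f _; set H := g _.
  rewrite (_ : _ - _ = F * (H - g z) + (F - f z) * g z); last by ring.
  rewrite (le_trans (ler_normD _ _))// !normrM.
  have h1 : `|F| * `|H - g z| <= A * (B * `|t|) by apply: ler_pM => //; [exact: fA|exact: gl].
  have h2 : `|F - f z| * `|g z| <= (A * `|t|) * B by apply: ler_pM => //; exact: fl.
  rewrite (le_trans (lerD h1 h2))//.
  have : 0 <= A * B * `|t| by rewrite !mulr_ge0.
  by lra.
- have := fl t z; have := gl t z; have := ft t z; have := gt t z.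
  set F := f (_ + _); set H := g (_ + _) => h4 h3 h2 h1.
  rewrite (_ : _ - _ - _ = (F - f z) * (H - g z) + f z * (H - g z - t * g' z)
    + g z * (F - f z - t * f' z)); last by ring.
  have k1 : `|(F - f z) * (H - g z)| <= (A * `|t|) * (B * `|t|) by rewrite normrM ler_pM.
  have k2 : `|f z * (H - g z - t * g' z)| <= A * (B * t ^+ 2) by rewrite normrM ler_pM.
  have k3 : `|g z * (F - f z - t * f' z)| <= B * (A * t ^+ 2) by rewrite normrM ler_pM.
  rewrite (le_trans (ler_normD _ _))// (le_trans (lerD (ler_normD _ _) (lexx _)))//.
  rewrite (le_trans (lerD (lerD k1 k2) k3))// -(real_normK (num_real t)).
  by apply: eq_ler; ring.
Qed.

(** The bound on [S'] is integrated by cutting the interval into [N] pieces: the quadratic errors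
    add up to M (b - a)^2 / N, less than any [e]. *)
Lemma C11_lip M S S' a b : C11 M S S' -> `|S b - S a| <= M * `|b - a|.
Proof.
move=> CS; have M0 := C11_ge0 CS; have [S0 S'M S'l St] := CS.
apply/ler_addgt0Pr => e e0.
pose N := (Num.trunc (M * (b - a) ^+ 2 / e)).+1.
have N0 : 0 < N%:R :> R by rewrite ltr0n.
pose x (i : nat) := a + (i%:R / N%:R) * (b - a).
have -> : S b - S a = \sum_(i < N) (S (x i.+1) - S (x i)).
  rewrite -(big_mkord xpredT (fun i => S (x i.+1) - S (x i))) telescope_sumr// /x.
  by rewrite divff ?gt_eqF// mul1r subrKC mul0r mul0r addr0.
rewrite (le_trans (ler_norm_sum _ _ _))//.
pose D := (b - a) / N%:R.
have xD i : x i.+1 - x i = D.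
  by rewrite /x /D -natr1; move: (N%:R : R) N0 => c c0; field; rewrite gt_eqF.
apply: (@le_trans _ _ (\sum_(i < N) (M * `|D| + M * D ^+ 2))).
  apply: ler_sum => i _; rewrite -[S _ - S _](subrK (S' (x i) * (x i.+1 - x i))) addrC.
  rewrite (le_trans (ler_normD _ _))// xD; apply: lerD; first by rewrite normrM ler_wpM2r.
  by have := St (x i) (x i.+1); rewrite xD.
rewrite sumr_const card_ord -[leLHS]mulr_natl mulrDr; apply: lerD.
  rewrite /D normrM normfV (gtr0_norm N0); apply: eq_ler.
  by move: (N%:R : R) N0 => c c0; field; rewrite gt_eqF.
rewrite /D expr_div_n (_ : _ * _ = M * (b - a) ^+ 2 / N%:R); last first.
  by move: (N%:R : R) N0 => c c0; field; rewrite gt_eqF.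
rewrite ler_pdivrMr// -ler_pdivrMl// mulrC; exact: ltW (truncnS_gt _).
Qed.

Lemma C11_le M S S' t : C11 M S S' -> `|S t| <= M * `|t|.
Proof. by move=> CS; have [S0 _ _ _] := CS; have := C11_lip 0 t CS; rewrite S0 !subr0. Qed.

Lemma tay_comp i f f' M S S' : C11 M S S' -> tay i f f' ->
  tay i (fun z => S (f z)) (fun z => S' (f z) * f' z).
Proof.
move=> CS [A [A0 fA fl ft]]; have M0 := C11_ge0 CS; have [S0 S'M S'l St] := CS.
exists (M * A + M * A ^+ 2); split => [|z|t z|t z]; first by rewrite addr_ge0// mulr_ge0 ?sqr_ge0.
- by rewrite (le_trans (C11_le _ CS))// (le_trans (ler_wpM2l M0 (fA z)))// lerDl mulr_ge0 ?sqr_ge0.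
- rewrite (le_trans (C11_lip _ _ CS))// (le_trans (ler_wpM2l M0 (fl t z)))// mulrA.
  by rewrite ler_wpM2r// lerDl mulr_ge0 ?sqr_ge0.
- have := ft t z; have := fl t z; have := St (f z) (f (t *: e_ i + z)).
  set F := f (_ + _) => h3 h2 h1.
  rewrite (_ : _ - _ - _ = (S F - S (f z) - S' (f z) * (F - f z)) + S' (f z)
    * (F - f z - t * f' z)); last by ring.
  have k1 : `|S' (f z) * (F - f z - t * f' z)| <= M * (A * t ^+ 2) by rewrite normrM ler_pM.
  have k2 : M * (F - f z) ^+ 2 <= M * (A ^+ 2 * t ^+ 2).
    rewrite ler_wpM2l// -exprMn -(real_normK (num_real (F - f z))) -(real_normK (num_real (A * t))).
    by rewrite ler_sqr ?nnegrE// normrM (ger0_norm A0).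
  rewrite (le_trans (ler_normD _ _))// (le_trans (lerD (le_trans h3 k2) k1))//.
  by apply: eq_ler; ring.
Qed.

Lemma norm_bool_le1 (b : bool) : `|b%:R : R| <= 1.
Proof. by case: b; rewrite ?normr1 ?normr0. Qed.

Lemma Iable_ball (r : R) : Iable (fun z : 'rV[R]_n => (enorm (z - 0) <= r)%R%:R).
Proof.
apply: (@Iable_bounded_supp _ _ _ 1 r); [by meas_auto|by move=> z; exact: norm_bool_le1|].
by move=> z rz; rewrite subr0 leNgt rz.
Qed.

Lemma enorm_delta i : enorm (e_ i) = 1.
Proof.
rewrite /enorm /dot (bigD1 i)//= !mxE !eqxx mulr1 big1 ?addr0 ?sqrtr1// => j ji.
by rewrite !mxE (negbTE ji) andbF mulr0.
Qed.

(** [f] and its translate have the same integral, so [t * RI f'] is, up to sign, the integral of the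
    Taylor error, which is O(t^2) on a fixed ball. *)
Lemma RI_tay0 i f f' (r : R) : tay i f f' -> Iable f' -> mf f -> 
  (forall z, r < enorm z -> f z = 0) -> (forall z, r < enorm z -> f' z = 0) -> RI f' = 0.
Proof.
move=> [C [C0 fC _ ft]] If' mf_f f0 f'0.
pose Q (z : 'rV[R]_n) : R := (enorm (z - 0) <= r + 1)%R%:R.
have IQ : Iable Q by exact: Iable_ball.
have If : Iable f by exact: (Iable_bounded_supp mf_f fC f0).
have key t : 0 < t -> t <= 1 -> `|RI f'| <= t * (C * RI Q).
  move=> t0 t1; have Ish : Iable (fun z => f (z + t *: e_ i)) by exact: Iable_shift.
  have It : Iable (fun z => t * f' z) by exact: IableZ.
  have Id : Iable (fun z => f (z + t *: e_ i) - f z - t * f' z) by apply: IableB => //;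
    exact: IableB.
  have E : RI (fun z => f (z + t *: e_ i) - f z - t * f' z) = - (t * RI f').
    rewrite RIB//; last exact: IableB.
    by rewrite RIB// RI_shift// subrr sub0r RIZ.
  rewrite -(ler_pM2l t0) -{1}(gtr0_norm t0) -normrM -normrN -E (le_trans (RI_norm Id))//.
  rewrite (_ : t * (t * (C * RI Q)) = t ^+ 2 * C * RI Q); last by ring.
  rewrite -RIZ//; apply: RI_le; [exact: Iable_norm|exact: IableZ|] => z.
  rewrite /Q subr0; have [zr|zr] := leP (enorm z) (r + 1).
    by rewrite mulr1 (addrC z) (mulrC (t ^+ 2)); exact: ft.
  have zr' : r < enorm z by apply: lt_trans zr; rewrite ltrDl.
  have zr2 : r < enorm (z + t *: e_ i).
    have := enorm_tri z (- (t *: e_ i)) 0; rewrite !subr0 opprK enormN enormZ (gtr0_norm t0).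
    by rewrite enorm_delta mulr1; lra.
  by rewrite f0// f0// f'0// !(mulr0, subr0) normr0.
have Q0 : 0 <= C * RI Q by rewrite mulr_ge0// RI_ge0// => z; exact: ler0n.
apply/eqP; rewrite -normr_le0 leNgt; apply/negP => fpos.
pose t := Num.min 1 (`|RI f'| / (2 * (C * RI Q + 1))).
have c0 : 0 < 2 * (C * RI Q + 1) by rewrite mulr_gt0// ltr_wpDl.
have t0 : 0 < t by rewrite lt_min ltr01 divr_gt0.
have t1 : t <= 1 by rewrite ge_min lexx.
have := key t t0 t1; have tl : t <= `|RI f'| / (2 * (C * RI Q + 1)) by rewrite ge_min lexx orbT.
apply/negP; rewrite -ltNge (le_lt_trans (ler_wpM2r Q0 tl))//.
by rewrite mulrAC ltr_pdivrMr// ltr_pM2l//; lra.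
Qed.

Lemma tay_smooth i f (M : R) : smooth f -> (forall z, `|f z| <= M) ->
  (forall z, `|partial i f z| <= M) -> (forall z, `|partial i (partial i f) z| <= M) ->
    tay i f (partial i f).
Proof.
move=> sf f0 f1 f2; exists M; split => // [|t z|t z]; first exact: le_trans (f0 0).
  exact: smooth_lip.
exact: smooth_taylor.
Qed.

Lemma tay_cc i f : cc f -> tay i f (partial i f).
Proof.
move=> cf; have [A A0 fA] := cc_bounded cf; have [B B0 fB] := cc_bounded (cc_partial i cf).
have [C C0' fC] := cc_bounded (cc_partial i (cc_partial i cf)).
apply: (@tay_smooth i f (A + B + C)); first by case: cf.
- by move=> z; rewrite (le_trans (fA z))//; lra.
- by move=> z; rewrite (le_trans (fB z))//; lra.
- by move=> z; rewrite (le_trans (fC z))//; lra.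
Qed.

Lemma partial_conv2 f r i z : Iable f -> cc r ->
  partial i (partial i (conv f r)) z = conv f (partial i (partial i r)) z.
Proof.
move=> If cr; rewrite (_ : partial i (conv f r) = fun z => - conv f (partial i r) z); last first.
  by apply/funext => w; exact: partial_conv.
have /smooth_derivable dc := conv_smooth If (cc_partial i cr).
rewrite /partial deriveN; last exact: dc.
by have := partial_conv i z If (cc_partial i cr); rewrite /partial => ->; rewrite opprK.
Qed.

Lemma tay_conv i f r : Iable f -> cc r -> tay i (conv f r) (partial i (conv f r)).
Proof.
move=> If cr; have [A fA] := conv_bounded If cr; have [B fB] := conv_bounded If (cc_partial i cr).
have [C fC] := conv_bounded If (cc_partial i (cc_partial i cr)).
have h0 : 0 <= A by exact: le_trans (fA 0).
have h1 : 0 <= B by exact: le_trans (fB 0).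
have h2 : 0 <= C by exact: le_trans (fC 0).
apply: (@tay_smooth i _ (A + B + C)); first exact: conv_smooth.
- by move=> z; rewrite (le_trans (fA z))//; lra.
- by move=> z; rewrite partial_conv// normrN (le_trans (fB z))//; lra.
- by move=> z; rewrite partial_conv2// (le_trans (fC z))//; lra.
Qed.

Lemma C11_cont M S S' : C11 M S S' -> continuous S /\ continuous S'.
Proof.
move=> CS; have M0 := C11_ge0 CS.
have H (g : R -> R) : (forall a b, `|g b - g a| <= M * `|b - a|) -> continuous g.
  move=> gl x; have M1 : 0 < M + 1 by rewrite ltr_wpDl.
  apply/cvgrPdist_le => e e0; near=> y.
  rewrite (le_trans (gl _ _))//.
  apply: (@le_trans _ _ ((M + 1) * `|x - y|)); first by rewrite ler_wpM2r// lerDl.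
  rewrite -ler_pdivlMl//; near: y; apply: cvgr_dist_le; first exact: cvg_id.
  by rewrite mulr_gt0// invr_gt0.
split; apply: H; first by move=> a b; exact: C11_lip CS.
by case: CS.
Unshelve. all: by end_near. Qed.

Lemma mf_C11 M S S' f : C11 M S S' -> mf f -> mf (fun z => S (f z)) /\ mf (fun z => S' (f z)).
Proof.
by move=> /C11_cont[cS cS'] hf; split; apply: mf_comp => //; exact: continuous_measurable_fun.
Qed.

Lemma Iable_tail f (e : R) : Iable f -> 0 < e ->
  exists N : nat, (II (fun z => `|f z| * (N%:R < `|f z|)%R%:R)%R <= e%:E)%E.
Proof.
move=> If e0; have hf := Iable_mf If.
pose F (N : nat) z := `|f z| * (N%:R < `|f z|)%R%:R.
have mF N : mf (F N) by rewrite /F; meas_auto.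
have F0 N z : 0 <= F N z by rewrite /F mulr_ge0.
have Fg N z : `|F N z| <= `|f z|.
  by rewrite ger0_norm// /F; case: (_ < `|f z|); rewrite ?mulr1 ?mulr0.
have lim : RI (F N) @[N --> \oo] --> RI (fun _ : 'rV[R]_n => 0 : R).
  apply: (RI_dct mF (mfC 0) (Iable_norm If) _ Fg); apply: aeW => z; apply/cvgrPdist_le => d d0.
  near=> N; rewrite sub0r normrN ger0_norm// /F.
  rewrite (_ : (N%:R < `|f z|) = false) ?mulr0 ?ltW//; apply/negbTE; rewrite -leNgt.
  near: N; exists (Num.trunc `|f z|).+1 => // N /= HN.
  by rewrite (le_trans (ltW (truncnS_gt _)))// ler_nat.
rewrite RI0 in lim; move/cvgrPdist_le : lim => /(_ _ e0)[N _ /(_ N (leqnn N))].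
rewrite /= sub0r normrN ger0_norm ?RI_ge0// => H; exists N.
have IF : Iable (F N) by exact: (Iable_le (mF N) (Fg N) (Iable_norm If)).
by rewrite -/(II (F N)) /II -RI_EFin// lee_fin.
Unshelve. all: by end_near. Qed.

Lemma wg_mul v G chi : cc chi -> WG v G ->
  WG (fun z => chi z * v z) (fun z => chi z *: G z + v z *: grad chi z).
Proof.
move=> cchi [Iv IG vG]; have [B B0 cB] := cc_bounded cchi; have [B' B'0 cB'] := cc_partial_bounded
  cchi.
have mchi : mf chi by apply: mf_smooth; case: cchi.
have mp i : mf (partial i chi) by apply: mf_smooth; apply: smooth_partial; case: cchi.
have I1 : Iable (fun z => chi z * v z).
  by have := Iable_mulb Iv mchi cB; congr Iable; apply/funext => z; rewrite mulrC.
have I2 i : Iable (fun z => chi z * G z 0 i).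
  by have := Iable_mulb (IG i) mchi cB; congr Iable; apply/funext => z; rewrite mulrC.
have I3 i : Iable (fun z => v z * partial i chi z) by exact: (Iable_mulb Iv (mp i) (cB' i)).
have GE i : (fun z => (chi z *: G z + v z *: grad chi z) 0 i)
  = fun z => chi z * G z 0 i + v z * partial i chi z.
  by apply/funext => z; rewrite !mxE.
split => [//|i|psi cpsi i]; first by rewrite GE; exact: IableD.
have [P P0 pP] := cc_bounded cpsi; have mpsi : mf psi by apply: mf_smooth; case: cpsi.
have := vG _ (cc_mul cchi.1 cpsi) i.
under eq_fun do rewrite (partial_mul i _ cchi.1 cpsi.1) mulrDr.
have J1 : Iable (fun z => v z * (chi z * partial i psi z)).
  have [Q _ pQ] := cc_bounded (cc_mul cchi.1 (cc_partial i cpsi)).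
  apply: (Iable_mulb Iv _ pQ); apply: mf_smooth; apply: smooth_mul; first by case: cchi.
  by apply: smooth_partial; case: cpsi.
have J2 : Iable (fun z => v z * (psi z * partial i chi z)).
  by have := Iable_mulb (I3 i) mpsi pP; congr Iable; apply/funext => z; ring.
have J3 : Iable (fun z => chi z * G z 0 i * psi z) by exact: Iable_mulb (I2 i) mpsi pP.
rewrite RID// => H.

rewrite (_ : (fun z => _ * psi z) = fun z => chi z * G z 0 i * psi z + v z * (psi z * partial i
  chi z)); last first.
  by apply/funext => z; have := congr1 (fun f => f z) (GE i) => /= ->; ring.
rewrite RID//.
rewrite (_ : (fun z => chi z * v z * _) = (fun z => v z * (chi z * partial i psi z)));
  last by apply/funext => z; ring.
rewrite (_ : (fun z => chi z * G z 0 i * psi z) = (fun z => G z 0 i * (chi z * psi z)));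
  last by apply/funext => z; ring.
by rewrite opprD -H addrK.
Qed.

(** For the mollification [vd] the product [S (vd) * psi] satisfies [tay], so [RI_tay0] gives the
    identity although [S] need not be smooth. In the limit the delicate term is (S'(v) - S'(vd)) G:
    the Lipschitz bound on [S'] serves where |G| <= N, the bound on [S'] and the integrability of
    [G] elsewhere. *)
Lemma wg_chain v G M S S' (r : R) : (0 < n)%N -> WG v G -> (forall z, r < enorm z -> v z = 0) ->
  (forall z, r < enorm z -> G z = 0) -> C11 M S S' ->
  WG (fun z => S (v z)) (fun z => S' (v z) *: G z).
Proof.
move=> n0 [Iv IG vG] v0 G0 CS; have mv := Iable_mf Iv; have M0 := C11_ge0 CS.
have [mSv mS'v] := mf_C11 CS mv; have [_ S'M S'l _] := CS.
have ISv : Iable (fun z => S (v z)).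
  by apply: (Iable_le (g := fun z => M * `|v z|) mSv) => [z|]; [exact: C11_le CS|apply: IableZ;
    exact: Iable_norm].
have GE i : (fun z => (S' (v z) *: G z) 0 i) = fun z => G z 0 i * S' (v z).
  by apply/funext => z; rewrite !mxE mulrC.
have ISG i : Iable (fun z => G z 0 i * S' (v z)) by exact: Iable_mulb (IG i) mS'v (fun z => S'M _).
split => [//|i|psi cpsi i]; first by rewrite GE.
rewrite (_ : (fun z => _ * psi z) = fun z => G z 0 i * S' (v z) * psi z); last first.
  by apply/funext => z; have := congr1 (fun f => f z) (GE i) => /= ->.
have [P1 P10 pP1] := cc_bounded cpsi; have [P2 P20 pP2] := cc_bounded (cc_partial i cpsi).
have mpsi : mf psi by apply: mf_smooth; case: cpsi.
have mppsi : mf (partial i psi) by apply: mf_smooth; apply: smooth_partial; case: cpsi.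
pose P := P1 + P2; have P0 : 0 <= P by rewrite addr_ge0.
have pP z : `|psi z| <= P by rewrite (le_trans (pP1 z))// lerDl.
have pP' z : `|partial i psi z| <= P by rewrite (le_trans (pP2 z))// lerDr.
have J1 : Iable (fun z => S (v z) * partial i psi z) by exact: Iable_mulb ISv mppsi pP'.
have J2 : Iable (fun z => G z 0 i * S' (v z) * psi z) by exact: Iable_mulb (ISG i) mpsi pP.
apply/eqP; rewrite -subr_eq0 opprK -RID//.
set T := RI _; rewrite -normr_le0; apply/ler_addgt0Pr => e e0; rewrite add0r.
(* Four errors of size [P * M * (e / c)]: two from the mollifications, two from the tail of [G]. *)
pose c := P * M * 4 + 1; have c0 : 0 < c by rewrite ltr_wpDl// !mulr_ge0.
have ec : 0 < e / c by rewrite divr_gt0.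
have [N HN] := Iable_tail (IG i) ec.
have N1 : 0 < N.+1%:R :> R by rewrite ltr0n.
have ecN : 0 < e / c / N.+1%:R by rewrite divr_gt0.
have [s1 s10 H1] := conv_L1 n0 Iv v0 ecN.
have G0i z : r < enorm z -> G z 0 i = 0 by move=> /G0 ->; rewrite mxE.
have [s2 s20 H2] := conv_L1 n0 (IG i) G0i ec.
pose d := Num.min s1 s2 / 2.
have m0 : 0 < Num.min s1 s2 by rewrite lt_min s10 s20.
have d0 : 0 < d by rewrite divr_gt0.
have dm : d < Num.min s1 s2 by rewrite ltr_pdivrMr// ltr_pMr// ltr1n.
have {}H1 : (II (fun z => `|conv v (rho d) z - v z|)%R <= (e / c / N.+1%:R)%:E)%E.
  by apply: H1 => //; apply: lt_le_trans dm _; rewrite ge_min lexx.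
have {}H2 : (II (fun z => `|conv (fun y => G y 0%R i) (rho d) z - G z 0%R i|)%R <= (e / c)%:E)%E.
  by apply: H2 => //; apply: lt_le_trans dm _; rewrite ge_min lexx orbT.
have cr := @cc_rho R n d d0; have wg : WG v G by split.
have pc z := wg_partial_conv i z wg d0.
have ty : tay i (fun z => S (conv v (rho d) z) * psi z)
   (fun z => S (conv v (rho d) z) * partial i psi z + psi z * (S' (conv v (rho d) z)
     * partial i (conv v (rho d)) z)).
  exact: tay_mul (tay_comp CS (tay_conv i Iv cr)) (tay_cc i cpsi).
have IGd : Iable (conv (fun y => G y 0 i) (rho d)).
  have ID : Iable (fun z => conv (fun y => G y 0 i) (rho d) z - G z 0 i).
    apply/IableP; split; last exact: le_lt_trans H2 (ltry _).
    by apply: mfB; [exact: mf_conv|exact: Iable_mf].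
  by have := IableD ID (IG i); congr Iable; apply/funext => z; rewrite subrK.
move: ty H1 H2 pc; have mvd : mf (conv v (rho d)) by exact: mf_conv.
have mgd : mf (conv (fun y => G y 0 i) (rho d)) by exact: mf_conv.
have [A pA] := conv_bounded Iv cr.
move: mvd mgd pA IGd; set vd := conv v (rho d); set gd := conv _ (rho d)
  => mvd mgd pA IGd ty H1 H2 pc.
have {}ty : tay i (fun z => S (vd z) * psi z) (fun z => S (vd z)
  * partial i psi z + gd z * S' (vd z) * psi z).
  by move: ty; congr tay; apply/funext => z; rewrite pc; ring.
clear pc; clearbody vd gd.
have [mSd mS'd] := mf_C11 CS mvd.
have A0 : 0 <= A by exact: le_trans (pA 0).
have SdM z : `|S (vd z)| <= M * A by rewrite (le_trans (C11_le _ CS))// ler_wpM2l.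
have K1 : Iable (fun z => S (vd z) * partial i psi z).
  by have := Iable_mulb (cc_Iable (cc_partial i cpsi)) mSd SdM; congr Iable; apply/funext => z;
    rewrite mulrC.
have K2 : Iable (fun z => gd z * S' (vd z) * psi z).
  by apply: (Iable_mulb _ mpsi pP); exact: (Iable_mulb IGd mS'd (fun z => S'M _)).
have [rp psi0] := cpsi.2.
have T0 : RI (fun z => S (vd z) * partial i psi z + gd z * S' (vd z) * psi z) = 0.
  have [rp' ppsi0] := (cc_partial i cpsi).2.
  apply: (@RI_tay0 i _ _ (Num.max rp rp') ty); [exact: IableD|by meas_auto| |].
  - by move=> z; rewrite gt_max => /andP[rz _]; rewrite psi0// mulr0.
  - by move=> z; rewrite gt_max => /andP[rz rz']; rewrite psi0// ppsi0// !mulr0 addr0.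
have -> : T = RI (fun z => (S (v z) * partial i psi z + G z 0 i * S' (v z) * psi z) -
   (S (vd z) * partial i psi z + gd z * S' (vd z) * psi z)).
  by rewrite RIB ?T0 ?subr0//; exact: IableD.
have mG : mf (fun z => G z 0 i) by exact: Iable_mf.
apply: RI_norm_le; first by apply: IableB; exact: IableD.
apply: (@le_trans _ _ (II (fun z => P * M * (N.+1%:R * `|vd z - v z| + `|gd z - G z 0%R i| +
    2 * (`|G z 0%R i| * (N%:R < `|G z 0%R i|)%R%:R)))%R)).
  apply: II_le; [by meas_auto|by meas_auto|by nonneg|].
  move=> z; set a := `|vd z - v z|; set b := `|gd z - _|; set g := G z 0 i.
  rewrite (_ : _ - _ = (S (v z) - S (vd z)) * partial i psi z + (S' (vd z) * (g - gd z)
    + (S' (v z) - S' (vd z)) * g) * psi z); last by ring.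
  have k1 : `|(S (v z) - S (vd z)) * partial i psi z| <= M * a * P.
    by rewrite normrM ler_pM// (le_trans (C11_lip _ _ CS))// /a distrC.
  have k2 : `|S' (vd z) * (g - gd z)| <= M * b by rewrite normrM ler_pM// /b distrC.
  have k3 : `|(S' (v z) - S' (vd z)) * g| <= M * (N%:R * a + 2 * (`|g| * (N%:R < `|g|)%R%:R)).
    rewrite normrM; have [gN|gN] := ltP N%:R `|g|.
      rewrite (le_trans (_ : _ <= (M + M) * `|g|))//; last first.
        have a0 : 0 <= a by exact: normr_ge0.
        have -> : M * (N%:R * a + 2 * (`|g| * true%:R)) = M * (N%:R * a) + (M + M) * `|g|
          by rewrite mulr1; ring.
        by rewrite lerDr !mulr_ge0.
      by rewrite ler_wpM2r// (le_trans (ler_normB _ _))// lerD.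
    rewrite mulr0 mulr0 addr0 (_ : M * (N%:R * a) = (M * a) * N%:R); last by ring.
    by rewrite ler_pM// (le_trans (S'l _ _))// /a distrC.
  rewrite (le_trans (ler_normD _ _))//.
  have k4 : `|(S' (vd z) * (g - gd z) + (S' (v z) - S' (vd z)) * g) * psi z| <=
     (M * b + M * (N%:R * a + 2 * (`|g| * (N%:R < `|g|)%R%:R))) * P.
    by rewrite normrM ler_pM// (le_trans (ler_normD _ _))// lerD.
  rewrite (le_trans (lerD k1 k4))// -natr1; apply: eq_ler; ring.
apply: (@le_trans _ _ (P * M * (N.+1%:R * (e / c / N.+1%:R) + e / c + 2 * (e / c)))%:E).
  apply: II_scale_le; [by meas_auto|by nonneg|by nonneg|].
  rewrite II_add; [|by meas_auto|by meas_auto|by nonneg|by nonneg].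
  rewrite EFinD; apply: leeD; last by apply: II_scale_le; [by meas_auto|by nonneg|by nonneg|exact:
    HN].
  rewrite II_add; [|by meas_auto|by meas_auto|by nonneg|by nonneg].
  rewrite EFinD; apply: leeD => //; by apply: II_scale_le; [by meas_auto|by nonneg|by
    nonneg|exact: H1].
rewrite lee_fin (mulrC N.+1%:R) divfK ?gt_eqF//.
have -> : P * M * (e / c + e / c + 2 * (e / c)) = e * (P * M * 4) / c by ring.
by rewrite ler_pdivrMr// ler_pM2l// /c lerDl.
Qed.

End weak_gradient.

(** * Averages and the Poincare inequality *)

Section ball_indicator.
Context {R : realType} {n : nat}.

Local Notation X := (bT R n).
Local Notation mu := (@mu R n).
Implicit Types (f v k : 'rV[R]_n -> R) (G : 'rV[R]_n -> 'rV[R]_n) (x : 'rV[R]_n).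

(** A real-valued indicator, so that localisation to a ball is a product inside integrands. *)
Definition Bl x (s : R) z : R := (enorm (z - x) < s)%R%:R.

Lemma mf_Bl x s : mf (Bl x s).
Proof. by rewrite /Bl; meas_auto. Qed.

Lemma Bl_ge0 x s z : 0 <= Bl x s z. Proof. exact: ler0n. Qed.

End ball_indicator.

#[global] Hint Resolve Bl_ge0 : core.

Section averages.
Context {R : realType} {n : nat}.
Hypothesis n0 : (0 < n)%N.
Local Notation X := (bT R n).
Local Notation mu := (@mu R n).
Implicit Types (f v k : 'rV[R]_n -> R) (G : 'rV[R]_n -> 'rV[R]_n) (x : 'rV[R]_n).

Definition ball_vol (s : R) : R := fine (mu (eball 0 s)).
Definition ballavg v x (s : R) : R := (ball_vol s)^-1 * RI (fun z => v z * Bl x s z).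

Lemma Bl_le1 x s z : Bl x s z <= 1. Proof. by rewrite /Bl; case: (_ < _). Qed.

Lemma mu_eball_fin (s : R) : 0 <= s -> mu (eball 0 s) = (ball_vol s)%:E.
Proof.
move=> s0; rewrite fineK// ge0_fin_numE ?measure_ge0//.
exact: le_lt_trans (mu_eball_le _ s0) (ltry _).
Qed.

Lemma II_Bl x s : 0 <= s -> II (Bl x s) = (ball_vol s)%:E.
Proof.
move=> s0; have -> : II (Bl x s) = II (Bl (0 : 'rV[R]_n) s).
  rewrite -(II_shift (- x) (mf_Bl 0 s) (Bl_ge0 0 s)); apply: II_eq => z.
  by rewrite /Bl subr0.
rewrite -mu_eball_fin// /Bl II_bool; last exact: measurable_eball.
by [].
Qed.

Lemma ball_vol_ge s : 0 <= s -> (2 * (s / n%:R)) ^+ n <= ball_vol s.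
Proof. by move=> s0; rewrite -lee_fin -mu_eball_fin//; exact: mu_eball_ge. Qed.

Lemma ball_vol_le s : 0 <= s -> ball_vol s <= (2 * s) ^+ n.
Proof. by move=> s0; rewrite -lee_fin -mu_eball_fin//; exact: mu_eball_le. Qed.

Lemma ball_vol_gt0 s : 0 < s -> 0 < ball_vol s.
Proof.
move=> s0; apply: lt_le_trans (ball_vol_ge (ltW s0)).
by rewrite exprn_gt0// mulr_gt0// divr_gt0// ltr0n.
Qed.

Lemma Iable_Bl x s : 0 <= s -> Iable (Bl x s).
Proof.
move=> s0; apply/IableP; split; first exact: mf_Bl.
under II_eq do rewrite (ger0_norm (Bl_ge0 _ _ _)).
by rewrite II_Bl// ltry.
Qed.

Lemma RI_Bl x s : 0 <= s -> RI (Bl x s) = ball_vol s.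
Proof.
by move=> s0; have := RI_EFin (Iable_Bl x s0); rewrite -/(II (Bl x s)) II_Bl// => -[].
Qed.

Lemma Iable_mBl f x s (M : R) : 0 <= s -> mf f -> (forall z, `|f z| <= M) ->
  Iable (fun z => f z * Bl x s z).
Proof.
move=> s0 hf fM; have := Iable_mulb (Iable_Bl x s0) hf fM.
by congr Iable; apply/funext => z; rewrite mulrC.
Qed.

Lemma av_jensen f x s (M : R) : 0 < s -> mf f -> (forall z, `|f z| <= M) ->
  ((ball_vol s * ballavg f x s ^+ 2)%:E <= II (fun z => f z ^+ 2 * Bl x s z)%R)%E.
Proof.
move=> s0 hf fM; have b0 := ball_vol_gt0 s0; have s0' := ltW s0.
pose q z := (ball_vol s)^-1 * Bl x s z.
have Iq : Iable q by apply: IableZ; exact: Iable_Bl.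
have mq : mf q by exact: Iable_mf.
have q0 z : 0 <= q z by rewrite mulr_ge0 ?Bl_ge0// invr_ge0 ltW.
have q1 : RI q = 1 by rewrite RIZ ?RI_Bl// ?mulVf ?gt_eqF//; exact: Iable_Bl.
have Ifq : Iable (fun z => f z * q z).
  by have := Iable_mulb Iq hf fM; congr Iable; apply/funext => z; rewrite mulrC.
have := jensen hf q0 Iq q1 Ifq.
have -> : RI (fun z => f z * q z) = ballavg f x s.
  rewrite /ballavg -RIZ; last exact: Iable_mBl fM.
  by congr RI; apply/funext => z; rewrite /q mulrCA.
have mB := mf_Bl x s.
have -> : II (fun z => f z ^+ 2 * q z) = ((ball_vol s)^-1%:E * II (fun z => f z ^+ 2 * Bl x s
  z)%R)%E.
  rewrite -II_scale; [|by meas_auto| |by rewrite invr_ge0 ltW].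
    by apply: II_eq => z; rewrite /q mulrCA.
  by move=> z; rewrite mulr_ge0 ?sqr_ge0 ?Bl_ge0.
move=> H; rewrite EFinM muleC; apply: le_trans (lee_wpmul2r _ H) _; first by rewrite lee_fin ltW.
by rewrite muleAC -EFinM mulVf ?gt_eqF// mul1e.
Qed.

Lemma avB f x s (c M : R) : 0 < s -> mf f -> (forall z, `|f z| <= M) -> ballavg (fun z => f z - c)
  x s = ballavg f x s - c.
Proof.
move=> s0 hf fM; have s0' := ltW s0; rewrite /ballavg.
rewrite (_ : (fun z => (f z - c) * _) = (fun z => f z * Bl x s z - c * Bl x s z)); last first.
  by apply/funext => z; rewrite mulrBl.
rewrite RIB; [|exact: Iable_mBl fM|by apply: IableZ; exact: Iable_Bl].
rewrite RIZ ?RI_Bl//; last exact: Iable_Bl.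
by rewrite mulrBr mulrCA mulVf ?mulr1// gt_eqF// ball_vol_gt0.
Qed.

(** Jensen for [v - v z] on the ball around [x], which lies in the ball of radius [t] around [z];
    oscillation is thereby expressed through increments [v (z + h) - v z]. *)
Lemma osc_pt v x z s t (M : R) : 0 < s -> mf v -> (forall z, `|v z| <= M) ->
  (forall y, enorm (y - x) < s -> enorm (y - z) < t) ->
  ((ball_vol s * (v z - ballavg v x s) ^+ 2)%:E <= II (fun h => Bl 0%R t h * (v (z + h) - v z)
    ^+ 2)%R)%E.
Proof.
move=> s0 mv vM xz; have mB y u := mf_Bl y u.
have vzM y : `|v y - v z| <= M + M by rewrite (le_trans (ler_normB _ _))// lerD.
have mvz : mf (fun y => v y - v z) by meas_auto.
have := @av_jensen (fun y => v y - v z) x s (M + M) s0 mvz vzM.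
rewrite (avB _ _ s0 mv vM) -sqrrN opprB => /le_trans; apply.
rewrite -(II_shift z); [|by meas_auto|by move=> y; rewrite mulr_ge0 ?sqr_ge0 ?Bl_ge0].
apply: II_le.
- apply: mfM; last exact: mf_shift.
  by apply: mfX; apply: mfB; [exact: mf_shift|exact: mfC].
- apply: mfM => //; apply: mfX; apply: mfB; last exact: mfC.
  by have := mf_shift z mv; congr mf; apply/funext => h; rewrite addrC.
- by move=> y; rewrite mulr_ge0 ?sqr_ge0 ?Bl_ge0.
- move=> h; rewrite (addrC z) mulrC ler_wpM2r ?sqr_ge0// /Bl.
  have [/xz|_] := boolP (enorm (h + z - x) < s); last exact: ler0n.
  by rewrite addrK subr0 => ->.
Qed.

(* Poincare on a ball: the translation estimate for all [|h| < 2 s]. *)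
Lemma poincare v G x s (b M r : R) : 0 < s -> WG v G -> (forall z, `|v z| <= M) ->
  (forall z, r < enorm z -> v z = 0) ->
  (II (fun z => Bl x (4 * s) z * enorm (G z) ^+ 2)%R <= b%:E)%E ->
  (II (fun z => Bl x s z * (v z - ballavg v x s) ^+ 2)%R <=
     ((ball_vol s)^-1 * (n%:R * (2 * s) ^+ 2 * b) * ball_vol (2 * s))%:E)%E.
Proof.
move=> s0 wg vM vr Hb; have [Iv IG vG] := wg; have mv := Iable_mf Iv.
have b0 := ball_vol_gt0 s0; have s20 : 0 < 2 * s by rewrite mulr_gt0.
have mB (y : 'rV[R]_n) (t : R) : mf (Bl y t) by exact: mf_Bl.
have b'0 : 0 <= b by rewrite -lee_fin; apply: le_trans Hb; apply: II_ge0 => z;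
  rewrite mulr_ge0 ?sqr_ge0 ?Bl_ge0.
have -> : ((ball_vol s)^-1 * (n%:R * (2 * s) ^+ 2 * b) * ball_vol (2 * s))%:E =
    II (fun h : 'rV[R]_n => (ball_vol s)^-1 * (n%:R * (2 * s) ^+ 2 * b) * Bl 0 (2 * s) h).
  rewrite (II_scale (mB _ _) (Bl_ge0 _ _)); last first.
    by apply: mulr_ge0; [rewrite invr_ge0 ltW|apply: mulr_ge0 => //; apply: mulr_ge0;
      [exact: ler0n|exact: sqr_ge0]].
  by rewrite II_Bl ?(ltW s20)// EFinM.
pose F z h := (ball_vol s)^-1 * (Bl x s z * (Bl 0 (2 * s) h * (v (z + h) - v z) ^+ 2)).
apply: (@II_le_fubini _ _ _ _ F).
- by meas_auto.
- by meas_auto.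
- rewrite /F; apply: (@mf2M _ _ (fun _ _ => (ball_vol s)^-1)); first exact: (mf2_fst (mfC _)).
  apply: mf2M; first exact: (mf2_fst (mB x s)).
  apply: mf2M; first exact: (mf2_snd (mB 0 (2 * s))).
  apply: mf2X; apply: mf2D; first exact: mf2_add.
  by apply: mf2N; exact: mf2_fst.
- by move=> z; rewrite mulr_ge0 ?sqr_ge0 ?Bl_ge0.
- by nonneg.
- by move=> z h; rewrite /F; nonneg.
- move=> z; rewrite /F; have [zx|zx] := boolP (enorm (z - x) < s); last first.
    by rewrite /Bl (negbTE zx) mul0r; apply: II_ge0 => h; rewrite mul0r mulr0.
  rewrite {1}/Bl zx mul1r.
  under II_eq do rewrite {1}/Bl zx mul1r.
  have mvh : mf (fun h => v (z + h)).
    by have := mf_shift z mv; congr mf; apply/funext => h; rewrite addrC.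
  rewrite II_scale; [|by meas_auto|by nonneg|by rewrite invr_ge0 ltW].
  have xz y : enorm (y - x) < s -> enorm (y - z) < 2 * s.
    by have := enorm_tri y x z; rewrite (enorm_distC x z); move: zx => ?; lra.
  have := osc_pt s0 mv vM xz => H.
  rewrite -[_ ^+ 2](mulKf (lt0r_neq0 b0)) EFinM lee_wpmul2l ?lee_fin ?invr_ge0 ?(ltW b0)//.
- move=> h; rewrite /F.
  have [hs|hs] := boolP (enorm h < 2 * s); last first.
    rewrite /Bl subr0 (negbTE hs) mulr0 (_ : (fun z => _) = fun=> 0).
      by rewrite /II integral0.
    by apply/funext => z; rewrite mul0r !mulr0.
  have -> : Bl 0 (2 * s) h = 1 by rewrite /Bl subr0 hs.
  rewrite mulr1.
  apply: (@le_trans _ _ (II (fun z => (ball_vol s)^-1 * (Bl x s z * (v (z + h) - v z) ^+ 2))%R)).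
    by rewrite le_eqVlt; apply/orP; left; apply/eqP; apply: II_eq => z; rewrite mul1r.
  apply: II_scale_le; [by meas_auto|by move=> z; rewrite mulr_ge0 ?sqr_ge0 ?Bl_ge0|by rewrite
    invr_ge0 ltW|].
  apply: (@le_trans _ _ (n%:R * enorm h ^+ 2 * b)%:E); last first.
    rewrite lee_fin ler_wpM2r// ler_wpM2l ?ler0n// ler_sqr ?nnegrE ?enorm_ge0//; exact: ltW.
  apply: (wg_translation (K := 1) n0 wg vM vr s0 (mB x s) (mB x (3 * s)) (mB x (4 * s))
    _ _ _ _ _ Hb).
  + by move=> z; rewrite Bl_ge0 Bl_le1.
  + by move=> z; exact: Bl_ge0.
  + by move=> z; exact: Bl_ge0.
  + move=> z y yz; rewrite /Bl; have [zx|_] := boolP (enorm (z - x) < s); last exact: ler0n.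
    by rewrite (_ : _ < _ = true)//; have := enorm_tri y z x; move: hs zx yz => ? ? ?; lra.
  + move=> z y yz; rewrite /Bl; have [zx|_] := boolP (enorm (z - x) < 3 * s); last exact: ler0n.
    rewrite (_ : (_ < 4 * s) = true)//; have := enorm_tri (y + z) z x.
    by rewrite addrK; move: zx yz => ? ?; lra.
Qed.

(** The difference of the averages is the average of [v - ballavg v x s] over the smaller ball;
    Jensen's inequality and [poincare] on the larger one bound it. *)
Lemma av_step v G x s (b M r : R) : 0 < s -> WG v G -> (forall z, `|v z| <= M) ->
  (forall z, r < enorm z -> v z = 0) ->
  (II (fun z => Bl x (4 * s) z * enorm (G z) ^+ 2)%R <= b%:E)%E ->
  ball_vol (s / 2) * (ballavg v x (s / 2) - ballavg v x s) ^+ 2 <= (ball_vol s)^-1 * (n%:R * (2 *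
    s) ^+ 2 * b) * ball_vol (2 * s).
Proof.
move=> s0 wg vM vr Hb; have s20 : 0 < s / 2 by rewrite divr_gt0.
have [Iv _ _] := wg; have mv := Iable_mf Iv; have mB y t := mf_Bl y t.
rewrite -lee_fin; apply: le_trans (poincare s0 wg vM vr Hb).
have mc : mf (fun z => v z - ballavg v x s) by meas_auto.
have cM z : `|v z - ballavg v x s| <= M + `|ballavg v x s| by rewrite (le_trans (ler_normB _ _))//
  lerD.
have := av_jensen x s20 mc cM; rewrite (avB _ _ s20 mv vM) => /le_trans; apply.
apply: II_le; [by meas_auto|by meas_auto|by nonneg|] => z.
rewrite mulrC ler_wpM2r ?sqr_ge0// /Bl; have [zx|_] := boolP (_ < s / 2); last exact: ler0n.
by rewrite (lt_trans zx)// ltr_pdivrMr// ltr_pMr// ltr1n.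
Qed.

(** Ball volumes are only placed between those of cubes of side 2 s / n and 2 s; the power [n]
    collects these ratios. *)
Definition step_cst : R := 4 * n%:R * (2 * n%:R ^+ 2) ^+ n.

Lemma av_step_le v G x s (b M r : R) : 0 < s -> WG v G -> (forall z, `|v z| <= M) ->
  (forall z, r < enorm z -> v z = 0) ->
  (II (fun z => Bl x (4 * s) z * enorm (G z) ^+ 2)%R <= b%:E)%E ->
  (ballavg v x (s / 2) - ballavg v x s) ^+ 2 <= step_cst * (s ^+ 2 * b / s ^+ n).
Proof.
move=> s0 wg vM vr Hb; have s20 : 0 < s / 2 by rewrite divr_gt0.
have b0 : 0 <= b by rewrite -lee_fin; apply: le_trans Hb; apply: II_ge0 => z; nonneg.
have N0 : 0 < n%:R :> R by rewrite ltr0n.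
have h1 := ball_vol_ge (ltW s20); have h2 := ball_vol_ge (ltW s0);
  have s2 : 0 < 2 * s by rewrite mulr_gt0.
have h3 := ball_vol_le (ltW s2); have p1 := ball_vol_gt0 s20; have p2 := ball_vol_gt0 s0.
have := av_step s0 wg vM vr Hb; set D := (_ - _) ^+ 2 => H.
have D0 : 0 <= D by exact: sqr_ge0.
rewrite -ler_pdivlMl// in H; apply: (le_trans H).
have q1 : 0 < (2 * (s / 2 / n%:R)) ^+ n by rewrite exprn_gt0// mulr_gt0// divr_gt0.
have q2 : 0 < (2 * (s / n%:R)) ^+ n by rewrite exprn_gt0// mulr_gt0// divr_gt0.
have sn : 0 < s ^+ n by rewrite exprn_gt0.
apply: (@le_trans _ _ (((2 * (s / 2 / n%:R)) ^+ n)^-1 * (((2 * (s / n%:R))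
  ^+ n)^-1 * (n%:R * (2 * s) ^+ 2 * b) * (2 * (2 * s)) ^+ n))).
  have c0 : 0 <= n%:R * (2 * s) ^+ 2 * b by rewrite !mulr_ge0// ltW.
  apply: ler_pM; [by rewrite invr_ge0 ltW| |by rewrite lef_pV2|].
    by rewrite !mulr_ge0// ?invr_ge0 ltW// ball_vol_gt0.
  by apply: ler_pM; [by rewrite mulr_ge0// invr_ge0 ltW|by rewrite ltW// ball_vol_gt0|by rewrite
    ler_wpM2r// lef_pV2|].
rewrite /step_cst -!exprVn.
rewrite (_ : (2 * (s / 2 / n%:R))^-1 = n%:R * s^-1); last by field; rewrite !gt_eqF.
rewrite (_ : (2 * (s / n%:R))^-1 = 2^-1 * n%:R * s^-1); last by field; rewrite !gt_eqF.
apply: eq_ler.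
have -> : (n%:R / s) ^+ n * ((2^-1 * n%:R / s) ^+ n * (n%:R * (2 * s) ^+ 2 * b) * (2 * (2 * s))
  ^+ n) =
  (n%:R * (2 * s) ^+ 2 * b) * ((n%:R / s) * (2^-1 * n%:R / s) * (2 * (2 * s))) ^+ n.
  by rewrite !exprMn; ring.
have -> : (n%:R / s) * (2^-1 * n%:R / s) * (2 * (2 * s)) = (2 * n%:R ^+ 2) / s.
  by field; rewrite gt_eqF.
by rewrite (exprMn n (2 * n%:R ^+ 2) s^-1); ring.
Qed.

End averages.

Section hausdorff_lists.
Context {R : realType} {n : nat}.
Variable d : R.
Hypothesis d0 : 0 < d.

Lemma hausdorff_seq (l : seq 'rV[R]_n) (F : 'rV[R]_n -> set 'rV[R]_n) (b : R) :
  (forall x, x \in l -> (hausdorff d (F x) <= b%:E)%E) ->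
  (hausdorff d (\bigcup_(x in [set` l]) F x) <= ((size l)%:R * b)%:E)%E.
Proof.
elim: l => [|x l IH] H.
  rewrite (_ : \bigcup_(x in _) _ = set0) ?hausdorff0 ?mul0r//.
  by apply/seteqP; split => z // -[y /=].
rewrite (_ : \bigcup_(y in _) _ = F x `|` \bigcup_(y in [set` l]) F y); last first.
  apply/seteqP; split => [z [y /=]|z [xz|[y /= yl yz]]].
  - by rewrite inE => /orP[/eqP -> ?|yl ?]; [left|right; exists y].
  - by exists x => //=; rewrite mem_head.
  - by exists y => //=; rewrite inE yl orbT.
apply: le_trans (hausdorffU d0 _ _) _.
rewrite (_ : ((size (x :: l))%:R * b)%:E = (b%:E + ((size l)%:R * b)%:E)%E); last first.
  by rewrite /= -natr1 mulrDl mul1r addrC EFinD.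
apply: leeD; first by apply: H; rewrite mem_head.
by apply: IH => y yl; apply: H; rewrite inE yl orbT.
Qed.

Lemma nneseries_le (u : nat -> \bar R) (b : \bar R) : (forall k, (0 <= u k)%E) ->
  (forall N, (\sum_(k < N) u k <= b)%E) -> (\sum_(0 <= k <oo) u k <= b)%E.
Proof.
move=> u0 H; apply: lime_le; first by apply: is_cvg_nneseries => k _ _; exact: u0.
by apply: nearW => N; rewrite big_mkord.
Qed.

Lemma separated_Bl (a : R) (l : seq 'rV[R]_n) z : separated (2 * a) l ->
  \sum_(x <- l) Bl x a z <= 1.
Proof.
elim: l => [|x l IH]; first by rewrite big_nil.
move=> /= /andP[xl sl]; rewrite big_cons /Bl.
have [zx|zx] := boolP (enorm (z - x) < a); last by rewrite add0r; exact: IH.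
rewrite big_seq big1 ?addr0// => y yl; rewrite (_ : (_ < a) = false)//.
apply/negbTE; rewrite -leNgt; have := allP xl y yl; have := enorm_tri x z y.
by rewrite (enorm_distC x z); move: zx => ? ? ?; lra.
Qed.
End hausdorff_lists.

(** * The Hardy inequality *)

Ltac posit := lazymatch goal with
  | |- is_true (0 < ?a * ?b) => apply: mulr_gt0; posit
  | |- is_true (0 < ?a - ?b) => first [assumption | rewrite subr_gt0]
  | |- is_true (0 < ?a + ?b) => apply: addr_gt0; posit
  | |- is_true (0 < ?a ^-1) => rewrite invr_gt0; posit
  | |- is_true (0 < ?a ^+ _) => apply: exprn_gt0; posit
  | |- is_true (0 < _ `^ _) => apply: powR_gt0; posit
  | |- is_true (0 < _.+1%:R) => exact: ltr0Sn
  | |- is_true (0 < _%:R) => rewrite ltr0n; by [assumption | done]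
  | |- is_true (0 < ?a) => first [assumption | solve [auto] | idtac]
  | |- forall _, _ => intro; posit
  | |- _ => idtac
  end.

Lemma sum_lb (R : realType) (T : eqType) (L : seq T) (f : T -> \bar R) (c : R) :
  (forall x, x \in L -> (c%:E <= f x)%E) -> (((size L)%:R * c)%:E <= \sum_(x <- L) f x)%E.
Proof.
elim: L => [|x L IH] H; first by rewrite big_nil mul0r.
rewrite big_cons (_ : ((size (x :: L))%:R * c)%:E = (c%:E + ((size L)%:R * c)%:E)%E); last first.
  by rewrite /= -natr1 mulrDl mul1r addrC EFinD.
apply: leeD; first by apply: H; rewrite mem_head.
by apply: IH => y yl; apply: H; rewrite inE yl orbT.
Qed.

Lemma half_pow (R : realType) (l : R) j : l / 2 ^+ j.+1 = l / 2 ^+ j / 2.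
Proof. by rewrite exprSr invfM mulrA. Qed.

Lemma half_pow_lt (R : realType) (l e : R) : 0 < e -> exists j : nat, l / 2 ^+ j < e.
Proof.
move=> e0; exists (Num.trunc (l / e)).+1; rewrite ltr_pdivrMr ?exprn_gt0// mulrC -ltr_pdivrMr//.
apply: (lt_trans (truncnS_gt _)); rewrite -natrX ltr_nat; exact: ltn_expl.
Qed.

Section hardy.
Context {R : realType} {n : nat}.
Variables d C0 : R.
Hypotheses (n0 : (0 < n)%N) (d0 : 0 < d) (dn : d < n%:R - 1) (C01 : 1 <= C0).
Local Notation X := (bT R n).
Local Notation mu := (@mu R n).
Implicit Types (v : 'rV[R]_n -> R) (G : 'rV[R]_n -> 'rV[R]_n).

(** The midpoint between max(0, 2 + d - n) and 1, an interval that is nonempty as d < n - 1. Above 2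
    + d - n the exponent [kappa] is positive; below 1 the sum over the layers in [hardy]
    converges. *)
Definition theta : R := (1 + Num.max 0 (2 + d - n%:R)) / 2.
Definition kappa : R := n%:R - 2 - d + theta.
(** A third of the gain 2^(-theta) per dyadic step. Two thirds go into the threshold [lam], which
    makes the increments of averages summable; the last third makes the measures of the bad sets
    summable. *)
Definition tq : R := 2 `^ (- (theta / 3)).

Lemma theta_lt1 : theta < 1.
Proof.
have : Num.max 0 (2 + d - n%:R) < 1 by rewrite gt_max ltr01/=; move: dn => ?; lra.
by rewrite /theta ltr_pdivrMr//; lra.
Qed.

Lemma theta_gt0 : 0 < theta.
Proof. by rewrite /theta divr_gt0// ltr_pwDl// le_max lexx. Qed.

Lemma kappa_gt0 : 0 < kappa.
Proof.
have h1 : 2 + d - n%:R <= Num.max 0 (2 + d - n%:R) by rewrite le_max lexx orbT.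
have h2 : Num.max 0 (2 + d - n%:R) < 1 by rewrite gt_max ltr01/=; move: dn => ?; lra.
suff : 2 + d - n%:R < theta by rewrite /kappa => ?; lra.
by rewrite /theta ltr_pdivlMr//; lra.
Qed.

Lemma tq_gt0 : 0 < tq. Proof. exact: powR_gt0. Qed.

Lemma tq_lt1 : tq < 1.
Proof. by apply: powR2_lt1; rewrite oppr_lt0 divr_gt0// theta_gt0. Qed.

Lemma tq3 : tq ^+ 3 = 2 `^ (- theta).
Proof. by rewrite -powR_mulrn ?powR_ge0// -powRrM mulNr divfK. Qed.

Definition net_cst : R := C0 * 8 `^ d * 4 `^ kappa.
(** Chosen so that all bad sets together have measure at most half of the lower Ahlfors bound
    C0^(-1) l^d. *)
Definition good_cst : R := 2 * net_cst * C0 / (1 - tq).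

Let C0p : 0 < C0. Proof. exact: lt_le_trans C01. Qed.

Lemma net_cst_gt0 : 0 < net_cst.
Proof. by rewrite !mulr_gt0// powR_gt0. Qed.

Lemma good_cst_gt0 : 0 < good_cst.
Proof. by rewrite divr_gt0 ?subr_gt0 ?tq_lt1// !mulr_gt0// net_cst_gt0. Qed.

Variable Gamma : set 'rV[R]_n.
Hypotheses (G0 : Gamma !=set0) (cG : closed Gamma) (AR : ahlfors_regular d C0 Gamma).
Local Notation delta := (dist Gamma).
Local Notation w := (weight d Gamma).

Section good_point.
Variables (v : 'rV[R]_n -> R) (G : 'rV[R]_n -> 'rV[R]_n) (N : set 'rV[R]_n) (z y : 'rV[R]_n)
  (l J : R).
Hypotheses (mG : forall i, mf (fun z => G z 0 i)) (GG : forall z, Gamma z -> G z = 0).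
Hypotheses (l0 : 0 < l) (J0 : 0 < J) (Gy : Gamma y) (zy : enorm (z - y) < 2 * l).
Hypothesis HJ : (II (fun a => Bl z (8 * l) a * (enorm (G a) ^+ 2 * delta a `^ (- kappa)))%R <=
  J%:E)%E.
Hypothesis HN : hausdorff d N = 0%E.

(** The energy tolerated in the ball of radius 4 l / 2^j. The power n - 2 is the scaling of
    [av_step_le], so that at a good point the averages at scales l / 2^j and l / 2^(j+1) differ by a
    multiple of [tq ^+ j]. *)
Definition lam (j : nat) : R :=
  (l / 2 ^+ j) `^ (n%:R - 2) * (good_cst * (tq ^+ j) ^+ 2 * l `^ (theta - d) * J).

Definition good xi := forall j : nat,
  (II (fun a => Bl xi (4 * (l / 2 ^+ j)) a * enorm (G a) ^+ 2)%R <= (lam j)%:E)%E.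

Let lj (j : nat) : 0 < l / 2 ^+ j. Proof. by rewrite divr_gt0// exprn_gt0. Qed.
Let ljl (j : nat) : l / 2 ^+ j <= l.
Proof. by rewrite ler_pdivrMr ?exprn_gt0// ler_peMr ?(ltW l0)// exprn_ege1// ler1n. Qed.

Lemma lam_gt0 j : 0 < lam j.
Proof.
have := tq_gt0; have := good_cst_gt0; have := lj j => ? ? ?.
by rewrite /lam; posit.
Qed.

Lemma mf_enormG : mf (fun a => enorm (G a)).
Proof.
rewrite (_ : (fun a => enorm (G a)) = fun a => (\sum_i G a 0 i ^+ 2) `^ 2^-1).
  by meas_auto.
apply/funext => a; rewrite -sqr_enorm_coord powR12_sqrt ?sqr_ge0//.
by rewrite sqrtr_sqr ger0_norm// enorm_ge0.
Qed.

Let bad j : set 'rV[R]_n := [set xi | [/\ Gamma xi, enorm (xi - y) < l &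
  ~ (II (fun a => Bl xi (4 * (l / 2 ^+ j)) a * enorm (G a) ^+ 2)%R <= (lam j)%:E)%E]].

(** The balls of radius 4 s around the points are disjoint, so their energies add up. On them delta
    <= 4 s, and [kappa > 0] turns this into a factor (4 s)^kappa against the weight in [HJ]. *)
Let bad_count j L : separated (8 * (l / 2 ^+ j)) L -> (forall xi, xi \in L -> bad j xi) ->
  (size L)%:R <= (4 * (l / 2 ^+ j)) `^ kappa * J / lam j.
Proof.
set s := l / 2 ^+ j => sL Lb; have s0 : 0 < s := lj j.
have mE := mf_enormG; have mB xi t := @mf_Bl R n xi t.
rewrite ler_pdivlMr ?lam_gt0// -lee_fin.
apply: (@le_trans _ _ (\sum_(xi <- L) II (fun a => Bl xi (4 * s) a * enorm (G a) ^+ 2)%R)%E).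
  apply: sum_lb => xi /Lb[_ _ /negP]; rewrite -ltNge; exact: ltW.
rewrite -II_sum; [|by move=> xi; meas_auto|by nonneg].
have mk : mf (fun a => Bl z (8 * l) a * (enorm (G a) ^+ 2 * delta a `^ (- kappa))) by meas_auto.
apply: le_trans (II_scale_le mk _ (powR_ge0 _ _) HJ); last by nonneg.
apply: II_le; [by meas_auto|by meas_auto|by nonneg|] => a.
have [Ga|Ga] := pselect (Gamma a).
  rewrite GG// enorm0 expr0n/= mul0r !mulr0 big1// => i _; exact: mulr0.
have da : 0 < delta a by exact: dist_gt0.
rewrite -mulr_suml; have [/hasP[xi xiL axi]|/hasPn nh] := boolP (has (fun xi => enorm (a - xi)
  < 4 * s) L).
  have [Gxi xiy _] := Lb xi xiL.
  (* 4 l + l + 2 l < 8 l: the radius of the ball, the distance of its centre to [y], and that of [y]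
     to [z]. *)
  have -> : Bl z (8 * l) a = 1.
    rewrite /Bl (_ : _ < _ = true)//; have := enorm_tri a xi z; have := enorm_tri xi y z.
    have := ljl j; rewrite -/s (enorm_distC y z); move: axi xiy zy l0 => ? ? ? ? ? ? ?; lra.
  rewrite mul1r; have := sqr_ge0 (enorm (G a)); move: (_ ^+ 2) => g g2.
  rewrite (mulrCA _ g) (mulrC _ g); apply: ler_wpM2l => //.
  rewrite (le_trans (separated_Bl a (a := 4 * s) _))//; first by rewrite mulrA -natrM.
  rewrite powRN -ler_pdivrMr ?invr_gt0 ?powR_gt0// invrK mul1r ge0_ler_powR ?nnegrE ?(ltW
    kappa_gt0)//.
  - exact: dist_ge0.
  - by rewrite mulr_ge0// ltW.
  - by rewrite (le_trans (dist_le G0 a Gxi))// ltW.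
rewrite big_seq big1 ?mul0r; first by nonneg.
by move=> xi xiL; rewrite /Bl (negbTE (nh xi xiL)).
Qed.

Let s_theta (j : nat) : (l / 2 ^+ j) `^ theta = l `^ theta * (tq ^+ j) ^+ 3.
Proof. by rewrite powR_dyadic// -exprM mulnC exprM tq3. Qed.

(** A maximal net of bad points covers the bad set by balls of radius 8 s. Since s^(kappa + d) =
    s^(n-2) s^theta, everything cancels against [lam] except the third part [tq ^+ j] of the
    gain. *)
Let bad_measure j : (hausdorff d (bad j) <= (net_cst / good_cst * l `^ d * tq ^+ j)%:E)%E.
Proof.
set s := l / 2 ^+ j; have s0 : 0 < s := lj j.
have [t0 g0] := (tq_gt0, good_cst_gt0).
pose b := (4 * s) `^ kappa * J / lam j.
have bE : b * (C0 * (8 * s) `^ d) = net_cst / good_cst * l `^ d * tq ^+ j.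
  rewrite /b /lam -/s /net_cst (powRM _ (ler0n R 4) (ltW s0)) (powRM _ (ler0n R 8) (ltW s0)).
  have e1 : s `^ kappa * s `^ d = s `^ (n%:R - 2) * (l `^ theta * (tq ^+ j) ^+ 3).
    by rewrite -s_theta -!powR_add//; congr (_ `^ _); rewrite /kappa; ring.
  have e2 : l `^ (theta - d) * l `^ d = l `^ theta by rewrite -powR_add// subrK.
  have p1 : 0 < s `^ (n%:R - 2) by exact: powR_gt0.
  have p2 : 0 < l `^ (theta - d) by exact: powR_gt0.
  have p3 : 0 < tq ^+ j by exact: exprn_gt0.
  move: e1 e2 p1 p2 p3; rewrite -[_ / good_cst]/(_ * _).
  set A := s `^ (n%:R - 2); set B := l `^ (theta - d); set T := tq ^+ j => e1 e2 p1 p2 p3.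
  transitivity (4 `^ kappa * C0 * 8 `^ d * J * (s `^ kappa * s `^ d)
    / (A * (good_cst * T ^+ 2 * B * J))); first by ring.
  rewrite e1 -e2; field; rewrite !gt_eqF//.
have Hb L : separated (8 * s) L -> (forall xi, xi \in L -> bad j xi) -> (size L)%:R <= b.
  exact: bad_count.
have [L [sL LS Lnet]] := @maximal_net R n (8 * s) (bad j) (Num.trunc b).+1 (fun L h1 h2 =>
  ltac:(by rewrite -(ler_nat R) (le_trans (Hb L h1 h2))// ltW// truncnS_gt)).
apply: (@le_trans _ _ (hausdorff d (\bigcup_(xi in [set` L]) (Gamma `&` eball xi (8 * s))))).
  apply: hausdorffS => xi [Gxi xy Hxi]; have [x xL xix] := Lnet xi (And3 Gxi xy Hxi).
  by exists x.
have s80 : 0 < 8 * s by rewrite mulr_gt0.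
apply: le_trans (hausdorff_seq d0 (b := C0 * (8 * s) `^ d) _) _.
  by move=> xi /LS[Gxi _ _]; exact: (AR Gxi s80).2.
by rewrite lee_fin -bE ler_wpM2r ?Hb// mulr_ge0 ?powR_ge0// ltW.
Qed.

(* The points where the energy is too large at scale [l / 2 ^ j] are covered by balls of a
   separated family; summing the energies bounds their measure by a small multiple of [l ^ d]
   times [tq ^ j]. *)
Lemma good_point_ex : exists xi, [/\ Gamma xi, enorm (xi - y) < l, ~ N xi & good xi].
Proof.
apply: contrapT => H.
have [t0 g0] := (tq_gt0, good_cst_gt0).
have sub : Gamma `&` eball y l `<=` N `|` \bigcup_j bad j.
  move=> xi [Gxi xy]; have [Nxi|Nxi] := pselect (N xi); first by left.
  right; apply: contrapT => nb; apply: H; exists xi; split => // j.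
  by apply: contrapT => hj; apply: nb; exists j.
have := le_trans (AR Gy l0).1 (hausdorffS d sub).
apply/negP; rewrite -ltNge; apply: le_lt_trans (hausdorffU d0 _ _) _; rewrite HN add0e.
have := hausdorff_bigcup d bad; move=> /le_lt_trans; apply.
apply: (@le_lt_trans _ _ (net_cst / good_cst * l `^ d * (1 - tq)^-1)%:E).
  apply: nneseries_le => [k|k]; first exact: hausdorff_ge0.
  apply: (@le_trans _ _ (\sum_(i < k) (net_cst / good_cst * l `^ d * tq ^+ i)%:E)%E).
    by apply: lee_sum => i _; exact: bad_measure.
  rewrite sumEFin lee_fin -mulr_sumr ler_wpM2l ?geo_sum_le ?(ltW t0) ?tq_lt1//.
  by have := net_cst_gt0 => ?; nonneg.
have p1 : 0 < 1 - tq by rewrite subr_gt0 tq_lt1.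
have p2 := net_cst_gt0.
rewrite lte_fin /good_cst (_ : _ * _ / _ = C0^-1 * l `^ d / 2); last by field; rewrite !gt_eqF.
have p3 : 0 < C0^-1 * l `^ d by posit.
by rewrite ltr_pdivrMr// ltr_pMr// ltr1n.
Qed.

Hypotheses (wg : WG v G) (M r : R) (vM : forall z, `|v z| <= M) (vr : forall z, r < enorm z ->
  v z = 0).

Definition trace0 xi := forall e : R, 0 < e -> exists2 s0, 0 < s0 & forall s, 0 < s -> s < s0 ->
  `|ballavg v xi s| <= e.

Definition avg_cst : R := @step_cst R n * good_cst / (1 - tq) ^+ 2.

Lemma step_cst_gt0 : 0 < @step_cst R n.
Proof. by rewrite /step_cst; posit. Qed.

(** Averages over halving balls telescope with increments at most [E * tq ^+ j]. Their limit is the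
    trace, namely 0, so the average at scale [l] is bounded by the sum of the geometric series. *)
Lemma avg_bound xi : good xi -> trace0 xi -> ballavg v xi l ^+ 2 <= avg_cst * (l `^ (theta - d)
  * J).
Proof.
move=> gxi txi; have [t0 g0] := (tq_gt0, good_cst_gt0); have s0 := step_cst_gt0.
have p1 : 0 < 1 - tq by rewrite subr_gt0 tq_lt1.
pose E := Num.sqrt (@step_cst R n * good_cst * (l `^ (theta - d) * J)).
have E0 : 0 <= E by exact: sqrtr_ge0.
have E2 : E ^+ 2 = @step_cst R n * good_cst * (l `^ (theta - d) * J).
  by rewrite sqr_sqrtr//; apply: ltW; posit.
have step j : `|ballavg v xi (l / 2 ^+ j.+1) - ballavg v xi (l / 2 ^+ j)| <= E * tq ^+ j.
  have := av_step_le n0 (lj j) wg vM vr (gxi j).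
  rewrite -half_pow => H.
  rewrite -(@ler_pXn2r _ 2)// ?nnegrE//; last by apply: mulr_ge0 => //; apply: exprn_ge0;
    exact: ltW.
  rewrite real_normK ?num_real// (le_trans H)// [X in _ <= X]exprMn E2 /lam.
  have sj := lj j; set s := l / 2 ^+ j in sj *.
  have e1 : s ^+ n = s `^ (n%:R - 2) * s ^+ 2.
    by rewrite -!powR_mulrn ?(ltW sj)// -powR_add// subrK.
  rewrite e1; have : 0 < s `^ (n%:R - 2) by exact: powR_gt0.
  move: (s `^ _) => A A0; apply: eq_ler; field; rewrite !gt_eqF//.
have tele j : `|ballavg v xi l - ballavg v xi (l / 2 ^+ j)| <= E / (1 - tq).
  rewrite (le_trans (_ : _ <= E * \sum_(i < j) tq ^+ i))//; last first.
    by rewrite ler_wpM2l// geo_sum_le ?tq_lt1// ltW.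
  elim: j => [|j IH]; first by rewrite expr0 divr1 subrr normr0 big_ord0 mulr0.
  rewrite big_ord_recr/= mulrDr (le_trans _ (lerD IH (step j)))//.
  by rewrite [X in _ <= _ + X]distrC ler_distD.
have A0 : `|ballavg v xi l| <= E / (1 - tq).
  apply/ler_addgt0Pr => e e0; have [s1 s10 Hs] := txi e e0.
  have [j hj] : exists j : nat, l / 2 ^+ j < s1.
    exact: half_pow_lt.
  have := Hs _ (lj j) hj; have := tele j.
  have := ler_normD (ballavg v xi l - ballavg v xi (l / 2 ^+ j)) (ballavg v xi (l / 2 ^+ j)).
  by rewrite subrK; lra.
rewrite -real_normK ?num_real// (le_trans (_ : _ <= (E / (1 - tq)) ^+ 2))//.
  by rewrite ler_sqr ?nnegrE// divr_ge0// ltW.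
by rewrite expr_div_n E2 /avg_cst; apply: eq_ler; field; rewrite gt_eqF.
Qed.

End good_point.

(** [v z] is compared with the average over the ball of radius [l] around a good point within 3 l of
    [z]: the average is bounded by [avg_bound], the difference by increments of length below 4 l. *)
Lemma layer_pt v G (z : 'rV[R]_n) (l M r : R) : (forall z, Gamma z -> G z = 0) -> WG v G ->
  (forall z, `|v z| <= M) -> (forall z, r < enorm z -> v z = 0) ->
  hausdorff d [set xi | Gamma xi /\ ~ trace0 v xi] = 0%E -> 0 < l -> delta z <= l ->
  ((v z ^+ 2)%:E <= (2 * avg_cst * l `^ (theta - d))%:E *
       II (fun a => Bl z (8 * l) a * (enorm (G a) ^+ 2 * delta a `^ (- kappa)))%R +
     (2 / @ball_vol R n l)%:E * II (fun h => Bl 0%R (4 * l) h * (v (z + h) - v z) ^+ 2)%R)%E.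
Proof.
move=> GG wg vM vr HN l0 zl; have [Iv IG _] := wg; have mv := Iable_mf Iv.
have mG i : mf (fun z => G z 0 i) by exact: Iable_mf.
have b0 := @ball_vol_gt0 R n n0 l l0.
have c0 : 0 < avg_cst.
  have [t0 g0] := (tq_gt0, good_cst_gt0); have s0 := step_cst_gt0.
  by rewrite /avg_cst; posit; rewrite tq_lt1.
set J := II _; set D := II (fun h => _).
have J0 : (0 <= J)%E by apply: II_ge0 => a; nonneg.
have D0 : (0 <= D)%E by apply: II_ge0 => a; nonneg.
have k1 : (0 < (2 * avg_cst * l `^ (theta - d))%:E)%E by rewrite lte_fin; posit.
have k2 : (0 < (2 / @ball_vol R n l)%:E)%E by rewrite lte_fin; posit.
have [Joo|] := ltP J +oo%E; last first.
  by rewrite leye_eq => /eqP ->; rewrite gt0_muley// addye ?leey// gt_eqF// (lt_le_trans ltNy0)//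
    mule_ge0// ltW.
have [Doo|] := ltP D +oo%E; last first.
  by rewrite leye_eq => /eqP ->; rewrite gt0_muley// addey ?leey// gt_eqF// (lt_le_trans ltNy0)//
    mule_ge0// ltW.
have JE : J = (fine J)%:E by rewrite fineK// ge0_fin_numE.
have DE : D = (fine D)%:E by rewrite fineK// ge0_fin_numE.
rewrite JE DE -!EFinM -EFinD lee_fin; apply/ler_addgt0Pr => e e0.
(* The energy is enlarged because [good_point_ex] asks for a positive bound; the surplus is worth
   exactly [e] in the result. *)
pose b := fine J + e / (2 * avg_cst * l `^ (theta - d)).
have q0 : 0 < 2 * avg_cst * l `^ (theta - d) by move: k1; rewrite lte_fin.
have bp : 0 < b by rewrite ltr_wpDl ?fine_ge0// divr_gt0.
have Jb : (J <= b%:E)%E by rewrite JE lee_fin lerDl divr_ge0// ltW.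
have [y Gy zy] : exists2 y, Gamma y & enorm (z - y) < 2 * l.
  by apply: dist_lt => //; rewrite (le_lt_trans zl)// ltr_pMl// ltr1n.
have [xi [Gxi xiy Nxi gxi]] := good_point_ex mG GG l0 bp Gy zy Jb HN.
have txi : trace0 v xi by apply: contrapT => h; apply: Nxi.
have h1 := avg_bound l0 bp wg vM vr gxi txi.
have h2 : @ball_vol R n l * (v z - ballavg v xi l) ^+ 2 <= fine D.
  rewrite -lee_fin -DE; apply: osc_pt vM _ => // a axi.
  have := enorm_tri a xi z; have := enorm_tri xi y z; rewrite (enorm_distC y z).
  by move: axi zy xiy => ? ? ?; lra.
have h3 : (v z - ballavg v xi l) ^+ 2 <= fine D / @ball_vol R n l by rewrite ler_pdivlMr// mulrC.
have h4 : v z ^+ 2 <= 2 * ballavg v xi l ^+ 2 + 2 * (v z - ballavg v xi l) ^+ 2.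
  by have := sqr_ge0 (v z - 2 * ballavg v xi l); lra.
apply: (le_trans h4).
have -> : 2 * avg_cst * l `^ (theta - d) * fine J + 2 / @ball_vol R n l * fine D + e =
   2 * (avg_cst * (l `^ (theta - d) * b)) + 2 * (fine D / @ball_vol R n l).
  have qp : 0 < l `^ (theta - d) by exact: powR_gt0.
  by rewrite /b; field; rewrite !gt_eqF.
by rewrite lerD// ler_wpM2l.
Qed.

Lemma avg_cst_gt0 : 0 < avg_cst.
Proof.
have [t0 g0] := (tq_gt0, good_cst_gt0); have s0 := step_cst_gt0.
by rewrite /avg_cst; posit; rewrite tq_lt1.
Qed.

Definition layer_cst : R := 2 * avg_cst * 16 ^+ n + 32 * n%:R * 10 `^ kappa * (4 * n%:R) ^+ n.

Lemma layer_cst_gt0 : 0 < layer_cst.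
Proof. by have := avg_cst_gt0 => ?; rewrite /layer_cst; posit. Qed.

Lemma Bl_sym (x y : 'rV[R]_n) s : Bl x s y = Bl y s x.
Proof. by rewrite /Bl enorm_distC. Qed.

(** [layer_pt] integrated over the layer. By Fubini its first term costs the volume of a ball of
    radius 8 l; the second is the translation estimate for |h| < 4 l. Both scale like l^(n-d+theta),
    since n - d + theta = 2 + kappa. *)
Lemma hardy_layer v G (l M r P : R) : (forall z, Gamma z -> G z = 0) -> WG v G ->
  (forall z, `|v z| <= M) -> (forall z, r < enorm z -> v z = 0) ->
  hausdorff d [set xi | Gamma xi /\ ~ trace0 v xi] = 0%E -> 0 < l ->
  (II (fun a => (delta a < 10 * l)%R%:R * (enorm (G a) ^+ 2 * delta a `^ (- kappa)))%R <= P%:E)%E ->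
  (II (fun z => (l / 2 < delta z <= l)%R%:R * v z ^+ 2)%R <= (layer_cst * l `^ (n%:R - d + theta)
    * P)%:E)%E.
Proof.
move=> GG wg vM vr HN l0 HP; have [Iv IG _] := wg; have mv := Iable_mf Iv.
have mG i : mf (fun z => G z 0 i) by exact: Iable_mf.
have mE := mf_enormG mG; have b0 := @ball_vol_gt0 R n n0 l l0; have c0 := avg_cst_gt0.
have mB (x : 'rV[R]_n) t := @mf_Bl R n x t.
pose L z : R := (l / 2 < delta z <= l)%R%:R.
have mL : mf L by exact: mf_layer.
have L0 z : 0 <= L z by exact: ler0n.
have md := mf_dist G0.
pose g a := enorm (G a) ^+ 2 * delta a `^ (- kappa).
have mg : mf g by rewrite /g; meas_auto.
have g0 a : 0 <= g a by rewrite /g; nonneg.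
have P0 : 0 <= P by rewrite -lee_fin; apply: le_trans HP; apply: II_ge0 => a; nonneg.
pose c1 := 2 * avg_cst * l `^ (theta - d).
pose c2 := 2 / @ball_vol R n l.
have c10 : 0 <= c1 by apply: ltW; rewrite /c1; posit.
have c20 : 0 <= c2 by apply: ltW; rewrite /c2; posit.
pose D a : R := (delta a < 10 * l)%R%:R.
have mD : mf D by rewrite /D; meas_auto.
have D0 a : 0 <= D a by exact: ler0n.
have l8 : 0 <= 8 * l by rewrite mulr_ge0// ltW.
have l4 : 0 <= 4 * l by rewrite mulr_ge0// ltW.
have l10 : 0 <= 10 * l by rewrite mulr_ge0// ltW.
pose Q := (10 * l) `^ kappa * P.
have Q0 : 0 <= Q by rewrite /Q; nonneg.
have HQ : (II (fun a => D a * enorm (G a) ^+ 2)%R <= Q%:E)%E.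
  apply: (@le_trans _ _ (II (fun a => (10 * l) `^ kappa * (D a * g a))%R)).
    apply: II_le; [by meas_auto|by meas_auto|by nonneg|] => a.
    have [Ga|Ga] := pselect (Gamma a); first by rewrite GG// enorm0 expr0n/= mulr0; nonneg.
    have da : 0 < delta a by exact: dist_gt0.
    rewrite /D; have [al|_] := ltP (delta a) (10 * l); last by rewrite !mul0r mulr0.
    rewrite /g; have := sqr_ge0 (enorm (G a)); move: (_ ^+ 2) => u u0.
    rewrite !mul1r mulrCA ler_peMr// powRN ler_pdivlMr ?powR_gt0// mul1r.
    by rewrite ge0_ler_powR ?nnegrE ?(ltW kappa_gt0) ?(ltW al)// ltW.
  apply: II_scale_le => //; [by meas_auto|by nonneg|exact: powR_ge0].
pose F z y := c1 * (L z * (Bl z (8 * l) y * g y)) + c2 * (L z * (Bl 0 (4 * l) y * (v (z + y)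
  - v z) ^+ 2)).
pose B y := c1 * (@ball_vol R n (8 * l) * (D y * g y)) + c2 * (n%:R * (4 * l) ^+ 2 * Q)
  * Bl 0 (4 * l) y.
have bm8 : 0 <= @ball_vol R n (8 * l) by apply/ltW/ball_vol_gt0 => //; rewrite mulr_gt0.
have bm4 : 0 <= @ball_vol R n (4 * l) by apply/ltW/ball_vol_gt0 => //; rewrite mulr_gt0.
have HB : (II B <= (c1 * (@ball_vol R n (8 * l) * P) + c2 * (n%:R * (4 * l) ^+ 2 * Q)
  * @ball_vol R n (4 * l))%:E)%E.
  rewrite /B II_add; [|by meas_auto|by meas_auto|by nonneg|by nonneg]; rewrite EFinD; apply: leeD.
    apply: II_scale_le; [by meas_auto|by nonneg|by nonneg|].
    by apply: II_scale_le; [by meas_auto|by nonneg|by nonneg|exact: HP].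
  by apply: II_scale_le; [by meas_auto|by nonneg|by nonneg|rewrite II_Bl].
have num : c1 * (@ball_vol R n (8 * l) * P) + c2 * (n%:R * (4 * l) ^+ 2 * Q)
  * @ball_vol R n (4 * l) <=
    layer_cst * l `^ (n%:R - d + theta) * P.
  have N0 : 0 < n%:R :> R by rewrite ltr0n.
  have e1 : l `^ (n%:R - d + theta) = l `^ (theta - d) * l ^+ n.
    by rewrite -powR_mulrn ?(ltW l0)// -powR_add//; congr (_ `^ _); ring.
  have e2 : l `^ (n%:R - d + theta) = l ^+ 2 * l `^ kappa.
    by rewrite -powR_mulrn ?(ltW l0)// -powR_add//; congr (_ `^ _); rewrite /kappa; ring.
  rewrite /layer_cst (mulrDl _ _ (l `^ _)) (mulrDl _ _ P); apply: lerD.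
    rewrite e1 /c1 (_ : _ * _ * (_ * _) * P = 2 * avg_cst * l `^ (theta - d) * ((2 * (8 * l))
      ^+ n * P)).
      by apply: ler_wpM2l => //; apply: ler_wpM2r => //; exact: ball_vol_le.
    by rewrite (_ : 2 * (8 * l) = 16 * l) ?exprMn; ring.
  have b1 := ball_vol_ge n0 (ltW l0); have b4 := @ball_vol_le R n _ l4.
  have q1 : 0 < (2 * (l / n%:R)) ^+ n by posit; rewrite ltr0n.
  apply: (@le_trans _ _ (2 / (2 * (l / n%:R)) ^+ n * (n%:R * (4 * l) ^+ 2 * Q) * (2 * (4 * l))
    ^+ n)).
    apply: ler_pM => //; first by nonneg.
    by apply: ler_wpM2r; [by nonneg|rewrite /c2 ler_wpM2l// lef_pV2].
  rewrite e2 /Q powRM ?(ltW l0)// -exprVn (_ : (2 * (l / n%:R))^-1 = n%:R * (2 * l)^-1); last first.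
    by field; rewrite !gt_eqF.
  rewrite (_ : (4 * n%:R) ^+ n = (n%:R / (2 * l)) ^+ n * (2 * (4 * l)) ^+ n).
    by apply: eq_ler; ring.
  by rewrite -exprMn; congr (_ ^+ _); field; rewrite gt_eqF.
apply: le_trans (le_trans HB _); last by rewrite lee_fin.
apply: (@II_le_fubini _ _ _ _ F).
- by meas_auto.
- by rewrite /B; meas_auto.
- rewrite /F; apply: mf2D.
    apply: (@mf2M _ _ (fun _ _ => c1)); first exact: (mf2_fst (mfC _)).
    apply: mf2M; first exact: mf2_fst.
    apply: mf2M; last exact: mf2_snd.
    have := mf2_sub (mB 0 (8 * l)); congr mf2; apply/funext => x; apply/funext => y.
    by rewrite /Bl subr0.
  apply: (@mf2M _ _ (fun _ _ => c2)); first exact: (mf2_fst (mfC _)).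
  apply: mf2M; first exact: mf2_fst.
  apply: mf2M; first exact: (mf2_snd (mB 0 (4 * l))).
  apply: mf2X; apply: mf2D; first exact: mf2_add.
  by apply: mf2N; exact: mf2_fst.
- by nonneg.
- by move=> y; rewrite /B; nonneg.
- by move=> z y; rewrite /F; nonneg.
- move=> z; rewrite -/(L z).
  have mvz : mf (fun h => v (z + h)).
    by have := mf_shift z mv; congr mf; apply/funext => h; rewrite addrC.
  rewrite /F II_add; [|by meas_auto|by meas_auto|by nonneg|by nonneg].
  rewrite II_scale; [|by meas_auto|by nonneg|by nonneg].
  rewrite II_scale; [|by meas_auto|by nonneg|by nonneg].
  rewrite II_scale; [|by meas_auto|by nonneg|by nonneg].
  rewrite II_scale; [|by meas_auto|by nonneg|by nonneg].
  rewrite /L; have [/andP[_ zl]|_] := boolP (_ < _ <= _); last first.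
    by rewrite !mul0e !mule0 adde0 mul0r.
  rewrite mul1r !mul1e; exact: layer_pt GG wg vM vr HN l0 zl.
- move=> y; rewrite /F /B EFinD.
  have mvy : mf (fun z => v (z + y)) by exact: mf_shift.
  have mBy : mf (fun z => Bl z (8 * l) y).
    by have := mB y (8 * l); congr mf; apply/funext => z; rewrite Bl_sym.
  rewrite II_add; [|by meas_auto|by meas_auto|by nonneg|by nonneg].
  apply: leeD.
    apply: II_scale_le; [by meas_auto|by nonneg|by nonneg|].
    have [yl|yl] := ltP (delta y) (10 * l).
      rewrite /D yl mul1r (mulrC (@ball_vol R n (8 * l))); apply: (@le_trans _ _ (II (fun z => g y
        * Bl y (8 * l) z)%R)).
        apply: II_le; [by meas_auto|by meas_auto|by nonneg|] => z.
        rewrite Bl_sym (mulrC (Bl y (8 * l) z)); apply: ler_piMl; first by nonneg.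
        by rewrite /L; case: (_ && _).
      by apply: II_scale_le; [by meas_auto|by nonneg|by nonneg|rewrite II_Bl].
    rewrite (_ : (fun z => _) = fun=> 0).
      by rewrite /II integral0 lee_fin; nonneg.
    apply/funext => z; rewrite /L; have [/andP[_ zl]|_] := boolP (_ < _ <= _);
      last by rewrite mul0r.
    rewrite /Bl (_ : _ < _ = false) ?mul0r ?mulr0//; apply/negbTE; rewrite -leNgt.
    by have := dist_lip G0 y z; move: yl zl l0 => ? ? ?; lra.
  rewrite -mulrA; apply: II_scale_le; [by meas_auto|by nonneg|by nonneg|].
  have [yl|yl] := boolP (enorm (y - 0) < 4 * l); last first.
    rewrite /Bl (negbTE yl) mulr0 (_ : (fun z => _) = fun=> 0); first by rewrite /II integral0.
    by apply/funext => z; rewrite mul0r mulr0.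
  have -> : Bl 0 (4 * l) y = 1 by rewrite /Bl yl.
  rewrite mulr1; under II_eq do rewrite mul1r.
  rewrite subr0 in yl.
  (* Margins: delta <= l on the layer, below 6 l after a shift by less than 4 l, below 10 l after
     mollification at a scale below [l]. *)
  pose k1 a : R := (delta a < 6 * l)%R%:R.
  have mk1 : mf k1 by rewrite /k1; meas_auto.
  apply: (@le_trans _ _ (n%:R * enorm y ^+ 2 * Q)%:E); last first.
    by rewrite lee_fin ler_wpM2r// ler_wpM2l ?ler0n// ler_sqr ?nnegrE ?enorm_ge0//; exact: ltW.
  apply: (wg_translation (K := 1) n0 wg vM vr l0 mL mk1 mD _ _ _ _ _ HQ).
  + by move=> z; rewrite L0/= /L; case: (_ && _).
  + by move=> z; exact: ler0n.
  + by [].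
  + move=> z a az; rewrite /L; have [/andP[_ zl]|_] := boolP (_ < _ <= _); last exact: ler0n.
    rewrite /k1 (_ : _ < _ = true)//; have := dist_lip G0 a z.
    by move: az yl zl => ? ? ?; lra.
  + move=> z a al; rewrite /k1; have [zl|_] := boolP (_ < 6 * l); last exact: ler0n.
    rewrite /D (_ : (_ < 10 * l) = true)//; have := dist_lip G0 (a + z) z.
    by rewrite addrK; move: al zl l0 => ? ? ?; lra.
Qed.

Definition hardy_cst : R :=
  2 `^ (n%:R + 1 - d) * layer_cst * (2 `^ (1 - theta) / (2 `^ (1 - theta) - 1) * 10 `^ (1 - theta)).

Lemma hardy_cst_gt0 : 0 < hardy_cst.
Proof.
have := layer_cst_gt0 => ?; have h : 0 < 1 - theta by rewrite subr_gt0 theta_lt1.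
by rewrite /hardy_cst; posit; rewrite powR2_gt1.
Qed.

(** On the layer at scale s the weight delta^(d-1-n) is of order s^(d-1-n), while [hardy_layer]
    yields s^(n-d+theta); a factor s^(-(1-theta)) remains on delta < 10 s. Summed over the scales by
    [dyadic_sum] it becomes delta^(-(1-theta)), which completes delta^(-kappa) to [w]. *)
Lemma hardy v G (l M r b : R) : (forall z, Gamma z -> G z = 0) -> WG v G ->
  (forall z, `|v z| <= M) -> (forall z, r < enorm z -> v z = 0) -> 0 < l ->
  (forall z, v z != 0 -> delta z <= l) ->
  hausdorff d [set xi | Gamma xi /\ ~ trace0 v xi] = 0%E ->
  (II (fun z => enorm (G z) ^+ 2 * w z)%R <= b%:E)%E ->
  (II (fun z => v z ^+ 2 * delta z `^ (d - 1 - n%:R))%R <= (hardy_cst * b)%:E)%E.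
Proof.
move=> GG wg vM vr l0 vl HN Hb; have [Iv IG _] := wg; have mv := Iable_mf Iv.
have mG i : mf (fun z => G z 0 i) by exact: Iable_mf.
have mE := mf_enormG mG; have md := mf_dist G0; have mw := mf_weight d G0.
have lc := layer_cst_gt0; have h1 : 0 < 1 - theta by rewrite subr_gt0 theta_lt1.
have h2 := powR2_gt1 h1; have h3 : 0 < 2 `^ (1 - theta) - 1 by rewrite subr_gt0.
pose g a := enorm (G a) ^+ 2 * delta a `^ (- kappa).
have mg : mf g by rewrite /g; meas_auto.
have g0 a : 0 <= g a by rewrite /g; nonneg.
have gw a : g a * delta a `^ (- (1 - theta)) = enorm (G a) ^+ 2 * w a.
  have [Ga|Ga] := pselect (Gamma a); first by rewrite /g GG// enorm0 expr0n/= !mul0r.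
  have da : 0 < delta a by exact: dist_gt0.
  by rewrite /g /weight -mulrA -powR_add//; congr (_ * _ `^ _); rewrite /kappa; ring.
apply: (II_dyadic G0 l0); [by meas_auto|by nonneg| |].
  move=> z; rewrite mulf_eq0 negb_or => /andP[vz dz]; apply/andP; split; last first.
    by apply: vl; apply: contraNneq vz => ->; rewrite expr0n.
  rewrite lt0r dist_ge0// andbT; apply: contraNneq dz => ->.
  by rewrite powR0//; apply/eqP; move: dn => ? ?; lra.
move=> N.
pose q i z := (0 < delta z < 10 * (l / 2 ^+ i))%R%:R * g z.
have mq i : mf (q i) by rewrite /q; meas_auto.
have q0 i z : 0 <= q i z by rewrite /q; nonneg.
have li i : 0 < l / 2 ^+ i by rewrite divr_gt0// exprn_gt0.
(* Each layer energy is finite because delta^(1-theta) is bounded there; [hardy_layer] takes a real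
   bound. *)
have qfin i : II (q i) = (fine (II (q i)))%:E.
  rewrite fineK// ge0_fin_numE ?II_ge0//.
  apply: (@le_lt_trans _ _ ((10 * (l / 2 ^+ i)) `^ (1 - theta) * b)%:E); last exact: ltry.
  apply: (@le_trans _ _ (II (fun a => (10 * (l / 2 ^+ i)) `^ (1 - theta) * (enorm (G a)
    ^+ 2 * w a))%R)).
    apply: II_le; [by []|by meas_auto|by []|] => a; rewrite -gw /q.
    have [/andP[a0 al]|_] := boolP (_ < _ < _); last by rewrite mul0r; nonneg.
    rewrite mul1r mulrCA ler_peMr// powRN ler_pdivlMr ?powR_gt0// mul1r.
    rewrite ge0_ler_powR ?nnegrE ?(ltW h1) ?(ltW al)//; first exact: ltW.
    by rewrite mulr_ge0// ltW.
  by apply: II_scale_le; [by meas_auto|by nonneg|exact: powR_ge0|].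
pose c := 2 `^ (n%:R + 1 - d) * layer_cst.
have c0 : 0 <= c by rewrite /c mulr_ge0 ?powR_ge0// ltW.
apply: (@le_trans _ _ (\sum_(i < N) II (fun z => c * ((l / 2 ^+ i) `^ (- (1 - theta))
  * q i z))%R)%E).
  apply: lee_sum => i _; have lp := li i; set s := l / 2 ^+ i in lp *.
  rewrite half_pow -/s.
  pose L z : R := (s / 2 < delta z <= s)%R%:R.
  have mL : mf L by exact: mf_layer.
  apply: (@le_trans _ _ (II (fun z => (s / 2) `^ (d - 1 - n%:R) * (L z * v z ^+ 2))%R)).
    apply: II_le; [apply: mfM; [by meas_auto|exact: mf_layer]|by meas_auto|by nonneg|] => z;
      rewrite /L.
    have [/andP[zs _]|_] := boolP (_ < _ <= _); last by rewrite mulr0 mul0r mulr0.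
    rewrite mulr1 mul1r mulrC ler_wpM2r ?sqr_ge0//; apply: powR_anti;
      [by rewrite divr_gt0|exact: ltW|].
    by move: dn => ?; lra.
  have HP : (II (fun a => (delta a < 10 * s)%R%:R * (enorm (G a)
    ^+ 2 * delta a `^ (- kappa)))%R <= (fine (II (q i)))%:E)%E.
    rewrite -qfin le_eqVlt; apply/orP; left; apply/eqP; apply: II_eq => a; rewrite /q -/s -/(g a).
    have [Ga|Ga] := pselect (Gamma a); first by rewrite /g GG// enorm0 expr0n/= mul0r !mulr0.
    by rewrite (dist_gt0 G0 cG Ga).
  have HL := hardy_layer GG wg vM vr HN lp HP.
  apply: (@le_trans _ _ ((s / 2) `^ (d - 1 - n%:R) * (layer_cst * s `^ (n%:R - d + theta)
    * fine (II (q i))))%:E).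
    by apply: II_scale_le; [by meas_auto|by nonneg|exact: powR_ge0|].
  rewrite II_scale; [|by meas_auto|by nonneg|by nonneg].
  rewrite II_scale; [|by meas_auto|by nonneg|by nonneg].
  rewrite qfin -!EFinM lee_fin /c powRM ?invr_ge0 ?(ltW lp)// powRV// -powRN.
  rewrite (_ : - (d - 1 - n%:R) = n%:R + 1 - d); last by ring.
  have e : s `^ (- (1 - theta)) = s `^ (d - 1 - n%:R) * s `^ (n%:R - d + theta).
    by rewrite -powR_add//; congr (_ `^ _); ring.
  by rewrite e; apply: eq_ler; ring.
rewrite -(@II_sum _ _ _ _ (fun (i : 'I_N) z => c * ((l / 2 ^+ i) `^ (- (1 - theta)) * q i z)))//;
  last 2 first.
- by move=> i; meas_auto.
- by move=> i z; nonneg.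
pose e := c * (2 `^ (1 - theta) / (2 `^ (1 - theta) - 1) * 10 `^ (1 - theta)).
apply: (@le_trans _ _ (II (fun a => e * (enorm (G a) ^+ 2 * w a))%R)).
  have ten : 0 < 10 :> R by [].
  apply: II_le; [apply: mf_sum => i; by meas_auto|by meas_auto|by move=> z;
    apply: sumr_ge0 => i _; nonneg|] => z.
  rewrite -gw -mulr_sumr /e -mulrA; apply: ler_wpM2l => //.
  have := ler_wpM2r (g0 z) (dyadic_sum Gamma N z h1 ten l0).
  rewrite mulr_suml => H; rewrite (mulrC (g z)) mulrA (le_trans _ H)//.
  by apply: ler_sum => i _; rewrite /q mulrA.
have e0 : 0 <= e by rewrite /e mulr_ge0// !mulr_ge0 ?powR_ge0// invr_ge0 ltW.
have -> : hardy_cst = e by rewrite /hardy_cst /e /c.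
by clearbody e; apply: II_scale_le; [by meas_auto|by nonneg| |].
Qed.

End hardy.

(** * The Faber-Krahn inequality *)

Section faber_krahn.
Context {R : realType} {n : nat}.
Variables d C0 : R.
Hypotheses (n0 : (0 < n)%N) (d0 : 0 < d) (dn : d < n%:R - 1) (C01 : 1 <= C0).
Local Notation X := (bT R n).
Local Notation mu := (@mu R n).
Variable Gamma : set 'rV[R]_n.
Hypotheses (G0 : Gamma !=set0) (cG : closed Gamma) (AR : ahlfors_regular d C0 Gamma).
Implicit Types (v : 'rV[R]_n -> R) (G : 'rV[R]_n -> 'rV[R]_n).
Local Notation delta := (dist Gamma).
Local Notation w := (weight d Gamma).
Local Notation hardy_cst := (@hardy_cst R n d C0).

Lemma weight_double z y : 0 < delta z -> delta y <= 2 * delta z -> 0 < delta y ->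
  w z <= 2 `^ (n%:R - 1 - d) * w y.
Proof.
move=> z0 yz y0; have p0 : d + 1 - n%:R <= 0 by move: dn => ?; lra.
have := powR_anti y0 yz p0; rewrite powRM ?(ltW z0)// => h.
rewrite /weight (_ : n%:R - 1 - d = - (d + 1 - n%:R)); last by ring.
by rewrite powRN mulrC ler_pdivlMr ?powR_gt0// mulrC.
Qed.

Lemma weight_near z y e : 0 < e -> 2 * e <= delta z -> enorm (y - z) <= e ->
  w z <= 2 `^ (n%:R - 1 - d) * w y /\ delta z - e <= delta y.
Proof.
move=> e0 ez yz; have h1 := dist_lip G0 z y; have h2 := dist_lip G0 y z.
rewrite enorm_distC in h1; split; last by lra.
by apply: weight_double; lra.
Qed.

Lemma dist_near z y e : 0 < e -> 4 * e <= delta z -> enorm (y - z) <= e -> 2 * e <= delta y.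
Proof. by move=> e0 ez yz; have h1 := dist_lip G0 z y; rewrite enorm_distC in h1; lra. Qed.

(** The front factors are those of L^2 as a function of [m]; the two summands belong to the region
    near [Gamma], by Hardy with (4 L)^2, and to the region away from it. *)
Definition fk_cst : R :=
  (n%:R / 2) ^+ 2 * 2 `^ (2 / n%:R) * (16 * hardy_cst + 2 * n%:R * 4 `^ (n%:R - 1 - d)).

Lemma fk_cst_gt0 : 0 < fk_cst.
Proof.
have N0 : 0 < n%:R :> R by rewrite ltr0n.
have hc : 0 < hardy_cst by exact: hardy_cst_gt0.
by rewrite /fk_cst; posit.
Qed.

(** At least half of the ball of radius [L] around [z] lies where [v] vanishes, and there the
    increment is [v z] up to sign. *)
Lemma half_zero v z (L m : R) : mf v -> 0 < L -> 0 <= m -> (mu [set a | (v a != 0)%R] <= m%:E)%E -> 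
  2 * m <= @ball_vol R n L ->
  ((v z ^+ 2 * (@ball_vol R n L / 2))%:E <= II (fun h => Bl 0%R L h * (v (z + h) - v z) ^+ 2)%R)%E.
Proof.
move=> mv L0 m0 Hm mL; have mB (x : 'rV[R]_n) t := @mf_Bl R n x t.
have mvz : mf (fun h => v (z + h)).
  by have := mf_shift z mv; congr mf; apply/funext => h; rewrite addrC.
have mN : measurable [set a : X | v a != 0] by exact: mf_setneq0.
pose N a : R := (v a != 0)%:R.
have mfN : mf N by exact: mf_bool.
have mNz : mf (fun h => N (z + h)).
  by have := mf_shift z mfN; congr mf; apply/funext => h; rewrite addrC.
have IN : (II (fun h => N (z + h)%R) <= m%:E)%E.
  apply: le_trans Hm; rewrite -(II_bool mN) -/N -(II_shift z mfN) ?le_eqVlt; last by move=> a;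
    exact: ler0n.
  by apply/orP; left; apply/eqP; apply: II_eq => h; rewrite addrC.
have N0 a : 0 <= N a by exact: ler0n.
have H : ((v z ^+ 2 * @ball_vol R n L)%:E <= II (fun h => Bl 0%R L h * (v (z + h) - v z)
  ^+ 2)%R + (v z ^+ 2 * m)%:E)%E.
  rewrite EFinM -(II_Bl (0 : 'rV[R]_n) (ltW L0)) -II_scale; [|exact: mB|by []|exact: sqr_ge0].
  apply: (@le_trans _ _ (II (fun h => Bl 0 L h * (v (z + h) - v z) ^+ 2 + v z ^+ 2 * N (z + h))%R)).
    apply: II_le; [by meas_auto|by meas_auto|by nonneg|] => h.
    rewrite /N; have [->|_] /= := eqVneq (v (z + h)) 0; first by rewrite sub0r sqrrN mulr0 addr0
      mulrC.
    rewrite mulr1 (le_trans (_ : _ <= v z ^+ 2))// ?lerDr; last by nonneg.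
    by rewrite ler_piMr ?sqr_ge0// Bl_le1.
  rewrite II_add; [|by meas_auto|by meas_auto|by nonneg|by nonneg].
  by apply: leeD => //; apply: II_scale_le; [by meas_auto|by nonneg|exact: sqr_ge0|].
have [Doo|] := ltP (II (fun h => Bl 0 L h * (v (z + h) - v z) ^+ 2)) +oo%E; last first.
  by rewrite leye_eq => /eqP ->; rewrite leey.
have DE : II (fun h => Bl 0 L h * (v (z + h) - v z) ^+ 2) = (fine (II (fun h => Bl 0 L h * (v (z +
  h) - v z) ^+ 2)))%:E.
  by rewrite fineK// ge0_fin_numE ?II_ge0//; nonneg.
move: H; rewrite DE -EFinD !lee_fin => H.
by have := sqr_ge0 (v z) => h; nra.
Qed.

(** The length [L] is that of a ball of volume at least 2 m. Where delta < 4 L, w = delta^2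
    delta^(d-1-n) and Hardy supplies the factor L^2; where delta >= 4 L the weight varies by bounded
    factors at scale [L], and [half_zero] reduces the claim to translations. *)
Lemma faber_krahn v G (l M r b m : R) : (forall z, Gamma z -> G z = 0) -> WG v G ->
  (forall z, `|v z| <= M) -> (forall z, r < enorm z -> v z = 0) -> 0 < l ->
  (forall z, v z != 0 -> delta z <= l) ->
  hausdorff d [set xi | Gamma xi /\ ~ trace0 v xi] = 0%E ->
  (II (fun z => enorm (G z) ^+ 2 * w z)%R <= b%:E)%E ->
  0 < m -> (mu [set z | (v z != 0)%R] <= m%:E)%E ->
  (II (fun z => v z ^+ 2 * w z)%R <= (fk_cst * m `^ (2 / n%:R) * b)%:E)%E.
Proof.
move=> GG wg vM vr l0 vl HN Hb m0 Hm; have [Iv IG _] := wg; have mv := Iable_mf Iv.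
have mG i : mf (fun z => G z 0 i) by exact: Iable_mf.
have mE := mf_enormG mG; have md := mf_dist G0; have mw := mf_weight d G0.
have mB (x : 'rV[R]_n) t := @mf_Bl R n x t.
have N0 : 0 < n%:R :> R by rewrite ltr0n.
have b0 : 0 <= b by rewrite -lee_fin; apply: le_trans Hb; apply: II_ge0 => z; nonneg.
(* The cube of side 2 L / n contained in the ball of radius [L] has volume exactly 2 m. *)
pose L := n%:R / 2 * (2 * m) `^ (n%:R^-1).
have m20 : 0 < 2 * m by rewrite mulr_gt0.
have L0 : 0 < L by rewrite /L; posit.
have LE : (2 * (L / n%:R)) ^+ n = 2 * m.
  rewrite /L (_ : 2 * (_ / n%:R) = (2 * m) `^ (n%:R^-1)); last by field; rewrite gt_eqF.
  by rewrite -powR_mulrn ?powR_ge0// -powRrM mulVf ?gt_eqF// powRr1// ltW.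
have L2 : L ^+ 2 = (n%:R / 2) ^+ 2 * (2 `^ (2 / n%:R) * m `^ (2 / n%:R)).
  have e : ((2 * m) `^ (n%:R^-1)) ^+ 2 = (2 * m) `^ (2 / n%:R).
    by rewrite -powR_mulrn ?powR_ge0// -powRrM (mulrC n%:R^-1).
  by rewrite /L exprMn e powRM// ltW.
have bL : 2 * m <= @ball_vol R n L by rewrite -LE; apply: ball_vol_ge => //; exact: ltW.
have bL0 := @ball_vol_gt0 R n n0 L L0.
have hc : 0 < hardy_cst by exact: hardy_cst_gt0.
pose k z := (4 * L <= delta z)%R%:R * w z.
have mk : mf k by rewrite /k; meas_auto.
have k0 z : 0 <= k z by rewrite /k; nonneg.
pose P := 2 `^ (n%:R - 1 - d).
have P0 : 0 <= P by exact: powR_ge0.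
apply: (@le_trans _ _ (II (fun z => (4 * L) ^+ 2 * (v z ^+ 2 * delta z `^ (d - 1 - n%:R))
  + k z * v z ^+ 2)%R)).
  apply: II_le; [by meas_auto|by meas_auto|by nonneg|] => z; rewrite /k.
  have [Lz|Lz] := leP (4 * L) (delta z); first by rewrite mul1r mulrC lerDr; nonneg.
  rewrite !mul0r addr0 mulrCA ler_wpM2l ?sqr_ge0// /weight.
  have := dist_ge0 G0 z; rewrite le_eqVlt => /orP[/eqP <-|z0].
    by rewrite powR0; [nonneg|apply/eqP; move: dn => ? ?; lra].
  rewrite (_ : d + 1 - n%:R = 2 + (d - 1 - n%:R)); last by ring.
  rewrite (powR_add 2 _ z0) ler_wpM2r ?powR_ge0// powR_mulrn ?(ltW z0)// ler_sqr ?nnegrE ?(ltW z0)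
    ?(ltW Lz)//.
  by rewrite mulr_ge0// ltW.
rewrite II_add; [|by meas_auto|by meas_auto|by nonneg|by nonneg].
apply: (@le_trans _ _ (((4 * L) ^+ 2 * (hardy_cst * b))%:E + (2 * (n%:R * L ^+ 2 * (4 `^ (n%:R - 1
  - d) * b)))%:E)%E); last first.
  by rewrite -EFinD lee_fin /fk_cst exprMn L2; apply: eq_ler; ring.
apply: leeD.
  apply: II_scale_le; [by meas_auto|by nonneg|by nonneg|].
  exact: (hardy n0 d0 dn C01 G0 cG AR GG wg vM vr l0 vl HN Hb).
pose F z h := k z * (Bl 0 L h * (v (z + h) - v z) ^+ 2).
pose Q := 4 `^ (n%:R - 1 - d) * b.
have Q0 : 0 <= Q by rewrite /Q; nonneg.
suff H : (II (fun z => @ball_vol R n L / 2 * (k z * v z ^+ 2))%R <= (@ball_vol R n L * (n%:R * L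
  ^+ 2 * Q))%:E)%E.
  move: H; rewrite II_scale; [|by meas_auto|by nonneg|by nonneg] => H.
  have -> : II (fun z => k z * v z ^+ 2) =
      ((2 / @ball_vol R n L)%:E * ((@ball_vol R n L / 2)%:E * II (fun z => k z * v z ^+ 2)%R))%E.
    rewrite muleA -EFinM (_ : 2 / @ball_vol R n L * (@ball_vol R n L / 2) = 1) ?mul1e//.
    by field; rewrite gt_eqF.
  have -> : 2 * (n%:R * L ^+ 2 * (4 `^ (n%:R - 1 - d) * b)) =
      2 / @ball_vol R n L * (@ball_vol R n L * (n%:R * L ^+ 2 * Q)).
    by rewrite /Q; field; rewrite gt_eqF.
  rewrite [X in (_ <= X)%E]EFinM; apply: lee_wpmul2l => //; rewrite lee_fin; nonneg.
have -> : (@ball_vol R n L * (n%:R * L ^+ 2 * Q))%:E = II (fun h => n%:R * L ^+ 2 * Q * Bl (0 :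
  'rV[R]_n) L h).
  by rewrite II_scale ?II_Bl ?(ltW L0)// -?EFinM 1?mulrC//; nonneg.
apply: (@II_le_fubini _ _ _ _ F).
- by meas_auto.
- by meas_auto.
- rewrite /F; apply: mf2M; first exact: mf2_fst.
  apply: mf2M; first exact: (mf2_snd (mB 0 L)).
  apply: mf2X; apply: mf2D; first exact: mf2_add.
  by apply: mf2N; exact: mf2_fst.
- by nonneg.
- by nonneg.
- by move=> z h; rewrite /F; nonneg.
- move=> z; rewrite /F.
  have mvz : mf (fun h => v (z + h)).
    by have := mf_shift z mv; congr mf; apply/funext => h; rewrite addrC.
  rewrite II_scale; [|by meas_auto|by nonneg|by []].
  rewrite mulrCA EFinM lee_wpmul2l ?lee_fin// mulrC.
  exact: half_zero (ltW m0) Hm bL.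
- move=> h; rewrite /F; have [hL|hL] := boolP (enorm (h - 0) < L); last first.
    rewrite /Bl (negbTE hL) mulr0 (_ : (fun z => _) = fun=> 0); first by rewrite /II integral0.
    by apply/funext => z; rewrite mul0r mulr0.
  have -> : Bl 0 L h = 1 by rewrite /Bl hL.
  rewrite mulr1; under II_eq do rewrite mul1r.
  rewrite subr0 in hL.
  (* Each of the two moves, by [h] and by the mollification, costs one doubling factor [P]; together
     they give 4^(n-1-d). *)
  pose k1 a := P * ((2 * L <= delta a)%R%:R * w a).
  pose k2 a := (P * P) * w a.
  have mk1 : mf k1 by rewrite /k1; meas_auto.
  have mk2 : mf k2 by rewrite /k2; meas_auto.
  apply: (@le_trans _ _ (n%:R * enorm h ^+ 2 * Q)%:E); last first.
    by rewrite lee_fin ler_wpM2r// ler_wpM2l ?ler0n// ler_sqr ?nnegrE ?enorm_ge0//; exact: ltW.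
  have HQ : (II (fun a => k2 a * enorm (G a) ^+ 2)%R <= Q%:E)%E.
    rewrite /Q (_ : 4 = 2 * 2 :> R); last by ring.
    rewrite powRM// -/P; under II_eq do rewrite /k2 -mulrA (mulrC (w _)).
    by apply: II_scale_le; [by meas_auto|by nonneg|by nonneg|].
  apply: (wg_translation (K := (4 * L) `^ (d + 1 - n%:R)) n0 wg vM vr L0 mk mk1 mk2 _ _ _ _ _ HQ).
  + move=> z; rewrite k0/= /k; have [Lz|_] := boolP (_ <= delta z); last by rewrite mul0r powR_ge0.
    by rewrite mul1r; apply: weight_ub => //; rewrite mulr_gt0.
  + by move=> z; rewrite /k1; nonneg.
  + by move=> z; rewrite /k2; nonneg.
  + move=> z y yz; rewrite /k; have [Lz|_] := boolP (_ <= delta z); last by rewrite mul0r /k1;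
    nonneg.
    have L2z : 2 * L <= delta z by rewrite (le_trans _ Lz)// ler_pM2r// ler_nat.
    have [h1 h2] := weight_near L0 L2z (le_trans yz (ltW hL)).
    have h3 := dist_near L0 Lz (le_trans yz (ltW hL)).
    have -> : k1 y = P * w y by rewrite /k1 h3 mul1r.
    by rewrite mul1r.
  + move=> z y yL; rewrite /k1 /k2 -mulrA; apply: ler_wpM2l; first exact: P0.
    have [Lz|_] := boolP (_ <= delta z); last by rewrite mul0r; nonneg.
    have yL' : enorm (y + z - z) <= L by rewrite addrK ltW.
    by rewrite mul1r; have [] := weight_near L0 Lz yL'.
Qed.

End faber_krahn.

(** * Bounded truncations *)

Section truncation.
Context {R : realType}.
Implicit Types (kp k t s a b : R).

Definition pos k t : R := Num.max 0 (t - k).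
(** The linear term makes [tc kp s] resemble s, the constant makes its derivative vanish at 0, the
    quadratic term bounds it by 1 / kp. *)
Definition den kp s : R := kp + s + kp * s ^+ 2.
Definition tc kp s : R := s ^+ 2 / den kp s.
(** The derivative of [tc kp]; the cubic terms of the quotient rule cancel. *)
Definition tc' kp s : R := s * (s + 2 * kp) / den kp s ^+ 2.
(* [trc kp k t] increases to [(t - k)^+] as [kp] decreases to 0, is at most [1 / kp], and its
   derivative [trc'] satisfies [trc ^ 2 <= ((t - k)^+) ^ 2 * trc'] and [trc' ^ 2 <= trc']: the
   same function serves as test function and in the Faber-Krahn inequality. *)
Definition trc kp k t : R := tc kp (pos k t).
Definition trc' kp k t : R := tc' kp (pos k t).

Lemma pos_ge0 k t : 0 <= pos k t. Proof. by rewrite /pos le_max lexx. Qed.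

Lemma pos_gt0 k t : (0 < pos k t) = (k < t).
Proof. by rewrite /pos lt_max ltxx subr_gt0. Qed.

Lemma pos0 k t : t <= k -> pos k t = 0.
Proof. by move=> tk; rewrite /pos max_l// subr_le0. Qed.

Lemma posE k t : k <= t -> pos k t = t - k.
Proof. by move=> tk; rewrite /pos max_r// subr_ge0. Qed.

Lemma pos_le k t : 0 <= k -> 0 <= t -> pos k t <= t.
Proof. by move=> k0 t0; rewrite /pos ge_max t0 lerBlDr lerDl. Qed.

Lemma den_gt0 kp s : 0 < kp -> 0 <= s -> 0 < den kp s.
Proof. by move=> k0 s0; rewrite /den; have := sqr_ge0 s; nra. Qed.

Lemma den_bounds kp s : 0 < kp -> 0 <= s -> [/\ kp <= den kp s,
  s <= den kp s & kp * s ^+ 2 <= den kp s].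
Proof. by move=> k0 s0; rewrite /den; have := sqr_ge0 s; split; nra. Qed.

Lemma tc_ge0 kp s : 0 < kp -> 0 <= s -> 0 <= tc kp s.
Proof. by move=> k0 s0; rewrite /tc divr_ge0 ?sqr_ge0// ltW// den_gt0. Qed.

Lemma tc_le kp s : 0 < kp -> 0 <= s -> tc kp s <= s.
Proof.
move=> k0 s0; have D0 := den_gt0 k0 s0; rewrite /tc ler_pdivrMr// expr2.
by apply: ler_wpM2l => //; have [] := den_bounds k0 s0.
Qed.

Lemma tc_ub kp s : 0 < kp -> 0 <= s -> tc kp s <= kp^-1.
Proof.
move=> k0 s0; have D0 := den_gt0 k0 s0; rewrite /tc ler_pdivrMr//.
by rewrite ler_pdivlMl//; have [] := den_bounds k0 s0.
Qed.

Lemma tc'_ge0 kp s : 0 < kp -> 0 <= s -> 0 <= tc' kp s.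
Proof.
move=> k0 s0; rewrite /tc' divr_ge0 ?sqr_ge0// mulr_ge0// addr_ge0// mulr_ge0// ltW//.
Qed.

Lemma tc'_le1 kp s : 0 < kp -> 0 <= s -> tc' kp s <= 1.
Proof.
move=> k0 s0; have D0 := den_gt0 k0 s0; rewrite /tc' ler_pdivrMr ?exprn_gt0// mul1r /den.
have -> : (kp + s + kp * s ^+ 2) ^+ 2 = s * (s + 2 * kp) + (kp ^+ 2 + 2 * (kp + s) * (kp * s ^+ 2)
  + (kp * s ^+ 2) ^+ 2) by ring.
by rewrite lerDl; have := ltW k0; move=> ?; nonneg.
Qed.

Lemma tc_sqr_le kp s : 0 < kp -> 0 <= s -> tc kp s ^+ 2 <= s ^+ 2 * tc' kp s.
Proof.
move=> k0 s0; have D0 := den_gt0 k0 s0; rewrite /tc /tc' expr_div_n mulrA.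
apply: ler_wpM2r; first by rewrite invr_ge0 sqr_ge0.
have -> : s ^+ 2 ^+ 2 = s ^+ 2 * (s * s) by ring.
apply: ler_wpM2l; first exact: sqr_ge0.
by apply: ler_wpM2l => //; rewrite lerDl; nra.
Qed.

Lemma tc'_lip0 kp s : 0 < kp -> 0 <= s -> tc' kp s <= 3 / kp * s.
Proof.
move=> k0 s0; have D0 := den_gt0 k0 s0; have [h1 h2 _] := den_bounds k0 s0.
rewrite /tc' ler_pdivrMr ?exprn_gt0//; have -> : 3 / kp * s * den kp s ^+ 2 = s * (3 * (kp^-1 *
  den kp s ^+ 2)) by ring.
apply: ler_wpM2l => //; apply: (@le_trans _ _ (3 * den kp s)); first by lra.
rewrite ler_pM2l// ler_pdivlMl// expr2.
by apply: ler_wpM2r => //; exact: ltW.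
Qed.

(** The remainder is exactly a rational function times (b - a)^2; every monomial of its numerator is
    dominated by the denominator through [den_bounds]. *)
Lemma tc_taylor kp a b : 0 < kp -> 0 <= a -> 0 <= b ->
  `|tc kp b - tc kp a - tc' kp a * (b - a)| <= (kp^-1 + 4 * kp) * (b - a) ^+ 2.
Proof.
move=> k0 a0 b0; have Da := den_gt0 k0 a0; have Db := den_gt0 k0 b0.
have [a1 a2 a3] := den_bounds k0 a0; have [b1 b2 b3] := den_bounds k0 b0.
have e : tc kp b - tc kp a - tc' kp a * (b - a) =
   ((kp ^+ 2 * (1 - a ^+ 2) - kp * a * (a + 2 * kp) * b) / (den kp b * den kp a ^+ 2)) * (b - a)
     ^+ 2.
  rewrite /tc /tc'; move: Da Db; rewrite /den => Da Db; field.
  by rewrite !gt_eqF.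
rewrite e normrM (ger0_norm (sqr_ge0 (b - a))); apply: ler_wpM2r; first exact: sqr_ge0.
clear e.
have DD : 0 < den kp b * den kp a ^+ 2 by rewrite mulr_gt0// exprn_gt0.
rewrite normrM normfV (gtr0_norm DD) ler_pdivrMr//.
have kk : kp != 0 by rewrite gt_eqF.
move: (den kp a) (den kp b) Da Db a1 a2 a3 b1 b2 b3 DD => A B A0 B0 a1 a2 a3 b1 b2 b3 _.
have A2 : kp ^+ 2 <= A ^+ 2 by rewrite ler_sqr ?nnegrE ?(ltW k0) ?(ltW A0).
have A3 : a ^+ 2 <= A ^+ 2 by rewrite ler_sqr ?nnegrE ?(ltW A0).
have A4 : kp * a <= A ^+ 2 by rewrite expr2; apply: ler_pM => //; exact: ltW.
have h1 : kp ^+ 2 <= kp^-1 * (B * A ^+ 2).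
  by rewrite ler_pdivlMl//; apply: ler_pM => //; [exact: ltW|exact: sqr_ge0].
have h2 : kp ^+ 2 * a ^+ 2 <= kp * (B * A ^+ 2).
  rewrite expr2 -mulrA; apply: ler_wpM2l; first exact: ltW.
  by apply: ler_pM => //; [exact: ltW|exact: sqr_ge0].
have h3 : kp * a * (a + 2 * kp) * b <= 3 * kp * (B * A ^+ 2).
  have -> : kp * a * (a + 2 * kp) * b = kp * (b * a ^+ 2) + 2 * kp * (b * (kp * a)) by ring.
  have -> : 3 * kp * (B * A ^+ 2) = kp * (B * A ^+ 2) + 2 * kp * (B * A ^+ 2) by ring.
  apply: lerD; apply: ler_wpM2l.
  - exact: ltW.
  - by apply: ler_pM => //; exact: sqr_ge0.
  - by rewrite mulr_ge0// ltW.
  - by apply: ler_pM => //; rewrite mulr_ge0// ltW.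
have p3 : 0 <= kp * a * (a + 2 * kp) * b by have := ltW k0; move=> ?; nonneg.
have p2 : 0 <= kp ^+ 2 * a ^+ 2 by nonneg.
have p1 : 0 <= kp ^+ 2 by nonneg.
have -> : kp ^+ 2 * (1 - a ^+ 2) = kp ^+ 2 - kp ^+ 2 * a ^+ 2 by ring.
have -> : (kp^-1 + 4 * kp) * (B * A ^+ 2) = kp^-1 * (B * A ^+ 2) + 4 * (kp * (B * A ^+ 2)) by ring.
move: h3; rewrite -(mulrA 3 kp) => h3.
move: (kp ^+ 2 * a ^+ 2) (kp ^+ 2) (kp * a * (a + 2 * kp) * b) (kp^-1 * (B * A ^+ 2))
  (kp * (B * A ^+ 2)) h1 h2 h3 p1 p2 p3.
clear; move=> X1 X2 X3 X4 X5 h1 h2 h3 p1 p2 p3.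
by rewrite ler_norml; apply/andP; split; lra.
Qed.

(** The expansions at [a] and at [b] add up to (S'(b) - S'(a)) (b - a), so the Taylor bound implies
    the Lipschitz bound on [S'] with twice the constant. *)
Lemma C11_taylor (S S' : R -> R) (M : R) : S 0 = 0 -> (forall t, `|S' t| <= M) ->
  (forall a b, `|S b - S a - S' a * (b - a)| <= M * (b - a) ^+ 2) -> C11 (2 * M) S S'.
Proof.
move=> S0 SM HT; have M0 : 0 <= M by exact: le_trans (SM 0).
have MM : M <= 2 * M by lra.
split => //; [by move=> t; exact: le_trans MM| |].
  move=> a b; have [->|ab] := eqVneq a b; first by rewrite !subrr normr0 mulr0.
  have ba : 0 < `|b - a| by rewrite normr_gt0 subr_eq0 eq_sym.
  rewrite -(ler_pM2r ba) -normrM.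
  have -> : 2 * M * `|b - a| * `|b - a| = 2 * M * (b - a) ^+ 2 by rewrite -mulrA -expr2 real_normK
    ?num_real.
  have -> : (S' b - S' a) * (b - a) = (S b - S a - S' a * (b - a)) + (S a - S b - S' b * (a - b))
    by ring.
  apply: le_trans (ler_normD _ _) _; have := HT a b; have := HT b a.
  by rewrite -(sqrrN (a - b)) opprB; lra.
move=> a b; apply: le_trans (HT a b) _; apply: ler_wpM2r => //; exact: sqr_ge0.
Qed.

(** The kink of [pos] at [k] does no harm because [tc] and its derivative both vanish at 0; the
    cases are the sides of [k] on which [a] and [b] lie. *)
Lemma C11_trc kp k : 0 < kp -> 0 <= k -> exists M, C11 M (trc kp k) (trc' kp k).
Proof.
move=> kp0 k0; pose M := 1 + kp^-1 + 4 * kp + 3 / kp.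
have ki : 0 < kp^-1 by rewrite invr_gt0.
exists (2 * M); apply: C11_taylor.
- by rewrite /trc pos0// /tc expr0n mul0r.
- move=> t; rewrite /trc' ger0_norm ?tc'_ge0 ?pos_ge0//.
  by apply: le_trans (tc'_le1 kp0 (pos_ge0 _ _)) _; rewrite /M; lra.
have T0 : tc kp 0 = 0 by rewrite /tc expr0n mul0r.
have T'0 : tc' kp 0 = 0 by rewrite /tc' !mul0r.
move=> a b; rewrite /trc /trc'; have [ak|ak] := leP a k.
  rewrite (pos0 ak) T0 T'0 mul0r !subr0; have [bk|bk] := leP b k.
    by rewrite (pos0 bk) T0 normr0 mulr_ge0 ?sqr_ge0//; rewrite /M; lra.
  have := tc_taylor kp0 (lexx 0) (pos_ge0 k b); rewrite T0 T'0 mul0r !subr0 => h.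
  apply: le_trans h _; rewrite posE ?(ltW bk)//; apply: ler_pM.
  - by rewrite addr_ge0// ?mulr_ge0// ltW.
  - exact: sqr_ge0.
  - by rewrite /M; lra.
  - by rewrite ler_sqr ?nnegrE; lra.
have ea := posE (ltW ak); have [bk|bk] := leP k b.
  have := tc_taylor kp0 (pos_ge0 k a) (pos_ge0 k b); rewrite ea (posE bk).
  have -> : b - k - (a - k) = b - a by ring.
  move=> h; apply: le_trans h _; apply: ler_wpM2r; first exact: sqr_ge0.
  by rewrite /M; lra.
(* Here b < k < a: expand from [a] down to [k] only. The remaining length k - b contributes a term
   linear in it times the derivative, which [tc'_lip0] makes quadratic. *)
have := tc_taylor kp0 (pos_ge0 k a) (lexx 0); rewrite (pos0 (ltW bk)) T0 ea.
have := tc'_lip0 kp0 (pos_ge0 k a); have := tc'_ge0 kp0 (pos_ge0 k a); rewrite ea.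
have -> : b - a = (0 - (a - k)) - (k - b) by ring.
have h1 : 0 < a - k by lra. have h2 : 0 < k - b by lra.
move: (a - k) (k - b) h1 h2 => p q p0 q0; move: (tc' kp p) (tc kp p) => c t c0 cp h.
have cq : c * q <= 3 / kp * p * q by rewrite ler_wpM2r// ltW.
have cq0 : 0 <= c * q by rewrite mulr_ge0// ltW.
have -> : 0 - t - c * (0 - p - q) = (0 - t - c * (0 - p)) + c * q by ring.
apply: le_trans (ler_normD _ _) _; rewrite (ger0_norm cq0).
have -> : M * (0 - p - q) ^+ 2 = (kp^-1 + 4 * kp) * (0 - p) ^+ 2 + (M - 3 / kp - 1)
  * (2 * p * q + q ^+ 2) + p ^+ 2 + 3 / kp * p ^+ 2 + (3 / kp + 1) * (2 * p * q + q ^+ 2).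
  by rewrite /M; ring.
have e1 : 0 <= (M - 3 / kp - 1) * (2 * p * q + q ^+ 2).
  have ? := ltW p0; have ? := ltW q0; have ? := ltW kp0.
  by apply: mulr_ge0; [rewrite /M; lra|nonneg].
have e2 : 0 <= 3 / kp * p ^+ 2 by have ? := ltW kp0; nonneg.
have e3 : 3 / kp * p * q <= (3 / kp + 1) * (2 * p * q + q ^+ 2).
  have -> : (3 / kp + 1) * (2 * p * q + q ^+ 2) = 3 / kp * p * q + (3 / kp * p * q + 3 / kp
    * q ^+ 2 + (2 * p * q + q ^+ 2)) by ring.
  rewrite lerDl; have ? := ltW p0; have ? := ltW q0; have ? := ltW kp0; nonneg.
have e4 := sqr_ge0 p.
by lra.
Qed.

Lemma tc_lim s (e : R) : 0 <= s -> 0 < e -> \forall kp \near 0^'+, `|tc kp s - s| <= e.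
Proof.
move=> s0 e0; have [->|sn] := eqVneq s 0.
  by near=> kp; rewrite /tc expr0n mul0r subr0 normr0 ltW.
have sp : 0 < s by rewrite lt_neqAle eq_sym sn.
have c0 : 0 < e / (1 + s ^+ 2) by rewrite divr_gt0// ltr_pwDl// sqr_ge0.
near=> kp.
have k0 : 0 < kp by near: kp; exact: nbhs_right_gt.
have kc : kp < e / (1 + s ^+ 2) by near: kp; exact: nbhs_right_lt.
have D0 := den_gt0 k0 s0; have [_ h _] := den_bounds k0 s0.
rewrite ltr_pdivlMr in kc; last by rewrite ltr_pwDl// sqr_ge0.
rewrite distrC ger0_norm ?subr_ge0 ?tc_le//.
have -> : s - tc kp s = s * (kp * (1 + s ^+ 2)) / den kp s.
  by rewrite /tc /den; field; rewrite gt_eqF//.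
rewrite ler_pdivrMr// mulrC; apply: ler_pM => //; [|exact: ltW].
by rewrite mulr_ge0 ?(ltW k0)// addr_ge0// sqr_ge0.
Unshelve. all: by end_near.
Qed.

Lemma trc_cvg k t : (fun m : nat => trc (m.+1%:R^-1) k t) @ \oo --> pos k t.
Proof.
apply/cvgrPdist_le => e e0; rewrite /trc.
have [eps /= ep H] := tc_lim (pos_ge0 k t) e0.
have [N HN] : exists N : nat, eps^-1 < N%:R.
  by exists (Num.truncn (eps^-1)).+1; rewrite truncnS_gt.
exists N => // m /= Nm; rewrite distrC; apply: H => /=; last by rewrite invr_gt0.
rewrite sub0r normrN gtr0_norm ?invr_gt0// invf_plt ?posrE//.
by apply: lt_le_trans HN _; rewrite ler_nat; exact: leq_trans Nm _.
Qed.

End truncation.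

(** * Subsolutions with zero trace *)

Section integral_bounds.
Context {R : realType} {n : nat}.

Lemma Iable_nonneg (f : 'rV[R]_n -> R) (b : R) : mf f -> (forall z, 0 <= f z) ->
  (II f <= b%:E)%E -> Iable f.
Proof.
move=> mff f0 fb; apply/IableP; split => //; rewrite (II_eq (g := f)); last by move=> z;
  rewrite ger0_norm.
exact: le_lt_trans fb (ltry _).
Qed.

Lemma RI_le_II (f : 'rV[R]_n -> R) (b : R) : mf f -> (forall z, 0 <= f z) -> (II f <= b%:E)%E ->
  RI f <= b.
Proof.
move=> mff f0 fb; apply: le_trans (ler_norm _) _; apply: RI_norm_le (Iable_nonneg mff f0 fb) _.
by rewrite (II_eq (g := f))// => z; rewrite ger0_norm.
Qed.

Lemma II_le_RI (f : 'rV[R]_n -> R) (b : R) : Iable f -> (forall z, 0 <= f z) -> RI f <= b ->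
  (II f <= b%:E)%E.
Proof. by move=> If f0 fb; rewrite /II -RI_EFin// lee_fin. Qed.

Lemma Iable_mul2 (f h : 'rV[R]_n -> R) : mf f -> mf h -> Iable (fun z => f z ^+ 2) ->
  Iable (fun z => h z ^+ 2) ->
  Iable (fun z => f z * h z).
Proof.
move=> mff mh If Ih; apply: (Iable_le _ _ (IableD If Ih)); first by meas_auto.
by move=> z; rewrite normrM -(real_normK (num_real (f z))) -(real_normK (num_real (h z)));
  have := sqr_ge0 (`|f z| - `|h z|); nra.
Qed.

Lemma RI_mul2_le (f h : 'rV[R]_n -> R) (t : R) : 0 < t -> mf f -> mf h ->
  Iable (fun z => f z ^+ 2) -> Iable (fun z => h z ^+ 2) ->
  `|RI (fun z => f z * h z)| <= (t * RI (fun z => f z ^+ 2) + t^-1 * RI (fun z => h z ^+ 2)) / 2.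
Proof.
move=> t0 mff mh If Ih; have Ifh := Iable_mul2 mff mh If Ih.
apply: le_trans (RI_norm Ifh) _.
rewrite -RIZ// -(RIZ t^-1)// -RID; [|exact: IableZ|exact: IableZ].
rewrite mulrC -RIZ; last by apply: IableD; exact: IableZ.
apply: RI_le => //; first exact: Iable_norm.
  by apply: IableZ; apply: IableD; exact: IableZ.
move=> z; rewrite normrM ler_pdivlMl// -(real_normK (num_real (f z)))
  -(real_normK (num_real (h z))).
move: `|f z| `|h z| => a b; rewrite -subr_ge0.
have -> : t * a ^+ 2 + t^-1 * b ^+ 2 - 2 * (a * b) = t^-1 * (t * a - b) ^+ 2 by field;
  rewrite gt_eqF.
by rewrite mulr_ge0 ?sqr_ge0// invr_ge0 ltW.
Qed.

Lemma amgm (p q m : R) : 0 <= p -> 0 <= q -> m ^+ 2 <= p * q -> 2 * m <= p + q.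
Proof.
move=> p0 q0 h; rewrite leNgt; apply/negP => h2.
have : (p + q) ^+ 2 < (2 * m) ^+ 2 by rewrite ltr_sqr ?nnegrE//;
  [exact: addr_ge0|apply: le_trans (ltW h2); exact: addr_ge0].
by have := sqr_ge0 (p - q); nra.
Qed.

(** The Caccioppoli computation at one point: [x] is the cut-off, [S] the truncation, [c] its
    derivative. Ellipticity provides twice the left-hand side; S^2 <= s^2 c lets the
    arithmetic-geometric inequality absorb the cross term into one copy of it. *)
Lemma caccio_pt (C1 x gg Y c S s ww fg fd : R) : 1 <= C1 -> 0 <= gg -> 0 <= Y -> 0 <= c ->
  0 <= ww -> 0 <= S ->
  S ^+ 2 <= s ^+ 2 * c -> C1^-1 * ww * gg ^+ 2 <= fg -> `|fd| <= C1 * ww * gg * Y ->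
  x ^+ 2 * (c * (gg ^+ 2 * ww)) <= 2 * C1 * (x ^+ 2 * c * fg + 2 * x * S * fd)
    + 4 * C1 ^+ 4 * (Y ^+ 2 * s ^+ 2 * ww).
Proof.
move=> C1_ge1 g0 Y0 c0 w0 S0 Ss h1 h2.
have C10 : 0 < C1 by apply: lt_le_trans C1_ge1.
have e1 : x ^+ 2 * (c * (gg ^+ 2 * ww)) * 2 <= 2 * C1 * (x ^+ 2 * c * fg).
  apply: (@le_trans _ _ (2 * C1 * (x ^+ 2 * c * (C1^-1 * ww * gg ^+ 2)))).
    by apply: eq_ler; field; rewrite gt_eqF.
  apply: ler_wpM2l; first by rewrite mulr_ge0// ltW.
  by apply: ler_wpM2l => //; rewrite mulr_ge0// sqr_ge0.
have e2 : - (2 * (2 * C1 ^+ 2 * S * (`|x| * gg) * Y) * ww) <= 2 * C1 * (2 * x * S * fd).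
  have : `|2 * C1 * (2 * x * S * fd)| <= 2 * (2 * C1 ^+ 2 * S * (`|x| * gg) * Y) * ww.
    rewrite !normrM (ger0_norm S0) (gtr0_norm C10) !(@normr_nat R 2).
    have -> : 2 * (2 * C1 ^+ 2 * S * (`|x| * gg) * Y) * ww = 2 * C1 * (2 * `|x|
      * S * (C1 * ww * gg * Y)) by ring.
    apply: ler_wpM2l; first by rewrite mulr_ge0// ltW.
    by apply: ler_wpM2l => //; rewrite !mulr_ge0.
  by rewrite ler_norml => /andP[].
have e3 : 2 * (2 * C1 ^+ 2 * S * (`|x| * gg) * Y) <= x ^+ 2 * (c * gg ^+ 2)
  + 4 * C1 ^+ 4 * (Y ^+ 2 * s ^+ 2).
  apply: amgm.
  - by nonneg.
  - by have ? := ltW C10; nonneg.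
  have -> : (2 * C1 ^+ 2 * S * (`|x| * gg) * Y) ^+ 2 = 4 * C1 ^+ 4 * `|x|
    ^+ 2 * gg ^+ 2 * Y ^+ 2 * S ^+ 2 by ring.
  have -> : x ^+ 2 * (c * gg ^+ 2) * (4 * C1 ^+ 4 * (Y ^+ 2 * s ^+ 2))
    = 4 * C1 ^+ 4 * x ^+ 2 * gg ^+ 2 * Y ^+ 2 * (s ^+ 2 * c) by ring.
  rewrite real_normK ?num_real//; apply: ler_wpM2l => //.
  by have ? := ltW C10; nonneg.
have e4 := ler_wpM2r w0 e3.
move: e1 e2 e4; rewrite !mulrDr (mulrDl (x ^+ 2 * _)).
have -> : x ^+ 2 * (c * gg ^+ 2) * ww = x ^+ 2 * (c * (gg ^+ 2 * ww)) by ring.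
have -> : 4 * C1 ^+ 4 * (Y ^+ 2 * s ^+ 2) * ww = 4 * C1 ^+ 4 * (Y ^+ 2 * s ^+ 2 * ww) by ring.
move: (2 * (2 * C1 ^+ 2 * S * (`|x| * gg) * Y) * ww) (x ^+ 2 * (c * (gg ^+ 2 * ww))) (4 * _ * _)
  (2 * C1 * _) (2 * C1 * _).
by clear; move=> X1 X2 X3 X4 X5 ? ? ?; lra.
Qed.

End integral_bounds.

(** * Calculus on 2B: cut-offs, weak gradients across [Gamma] *)

Section local_calculus.
Context {R : realType} {n : nat}.
Variables d C0 : R.
Hypotheses (n0 : (0 < n)%N) (d0 : 0 < d) (dn : d < n%:R - 1) (C01 : 1 <= C0).
Local Notation X := (bT R n).
Local Notation mu := (@mu R n).
Variable Gamma : set 'rV[R]_n.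
Hypotheses (G0 : Gamma !=set0) (cG : closed Gamma) (AR : ahlfors_regular d C0 Gamma).
Local Notation delta := (dist Gamma).
Local Notation w := (weight d Gamma).
Variables (x0 : 'rV[R]_n) (r : R).
Hypotheses (Gx0 : Gamma x0) (r0 : 0 < r).
Implicit Types (phi chi psi : 'rV[R]_n -> R).

Definition in_domain z := enorm (z - x0) < 2 * r /\ ~ Gamma z.

(** Functions satisfying [adm] vanish near [Gamma] and near the sphere of radius 2 r, and can be
    used to test the equation; those satisfying [adm0] may cross [Gamma]. The uniform margin [e]
    leaves room for mollification. *)
Definition adm chi := cc chi /\ exists2 e, 0 < e & forall z, chi z != 0 -> enorm (z - x0)
  <= 2 * r - e /\ e <= delta z.
Definition adm0 phi := cc phi /\ exists2 e, 0 < e & forall z, phi z != 0 -> enorm (z - x0)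
  <= 2 * r - e.

Lemma partial_open_eq (f h : 'rV[R]_n -> R) i (U : set 'rV[R]_n) : open U ->
  (forall z, U z -> f z = h z) -> forall z, U z -> partial i f z = partial i h z.
Proof.
move=> oU fh z Uz; rewrite /partial; apply: near_eq_derive.
by apply: filterS (open_nbhs_nbhs (conj oU Uz)) => y; exact: fh.
Qed.

Lemma partial_cst i (c : R) z : partial i (fun _ : 'rV[R]_n => c) z = 0.
Proof. exact: derive_cst. Qed.

Lemma open_lt_cont (f : 'rV[R]_n -> R) (a : R) : continuous f -> open [set z | f z < a].
Proof. by move=> cf; apply: (@open_comp _ _ f [set s | s < a]) => [z _|];
  [exact: cf|exact: open_lt]. Qed.

Lemma open_gt_cont (f : 'rV[R]_n -> R) (a : R) : continuous f -> open [set z | a < f z].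
Proof. by move=> cf; apply: (@open_comp _ _ f [set s | a < s]) => [z _|];
  [exact: cf|exact: open_gt]. Qed.

Lemma open_neq0_cont (f : 'rV[R]_n -> R) : continuous f -> open [set z | f z != 0].
Proof.
move=> cf; rewrite (_ : [set _ | _] = [set z | f z < 0] `|` [set z | 0 < f z]).
  by apply: openU; [exact: open_lt_cont|exact: open_gt_cont].
by apply/seteqP; split => z /=; [rewrite neq_lt => /orP|move=> H; rewrite neq_lt; apply/orP].
Qed.

Lemma partial_supp (f h : 'rV[R]_n -> R) (a : R) i : continuous h -> (forall z, f z != 0 ->
  h z <= a) ->
  forall z, partial i f z != 0 -> h z <= a.
Proof.
move=> ch fh z; apply: contraNT; rewrite -ltNge => az; apply/eqP.
apply: (partial_open0 i (open_gt_cont (a := a) ch) _ az) => y /= ay.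
by apply/eqP; apply: contraTT ay => /fh; rewrite -leNgt.
Qed.

Lemma adm_partial_supp chi i (e : R) :
  (forall z, chi z != 0 -> enorm (z - x0) <= 2 * r - e /\ e <= delta z) ->
  forall z, partial i chi z != 0 -> enorm (z - x0) <= 2 * r - e /\ e <= delta z.
Proof.
move=> He z pz; split.
  apply: (partial_supp (h := fun z => enorm (z - x0)) _ _ pz); first exact: continuous_edist.
  by move=> y /He[].
rewrite -lerN2; apply: (partial_supp (h := fun z => - delta z) _ _ pz).
  by move=> y; exact: (cvgN (@continuous_dist R n Gamma G0 y)).
by move=> y /He[_]; rewrite lerN2.
Qed.

Lemma adm_partial chi i : adm chi -> adm (partial i chi).
Proof.
move=> [cchi [e e0 He]]; split; first exact: cc_partial.
by exists e => //; exact: adm_partial_supp.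
Qed.

Lemma adm0_partial phi i : adm0 phi -> adm0 (partial i phi).
Proof.
move=> [cphi [e e0 He]]; split; first exact: cc_partial.
exists e => // z pz; apply: (partial_supp (h := fun z => enorm (z - x0)) _ _ pz) => //.
exact: continuous_edist.
Qed.

Lemma adm_adm0 chi : adm chi -> adm0 chi.
Proof. by move=> [cchi [e e0 He]]; split => //; exists e => // z /He[]. Qed.

Lemma adm0_supp phi z : adm0 phi -> phi z != 0 -> enorm (z - x0) < 2 * r.
Proof. by move=> [_ [e e0 He]] /He; lra. Qed.

Lemma adm_cut (e : R) : 0 < e -> exists2 chi, adm chi &
  forall z, enorm (z - x0) <= 2 * r - e -> e <= delta z -> chi z = 1.
Proof.
move=> e0; have [C C0' HC] := cutoff n0 (R := R).
pose F : set 'rV[R]_n := [set z | enorm (z - x0) < 2 * r - e / 2 /\ e / 2 < delta z].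
have e40 : 0 < e / 4 by rewrite divr_gt0.
have mF : measurable (F : set X).
  by apply: measurableI; [apply: mf_setlt; exact: mf_enorm|apply: mf_setgt; exact: mf_dist].
have FM : F `<=` eball 0 (enorm x0 + 2 * r).
  move=> z [zx _]; rewrite /eball/= subr0; have := enorm_tri z x0 0; rewrite !subr0.
  by move: zx e0 => ? ?; lra.
have [eta [se e01 _ e1 eta0]] := HC F (e / 4) (enorm x0 + 2 * r) e40 mF FM.
have supp z : eta z != 0 -> enorm (z - x0) <= 2 * r - e / 4 /\ e / 4 <= delta z.
  move=> /eqP ez; have [y yz Fy] : exists2 y, eball z (e / 4) y & F y.
    by apply: contrapT => H; apply: ez; apply: eta0 => y yz Fy; apply: H; exists y.
  have [y1 y2] := Fy; have := enorm_tri z y x0; have := dist_lip G0 y z.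
  by rewrite (enorm_distC z y); move: yz y1 y2; rewrite /eball/= => ? ? ? ? ?; lra.
exists eta.
  split; last by exists (e / 4).
  split => //; exists (enorm x0 + 2 * r) => z zr; apply/eqP/negPn/negP => /supp[h _].
  by have := enorm_tri z x0 0; rewrite !subr0; move: zr h e0 => ? ? ? ?; lra.
move=> z z1 z2; apply: e1 => y yz; have := enorm_tri y z x0; have := dist_lip G0 z y.
by rewrite /F/= (enorm_distC z y); move: yz z1 z2 e0; rewrite /eball/= => ? ? ? ? ? ?; lra.
Qed.

Lemma eta_ex : exists2 C : R, 0 < C & forall eps, 0 < eps -> eps <= r -> exists eta, [/\ smooth eta,
  forall z, 0 <= eta z <= 1, forall z, delta z <= eps -> eta z = 0,
  forall z, enorm (z - x0) < 2 * r -> 3 * eps < delta z -> eta z = 1 &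
  forall i z, enorm (z - x0) < 2 * r -> `|partial i eta z| <= C / eps * (eps <= delta z <= 3 *
    eps)%R%:R].
Proof.
have [C C0' HC] := cutoff n0 (R := R); exists C => // eps e0 er.
(* Radius 4 r, so that after mollification at scale [eps <= r] only the condition on delta matters
   inside the ball of radius 2 r. *)
pose F : set 'rV[R]_n := [set z | enorm (z - x0) < 4 * r /\ 2 * eps < delta z].
have mF : measurable (F : set X).
  by apply: measurableI; [apply: mf_setlt; exact: mf_enorm|apply: mf_setgt; exact: mf_dist].
have FM : F `<=` eball 0 (enorm x0 + 4 * r).
  move=> z [zx _]; rewrite /eball/= subr0; have := enorm_tri z x0 0; rewrite !subr0.
  by move: zx e0 => ? ?; lra.
have [eta [se e01 pe e1 eta0]] := HC F eps (enorm x0 + 4 * r) e0 mF FM.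
have one z : enorm (z - x0) < 2 * r -> 3 * eps < delta z -> eta z = 1.
  move=> z1 z2; apply: e1 => y yz; have := enorm_tri y z x0; have := dist_lip G0 z y.
  by rewrite /F/= (enorm_distC z y); move: yz z1 z2 e0 er; rewrite /eball/= => ? ? ? ? ? ? ?; lra.
have zero z : delta z <= eps -> eta z = 0.
  move=> z1; apply: eta0 => y yz [_ y2]; have := dist_lip G0 y z.
  by move: yz y2 z1; rewrite /eball/= => ? ? ? ?; lra.
exists eta; split => // i z zx; have [zl|zl] := ltP (delta z) eps.
  rewrite (partial_open0 i (open_lt_cont (a := eps) (@continuous_dist _ _ _ G0)))//;
    last by move=> y /= /ltW/zero.
  by rewrite normr0 mulr0.
have [zg|zg] := leP (delta z) (3 * eps); first by rewrite mulr1.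
have oU : open ([set z | enorm (z - x0) < 2 * r] `&` [set z | 3 * eps < delta z]).
  apply: openI; first by apply: open_lt_cont; exact: continuous_edist.
  by apply: open_gt_cont; exact: continuous_dist.
rewrite (partial_open_eq i oU (h := fun=> 1)) ?partial_cst ?normr0 ?mulr0//.
by move=> y [y1 y2]; exact: one.
Qed.

Variables (u : 'rV[R]_n -> R) (g : 'rV[R]_n -> 'rV[R]_n).
Hypotheses (mu_u : mf u) (mg : forall i, mf (fun z => g z 0 i)) (u0 : forall z, 0 <= u z).
Hypotheses (uE : forall z, ~ in_domain z -> u z = 0) (gE : forall z, ~ in_domain z -> g z = 0).
Hypothesis Hwg : forall chi, adm chi -> WG (fun z => chi z * u z)
  (fun z => chi z *: g z + u z *: grad chi z).
Hypothesis Hg : forall s, s < 2 * r -> exists b : R, (II (fun z => Bl x0 s z * (enorm (g z)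
  ^+ 2 * w z))%R <= b%:E)%E.

Lemma wg_eq (v v' : 'rV[R]_n -> R) (G G' : 'rV[R]_n -> 'rV[R]_n) : v =1 v' -> G =1 G' -> WG v G ->
  WG v' G'.
Proof. by move=> /funext -> /funext ->. Qed.

(** With a second cut-off [chi1] equal to 1 on the support of [chi], the function is [chi] times [S]
    of [chi1 * u]; the latter has a weak gradient on the whole space, to which [wg_chain] and
    [wg_mul] apply. *)
Lemma wg_local chi M S S' : adm chi -> C11 M S S' ->
  WG (fun z => chi z * S (u z)) (fun z => (chi z * S' (u z)) *: g z + S (u z) *: grad chi z).
Proof.
move=> achi CS; have [cchi [e e0 He]] := achi; have [S0 _ _ _] := CS.
have [chi1 achi1 H1] := adm_cut e0.
have one z : chi z != 0 -> chi1 z = 1 by move=> /He[h1 h2]; exact: H1.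
have onep i z : partial i chi z != 0 -> chi1 z = 1.
  by move=> /(adm_partial_supp He)[h1 h2]; exact: H1.
have gone z : chi z != 0 -> grad chi1 z = 0.
  move=> cz; apply/rowP => i; rewrite !mxE.
  rewrite (partial_open_eq i (open_neq0_cont (smooth_continuous cchi.1)) (h := fun=> 1))
    ?partial_cst//.
have far z : enorm x0 + 2 * r < enorm z -> chi1 z = 0.
  move=> zr; apply/eqP/negPn/negP => /(adm0_supp (adm_adm0 achi1)) h.
  by have := enorm_tri z x0 0; rewrite !subr0; move: zr h => ? ? ?; lra.
have gfar z : enorm x0 + 2 * r < enorm z -> grad chi1 z = 0.
  move=> zr; apply/rowP => i; rewrite !mxE.
  apply/eqP/negPn/negP => /(adm0_supp (adm0_partial i (adm_adm0 achi1))) h.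
  by have := enorm_tri z x0 0; rewrite !subr0; move: zr h => ? ? ?; lra.
have W1 := @wg_chain _ _ _ _ M S S' (enorm x0 + 2 * r) n0 (Hwg achi1) _ _ CS.
apply: (wg_eq _ _ (wg_mul cchi (W1 _ _))).
- move=> z /=; have [->|cz] := eqVneq (chi z) 0; first by rewrite !mul0r.
  by rewrite one// mul1r.
- move=> z /=; congr (_ + _).
    have [->|cz] := eqVneq (chi z) 0; first by rewrite mul0r !scale0r.
    by rewrite one// gone// mul1r scale1r scaler0 addr0 scalerA.
  apply/rowP => i; rewrite !mxE; have [->|pz] := eqVneq (partial i chi z) 0;
    first by rewrite !mulr0.
  by rewrite (onep i)// mul1r.
- by move=> z /far ->; rewrite mul0r.
- by move=> z zr; rewrite far// gfar// scale0r scaler0 addr0.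
Qed.

Lemma weight_lbE z : in_domain z -> (2 * r) `^ (d + 1 - n%:R) <= w z.
Proof.
move=> [zx Gz]; apply: weight_lb => //; first exact: dist_gt0.
by rewrite (le_trans (dist_le G0 z Gx0))// ltW.
Qed.

(** In the ball delta <= 2 r, and [w] is a decreasing function of delta, so weighted integrals
    control unweighted ones. *)
Lemma sqr_le_weight (f : 'rV[R]_n -> R) z : (~ in_domain z -> f z = 0) -> 0 <= f z ->
  f z <= (2 * r) `^ (n%:R - d - 1) * (f z * w z).
Proof.
move=> fE f0; have [zE|zE] := pselect (in_domain z); last by rewrite fE// mul0r mulr0.
rewrite mulrCA ler_peMr//; have := weight_lbE zE.
rewrite (_ : d + 1 - n%:R = - (n%:R - d - 1)); last by ring.
by rewrite powRN => h; rewrite mulrC -ler_pdivrMr ?powR_gt0 ?mulr_gt0// div1r.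
Qed.

Let mE := mf_enormG mg.

Lemma Iable_g s i : 0 <= s -> s < 2 * r -> Iable (fun z => Bl x0 s z * g z 0 i).
Proof.
move=> s0 sr; have [b Hb] := Hg sr; have mB := mf_Bl x0 s; have mw := mf_weight d G0.
have mgi := mg i.
have c0 : 0 <= (2 * r) `^ (n%:R - d - 1) by exact: powR_ge0.
have I1 : Iable (fun z => Bl x0 s z * (enorm (g z) ^+ 2 * w z)).
  apply/IableP; split; first by meas_auto.
  rewrite (II_eq (g := fun z => Bl x0 s z * (enorm (g z) ^+ 2 * w z))); last by move=> z;
    rewrite ger0_norm//; nonneg.
  exact: le_lt_trans Hb (ltry _).
apply: (@Iable_le _ _ _ (fun z => Bl x0 s z + (2 * r) `^ (n%:R - d - 1)
  * (Bl x0 s z * (enorm (g z) ^+ 2 * w z)))).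
- by meas_auto.
- move=> z; rewrite normrM (ger0_norm (Bl_ge0 _ _ _)) mulrCA -[X in X + _]mulr1 -mulrDr.
  apply: ler_wpM2l => //; have h1 := coord_le_enorm (g z) i.
  have h2 : enorm (g z) ^+ 2 <= (2 * r) `^ (n%:R - d - 1) * (enorm (g z) ^+ 2 * w z).
    by apply: (@sqr_le_weight (fun z => enorm (g z) ^+ 2)); [move=> /gE ->;
      rewrite enorm0 expr0n|exact: sqr_ge0].
  rewrite (le_trans h1)// (le_trans _ (lerD (lexx 1) h2))//.
  by have := enorm_ge0 (g z); nra.
- by apply: IableD; [exact: Iable_Bl|exact: IableZ].
Qed.

(** The start at r / 2 ensures [4 * epsk k <= 2 * r], as the volume bound inside [wg_cross]
    requires. *)
Definition epsk (k : nat) : R := r / 2 / 2 ^+ k.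

Lemma epsk_gt0 k : 0 < epsk k. Proof. by rewrite /epsk; posit. Qed.

Lemma epsk_le k : epsk k <= r / 2.
Proof. by rewrite /epsk ler_pdivrMr ?exprn_gt0// ler_peMr ?divr_ge0 ?(ltW r0)// exprn_ege1//
  ler1n. Qed.

Lemma eta_seq : exists2 C : R, 0 < C & exists eta : nat -> 'rV[R]_n -> R, forall k,
  [/\ smooth (eta k),
  forall z, 0 <= eta k z <= 1, forall z, delta z <= epsk k -> eta k z = 0,
  forall z, enorm (z - x0) < 2 * r -> 3 * epsk k < delta z -> eta k z = 1 &
  forall i z, enorm (z - x0) < 2 * r -> `|partial i (eta k) z|
    <= C / epsk k * (epsk k <= delta z <= 3 * epsk k)%R%:R].
Proof.
have [C C00 HC] := eta_ex; exists C => //.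
have er k : epsk k <= r by have := epsk_le k; move: r0 => ? ?; lra.
by have [eta Heta] := choice (fun k => HC (epsk k) (epsk_gt0 k) (er k)); exists eta.
Qed.

Lemma eta_lim (eta : nat -> 'rV[R]_n -> R) z :
  (forall k z, enorm (z - x0) < 2 * r -> 3 * epsk k < delta z -> eta k z = 1) ->
  in_domain z -> \forall k \near \oo, eta k z = 1.
Proof.
move=> H [zx Gz]; have z0 : 0 < delta z by exact: dist_gt0.
have d30 : 0 < delta z / 3 by rewrite divr_gt0.
have [N HN] := half_pow_lt (r / 2) d30.
exists N => // k /= Nk; apply: H => //; rewrite mulrC -ltr_pdivlMr//; apply: le_lt_trans HN.
have r2 : 0 < r / 2 by rewrite divr_gt0.
by rewrite /epsk ler_pM2l// lef_pV2 ?posrE ?exprn_gt0// ler_eXn2l// ltr1n.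
Qed.

Lemma RI_eta_lim (eta : nat -> 'rV[R]_n -> R) f : (forall k, smooth (eta k)) ->
  (forall k z, 0 <= eta k z <= 1) ->
  (forall k z, enorm (z - x0) < 2 * r -> 3 * epsk k < delta z -> eta k z = 1) ->
  Iable f -> (forall z, ~ in_domain z -> f z = 0) ->
  RI (fun z => eta k z * f z) @[k --> \oo] --> RI f.
Proof.
move=> se e01 e1 If fE; have mff := Iable_mf If.
apply: (@RI_dct _ _ _ _ (fun z => `|f z|)).
- by move=> k; apply: mfM => //; exact: mf_smooth.
- by [].
- exact: Iable_norm.
- apply: aeW => z; have [zE|zE] := pselect (in_domain z); last first.
    rewrite fE// (_ : (fun _ => _) = fun=> 0); first exact: cvg_cst.
    by apply/funext => k; rewrite mulr0.
  apply/cvgrPdist_le => e e0; apply: filterS (eta_lim e1 zE) => k ->.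
  by rewrite mul1r subrr normr0 ltW.
- move=> k z; rewrite normrM ler_piMl//; have /andP[h1 h2] := e01 k z.
  by rewrite ger0_norm.
Qed.

Lemma adm_eta eta phi eps : 0 < eps -> smooth eta -> (forall z, delta z <= eps -> eta z = 0) ->
  adm0 phi -> adm (fun z => eta z * phi z).
Proof.
move=> eps0 se e0 [cphi [e ep He]]; split; first exact: cc_mul.
exists (Num.min e eps); first by rewrite lt_min ep eps0.
move=> z; rewrite mulf_eq0 negb_or => /andP[ez pz]; split.
  by rewrite (le_trans (He z pz))// lerD2l lerN2 ge_min lexx.
rewrite ge_min; apply/orP; right; rewrite leNgt; apply/negP => /ltW/e0 e1.
by rewrite e1 eqxx in ez.
Qed.

Lemma grad_crossIE phi M S S' z : C11 M S S' -> ~ in_domain z -> adm0 phi ->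
  (phi z * S' (u z)) *: g z + S (u z) *: grad phi z = 0.
Proof.
move=> [S0 _ _ _] zE aphi; rewrite gE// scaler0 add0r uE// S0 scale0r//.
Qed.

(* The boundary term is at most [C / e] times the volume [C e ^ (n - d)] of the [3 e]-neighbourhood
   of [Gamma], and [n - d > 1]. *)
Lemma wg_cross phi M S S' B : adm0 phi -> C11 M S S' -> (forall t, `|S t| <= B) ->
  WG (fun z => phi z * S (u z)) (fun z => (phi z * S' (u z)) *: g z + S (u z) *: grad phi z).
Proof.
move=> aphi CS SB; have [cphi [e ep He]] := aphi; have [S0 S'M _ _] := CS.
have [mSu mS'u] := mf_C11 CS mu_u.
have mphi : mf phi by apply: mf_smooth; case: cphi.
have mpphi i : mf (partial i phi) by apply: mf_smooth; apply: smooth_partial; case: cphi.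
have [P P0 pP] := cc_bounded cphi; have B0 : 0 <= B by exact: le_trans (SB 0).
have M0 := C11_ge0 CS.
have Iv : Iable (fun z => phi z * S (u z)) by exact: Iable_mulb (cc_Iable cphi) mSu (fun z => SB _).
pose G i z := phi z * S' (u z) * g z 0 i + S (u z) * partial i phi z.
have GE i : (fun z => ((phi z * S' (u z)) *: g z + S (u z) *: grad phi z) 0 i) = G i.
  by apply/funext => z; rewrite !mxE.
have IG i : Iable (G i).
  apply: IableD; last first.
    have := Iable_mulb (cc_Iable (cc_partial i cphi)) mSu (fun z => SB _).
    by congr Iable; apply/funext => z; rewrite mulrC.
  pose s := Num.max 0 (2 * r - e / 2).
  have s0 : 0 <= s by rewrite le_max lexx.
  have sr : s < 2 * r by rewrite gt_max mulr_gt0//=; move: ep r0 => ? ?; lra.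
  have bb z : `|phi z * S' (u z)| <= P * M by rewrite normrM ler_pM.
  have := Iable_mulb (Iable_g i s0 sr) (mfM mphi mS'u) bb.
  congr Iable; apply/funext => z; rewrite mulrC mulrA.
  have [->|pz] := eqVneq (phi z) 0; first by rewrite !mul0r.
  rewrite /Bl (_ : _ < _ = true) ?mulr1//; apply: le_lt_trans (He z pz) _.
  by rewrite lt_max; apply/orP; right; move: ep => ?; lra.
have GzE i z : ~ in_domain z -> G i z = 0.
  by move=> zE; rewrite /G gE// uE// S0 mxE mulr0 mul0r addr0.
split => //; first by move=> i; rewrite GE.
move=> psi cpsi i; rewrite (_ : (fun z => _ * psi z) = fun z => G i z * psi z); last first.
  by apply/funext => z; rewrite -GE.
have [Q Q0 pQ] := cc_bounded cpsi; have [Q' Q'0 pQ'] := cc_bounded (cc_partial i cpsi).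
have mpsi : mf psi by apply: mf_smooth; case: cpsi.
have mppsi : mf (partial i psi) by apply: mf_smooth; apply: smooth_partial; case: cpsi.
have I1 : Iable (fun z => phi z * S (u z) * partial i psi z) by exact: Iable_mulb Iv mppsi pQ'.
have I2 : Iable (fun z => G i z * psi z) by exact: Iable_mulb (IG i) mpsi pQ.
have [C C00 [eta Heta]] := eta_seq.
have se k : smooth (eta k) by have [] := Heta k.
have e01 k z : 0 <= eta k z <= 1 by have [_ h _ _ _] := Heta k; exact: h.
have ez k z : delta z <= epsk k -> eta k z = 0 by have [_ _ h _ _] := Heta k; exact: h.
have e1 k z : enorm (z - x0) < 2 * r -> 3 * epsk k < delta z -> eta k z = 1.
  by have [_ _ _ h _] := Heta k; exact: h.
have pe k z : enorm (z - x0) < 2 * r -> `|partial i (eta k) z|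
  <= C / epsk k * (epsk k <= delta z <= 3 * epsk k)%R%:R.
  by have [_ _ _ _ h] := Heta k; exact: h.
have I1E z : ~ in_domain z -> phi z * S (u z) * partial i psi z = 0 by move=> zE;
  rewrite uE// S0 mulr0 mul0r.
have I2E z : ~ in_domain z -> G i z * psi z = 0 by move=> zE; rewrite GzE// mul0r.
have L1 := RI_eta_lim se e01 e1 I1 I1E.
have L2 := RI_eta_lim se e01 e1 I2 I2E.
pose Z k z := S (u z) * phi z * partial i (eta k) z * psi z.
pose a := n%:R - d - 1; have a0 : 0 < a by rewrite /a; move: dn => ?; lra.
pose c := B * P * Q * C * (@vol_cst R n d C0 * (4 `^ (n%:R - d) * (2 * r) `^ d)) * (r / 2) `^ a.
have Zb k : Iable (Z k) /\ `|RI (Z k)| <= c * (2 `^ (- a)) ^+ k.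
  have ek := epsk_gt0 k; have ek4 : 0 < 4 * epsk k by rewrite mulr_gt0.
  pose D : set 'rV[R]_n := eball x0 (2 * r) `&` [set z | delta z < 4 * epsk k].
  have mD : measurable (D : set X).
    by apply: measurableI; [exact: measurable_eball|apply: mf_setlt; exact: mf_dist].
  have mD1 : mf (\1_D) by exact: mf_indic.
  have ID : (II (\1_D)%R <= (@vol_cst R n d C0 * ((4 * epsk k) `^ (n%:R - d) * (2 * r) `^ d))%:E)%E.
    rewrite II_indic//.
    have e2r : 4 * epsk k <= 2 * r by have := epsk_le k; move: r0 => ? ?; lra.
    exact: (mu_layer_le d0 C01 G0 AR Gx0 ek4 e2r).
  have c10 : 0 <= B * P * Q * (C / epsk k) by nonneg.
  have Zle z : `|Z k z| <= B * P * Q * (C / epsk k) * \1_D z.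
    have [pz|pz] := eqVneq (phi z) 0.
      by rewrite /Z pz mulr0 !mul0r normr0; apply: mulr_ge0 => //; rewrite indicE.
    have zx := adm0_supp aphi pz; have := pe k z zx.
    rewrite /Z !normrM indicE => h.
    have h2 : (epsk k <= delta z <= 3 * epsk k)%R%:R <= (z \in D)%:R :> R.
      rewrite ler_nat; case: (z \in D) / (boolP (z \in D)) => [_|zD]; first by case: (_ && _).
      rewrite leqn0 eqb0; apply: contra zD => /andP[_ h3]; rewrite inE; split => //=.
      by move: h3 ek => ? ?; lra.
    have h1 := SB (u z); have h3 := pP z; have h4 := pQ z.
    have h5 : `|partial i (eta k) z| <= C / epsk k * (z \in D)%:R.
      by apply: (le_trans h); apply: ler_wpM2l h2; rewrite divr_ge0 ?ltW.
    have -> : B * P * Q * (C / epsk k) * (z \in D)%:R = B * P * (C / epsk k * (z \in D)%:R)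
      * Q by ring.
    by do 3 ?[apply: ler_pM => //]; do ?[apply: mulr_ge0 => //].
  have mZ : mf (Z k).
    by have := mf_smooth (smooth_partial i (se k)) => mpe; rewrite /Z; meas_auto.
  have IZ : (II (fun z => `|Z k z|)%R <= (c * (2 `^ (- a)) ^+ k)%:E)%E.
    apply: (@le_trans _ _ (II (fun z => B * P * Q * (C / epsk k) * \1_D z)%R)).
      by apply: II_le => //; meas_auto.
    apply: le_trans (II_scale_le mD1 _ c10 ID) _; first by move=> z; rewrite indicE.
    rewrite lee_fin; apply: eq_ler; rewrite /c.
    rewrite -!mulrA; do 3! congr (_ * _); rewrite -powR_dyadic; last by posit.
    rewrite -/(epsk k) (powRM _ _ (ltW ek))//.
    have -> : epsk k `^ (n%:R - d) = epsk k * epsk k `^ a.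
      have <- : 1 + a = n%:R - d by rewrite /a; ring.
      by rewrite powR_add// powRr1 ?ltW.
    by field; rewrite gt_eqF.
  have IaZ : Iable (Z k) by apply/IableP; split => //; exact: le_lt_trans IZ (ltry _).
  by split => //; exact: RI_norm_le IaZ IZ.
have XY k : RI (fun z => eta k z * (phi z * S (u z) * partial i psi z)) +
   RI (fun z => eta k z * (G i z * psi z)) = - RI (Z k).
  have [_ _ /(_ _ cpsi i)] := wg_local (adm_eta (epsk_gt0 k) (se k) (ez k) aphi) CS.
  rewrite (_ : (fun z => _ * partial i psi z) = (fun z => eta k z * (phi z * S (u z)
    * partial i psi z))); last first.
    by apply/funext => z; ring.
  rewrite (_ : (fun z => _ * psi z) = (fun z => eta k z * (G i z * psi z) + Z k z)); last first.
    apply/funext => z; rewrite !mxE partial_mul//; last exact: cphi.1.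
    by rewrite /G /Z; ring.
  rewrite RID//; last by have [] := Zb k.
    by move=> ->; ring.
  have mek := mf_smooth (se k).
  have eb z : `|eta k z| <= 1 by have /andP[h1 h2] := e01 k z; rewrite ger0_norm.
  by have := Iable_mulb I2 mek eb; congr Iable; apply/funext => z; rewrite mulrC.
apply/eqP; rewrite -subr_eq0 opprK -normr_le0.
have q1 : `|2 `^ (- a)| < 1 by rewrite ger0_norm ?powR_ge0// powR2_lt1// oppr_lt0.
have L3 : (c * (2 `^ (- a)) ^+ k) @[k --> \oo] --> c * 0 by exact: cvgMl_tmp (cvg_expr q1).
move: L1 L2 XY; set A := fun k => RI (fun z => eta k z * (phi z * S (u z) * _ z));
  set B' := fun k => RI (fun z => eta k z * (G i z * psi z)) => L1 L2 XY.
have L4 : `|A k + B' k| @[k --> \oo] --> `|RI (fun z => phi z * S (u z) * partial i psi z)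
  + RI (fun z => G i z * psi z)|.
  by apply: cvg_norm; exact: cvgD.
rewrite mulr0 in L3; apply: (ler_cvg_to L4 L3); apply: nearW => k.
by rewrite [X in `|X|](XY k) normrN; have [_] := Zb k.
Qed.

(** * Testing the equation; the Caccioppoli inequality up to [Gamma] *)

Variables (Yb : R) (F : 'rV[R]_n -> 'rV[R]_n) (C1 : R).
Hypothesis Hu : (II (fun z => u z ^+ 2 * w z)%R <= Yb%:E)%E.
Hypothesis Htr : hausdorff d [set xi | [/\ Gamma xi, enorm (xi - x0)
  < 2 * r & ~ trace0 u xi]] = 0%E.
Hypotheses (mF : forall i, mf (fun z => F z 0 i)) (C1_ge1 : 1 <= C1).
Hypothesis F_le : forall z, enorm (F z) <= C1 * w z * enorm (g z).
Hypothesis F_ge : forall z, C1^-1 * w z * enorm (g z) ^+ 2 <= dot (F z) (g z).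
Hypothesis F_sub : forall chi, adm chi -> (forall z, 0 <= chi z) -> RI (fun z => dot (F z)
  (grad chi z)) <= 0.

Let mw := mf_weight d G0.

Lemma Iable_u : Iable u.
Proof.
have c0 : 0 <= (2 * r) `^ (n%:R - d - 1) by exact: powR_ge0.
have r20 : 0 <= 2 * r by rewrite mulr_ge0// ltW.
apply: (@Iable_le _ _ _ (fun z => Bl x0 (2 * r) z + (2 * r) `^ (n%:R - d - 1) * (u z ^+ 2 * w z)))
  => //.
  move=> z; rewrite ger0_norm//; have [zE|zE] := pselect (in_domain z); last first.
    by rewrite uE//; apply: addr_ge0 => //; nonneg.
  have [zx _] := zE; rewrite /Bl zx /=.
  have h : u z ^+ 2 <= (2 * r) `^ (n%:R - d - 1) * (u z ^+ 2 * w z).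
    by apply: (@sqr_le_weight (fun z => u z ^+ 2)); [|exact: sqr_ge0].
  by apply: le_trans (lerD (lexx 1) h); have := u0 z; nra.
apply: IableD; first exact: Iable_Bl.
apply: IableZ; apply: Iable_nonneg Hu; [by meas_auto|by move=> z; nonneg].
Qed.

(** Averages of |v| are at most [c] times those of [u]. At points of [Gamma] outside the open ball
    [v] vanishes nearby, because the support of [phi] keeps a distance [e] from the sphere. *)
Lemma trace0_mul phi (v : 'rV[R]_n -> R) c : adm0 phi -> mf v -> 0 <= c -> (forall z, `|v z|
  <= c * u z) ->
  (forall z, phi z = 0 -> v z = 0) -> hausdorff d [set xi | Gamma xi /\ ~ trace0 v xi] = 0%E.
Proof.
move=> [cphi [e ep He]] mv c0 vu vphi; apply/eqP; rewrite eq_le hausdorff_ge0 andbT -Htr.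
apply: hausdorffS => // xi [Gxi ntr]; split => //.
  rewrite ltNge; apply/negP => hx; apply: ntr => eps eps0; exists e => // s s0 se.
  rewrite /ballavg (_ : (fun _ => _) = fun=> 0) ?RI0 ?mulr0 ?normr0 ?ltW//.
  apply/funext => z; have [pz|pz] := eqVneq (phi z) 0; first by rewrite vphi// mul0r.
  rewrite /Bl; have := He z pz; have := enorm_tri xi z x0; rewrite (enorm_distC xi z).
  by case: ltP => h h1 h2; rewrite ?mulr0//; move: h h1 h2 hx se => ? ? ? ? ?; lra.
move=> tru; apply: ntr => eps eps0.
have ec : 0 < eps / (c + 1) by rewrite divr_gt0// ltr_wpDl.
have [s0 s00 Hs] := tru _ ec; exists s0 => // s sp ss0.
have mB := mf_Bl xi s.
have IuB : Iable (fun z => u z * Bl xi s z).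
  by apply: (Iable_mulb (M := 1) Iable_u mB) => z; rewrite ger0_norm// Bl_le1.
have vB z : `|v z * Bl xi s z| <= c * (u z * Bl xi s z).
  by rewrite normrM (ger0_norm (Bl_ge0 _ _ _)) mulrA; apply: ler_wpM2r.
have IvB : Iable (fun z => v z * Bl xi s z).
  by apply: (Iable_le _ vB); [meas_auto|exact: IableZ].
have b0 := ball_vol_gt0 n0 sp.
have h1 : `|ballavg v xi s| <= c * ballavg u xi s.
  rewrite /ballavg normrM gtr0_norm ?invr_gt0// mulrCA; apply: ler_wpM2l;
    first by rewrite invr_ge0 ltW.
  apply: le_trans (RI_norm IvB) _; rewrite -RIZ//; apply: RI_le => //;
    [exact: Iable_norm|exact: IableZ].
apply: le_trans h1 _; have := ler_norm (ballavg u xi s); have := Hs s sp ss0.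
rewrite ler_pdivlMr ?ltr_wpDl// => h2 h3.
have a0 : 0 <= ballavg u xi s by rewrite /ballavg mulr_ge0 ?invr_ge0 ?(ltW b0)//;
  apply: RI_ge0 => z; exact: mulr_ge0.
by rewrite ger0_norm// in h2; move: h2; rewrite mulrDr mulr1 mulrC => ?; lra.
Qed.

(** [F_sub] concerns smooth test functions, so [tau] is mollified. Near the supports [w] is bounded,
    hence the flux is square integrable there, and the mollified gradients converge in L^2. *)
Lemma sub_test tau (G : 'rV[R]_n -> 'rV[R]_n) (e : R) : 0 < e -> WG tau G -> (forall z,
  0 <= tau z) ->
  (forall z, tau z != 0 -> enorm (z - x0) <= 2 * r - e /\ e <= delta z) ->
  (forall z, G z != 0 -> enorm (z - x0) <= 2 * r - e /\ e <= delta z) ->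
  (forall i, Iable (fun z => G z 0 i ^+ 2)) -> Iable (fun z => dot (F z) (G z))
    /\ RI (fun z => dot (F z) (G z)) <= 0.
Proof.
move=> e0 Hwgt tau0 tauS GS IG2.
have e20 : 0 < e / 2 by rewrite divr_gt0.
(* Cuts the flux down to a compact set slightly larger than the supports; there delta >= e / 2, so
   that [w <= cw]. *)
pose K z : R := ((enorm (z - x0) <= 2 * r - e / 2) && (e / 2 <= delta z))%R%:R.
have mK : mf K.
  by apply: mf_band; apply: mf_ble; rewrite ?/mf; try (exact: mf_enorm || exact: mf_dist ||
    exact: mfC).
have K1 z : enorm (z - x0) <= 2 * r - e / 2 -> e / 2 <= delta z -> K z = 1 by rewrite /K => -> ->.
have K0 z : 0 <= K z by rewrite /K.
have [b Hb] := Hg (s := 2 * r - e / 4) ltac:(by move: e0 => ?; lra).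
pose cw := (e / 2) `^ (d + 1 - n%:R).
pose FK i z := F z 0 i * K z.
have IFK2 i : Iable (fun z => FK i z ^+ 2).
  have mFi := mF i; have mB := mf_Bl x0 (2 * r - e / 4).
  have IB : Iable (fun z => Bl x0 (2 * r - e / 4) z * (enorm (g z) ^+ 2 * w z)).
    by apply: Iable_nonneg Hb; [meas_auto|move=> z; nonneg].
  apply: (@Iable_le _ _ _ (fun z => C1 ^+ 2 * cw * (Bl x0 (2 * r - e / 4) z * (enorm (g z)
    ^+ 2 * w z)))).
  - by rewrite /FK; meas_auto.
  - move=> z; rewrite ger0_norm ?sqr_ge0// /FK.
    have [kz|kz] := boolP ((enorm (z - x0) <= 2 * r - e / 2) && (e / 2 <= delta z)); last first.
      have -> : F z 0 i * K z = 0 by rewrite /K (negbTE kz) mulr0.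
      have cw0 : 0 <= cw by exact: powR_ge0.
      rewrite expr0n/=; apply: mulr_ge0; apply: mulr_ge0 => //; first exact: sqr_ge0.
      by apply: mulr_ge0; [exact: sqr_ge0|exact: weight_ge0].
    have /andP[k1 k2] := kz; rewrite K1// mulr1.
    rewrite /Bl (_ : _ < _ = true); last by move: k1 e0 => ? ?; lra.
    rewrite mul1r; have h1 := coord_le_enorm (F z) i; have h2 := F_le z.
    have h3 : w z <= cw by apply: weight_ub.
    apply: (@le_trans _ _ ((C1 * w z * enorm (g z)) ^+ 2)).
      by rewrite -[X in X <= _]real_normK ?num_real// ler_sqr ?nnegrE ?(le_trans h1)//;
        exact: le_trans (enorm_ge0 _) h2.
    have -> : (C1 * w z * enorm (g z)) ^+ 2 = C1 ^+ 2 * (w z * (enorm (g z) ^+ 2 * w z)) by ring.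
    rewrite -mulrA; apply: ler_wpM2l; first exact: sqr_ge0.
    by apply: ler_wpM2r => //; have := weight_ge0 d Gamma z => ?; nonneg.
  - exact: IableZ.
have mG i : mf (fun z => G z 0 i) by have [_ h _] := Hwgt; exact: Iable_mf (h i).
have mFK i : mf (FK i) by have := mF i => ?; rewrite /FK; meas_auto.
have GK z : G z = K z *: G z.
  have [->|Gz] := eqVneq (G z) 0; first by rewrite scaler0.
  by have [h1 h2] := GS z Gz; rewrite K1 ?scale1r//; move: h1 h2 e0 => ? ? ?; lra.
pose Cv h i := conv (fun z => G z 0 i) (rho h).
have IG i : Iable (fun z => G z 0 i) by have [_ h _] := Hwgt.
have far z : enorm x0 + 2 * r < enorm z -> G z = 0.
  move=> zr; apply/eqP/negPn/negP => /GS[h _].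
  by have := enorm_tri z x0 0; rewrite !subr0; move: zr h e0 => ? ? ? ?; lra.
have farG i z : enorm x0 + 2 * r < enorm z -> G z 0 i = 0 by move=> /far ->; rewrite mxE.
have mCv h i : 0 < h -> mf (Cv h i) by move=> h0; exact: mf_conv.
have IFG i : Iable (fun z => FK i z * G z 0 i) by apply: Iable_mul2.
have near2 i (eps : R) : 0 < eps -> exists2 s, 0 < s & forall h, 0 < h -> h < s ->
    Iable (fun z => (Cv h i z - G z 0 i) ^+ 2) /\ RI (fun z => (Cv h i z - G z 0 i) ^+ 2) <= eps.
  move=> eps0; have [s s0 Hs] := conv_L2 n0 (IG i) (farG i) (IG2 i) eps0.
  exists s => // h h0 hs; have B := Hs h h0 hs; have mc := mCv h i h0; have mGi := mG i.
  have m2 : mf (fun z => (Cv h i z - G z 0 i) ^+ 2) by meas_auto.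
  split; first by apply: Iable_nonneg B => // z; exact: sqr_ge0.
  by apply: RI_le_II B => // z; exact: sqr_ge0.
have Icv i : \forall h \near 0^'+, Iable (fun z => FK i z * Cv h i z).
  have [s s0 Hs] := near2 i 1 ltr01; near=> h.
  have h0 : 0 < h by near: h; exact: nbhs_right_gt.
  have hs : h < s by near: h; exact: nbhs_right_lt.
  have [I2 _] := Hs h h0 hs; have mc := mCv h i h0; have mGi := mG i.
  have := IableD (Iable_mul2 (mFK i) (mfB mc mGi) (IFK2 i) I2) (IFG i).
  by congr Iable; apply/funext => z; ring.
have L i : RI (fun z => FK i z * Cv h i z) @[h --> 0^'+] --> RI (fun z => FK i z * G z 0 i).
  apply/cvgrPdist_le => eps eps0; have A0 : 0 <= RI (fun z => FK i z ^+ 2) by apply: RI_ge0 => z;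
    exact: sqr_ge0.
  (* The weight in Young's inequality that makes each of its two terms at most [eps / 2]. *)
  pose t := eps / (RI (fun z => FK i z ^+ 2) + 1).
  have t0 : 0 < t by rewrite divr_gt0// ltr_wpDl.
  have [s s0 Hs] := near2 i (t * eps) (mulr_gt0 t0 eps0); near=> h.
  have h0 : 0 < h by near: h; exact: nbhs_right_gt.
  have hs : h < s by near: h; exact: nbhs_right_lt.
  have [I2 h2] := Hs h h0 hs; have mc := mCv h i h0; have mGi := mG i.
  have Ih : Iable (fun z => FK i z * Cv h i z) by near: h; exact: Icv.
  rewrite distrC -RIB// (_ : (fun z => _) = (fun z => FK i z * (Cv h i z - G z 0 i)));
    last by apply/funext => z; ring.
  apply: le_trans (RI_mul2_le t0 (mFK i) (mfB mc mGi) (IFK2 i) I2) _.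
  have h3 : t^-1 * RI (fun z => (Cv h i z - G z 0 i) ^+ 2) <= eps by rewrite ler_pdivrMl.
  have h4 : t * RI (fun z => FK i z ^+ 2) <= eps.
    by rewrite /t -mulrA ler_piMr ?(ltW eps0)// mulrC ler_pdivrMr ?ltr_wpDl// mul1r lerDl.
  by move: h3 h4; rewrite /=; lra.
have FGE : (fun z => dot (F z) (G z)) = fun z => \sum_i FK i z * G z 0 i.
  apply/funext => z; rewrite [in LHS]GK; apply: eq_bigr => i _.
  by rewrite mxE /FK; ring.
rewrite FGE; split; first exact: Iable_sum.
rewrite RI_sum//.
have Ls : \sum_i RI (fun z => FK i z * Cv h i z) @[h --> 0^'+] -->
  \sum_i RI (fun z => FK i z * G z 0 i).
  by apply: cvg_big => [|i _]; [exact: add_continuous|exact: L].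
apply: (cvgr_to_le Ls).
have Iall : \forall h \near 0^'+, forall i, Iable (fun z => FK i z * Cv h i z)
  by apply: filter_forall.
near=> h.
have h0 : 0 < h by near: h; exact: nbhs_right_gt.
have he : h < e / 2 by near: h; exact: nbhs_right_lt.
have Ih : forall i, Iable (fun z => FK i z * Cv h i z) by near: h.
pose th := conv tau (rho h).
have thS z : th z != 0 -> enorm (z - x0) <= 2 * r - e / 2 /\ e / 2 <= delta z.
  move=> tz; have [y yz ty] : exists2 y, enorm (y - z) < h & tau y != 0.
    apply: contrapT => H; move/eqP: tz; apply; apply: (conv_rho_supp h0) => y yz.
    by apply/eqP/negPn/negP => ty; apply: H; exists y.
  have [h1 h2] := tauS y ty; have := enorm_tri z y x0; have := dist_lip G0 y z;
    rewrite (enorm_distC z y).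
  by move: yz h1 h2 he => ? ? ? ? ? ?; lra.
have ath : adm th.
  split; last by exists (e / 2).
  split; first exact: wg_conv_smooth Hwgt h0.
  exists (enorm x0 + 2 * r) => z zr; apply/eqP/negPn/negP => /thS[h1 _].
  by have := enorm_tri z x0 0; rewrite !subr0; move: zr h1 e0 => ? ? ? ?; lra.
have th0 z : 0 <= th z by exact: conv_rho_ge0.
apply: le_trans (F_sub ath th0); rewrite -RI_sum//; apply: eq_ler; congr RI; apply/funext => z.
apply: eq_bigr => i _; rewrite mxE (wg_partial_conv i z Hwgt h0) -/(Cv h i z) /FK.
have [->|cz] := eqVneq (Cv h i z) 0; first by rewrite !mulr0.
have [k1 k2] : enorm (z - x0) <= 2 * r - e / 2 /\ e / 2 <= delta z.
  have pz : partial i th z != 0 by rewrite (wg_partial_conv i z Hwgt h0).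
  exact: adm_partial_supp thS _ pz.
by rewrite K1// mulr1.
Unshelve. all: by end_near.
Qed.

Lemma mf_pos k : mf (fun z => pos k (u z)).
Proof.
have -> : (fun z => pos k (u z)) = fun z => (k < u z)%R%:R * (u z - k).
  apply/funext => z; have [h|h] := leP (u z) k; first by rewrite pos0// mul0r.
  by rewrite posE ?ltW// mul1r.
have mk : mf (fun z => (k < u z)%R%:R : R) by apply: mf_blt => //; exact: mfC.
by meas_auto.
Qed.

Lemma mf_grad phi i : cc phi -> mf (fun z => grad phi z 0 i).
Proof.
move=> cphi; rewrite (_ : (fun z => _) = partial i phi); last by apply/funext => z; rewrite mxE.
by apply: mf_smooth; apply: smooth_partial; case: cphi.
Qed.

Lemma grad_bounded phi : cc phi -> exists2 Q, 0 <= Q & forall z, enorm (grad phi z) ^+ 2 <= Q.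
Proof.
move=> cphi; have [M M0 HM] := cc_partial_bounded cphi; exists (n%:R * M ^+ 2); first by nonneg.
move=> z; rewrite sqr_enorm_coord -[n in n%:R]card_ord -sum1_card natr_sum mulr_suml.
by apply: ler_sum => i _; rewrite mul1r mxE -real_normK ?num_real// ler_sqr ?nnegrE.
Qed.

Lemma enormD_sqr (a b : 'rV[R]_n) : enorm (a + b) ^+ 2 <= 2 * enorm a ^+ 2 + 2 * enorm b ^+ 2.
Proof.
apply: (@le_trans _ _ ((enorm a + enorm b) ^+ 2)).
  by rewrite ler_sqr ?nnegrE ?enormD ?enorm_ge0// addr_ge0 ?enorm_ge0.
by have := sqr_ge0 (enorm a - enorm b); nra.
Qed.

Lemma adm0_Bl phi : adm0 phi -> exists s, [/\ 0 <= s, s < 2 * r & forall z, phi z != 0 ->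
  Bl x0 s z = 1].
Proof.
move=> [_ [e e0 He]]; exists (Num.max 0 (2 * r - e / 2)); split.
- by rewrite le_max lexx.
- by rewrite gt_max mulr_gt0//=; move: e0 => ?; lra.
- move=> z /He h; rewrite /Bl lt_max (_ : _ < 2 * r - e / 2) ?orbT//; move: h e0 => ? ?; lra.
Qed.

Lemma Iable_gw s : s < 2 * r -> Iable (fun z => Bl x0 s z * (enorm (g z) ^+ 2 * w z)).
Proof.
by move=> sr; have [b Hb] := Hg sr; have mB := mf_Bl x0 s; apply: Iable_nonneg Hb;
  [meas_auto|move=> z; nonneg].
Qed.

Lemma Iable_gg s : s < 2 * r -> Iable (fun z => Bl x0 s z * enorm (g z) ^+ 2).
Proof.
move=> sr; have mB := mf_Bl x0 s.
apply: (@Iable_le _ _ _ (fun z => (2 * r) `^ (n%:R - d - 1) * (Bl x0 s z * (enorm (g z)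
  ^+ 2 * w z)))).
- by meas_auto.
- move=> z; rewrite ger0_norm; last by nonneg.
  rewrite [leRHS]mulrCA; apply: ler_wpM2l => //.
  by apply: (@sqr_le_weight (fun z => enorm (g z) ^+ 2)); [move=> /gE ->;
    rewrite enorm0 expr0n|exact: sqr_ge0].
- by apply: IableZ; exact: Iable_gw.
Qed.

Lemma grad_mul phi chi z : smooth phi -> smooth chi -> grad (fun z => phi z * chi z)
  z = phi z *: grad chi z + chi z *: grad phi z.
Proof. by move=> h1 h2; apply/rowP => i; rewrite !mxE partial_mul. Qed.

(** The test function is chi^2 trc(u). Its gradient carries [trc'], which weights the energy on the
    left, and [tc_sqr_le] lets the same [trc'] absorb the cross term. *)
Lemma caccioppoli_adm chi kp k (T : R) : adm chi -> 0 < kp -> 0 <= k ->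
  (II (fun z => enorm (grad chi z) ^+ 2 * pos k (u z) ^+ 2 * w z)%R <= T%:E)%E ->
  (II (fun z => chi z ^+ 2 * (trc' kp k (u z) * (enorm (g z)
    ^+ 2 * w z)))%R <= (4 * C1 ^+ 4 * T)%:E)%E.
Proof.
move=> achi kp0 k0 HT; have [M CS] := C11_trc kp0 k0.
have [mS mS'] := mf_C11 CS mu_u; have mp := mf_pos k.
have [cchi [e e0 He]] := achi; have mchi := mf_smooth cchi.1.
have [s [s00 sr sB]] := adm0_Bl (adm_adm0 achi).
have C10 : 0 < C1 by apply: lt_le_trans C1_ge1.
have S0 z : 0 <= trc kp k (u z) by exact: tc_ge0 (pos_ge0 _ _).
have Sb z : trc kp k (u z) <= kp^-1 by exact: tc_ub (pos_ge0 _ _).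
have S'0 z : 0 <= trc' kp k (u z) by exact: tc'_ge0 (pos_ge0 _ _).
have S'1 z : trc' kp k (u z) <= 1 by exact: tc'_le1 (pos_ge0 _ _).
have [P P0 pP] := cc_bounded cchi.
have mB := mf_Bl x0 s.
have apsi : adm (fun z => chi z * chi z).
  split; first exact: cc_mul cchi.1 cchi.
  by exists e => // z; rewrite mulf_eq0 orbb => /He.
have gpsi z : grad (fun z => chi z * chi z) z = (2 * chi z) *: grad chi z.
  by rewrite (grad_mul _ cchi.1 cchi.1) -scalerDl; congr (_ *: _); ring.
have W1 := wg_local apsi CS.
set tau := (X in WG X) in W1; set G := (X in WG _ X) in W1.
have GE z : G z = (chi z * chi z * trc' kp k (u z)) *: g z + (trc kp k (u z) * (2 * chi z))
  *: grad chi z.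
  by rewrite /G gpsi scalerA.
have tau0 z : 0 <= tau z by rewrite /tau -expr2 mulr_ge0// sqr_ge0.
have tauS z : tau z != 0 -> enorm (z - x0) <= 2 * r - e /\ e <= delta z.
  by move=> tz; apply: He; apply: contraNneq tz => c0; rewrite /tau c0 !mul0r.
have GS z : G z != 0 -> enorm (z - x0) <= 2 * r - e /\ e <= delta z.
  by move=> tz; apply: He; apply: contraNneq tz => c0; rewrite GE c0 !(mul0r, mulr0) !scale0r addr0.
have mpc i : mf (partial i chi) by apply: mf_smooth; apply: smooth_partial; case: cchi.
(* Required by [sub_test]: [trc] is at most 1 / kp, [trc'] at most 1, and [g] is square integrable
   on the support of [chi]. *)
have IG2 i : Iable (fun z => G z 0 i ^+ 2).
  have Ip : Iable (fun z => partial i chi z * partial i chi z).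
    by apply: cc_Iable; apply: cc_mul; [apply: smooth_partial; case: cchi|exact: cc_partial].
  have [_ hG _] := W1; have mGi := Iable_mf (hG i).
  apply: (@Iable_le _ _ _ (fun z => 2 * (P ^+ 2) ^+ 2 * (Bl x0 s z * enorm (g z) ^+ 2)
    + 8 * (kp^-1 * P) ^+ 2 * (partial i chi z * partial i chi z))).
  - by meas_auto.
  - move=> z; rewrite ger0_norm ?sqr_ge0// GE !mxE.
    have [c0|c0] := eqVneq (chi z) 0.
      rewrite c0 !(mul0r, mulr0) addr0 expr0n/=; apply: addr_ge0; apply: mulr_ge0 => //;
        [by nonneg|by nonneg| |by rewrite -expr2 sqr_ge0].
      by rewrite mulr_ge0// exprn_ge0// mulr_ge0// invr_ge0 ltW.
    rewrite sB// mul1r.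
    have a1 : (chi z * chi z * trc' kp k (u z) * g z 0 i) ^+ 2 <= (P ^+ 2) ^+ 2 * enorm (g z) ^+ 2.
      rewrite -exprMn -[X in X <= _]real_normK ?num_real// ler_sqr ?nnegrE; [|by nonneg|by nonneg].
      have -> : `|chi z * chi z * trc' kp k (u z) * g z 0 i| = `|chi z| * `|chi z|
        * trc' kp k (u z) * `|g z 0 i|.
        by rewrite normrM (normrM _ (trc' _ _ _)) (normrM (chi z) (chi z)) (ger0_norm (S'0 z)).
      apply: ler_pM; [by have ? := S'0 z; nonneg|nonneg| |exact: coord_le_enorm].
      rewrite -[X in _ <= X]mulr1; apply: ler_pM; [by nonneg|exact: S'0| |exact: S'1].
      by rewrite expr2; apply: ler_pM.
    have a2 : (trc kp k (u z) * (2 * chi z) * partial i chi z) ^+ 2 <= 4 * (kp^-1 * P)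
      ^+ 2 * (partial i chi z * partial i chi z).
      rewrite exprMn -expr2; apply: ler_wpM2r; first exact: sqr_ge0.
      have -> : (trc kp k (u z) * (2 * chi z)) ^+ 2 = 4 * (trc kp k (u z) * chi z) ^+ 2 by ring.
      apply: ler_wpM2l => //; rewrite -[X in X <= _]real_normK ?num_real// ler_sqr ?nnegrE//.
        by rewrite normrM; apply: ler_pM => //; rewrite ger0_norm.
      by rewrite mulr_ge0// invr_ge0 ltW.
    move: a1 a2; move: (chi z * chi z * _ * _) (trc kp k (u z) * (2 * chi z) * _) => a b a1 a2.
    by have := sqr_ge0 (a - b); nra.
  - by apply: IableD; apply: IableZ => //; exact: Iable_gg.
have [IFG RFG] := sub_test e0 W1 tau0 tauS GS IG2.
have mgc : mf (fun z => enorm (grad chi z)) by apply: mf_enormG => i; exact: mf_grad.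
have ITT : Iable (fun z => enorm (grad chi z) ^+ 2 * pos k (u z) ^+ 2 * w z).
  by apply: Iable_nonneg HT; [meas_auto|move=> z; nonneg].
have RT : RI (fun z => enorm (grad chi z) ^+ 2 * pos k (u z) ^+ 2 * w z) <= T.
  by apply: RI_le_II HT; [meas_auto|move=> z; nonneg].
have IE : Iable (fun z => chi z ^+ 2 * (trc' kp k (u z) * (enorm (g z) ^+ 2 * w z))).
  apply: (@Iable_le _ _ _ (fun z => P ^+ 2 * (Bl x0 s z * (enorm (g z) ^+ 2 * w z))));
    first by meas_auto.
    move=> z; rewrite ger0_norm; last by have ? := S'0 z; nonneg.
    have [c0|c0] := eqVneq (chi z) 0; first by rewrite c0 expr0n mul0r; nonneg.
    rewrite sB// mul1r; apply: ler_pM; [by nonneg|by have ? := S'0 z; nonneg| |].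
      by rewrite -[X in X <= _]real_normK ?num_real// ler_sqr ?nnegrE.
    by rewrite ler_piMl//; nonneg.
  by apply: IableZ; exact: Iable_gw.
apply: II_le_RI => //; first by move=> z; have ? := S'0 z; nonneg.
apply: (@le_trans _ _ (2 * C1 * RI (fun z => dot (F z) (G z))
  + 4 * C1 ^+ 4 * RI (fun z => enorm (grad chi z) ^+ 2 * pos k (u z) ^+ 2 * w z))).
  rewrite -!RIZ// -RID; [|exact: IableZ|exact: IableZ].
  apply: RI_le => //; first by apply: IableD; exact: IableZ.
  move=> z; have -> : dot (F z) (G z) = chi z ^+ 2 * trc' kp k (u z) * dot (F z) (g z)
    + 2 * chi z * trc kp k (u z) * dot (F z) (grad chi z).
    rewrite /dot GE 2!mulr_sumr -big_split/=; apply: eq_bigr => i _; rewrite !mxE; ring.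
  apply: caccio_pt => //; [exact: enorm_ge0|exact: enorm_ge0|exact: weight_ge0| |].
    exact: tc_sqr_le (pos_ge0 _ _).
  apply: le_trans (cauchy_schwarz _ _) _; apply: ler_wpM2r; first exact: enorm_ge0.
  exact: F_le.
have h1 : 2 * C1 * RI (fun z => dot (F z) (G z)) <= 0 by rewrite mulr_ge0_le0// mulr_ge0// ltW.
have h2 : 4 * C1 ^+ 4 * RI (fun z => enorm (grad chi z) ^+ 2 * pos k (u z) ^+ 2 * w z)
  <= 4 * C1 ^+ 4 * T.
  by apply: ler_wpM2l => //; rewrite mulr_ge0// exprn_ge0// ltW.
by move: h1 h2; lra.
Qed.

Definition kpm (m : nat) : R := m.+1%:R^-1.

Lemma kpm_gt0 m : 0 < kpm m. Proof. by rewrite /kpm invr_gt0. Qed.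

(** The inequality trc'^2 <= trc' reduces the energy of [phi * trc] to the quantity bounded by the
    Caccioppoli inequality. *)
Lemma cross_sqr_le phi kp k z : 0 < kp ->
  enorm ((phi z * trc' kp k (u z)) *: g z + trc kp k (u z) *: grad phi z) ^+ 2 <=
  2 * (phi z ^+ 2 * (trc' kp k (u z) * enorm (g z) ^+ 2)) + 2 * (pos k (u z)
    ^+ 2 * enorm (grad phi z) ^+ 2).
Proof.
move=> kp0; apply: le_trans (enormD_sqr _ _) _; rewrite !enormZ.
have h1 := tc'_ge0 kp0 (pos_ge0 k (u z)); have h2 := tc'_le1 kp0 (pos_ge0 k (u z)).
have h3 := tc_ge0 kp0 (pos_ge0 k (u z)); have h4 := tc_le kp0 (pos_ge0 k (u z)).
apply: lerD; apply: ler_wpM2l => //; rewrite exprMn real_normK ?num_real//.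
  rewrite exprMn -mulrA; apply: ler_wpM2l; first exact: sqr_ge0.
  apply: ler_wpM2r; first exact: sqr_ge0.
  by rewrite expr2 /trc' ler_piMl.
apply: ler_wpM2r; first exact: sqr_ge0.
by rewrite ler_sqr ?nnegrE ?pos_ge0.
Qed.

Lemma adm0_dist phi z : adm0 phi -> phi z != 0 -> delta z <= 2 * r.
Proof. by move=> aphi pz; apply: le_trans (dist_le G0 z Gx0) _; exact: ltW (adm0_supp aphi pz). Qed.

Lemma adm0_far phi z : adm0 phi -> enorm x0 + 2 * r < enorm z -> phi z = 0.
Proof.
move=> aphi zr; apply/eqP/negPn/negP => /(adm0_supp aphi) h.
by have := enorm_tri z x0 0; rewrite !subr0; move: zr h => ? ? ?; lra.
Qed.

Lemma pos_u_le k z : 0 <= k -> pos k (u z) <= u z.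
Proof. by move=> k0; exact: pos_le. Qed.

Lemma trc_le_u kp k z : 0 < kp -> 0 <= k -> trc kp k (u z) <= u z.
Proof. by move=> kp0 k0; apply: le_trans (pos_u_le z k0); exact: tc_le (pos_ge0 _ _). Qed.

(** Collects what [hardy] and [faber_krahn] ask for: the truncation is bounded, so [wg_cross]
    applies, and it is at most [u], so it inherits the zero trace. *)
Lemma cross_props phi kp k : adm0 phi -> 0 < kp -> 0 <= k ->
  let v := fun z => phi z * trc kp k (u z) in
  let G := fun z => (phi z * trc' kp k (u z)) *: g z + trc kp k (u z) *: grad phi z in
  [/\ forall z, Gamma z -> G z = 0, WG v G, exists M, forall z, `|v z| <= M,
      forall z, enorm x0 + 2 * r < enorm z -> v z = 0 &
      (forall z, v z != 0 -> delta z <= 2 * r) /\ hausdorff d [set xi |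
        Gamma xi /\ ~ trace0 v xi] = 0%E].
Proof.
move=> aphi kp0 k0 v G; have [M CS] := C11_trc kp0 k0; have [cphi _] := aphi.
have [P P0 pP] := cc_bounded cphi.
have [mS _] := mf_C11 CS mu_u; have mphi := mf_smooth cphi.1.
have S0 z : 0 <= trc kp k (u z) by exact: tc_ge0 (pos_ge0 _ _).
have Sb z : trc kp k (u z) <= kp^-1 by exact: tc_ub (pos_ge0 _ _).
split.
- by move=> z Gz; apply: (grad_crossIE CS) => // -[].
- apply: (wg_cross (B := kp^-1) aphi CS) => t; rewrite ger0_norm; last exact: tc_ge0 (pos_ge0 _ _).
  exact: tc_ub (pos_ge0 _ _).
- exists (P * kp^-1) => z; rewrite /v normrM; apply: ler_pM => //; rewrite ger0_norm//.
- by move=> z zr; rewrite /v (adm0_far aphi zr) mul0r.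
- split; first by move=> z vz; apply: (adm0_dist aphi); apply: contraNneq vz => p0;
  rewrite /v p0 mul0r.
  apply: (trace0_mul (phi := phi) (c := P)) => //; first by rewrite /v; meas_auto.
    move=> z; rewrite /v normrM; apply: ler_pM => //; rewrite ger0_norm//; exact: trc_le_u.
  by move=> z p0; rewrite /v p0 mul0r.
Qed.

(** Hardy for the truncations at level 0, then kp tends to 0. What is gained is finiteness: the part
    of the integral near [Gamma] becomes arbitrarily small, and [caccioppoli] needs this. *)
Lemma hardy_u phi : adm0 phi -> exists b : R, (II (fun z => (phi z * u z)
  ^+ 2 * delta z `^ (d - 1 - n%:R))%R <= b%:E)%E.
Proof.
move=> aphi; have [cphi _] := aphi; have [s [s00 sr sB]] := adm0_Bl aphi.
have [P P0 pP] := cc_bounded cphi; have [Q Q0 pQ] := grad_bounded cphi.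
have [bg Hbg] := Hg sr.
have mphi := mf_smooth cphi.1; have md := mf_dist (Gamma := Gamma) G0; have mB := mf_Bl x0 s.
exists (@hardy_cst R n d C0 * (2 * P ^+ 2 * bg + 2 * Q * Yb)).
apply: (@II_fatou _ _ (fun m z => (phi z * trc (kpm m) 0 (u z)) ^+ 2 * delta z `^ (d - 1 - n%:R))).
- move=> m; have [M CS] := C11_trc (kpm_gt0 m) (lexx 0); have [mS _] := mf_C11 CS mu_u;
  by meas_auto.
- by move=> m z; nonneg.
- move=> z; have := @trc_cvg R 0 (u z); rewrite posE// subr0 => h.
  by apply: cvgMr_tmp; apply: cvgM; apply: cvgMl_tmp.
move=> m; have kp0 := kpm_gt0 m.
have [gG wv [M vM] vf [vd trv]] := cross_props aphi kp0 (lexx 0).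
have r20 : 0 < 2 * r by rewrite mulr_gt0.
apply: (hardy n0 d0 dn C01 G0 cG AR gG wv vM vf r20 vd trv).
apply: (@le_trans _ _ (II (fun z => 2 * P ^+ 2 * (Bl x0 s z * (enorm (g z) ^+ 2 * w z))
  + 2 * Q * (u z ^+ 2 * w z))%R)).
  have [_ hG _] := wv; have mG := fun i => Iable_mf (hG i); have mGn := mf_enormG mG.
  apply: II_le; [by meas_auto|by meas_auto|by move=> z; nonneg|].
  move=> z; have -> : 2 * P ^+ 2 * (Bl x0 s z * (enorm (g z) ^+ 2 * w z))
    + 2 * Q * (u z ^+ 2 * w z) =
    (2 * (P ^+ 2 * (Bl x0 s z * enorm (g z) ^+ 2)) + 2 * (u z ^+ 2 * Q)) * w z by ring.
  apply: ler_wpM2r; first exact: weight_ge0.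
  apply: le_trans (cross_sqr_le phi 0 z kp0) _.
  have h1 := tc'_ge0 kp0 (pos_ge0 0 (u z)); have h2 := tc'_le1 kp0 (pos_ge0 0 (u z)).
  apply: lerD; apply: ler_wpM2l => //.
    have [p0|p0] := eqVneq (phi z) 0; first by rewrite p0 expr0n mul0r; nonneg.
    rewrite sB// mul1r; apply: ler_pM; [by nonneg|by rewrite mulr_ge0 ?sqr_ge0| |].
      by rewrite -[X in X <= _]real_normK ?num_real// ler_sqr ?nnegrE.
    by rewrite ler_piMl ?sqr_ge0.
  apply: ler_pM; [by nonneg|by nonneg| |exact: pQ].
  by rewrite ler_sqr ?nnegrE ?pos_ge0// pos_u_le.
rewrite II_add; [|by meas_auto|by meas_auto|by move=> z; nonneg|by move=> z; nonneg].
rewrite EFinD; apply: leeD.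
  by apply: II_scale_le Hbg; [meas_auto|move=> z; nonneg|nonneg].
by apply: II_scale_le Hu; [meas_auto|move=> z; nonneg|nonneg].
Qed.

(** [caccioppoli_adm] for [eta j * phi]. Where the gradient of [eta j] is nonzero it is of order
    1/delta, so the error is a part of the integral in [hardy_u] over a shrinking neighbourhood of
    [Gamma]. The constant doubles from 4 to 8 by (a + b)^2 <= 2 a^2 + 2 b^2. *)
Lemma caccioppoli phi kp k (T : R) : adm0 phi -> 0 < kp -> 0 <= k ->
  (II (fun z => enorm (grad phi z) ^+ 2 * pos k (u z) ^+ 2 * w z)%R <= T%:E)%E ->
  (II (fun z => phi z ^+ 2 * (trc' kp k (u z) * (enorm (g z)
    ^+ 2 * w z)))%R <= (8 * C1 ^+ 4 * T)%:E)%E.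
Proof.
move=> aphi kp0 k0 HT; have [cphi _] := aphi; have [M CS] := C11_trc kp0 k0.
have [mS mS'] := mf_C11 CS mu_u; have mp := mf_pos k; have mphi := mf_smooth cphi.1.
have C10 : 0 < C1 by apply: lt_le_trans C1_ge1.
have S'0 z : 0 <= trc' kp k (u z) by exact: tc'_ge0 (pos_ge0 _ _).
have [bh Hbh] := hardy_u aphi; have md := mf_dist (Gamma := Gamma) G0.
have [C C00 [eta Heta]] := eta_seq.
have se j : smooth (eta j) by have [] := Heta j.
have e01 j z : 0 <= eta j z <= 1 by have [_ h _ _ _] := Heta j; exact: h.
have ez j z : delta z <= epsk j -> eta j z = 0 by have [_ _ h _ _] := Heta j; exact: h.
have e1 j z : enorm (z - x0) < 2 * r -> 3 * epsk j < delta z -> eta j z = 1.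
  by have [_ _ _ h _] := Heta j; exact: h.
have pe j i z : enorm (z - x0) < 2 * r -> `|partial i (eta j) z|
  <= C / epsk j * (epsk j <= delta z <= 3 * epsk j)%R%:R.
  by have [_ _ _ _ h] := Heta j; exact: h.
pose H z := (phi z * u z) ^+ 2 * delta z `^ (d - 1 - n%:R).
pose Hj j z := (delta z <= 3 * epsk j)%R%:R * H z.
have mH : mf H by rewrite /H; meas_auto.
have H0 z : 0 <= H z by rewrite /H; nonneg.
have IH : Iable H by apply: Iable_nonneg Hbh.
have mb j : mf (fun z => (delta z <= 3 * epsk j)%R%:R : R) by apply: mf_ble => //; exact: mfC.
have mHj j : mf (Hj j) by have := mb j => ?; rewrite /Hj; meas_auto.
have Hj0 j z : 0 <= Hj j z by rewrite /Hj mulr_ge0.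
have HjH j z : Hj j z <= H z by rewrite /Hj ler_piMl// lern1 leq_b1.
have IHj j : Iable (Hj j) by apply: (Iable_le _ _ IH) => // z; rewrite ger0_norm.
have lim : RI (Hj j) @[j --> \oo] --> (0 : R).
  rewrite -(@RI0 R n); apply: (RI_dct (g := H)) => //; [exact: mfC| |by move=> j z;
    rewrite ger0_norm].
  apply: aeW => z; have [zE|zE] := pselect (in_domain z); last first.
    rewrite (_ : (fun _ => _) = fun=> 0); first exact: cvg_cst.
    by apply/funext => j; rewrite /Hj /H uE// mulr0 expr0n !(mul0r, mulr0).
  apply/cvgrPdist_le => e e0; have dz : 0 < delta z / 3 by rewrite divr_gt0//;
    apply: dist_gt0 => //; case: zE.
  have [N HN] := half_pow_lt (r / 2) dz; exists N => // j /= Nj.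
  suff zf : 3 * epsk j < delta z by rewrite /Hj (leNgt (delta z)) zf mul0r subrr normr0 ltW.
  rewrite mulrC -ltr_pdivlMr//; apply: le_lt_trans HN; rewrite /epsk ler_pM2l ?divr_gt0//.
  by rewrite lef_pV2 ?posrE ?exprn_gt0// ler_eXn2l// ltr1n.
(* 9 from delta <= 3 epsk on the support of the gradient, [n] from its coordinates, 2 from the
   square of a sum. *)
pose c := 18 * n%:R * C ^+ 2; have c0 : 0 <= c by rewrite /c; have ? := ltW C00; nonneg.
have mgp : mf (fun z => enorm (grad phi z)) by apply: mf_enormG => i; exact: mf_grad.
have bnd j : (II (fun z => (eta j z * phi z) ^+ 2 * (trc' kp k (u z) * (enorm (g z)
  ^+ 2 * w z)))%R <= (4 * C1 ^+ 4 * (2 * T + c * RI (Hj j)))%:E)%E.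
  have achi := adm_eta (epsk_gt0 j) (se j) (ez j) aphi.
  apply: caccioppoli_adm => //.
  have mgc : mf (fun z => enorm (grad (fun z => eta j z * phi z) z)).
    by apply: mf_enormG => i; apply: mf_grad; case: achi.
  apply: (@le_trans _ _ (II (fun z => 2 * (enorm (grad phi z) ^+ 2 * pos k (u z) ^+ 2 * w z)
    + c * Hj j z)%R)).
    have := mHj j => mHjj; apply: II_le; [by meas_auto|by meas_auto|by move=> z; nonneg|].
    move=> z; have [zE|zE] := pselect (in_domain z); last first.
      rewrite uE// (pos0 k0) expr0n mulr0 mul0r; apply: addr_ge0; first by rewrite !(mulr0, mul0r).
      by rewrite mulr_ge0.
    have [zx Gz] := zE; have dz : 0 < delta z by exact: dist_gt0.
    rewrite (grad_mul _ (se j) cphi.1).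
    have h1 : enorm (eta j z *: grad phi z) ^+ 2 <= enorm (grad phi z) ^+ 2.
      rewrite enormZ exprMn ler_piMl ?sqr_ge0// exprn_ile1 ?normr_ge0//.
      by have /andP[? ?] := e01 j z; rewrite ger0_norm.
    have h2 : enorm (grad (eta j) z) ^+ 2 <= 9 * n%:R * C ^+ 2 * (delta z `^ (- 2)
      * (delta z <= 3 * epsk j)%R%:R).
      pose X := 9 * C ^+ 2 * (delta z `^ (- 2) * (delta z <= 3 * epsk j)%R%:R).
      have X0 : 0 <= X by rewrite /X mulr_ge0// mulr_ge0// ?powR_ge0// sqr_ge0.
      have -> : 9 * n%:R * C ^+ 2 * (delta z `^ (- 2) * (delta z <= 3 * epsk j)%R%:R)
        = n%:R * X by rewrite /X; ring.
      rewrite sqr_enorm_coord -[n in n%:R]card_ord -sum1_card natr_sum mulr_suml.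
      apply: ler_sum => i _; rewrite mul1r mxE; have := pe j i z zx; have ej := epsk_gt0 j.
      have [/andP[a1 a2]|a1] := boolP (epsk j <= delta z <= 3 * epsk j); last first.
        by rewrite mulr0 normr_le0 => /eqP ->; rewrite expr0n/=.
      rewrite /X a2 !mulr1 => h.
      apply: (@le_trans _ _ ((C / epsk j) ^+ 2)).
        by rewrite -[X in X <= _]real_normK ?num_real// ler_sqr ?nnegrE// divr_ge0 ?ltW.
      rewrite expr_div_n ler_pdivrMr ?exprn_gt0//.
      have -> : delta z `^ (- 2) = (delta z ^+ 2)^-1 by rewrite powRN -powR_mulrn ?ltW.
      have -> : 9 * C ^+ 2 * (delta z ^+ 2)^-1 * epsk j ^+ 2 = C ^+ 2 * ((3 * epsk j)
        ^+ 2 / delta z ^+ 2).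
        by field; rewrite gt_eqF.
      rewrite -[X in X <= _]mulr1; apply: ler_wpM2l; first exact: sqr_ge0.
      rewrite ler_pdivlMr ?exprn_gt0// mul1r ler_sqr ?nnegrE ?(ltW dz)// mulr_ge0// ltW//.
    apply: (@le_trans _ _ ((2 * enorm (grad phi z) ^+ 2 + 2 * (phi z ^+ 2 * (9 * n%:R * C ^+ 2 *
      (delta z `^ (- 2) * (delta z <= 3 * epsk j)%R%:R)))) * (pos k (u z) ^+ 2 * w z))).
      rewrite -[leLHS]mulrA; apply: ler_wpM2r; first by nonneg.
      apply: le_trans (enormD_sqr _ _) _; apply: lerD; apply: ler_wpM2l => //.
      rewrite enormZ exprMn real_normK ?num_real//; apply: ler_wpM2l => //; exact: sqr_ge0.
    rewrite mulrDl; apply: lerD; first by apply: eq_ler; ring.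
    rewrite /Hj /H /c.
    have -> : delta z `^ (d - 1 - n%:R) = delta z `^ (- 2) * w z.
      by rewrite /weight -powR_add//; congr (_ `^ _); ring.
    have -> : 2 * (phi z ^+ 2 * (9 * n%:R * C ^+ 2 * (delta z `^ (- 2)
      * (delta z <= 3 * epsk j)%R%:R))) * (pos k (u z) ^+ 2 * w z) =
      18 * n%:R * C ^+ 2 * ((delta z <= 3 * epsk j)%R%:R * (phi z ^+ 2 * (delta z `^ (-2) * w z)))
        * pos k (u z) ^+ 2 by ring.
    have -> : 18 * n%:R * C ^+ 2 * ((delta z <= 3 * epsk j)%R%:R * ((phi z * u z)
      ^+ 2 * (delta z `^ (-2) * w z))) =
      18 * n%:R * C ^+ 2 * ((delta z <= 3 * epsk j)%R%:R * (phi z ^+ 2 * (delta z `^ (-2) * w z)))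
        * u z ^+ 2 by ring.
    apply: ler_wpM2l; first by have ? := ltW C00; nonneg.
    by rewrite ler_sqr ?nnegrE ?pos_ge0// pos_u_le.
  have := mHj j => mHjj.
  rewrite II_add; [|by meas_auto|by meas_auto|by move=> z; nonneg|by move=> z; rewrite mulr_ge0].
  rewrite EFinD; apply: leeD; first by apply: II_scale_le HT; [meas_auto|move=> z; nonneg|].
  by apply: II_scale_le => //; apply: II_le_RI.
apply/lee_addgt0Pr => e e0.
pose e' := e / (4 * C1 ^+ 4 * (c + 1)).
have D0 : 0 < 4 * C1 ^+ 4 * (c + 1) by rewrite mulr_gt0// ?ltr_wpDl// mulr_gt0// exprn_gt0.
have e'0 : 0 < e' by rewrite divr_gt0.
have [N _ HN] := (cvgrPdist_le _ _).1 lim e' e'0.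
apply: (@II_fatou _ _ (fun j z => (eta (j + N)%N z * phi z) ^+ 2 * (trc' kp k (u z) * (enorm (g z)
  ^+ 2 * w z)))).
- by move=> j; have := mf_smooth (se (j + N)%N) => ?; meas_auto.
- by move=> j z; have ? := S'0 z; nonneg.
- move=> z; have [zE|zE] := pselect (in_domain z); last first.
    rewrite gE// enorm0 expr0n mul0r !mulr0 (_ : (fun _ => _) = fun=> 0); first exact: cvg_cst.
    by apply/funext => j; rewrite !mulr0.
  apply/cvgrPdist_le => e2 e20; have [K _ HK] := eta_lim e1 zE; exists K => // j /= Kj.
  by rewrite HK ?mul1r ?subrr ?normr0 ?ltW//=; apply: leq_trans Kj _; exact: leq_addr.
move=> j; apply: le_trans (bnd _) _; rewrite -EFinD lee_fin.
have h : RI (Hj (j + N)%N) <= e'.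
  have := HN (j + N)%N (leq_addl _ _); rewrite sub0r normrN => h.
  by apply: le_trans (ler_norm _) h.
have h2 : c * RI (Hj (j + N)%N) <= (c + 1) * e'.
  apply: le_trans (ler_wpM2l c0 h) _; apply: ler_wpM2r; [exact: ltW|by rewrite lerDl].
have -> : e = 4 * C1 ^+ 4 * ((c + 1) * e') by rewrite mulrA /e' mulrC divfK// gt_eqF.
have -> : 8 * C1 ^+ 4 * T = 4 * C1 ^+ 4 * (2 * T) by ring.
by rewrite -mulrDr; apply: ler_wpM2l; [rewrite mulr_ge0// exprn_ge0// ltW|rewrite lerD2l].
Qed.

(** Faber-Krahn for [phi * trc]: its energy is at most 2 (8 C1^4 T) + 2 T <= 18 C1^4 T by
    [caccioppoli], uniformly in kp, and Fatou's lemma replaces [trc] by [pos]. *)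
Lemma energy_step phi k (T m : R) : adm0 phi -> 0 <= k -> 0 < m ->
  (II (fun z => enorm (grad phi z) ^+ 2 * pos k (u z) ^+ 2 * w z)%R <= T%:E)%E ->
  (mu [set z | (phi z != 0)%R && (k < u z)%R] <= m%:E)%E ->
  (II (fun z => (phi z * pos k (u z)) ^+ 2 * w z)%R <= (@fk_cst R n d C0 * m `^ (2 / n%:R)
    * (18 * C1 ^+ 4 * T))%:E)%E.
Proof.
move=> aphi k0 m0 HT Hm; have [cphi _] := aphi; have mphi := mf_smooth cphi.1.
have mgp : mf (fun z => enorm (grad phi z)) by apply: mf_enormG => i; exact: mf_grad.
have mp := mf_pos k.
have T0 : 0 <= T.
  by rewrite -lee_fin; apply: le_trans HT; apply: II_ge0 => z; nonneg.
apply: (@II_fatou _ _ (fun m z => (phi z * trc (kpm m) k (u z)) ^+ 2 * w z)).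
- move=> j; have [M CS] := C11_trc (kpm_gt0 j) k0; have [mS _] := mf_C11 CS mu_u; by meas_auto.
- by move=> j z; nonneg.
- move=> z; apply: cvgMr_tmp; apply: cvgM; apply: cvgMl_tmp; exact: trc_cvg.
move=> j; have kp0 := kpm_gt0 j; have Ca := caccioppoli aphi kp0 k0 HT.
have [gG wv [M vM] vf [vd trv]] := cross_props aphi kp0 k0.
have r20 : 0 < 2 * r by rewrite mulr_gt0.
have [M' CS] := C11_trc kp0 k0; have [mS mS'] := mf_C11 CS mu_u.
have S'0 z : 0 <= trc' (kpm j) k (u z) by exact: tc'_ge0 (pos_ge0 _ _).
apply: (faber_krahn n0 d0 dn C01 G0 cG AR gG wv vM vf r20 vd trv _ m0).
  apply: (@le_trans _ _ (II (fun z => 2 * (phi z ^+ 2 * (trc' (kpm j) k (u z) * (enorm (g z)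
    ^+ 2 * w z))) + 2 * (enorm (grad phi z) ^+ 2 * pos k (u z) ^+ 2 * w z))%R)).
    have [_ hG _] := wv; have mG := fun i => Iable_mf (hG i); have mGn := mf_enormG mG.
    apply: II_le; [by meas_auto|by meas_auto|by move=> z; nonneg|].
    move=> z; have -> : 2 * (phi z ^+ 2 * (trc' (kpm j) k (u z) * (enorm (g z) ^+ 2 * w z)))
      + 2 * (enorm (grad phi z) ^+ 2 * pos k (u z) ^+ 2 * w z) =
      (2 * (phi z ^+ 2 * (trc' (kpm j) k (u z) * enorm (g z) ^+ 2)) + 2 * (pos k (u z)
        ^+ 2 * enorm (grad phi z) ^+ 2)) * w z by ring.
    by apply: ler_wpM2r; [exact: weight_ge0|exact: cross_sqr_le].
  rewrite II_add; [|by meas_auto|by meas_auto|by move=> z; have ? := S'0 z; nonneg|by move=> z;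
    nonneg].
  apply: (@le_trans _ _ ((2 * (8 * C1 ^+ 4 * T))%:E + (2 * T)%:E)%E).
    apply: leeD; first by apply: II_scale_le Ca; [meas_auto|move=> z; have ? := S'0 z; nonneg|].
    by apply: II_scale_le HT; [meas_auto|move=> z; nonneg|].
  rewrite -EFinD lee_fin.
  have : 1 <= C1 ^+ 4 by rewrite exprn_ege1.
  by move: T0 (C1 ^+ 4) => T0 c hc; nra.
have mk : mf (fun z => (k < u z)%R%:R : R) by apply: mf_blt => //; exact: mfC.
apply: le_trans Hm; apply: mu_le.
- move=> z /= vz; apply/andP; split; first by apply: contraNneq vz => ->; rewrite mul0r.
  rewrite ltNge; apply: contraNN vz => uk; rewrite /trc pos0// /tc expr0n mul0r mulr0//.
- by apply: mf_setneq0; meas_auto.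
- rewrite (_ : [set _ | _] = [set z | phi z != 0] `&` [set z | k < u z]); last by apply/seteqP;
  split => z /= => [/andP[]|[-> ->]].
  by apply: measurableI; [exact: mf_setneq0|exact: mf_setgt].
Qed.

(** * The De Giorgi iteration *)

Variable Cc : R.
Hypothesis Cc0 : 0 < Cc.
Hypothesis Hcut : forall (D : set 'rV[R]_n) (e M : R), 0 < e -> measurable (D : set X) ->
  D `<=` eball 0 M ->
  exists eta, [/\ smooth eta, forall z, 0 <= eta z <= 1, forall i z, `|partial i eta z| <= Cc / e,
    forall z, eball z e `<=` D -> eta z = 1 & forall z, (forall y, eball z e y -> ~ D y) ->
      eta z = 0].
Hypothesis Yb0 : 0 < Yb.

Definition hj j : R := 2^-1 ^+ j.
(** The radii shrink from 2 r towards r while the levels [lvl] rise from 0 towards [K], both at rate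
    2^(-j). *)
Definition radius j : R := r * (1 + hj j).

Lemma hj_gt0 j : 0 < hj j. Proof. by rewrite /hj exprn_gt0// invr_gt0. Qed.
Lemma hjS j : hj j.+1 = hj j / 2. Proof. by rewrite /hj exprSr. Qed.
Lemma hj_le1 j : hj j <= 1.
Proof. by rewrite /hj exprn_ile1// ?invr_ge0// invf_le1// ler1n. Qed.

Lemma cut_ball j : exists phi, [/\ adm0 phi, forall z, 0 <= phi z <= 1,
  forall z, enorm (z - x0) < radius j.+1 -> phi z = 1, forall z, phi z != 0 -> enorm (z - x0)
    < radius j &
  forall z, enorm (grad phi z) ^+ 2 <= n%:R * (8 * Cc / (r * hj j)) ^+ 2 * Bl x0 (radius j) z].
Proof.
(* Consecutive radii differ by [4 * e]: the inner ball enlarged by [e] and mollified at scale [e]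
   gives a function equal to 1 on the inner ball and supported within [2 * e] of it. *)
pose e := r * hj j / 8; have e0 : 0 < e by rewrite divr_gt0// mulr_gt0// hj_gt0.
have h1 : radius j = radius j.+1 + 4 * e by rewrite /radius hjS /e; field.
have rj2 : radius j <= 2 * r by rewrite /radius; have := hj_le1 j; move: r0 => ? ?; nra.
pose D := eball x0 (radius j.+1 + e).
have DM : D `<=` eball 0 (enorm x0 + (radius j.+1 + e)).
  move=> z; rewrite /D/eball/= subr0; have := enorm_tri z x0 0; rewrite !subr0.
  by move=> ? ?; lra.
have mD : measurable (D : set X) by exact: measurable_eball.
have [eta [se e01 pe e1 ez]] := Hcut e0 mD DM.
have supp z : eta z != 0 -> enorm (z - x0) <= radius j.+1 + 2 * e.
  move=> tz; have [y yz ty] : exists2 y, eball z e y & D y.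
    apply: contrapT => H; move/eqP: tz; apply; apply: ez => y yz Dy; apply: H; by exists y.
  have := enorm_tri z y x0; rewrite (enorm_distC z y).
  by move: yz ty; rewrite /D /eball/= => ? ? ?; lra.
exists eta; split => //.
- split.
    split => //; exists (enorm x0 + 2 * r) => z zr; apply/eqP/negPn/negP => /supp h.
    by have := enorm_tri z x0 0; rewrite !subr0; move: zr h e0 h1 rj2 => ? ? ? ? ? ?; lra.
  by exists (2 * e); [rewrite mulr_gt0|move=> z /supp; move: h1 rj2 => ? ? ?; lra].
- move=> z zr; apply: e1 => y yz; have := enorm_tri y z x0.
  by move: yz zr; rewrite /D /eball/= => ? ? ?; lra.
- by move=> z /supp; move: h1 e0 => ? ? ?; lra.
- move=> z; have eE : 8 * Cc / (r * hj j) = Cc / e.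
    by rewrite /e; field; rewrite !gt_eqF ?hj_gt0.
  rewrite eE sqr_enorm_coord -mulrA -[n in n%:R]card_ord -sum1_card natr_sum mulr_suml.
  apply: ler_sum => i _; rewrite mul1r mxE.
  have [pz|pz] := eqVneq (partial i eta z) 0; first by rewrite pz expr0n/= mulr_ge0// sqr_ge0.
  have zr : enorm (z - x0) <= radius j.+1 + 2 * e.
    by apply: (partial_supp (h := fun z => enorm (z - x0)) _ supp pz); exact: continuous_edist.
  rewrite /Bl (_ : _ < _ = true) ?mulr1; last by move: zr h1 e0 => ? ? ?; lra.
  by rewrite -[X in X <= _]real_normK ?num_real// ler_sqr ?nnegrE// divr_ge0 ?ltW.
Qed.

(** The rate of decay of the energies, chosen so that (4 q)^(2/n) = 1/4: the gain from the volume
    term then cancels the factor 4^j from the gradients of the cut-offs. *)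
Definition dg_q : R := (4 * 2 ^+ n)^-1.
Definition dg_M : R := @fk_cst R n d C0 * (18 * C1 ^+ 4) * (64 * n%:R * Cc ^+ 2).
(** Solved from the requirement that one step of the recursion reproduce the next power of [dg_q]
    exactly; [dg_M] collects the constants of that step. *)
Definition dg_A : R := 2 `^ (n%:R - d + 1) * (dg_M / dg_q) `^ (n%:R / 2).

Lemma dg_q_gt0 : 0 < dg_q. Proof. by rewrite /dg_q invr_gt0 mulr_gt0// exprn_gt0. Qed.

Lemma dg_M_gt0 : 0 < dg_M.
Proof.
rewrite /dg_M; have := @fk_cst_gt0 R n d C0 n0 dn C01 => fk0.
have C10 : 0 < C1 by apply: lt_le_trans C1_ge1.
have n00 : 0 < n%:R :> R by rewrite ltr0n.
by repeat apply: mulr_gt0 => //; exact: exprn_gt0.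
Qed.

Lemma dg_A_gt0 : 0 < dg_A.
Proof. by rewrite /dg_A mulr_gt0// powR_gt0// divr_gt0// ?dg_M_gt0 ?dg_q_gt0. Qed.

Variable K : R.
Hypotheses (K0 : 0 < K) (KE : K ^+ 2 = dg_A * r `^ (- (d + 1)) * Yb).
Definition lvl j : R := K * (1 - hj j).

Lemma lvl_ge0 j : 0 <= lvl j.
Proof. by rewrite /lvl mulr_ge0 ?(ltW K0)// subr_ge0 hj_le1. Qed.

(** One step of the recursion with the Chebyshev bound [m] and the gradient bound [T] inserted: the
    powers of [r] cancel by the choice of [K], those of 4 by the choice of [dg_q]. *)
Lemma dg_arith j (m T : R) : m = (2 * r) `^ (n%:R - d - 1) * (2 / (K * hj j))
  ^+ 2 * (Yb * dg_q ^+ j) ->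
  T = n%:R * (8 * Cc / (r * hj j)) ^+ 2 * (Yb * dg_q ^+ j) ->
  @fk_cst R n d C0 * m `^ (2 / n%:R) * (18 * C1 ^+ 4 * T) = Yb * dg_q ^+ j.+1.
Proof.
move=> Em TE; have n00 : 0 < n%:R :> R by rewrite ltr0n.
have hh : hj j ^+ 2 = 4^-1 ^+ j by rewrite /hj exprAC; congr (_ ^+ _); rewrite expr2; field.
have h0 := hj_gt0 j; have q0 := dg_q_gt0; have M0 := dg_M_gt0.
have m1 : m = (r `^ n%:R * (dg_q / dg_M) `^ (n%:R / 2)) * (4 * dg_q) ^+ j.
  rewrite Em expr_div_n exprMn KE /dg_A hh.
  have -> : (2 * r) `^ (n%:R - d - 1) = 2 `^ (n%:R - d - 1) * r `^ (n%:R - d - 1)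
    by rewrite powRM// ltW.
  have -> : 2 `^ (n%:R - d + 1) = 2 `^ (n%:R - d - 1) * 2 ^+ 2 :> R.
    by rewrite -powR_mulrn// -powR_add//; congr (_ `^ _); ring.
  have -> : r `^ n%:R = r `^ (n%:R - d - 1) / r `^ (- (d + 1)).
    by rewrite -powRN -powR_add//; congr (_ `^ _); ring.
  have -> : dg_q / dg_M = (dg_M / dg_q)^-1 by rewrite invf_div.
  rewrite powRV ?divr_ge0 ?(ltW M0) ?(ltW q0)//.
  have e1 : (4^-1) ^+ j = (4 ^+ j)^-1 :> R by rewrite exprVn.
  rewrite e1 (exprMn j 4).
  have p1 : 0 < 2 `^ (n%:R - d - 1) :> R by rewrite powR_gt0.
  have p2 : 0 < r `^ (- (d + 1)) by rewrite powR_gt0.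
  have p3 : 0 < (dg_M / dg_q) `^ (n%:R / 2) by rewrite powR_gt0// divr_gt0.
  have p4 : 0 < 4 ^+ j :> R by rewrite exprn_gt0.
  by field; rewrite !gt_eqF.
have a1 : m `^ (2 / n%:R) = r ^+ 2 * (dg_q / dg_M) * (4^-1) ^+ j.
  have qM : 0 <= dg_q / dg_M by rewrite divr_ge0 ?ltW.
  move: qM m1; move: (dg_q / dg_M) => Q qM m1.
  have p2 (x : R) : 0 <= x -> x `^ 2 = x ^+ 2 by move=> x00; rewrite (powR_mulrn 2).
  rewrite m1 !powRM ?mulr_ge0 ?powR_ge0 ?exprn_ge0 ?mulr_ge0 ?(ltW q0)//.
  rewrite -!powRrM (_ : n%:R * (2 / n%:R) = 2); last by field; rewrite gt_eqF.
  rewrite (_ : n%:R / 2 * (2 / n%:R) = 1); last by field; rewrite gt_eqF.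
  rewrite (p2 _ (ltW r0)) (powRr1 qM); congr (_ * _).
  have pe (x a : R) : 0 <= x -> (x ^+ j) `^ a = (x `^ a) ^+ j.
    by move=> x00; rewrite -(powR_mulrn j x00) -(powR_mulrn j (powR_ge0 x a)) -!powRrM (mulrC a).
  rewrite pe ?mulr_ge0 ?(ltW q0)//; congr (_ ^+ _).
  rewrite /dg_q; have -> : 4 * (4 * 2 ^+ n)^-1 = 2 `^ (- n%:R) :> R.
    by rewrite powRN powR_mulrn//; field; rewrite gt_eqF// exprn_gt0.
  rewrite -powRrM (_ : - n%:R * (2 / n%:R) = - 2); last by field; rewrite gt_eqF.
  by rewrite powRN (p2 2)//; congr (_^-1); rewrite expr2; ring.
rewrite a1 TE expr_div_n (exprMn 2 r) hh exprS.
have p4 : 0 < 4^-1 ^+ j :> R by rewrite exprn_gt0// invr_gt0.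
have e2 : @fk_cst R n d C0 * (18 * C1 ^+ 4) * (64 * n%:R * Cc ^+ 2) = dg_M by [].
have -> : @fk_cst R n d C0 * (r ^+ 2 * (dg_q / dg_M) * 4^-1 ^+ j)
  * (18 * C1 ^+ 4 * (n%:R * ((8 * Cc) ^+ 2 / (r ^+ 2 * 4^-1 ^+ j)) * (Yb * dg_q ^+ j))) =
  (@fk_cst R n d C0 * (18 * C1 ^+ 4) * (64 * n%:R * Cc ^+ 2)) / dg_M * (Yb * (dg_q * dg_q ^+ j)).
  by field; rewrite !gt_eqF.
have Mn : dg_M != 0 by rewrite gt_eqF.
by rewrite e2 (divff Mn) mul1r -?exprS.
Qed.

Lemma dg_iter j : (II (fun z => Bl x0 (radius j) z * (pos (lvl j) (u z)
  ^+ 2 * w z))%R <= (Yb * dg_q ^+ j)%:E)%E.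
Proof.
elim: j => [|j IH].
  rewrite expr0 mulr1; apply: le_trans Hu; have mp := mf_pos (lvl 0);
    have mB := mf_Bl x0 (radius 0).
  apply: II_le; [by meas_auto|by meas_auto|by move=> z; nonneg|move=> z].
  have p0 : 0 <= pos (lvl 0) (u z) ^+ 2 * w z by nonneg.
  apply: (@le_trans _ _ (pos (lvl 0) (u z) ^+ 2 * w z)); first by rewrite ler_piMl// Bl_le1.
  apply: ler_wpM2r; first exact: weight_ge0.
  by rewrite ler_sqr ?nnegrE ?pos_ge0// pos_u_le// lvl_ge0.
have [phi [aphi p01 p1 psupp pgrad]] := cut_ball j; have [cphi _] := aphi.
pose m := (2 * r) `^ (n%:R - d - 1) * (2 / (K * hj j)) ^+ 2 * (Yb * dg_q ^+ j).
pose T := n%:R * (8 * Cc / (r * hj j)) ^+ 2 * (Yb * dg_q ^+ j).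
have h0 := hj_gt0 j; have q0 := dg_q_gt0.
have Kh : 0 < K * hj j by rewrite mulr_gt0.
have yq : 0 < Yb * dg_q ^+ j by rewrite mulr_gt0// exprn_gt0.
have m0 : 0 < m.
  apply: mulr_gt0 => //; apply: mulr_gt0; first by rewrite powR_gt0// mulr_gt0.
  by rewrite exprn_gt0// divr_gt0.
have kk : lvl j.+1 = lvl j + K * hj j / 2 by rewrite /lvl hjS; field.
have mp := mf_pos (lvl j); have mp1 := mf_pos (lvl j.+1); have mB := mf_Bl x0 (radius j);
  have mB1 := mf_Bl x0 (radius j.+1).
have mphi := mf_smooth cphi.1.
have mgp : mf (fun z => enorm (grad phi z)) by apply: mf_enormG => i; exact: mf_grad.
have pp1 z : pos (lvl j.+1) (u z) <= pos (lvl j) (u z).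
  by rewrite /pos ge_max !le_max lexx/= kk; apply/orP; right; move: Kh => ?; lra.
have HT : (II (fun z => enorm (grad phi z) ^+ 2 * pos (lvl j.+1) (u z) ^+ 2 * w z)%R <= T%:E)%E.
  apply: (@le_trans _ _ (II (fun z => n%:R * (8 * Cc / (r * hj j)) ^+ 2 * (Bl x0 (radius j)
    z * (pos (lvl j) (u z) ^+ 2 * w z)))%R)).
    apply: II_le; [by meas_auto|by meas_auto|by move=> z; nonneg|move=> z].
    rewrite -[leLHS]mulrA.
    have -> : n%:R * (8 * Cc / (r * hj j)) ^+ 2 * (Bl x0 (radius j) z * (pos (lvl j) (u z)
      ^+ 2 * w z)) =
       (n%:R * (8 * Cc / (r * hj j)) ^+ 2 * Bl x0 (radius j) z) * (pos (lvl j) (u z) ^+ 2 * w z)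
         by ring.
    apply: ler_pM => //; [exact: sqr_ge0|by nonneg|].
    by apply: ler_wpM2r; [exact: weight_ge0|rewrite ler_sqr ?nnegrE ?pos_ge0].
  by apply: II_scale_le IH; [meas_auto|move=> z; nonneg|rewrite mulr_ge0// sqr_ge0].
(* Chebyshev's inequality: above level [lvl j.+1] the excess over [lvl j] is at least
   [K * hj j / 2], and in the ball [w] is at least (2 r)^(d+1-n). *)
have Hm : (mu [set z | (phi z != 0)%R && (lvl j.+1 < u z)%R] <= m%:E)%E.
  have mset : measurable ([set z | (phi z != 0)%R && (lvl j.+1 < u z)%R] : set X).
    rewrite (_ : [set _ | _] = [set z | phi z != 0] `&` [set z | lvl j.+1 < u z]);
      last by apply/seteqP; split => z /= => [/andP[]|[-> ->]].
    by apply: measurableI; [exact: mf_setneq0|exact: mf_setgt].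
  have mb : mf (fun z => ((phi z != 0) && (lvl j.+1 < u z))%R%:R : R) by exact: mf_bool.
  rewrite -II_bool//.
  apply: (@le_trans _ _ (II (fun z => (2 * r) `^ (n%:R - d - 1) * (2 / (K * hj j))
    ^+ 2 * (Bl x0 (radius j) z * (pos (lvl j) (u z) ^+ 2 * w z)))%R)).
    apply: II_le => //; [by meas_auto|move=> z].
    have [/andP[pz uz]|_] := boolP (_ && _); last first.
      by apply: mulr_ge0; [rewrite mulr_ge0 ?powR_ge0 ?sqr_ge0|apply: mulr_ge0 => //;
        rewrite mulr_ge0 ?weight_ge0 ?sqr_ge0].
    have uz0 : 0 < u z by apply: le_lt_trans uz; exact: lvl_ge0.
    have zE : in_domain z by apply: contrapT => zE; move: uz0; rewrite uE// ltxx.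
    rewrite /Bl (psupp z pz) mul1r /=.
    have w1 := weight_lbE zE.
    have s1 : (K * hj j / 2) ^+ 2 <= pos (lvl j) (u z) ^+ 2.
      rewrite ler_sqr ?nnegrE ?pos_ge0//; last by rewrite divr_ge0 ?ltW.
      by rewrite posE; move: uz Kh; rewrite kk => ? ?; lra.
    apply: (@le_trans _ _ ((2 * r) `^ (n%:R - d - 1) * (2 / (K * hj j)) ^+ 2 * ((K * hj j / 2)
      ^+ 2 * (2 * r) `^ (d + 1 - n%:R)))).
      have -> : d + 1 - n%:R = - (n%:R - d - 1) by ring.
      rewrite powRN; have p0 : 0 < (2 * r) `^ (n%:R - d - 1) by rewrite powR_gt0// mulr_gt0.
      by apply: eq_ler; field; rewrite !gt_eqF.
    apply: ler_wpM2l; first by rewrite mulr_ge0 ?powR_ge0 ?sqr_ge0.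
    by apply: ler_pM => //; [exact: sqr_ge0|exact: powR_ge0].
  by apply: II_scale_le IH; [meas_auto|move=> z; nonneg|rewrite mulr_ge0 ?powR_ge0 ?sqr_ge0].
have := energy_step aphi (lvl_ge0 j.+1) m0 HT Hm; rewrite (dg_arith (erefl m) (erefl T)).
apply: le_trans; apply: II_le; [by meas_auto|by meas_auto|by move=> z; nonneg|move=> z].
rewrite exprMn mulrA; apply: ler_wpM2r; first exact: weight_ge0.
apply: ler_wpM2r; first exact: sqr_ge0.
rewrite /Bl; case: ltP => [h|_]; last exact: sqr_ge0.
by rewrite p1// expr1n.
Qed.

(** All levels lie below [K] and all radii above [r], so the integral of [f] is below every
    [Yb * dg_q ^+ j], hence 0; where u > K the integrand is positive, as [w] is positive off
    [Gamma]. *)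
Lemma de_giorgi : \forall z \ae mu, enorm (z - x0) < r -> u z <= K.
Proof.
pose f z := Bl x0 r z * (pos K (u z) ^+ 2 * w z).
have mp := mf_pos K; have mB := mf_Bl x0 r; have mf' : mf f by rewrite /f; meas_auto.
have f0 z : 0 <= f z by rewrite /f; nonneg.
have fz : II f = 0%E.
  have le j : (II f <= (Yb * dg_q ^+ j)%:E)%E.
    apply: le_trans (dg_iter j); have mpj := mf_pos (lvl j); have mBj := mf_Bl x0 (radius j).
    apply: II_le; [exact: mf'|by meas_auto|exact: f0|move=> z]; rewrite /f; apply: ler_pM;
      [exact: Bl_ge0|by nonneg| |].
      rewrite /Bl ler_nat; case: ltP => //= h; rewrite (_ : _ < _ = true)//.
      by apply: lt_le_trans h _; rewrite /radius ler_pMr// lerDl ltW// hj_gt0.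
    apply: ler_wpM2r; first exact: weight_ge0.
    rewrite ler_sqr ?nnegrE ?pos_ge0// /pos ge_max !le_max lexx/=; apply/orP; right.
    by rewrite lerD2l lerN2 /lvl ler_piMr ?(ltW K0)// gerBl ltW// hj_gt0.
  apply/eqP; rewrite eq_le II_ge0// andbT; apply/lee_addgt0Pr => e e0; rewrite add0e.
  have q1 : `|dg_q| < 1.
    rewrite gtr0_norm ?dg_q_gt0// /dg_q invf_lt1 ?mulr_gt0 ?exprn_gt0//.
    by have : 1 <= 2 ^+ n :> R by [rewrite exprn_ege1// ler1n]; lra.
  have L : (Yb * dg_q ^+ j) @[j --> \oo] --> Yb * 0 by exact: cvgMl_tmp (cvg_expr q1).
  rewrite mulr0 in L; have [N _ HN] := (cvgrPdist_le _ _).1 L e e0.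
  apply: le_trans (le N) _; rewrite lee_fin; apply: le_trans (ler_norm _) _.
  by have := HN N (leqnn _); rewrite sub0r normrN.
have : ae_eq mu setT (fun z : X => (f z)%:E) (cst 0%E).
  apply/ae_eq_integral_abs => //; first exact: mf_EFin.
  rewrite -[RHS]fz; apply: eq_integral => z _; by rewrite gee0_abs// lee_fin.
apply: filterS => z /(_ I) /= /eqP; rewrite eqe => /eqP fz0 zr.
rewrite leNgt; apply/negP => uK.
have uz0 : 0 < u z by apply: lt_trans uK.
have [zx Gz] : in_domain z by apply: contrapT => zE; move: uz0; rewrite uE// ltxx.
have : 0 < f z; last by rewrite fz0 ltxx.
by rewrite /f /Bl zr mul1r mulr_gt0 ?exprn_gt0 ?pos_gt0// weight_gt0//; apply: dist_gt0.
Qed.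

End local_calculus.

(** * Borel versions of Lebesgue measurable functions *)

Section lebesgue_borel.
Context {R : realType} {n : nat}.
Local Notation X := (bT R n).
Local Notation mu := (@mu R n).
Local Notation L := (lebT R n).
Implicit Types A B N : set 'rV[R]_n.

Lemma leb_Borel A : measurable (A : set X) -> leb_outer A = mu A.
Proof. by move=> mA; exact: measurable_mu_extE. Qed.

Lemma measurable_Borel A : measurable (A : set X) -> measurable (A : set L).
Proof.
move=> mA; apply: le_caratheodory_measurable => Y.
have : caratheodory_measurable ((leb_tuple n)^*)%mu (@rV_of_tuple R n @^-1` A).
  by apply: (@sub_caratheodory _ _ _ (leb_tuple n)); apply: sub_sigma_algebra; exact: mA.
by move=> /(_ (@rV_of_tuple R n @^-1` Y)) h; rewrite /leb_outer_measure /= /leb_outer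
  preimage_setI preimage_setI preimage_setC -h.
Qed.

Lemma mu_bigcup0 (F : nat -> set 'rV[R]_n) : (forall k, measurable (F k : set X)) -> (forall k,
  mu (F k) = 0%E) ->
  mu (\bigcup_k F k) = 0%E.
Proof.
move=> mF F0; apply/eqP; rewrite eq_le measure_ge0 andbT.
apply: le_trans (measure_sigma_subadditive _ _ _ (subset_refl _)) _ => //;
  first exact: bigcupT_measurable.
by rewrite eseries0// => k _ _; exact: F0.
Qed.

Lemma leb_cover_eps A (e : R) : leb_outer A \is a fin_num -> 0 < e ->
  exists B, [/\ measurable (B : set X), A `<=` B & (mu B <= leb_outer A + e%:E)%E].
Proof.
move=> fA e0; have [_ [F [mFF AF] <-] h] := lb_ereal_inf_adherent e0 fA.
have mB : measurable (@tuple_of_rV R n @^-1` (\bigcup_k F k) : set X).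
  change (measurable (@rV_of_tuple R n @^-1` (@tuple_of_rV R n @^-1` (\bigcup_k F k)))).
  rewrite (_ : _ @^-1` _ = \bigcup_k F k); first exact: bigcupT_measurable.
  by apply/seteqP; split => t; rewrite /preimage/= rV_of_tupleK.
exists (@tuple_of_rV R n @^-1` (\bigcup_k F k)); split => //.
  move=> z Az; apply: AF => /=; rewrite /preimage/=.
  by have -> : rV_of_tuple (tuple_of_rV z) = z by exact: tuple_of_rVK.
apply: le_trans (ltW h); rewrite /mu /pushforward.
rewrite (_ : _ @^-1` _ = \bigcup_k F k); last by apply/seteqP; split => t;
  rewrite /preimage/= rV_of_tupleK.
by apply: measure_sigma_subadditive => //; exact: bigcupT_measurable.
Qed.

(** The intersection of Borel covers whose measure exceeds that of [A] by at most 1/(k+1). *)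
Lemma leb_hull A : leb_outer A \is a fin_num ->
  exists B, [/\ measurable (B : set X), A `<=` B & mu B = leb_outer A].
Proof.
move=> fA; have HB k := leb_cover_eps fA (e := k.+1%:R^-1) ltac:(by rewrite invr_gt0).
have [B HB'] := choice HB; have mB : measurable ((\bigcap_k B k) : set X).
  by apply: bigcapT_measurable => k; have [] := HB' k.
have AB : A `<=` \bigcap_k B k by move=> z Az k _; have [_ h _] := HB' k; exact: h.
exists (\bigcap_k B k); split => //; apply/eqP; rewrite eq_le; apply/andP; split; last first.
  by rewrite -(leb_Borel mB); exact: (le_outer_measure (@leb_outer_measure R n)).
apply/lee_addgt0Pr => e e0; have [k hk] : exists k : nat, k.+1%:R^-1 <= e.
  exists (Num.truncn e^-1); rewrite invf_ple ?posrE//.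
  by apply/ltW; rewrite truncnS_gt.
have [mBk _ h] := HB' k; apply: (@le_trans _ _ (mu (B k))).
  by apply: mu_le => //; exact: bigcap_inf.
by apply: le_trans h _; rewrite leeD2l// lee_fin.
Qed.

Lemma leb_fin A (r : R) : A `<=` eball 0 r -> leb_outer A \is a fin_num.
Proof.
move=> Ar; rewrite fin_numElt; apply/andP; split.
  by apply: lt_le_trans (outer_measure_ge0 (@leb_outer_measure R n) A); exact: ltNyr.
apply: (@le_lt_trans _ _ (leb_outer (eball 0 r))); first exact: (le_outer_measure
  (@leb_outer_measure R n)).
rewrite leb_Borel; last exact: measurable_eball.
have [r0|r0] := leP 0 r; last first.
  rewrite (_ : eball 0 r = set0) ?measure0//; apply/seteqP; split => // z; rewrite /eball/= => h.
  by have := enorm_ge0 (z - 0); move: h r0 => ? ? ?; lra.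
by apply: le_lt_trans (mu_eball_le _ r0) _; exact: ltry.
Qed.

Lemma leb_null A : leb_outer A = 0%E -> exists N, [/\ measurable (N : set X),
  mu N = 0%E & A `<=` N].
Proof. by move=> A0; have [|B [mB AB h]] := @leb_hull A; [rewrite A0|exists B; rewrite h]. Qed.

(* A Borel hull of [A] differs from [A] by a null set, which has a Borel null hull. *)
Lemma Lmeasurable_Borel A : measurable (A : set L) ->
  exists N, [/\ measurable (N : set X), mu N = 0%E & measurable (A `\` N : set X)].
Proof.
move=> mA; pose Ak k := A `&` eball 0 k%:R.
have mAk k : measurable (Ak k : set L).
  by apply: measurableI => //; apply: measurable_Borel; exact: measurable_eball.
have fAk k : leb_outer (Ak k) \is a fin_num by apply: (@leb_fin _ k%:R); exact: subIsetr.
have HN k : exists N, [/\ measurable (N : set X), mu N = 0%E & measurable (Ak k `\` N : set X)].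
  have [B [mB AB muB]] := leb_hull (fAk k).
  have h0 : leb_outer (B `\` Ak k) = 0%E.
    have := @measureD _ _ _ (@leb R n) B (Ak k) (measurable_Borel mB) (mAk k).

    move=> h; rewrite [LHS]h; last by rewrite [X in (X < _)%E](leb_Borel mB) muB ltey_eq fAk.
    rewrite (setIidr AB) [X in (X - _)%E](leb_Borel mB) muB; exact: subee.
  have [N [mN N0 BN]] := leb_null h0; exists N; split => //.
  rewrite (_ : _ `\` _ = B `\` N); first exact: measurableD.
  apply/seteqP; split => z [h1 h2]; split => //; first exact: AB.
  by apply: contrapT => nA; apply: h2; apply: BN; split.
have [N HN'] := choice HN; exists (\bigcup_k N k); split.
- by apply: bigcupT_measurable => k; have [] := HN' k.
- by apply: mu_bigcup0 => k; have [] := HN' k.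
rewrite (_ : _ `\` _ = (\bigcup_k (Ak k `\` N k)) `\` \bigcup_k N k).
  apply: measurableD; apply: bigcupT_measurable => k; have [] := HN' k => //.
apply/seteqP; split => z [h1 h2]; split => //.
  have [k zk] : exists k : nat, enorm (z - 0) < k%:R by exists (Num.truncn (enorm (z - 0))).+1;
    rewrite truncnS_gt.
  by exists k => //; split => //= Nz; apply: h2; exists k.
by case: h1 => k _ [[]].
Qed.

Lemma null_union (I : countType) (F : I -> set 'rV[R]_n) : (forall q, measurable (F q : set X)) ->
  (forall q, mu (F q) = 0%E) ->
  exists N, [/\ measurable (N : set X), mu N = 0%E & forall q, F q `<=` N].
Proof.
move=> mF F0; pose Nk k := if @unpickle I k is Some q then F q else set0.
exists (\bigcup_k Nk k); split.
- by apply: bigcupT_measurable => k; rewrite /Nk; case: unpickle.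
- by apply: mu_bigcup0 => k; rewrite /Nk; case: unpickle.
by move=> q z Fz; exists (pickle q); [by []|rewrite /Nk pickleK].
Qed.

(** Superlevel sets at rational heights are Borel up to null sets, and there are countably many of
    them. Any Borel [N'] containing [N] is allowed, so that one null set can later serve for [u],
    the gradient and [A] together. *)
Lemma Borel_version (E : set 'rV[R]_n) (f : 'rV[R]_n -> R) : measurable (E : set X) ->
  measurable_fun (E : set L) f ->
  exists N, [/\ measurable (N : set X), mu N = 0%E &
    forall N', measurable (N' : set X) -> N `<=` N' -> mf (fun z => f z * \1_(E `\` N') z)].
Proof.
move=> mE mff; pose A (q : rat) : set 'rV[R]_n := E `&` [set z | ratr q < f z].
have mA q : measurable (A q : set L).
  rewrite /A (_ : [set z | _] = f @^-1` `]ratr q, +oo[); last by rewrite preimage_itvoy.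
  by apply: mff; [exact: measurable_Borel|exact: measurable_itv].
have [Nq HN] := choice (fun q => Lmeasurable_Borel (mA q)).
have [N [mN N0 NN]] : exists N, [/\ measurable (N : set X), mu N = 0%E & forall q, Nq q `<=` N].
  by apply: null_union => q; have [] := HN q.
exists N; split => // N' mN' NN'; apply: (measurability _ (RGenOInfty.measurableE R)) => //.
move=> /= _ [_ [t ->] <-]; rewrite setTI preimage_itvoy.
have mEN : measurable (E `\` N' : set X) by exact: measurableD.
rewrite (_ : [set z | _] = (\bigcup_(q : rat) (if t < ratr q then A q `\` N' else set0)) `|`
   (if t < 0 then ~` (E `\` N') else set0)).
  apply: measurableU; last by case: ifP => _ //; exact: measurableC.
  apply: bigcupT_measurable_rat => q; case: ifP => _ //.
  have [mNq _ mAN] := HN q; rewrite (_ : A q `\` N' = (A q `\` Nq q) `\` N');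
    first exact: measurableD.
  apply/seteqP; split => z [h1 h2]; split => //; last by case: h1.
  by split => // Nz; apply: h2; apply: NN'; exact: NN Nz.
apply/seteqP; split => z /=.
  have [zE|zE] := pselect ((E `\` N') z).
    rewrite indicE mem_set// mulr1 => /rat_in_itvoo[q]; rewrite inE/= => /itvP h.
    left; exists q => //; rewrite h; case: zE => zE zN; split => //; split => //=; by rewrite h.
  by rewrite indicE memNset// mulr0 => t0; right; rewrite t0.
move=> [[q _]|].
  case: ifP => // tq [[Ez /= qf] nN]; rewrite indicE mem_set; last by [].
  by rewrite mulr1; exact: lt_trans qf.
case: ifP => // t0 /= nEN; rewrite indicE memNset// mulr0//.
Qed.

(** Off [N] preimages are Borel; the rest lies in a null set and is measurable by completeness. *)
Lemma measurable_fun_Borel_eq (E N : set 'rV[R]_n) (f fB : 'rV[R]_n -> R) : measurable (E : set X)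
  -> measurable (N : set X) -> mu N = 0%E ->
  mf fB -> (forall z, E z -> ~ N z -> fB z = f z) -> measurable_fun (E : set L) f.
Proof.
move=> mE mN N0 mB fE _ Y mY.
rewrite (_ : E `&` _ = ((E `\` N) `&` fB @^-1` Y) `|` (E `&` N `&` f @^-1` Y)).
  apply: measurableU.
    by apply: measurable_Borel; apply: measurableI; [exact: measurableD|rewrite -[X in measurable
      X]setTI; exact: mB].
  apply: measure_is_complete_caratheodory; exists N; split => //; [exact: measurable_Borel|
    |by move=> z [[]]].
  by rewrite -N0; exact: leb_Borel.
apply/seteqP; split => z /=.
  move=> [Ez Yz]; have [Nz|Nz] := pselect (N z); first by right.
  by left; split => //; rewrite /preimage/= fE.
move=> [[[Ez Nz]]|[[Ez Nz] Yz]//]; rewrite /preimage/= fE//.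
Qed.

(** The identity from [lebT] to [bT] is measurable and pushes [leb] forward to [mu]. *)
Lemma ge0_integral_leb_mu (f : 'rV[R]_n -> \bar R) : measurable_fun setT (f : X -> \bar R) ->
  (forall z, 0 <= f z)%E ->
  (\int[@leb R n]_z f z = \int[mu]_z f z)%E.
Proof.
move=> mff f0; have mid : measurable_fun setT (fun z : L => (z : X)).
  by move=> _ Y mY; rewrite setTI; exact: measurable_Borel.
have := @ge0_integral_pushforward _ _ L X R _ mid (@leb R n)
  setT f measurableT mff (fun z _ => f0 z).
rewrite preimage_setT => <-; apply: eq_measure_integral => Y mY _.
exact: leb_Borel.
Qed.

Lemma integral_leb_mu (f : 'rV[R]_n -> \bar R) : measurable_fun setT (f : X -> \bar R) ->
  (\int[@leb R n]_z f z = \int[mu]_z f z)%E.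
Proof.
move=> mff; rewrite integralE [RHS]integralE; congr (_ - _)%E; apply: ge0_integral_leb_mu => //.
  exact: measurable_funepos.
exact: measurable_funeneg.
Qed.

Lemma integral_Borel_version (E N : set 'rV[R]_n) (f fB : 'rV[R]_n -> R) : measurable (E : set X)
  -> measurable (N : set X) -> mu N = 0%E ->
  mf fB -> (forall z, E z -> ~ N z -> fB z = f z) -> (forall z, ~ E z -> fB z = 0) ->
  (\int[@leb R n]_(z in E) (f z)%:E = \int[mu]_(z in (setT : set X)) (fB z)%:E)%E.
Proof.
move=> mE mN N0 mB fE f0; have mfE := measurable_fun_Borel_eq mE mN N0 mB fE.
have mfB : measurable_fun (E : set L) fB by apply: (measurable_fun_Borel_eq mE mN N0 mB).
rewrite -integral_leb_mu; last exact: mf_EFin.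
transitivity (\int[@leb R n]_(z in E) (fB z)%:E)%E.
  apply: ae_eq_integral; [exact: measurable_Borel|exact/measurable_EFinP|exact/measurable_EFinP|].
  exists N; split; [exact: measurable_Borel|by rewrite -N0; exact: leb_Borel|].
  move=> z /= h; apply: contrapT => Nz; apply: h => Ez; by rewrite fE.
rewrite integral_mkcond; congr (integral _ _ _); apply/funext => z; rewrite patchE.
by case: ifPn => // /negP; rewrite inE => zE; rewrite f0.
Qed.

Lemma Rintegral_Borel_version (E N : set 'rV[R]_n) (f fB : 'rV[R]_n -> R) : measurable (E : set X)
  -> measurable (N : set X) -> mu N = 0%E ->
  mf fB -> (forall z, E z -> ~ N z -> fB z = f z) -> (forall z, ~ E z -> fB z = 0) ->
  \int[@leb R n]_(z in E) f z = RI fB.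
Proof. by move=> mE mN N0 mB fE f0; rewrite /Rintegral (integral_Borel_version mE mN N0 mB fE f0).
  Qed.

Lemma Iable_Borel_version (E N : set 'rV[R]_n) (f fB : 'rV[R]_n -> R) : measurable (E : set X) ->
  measurable (N : set X) -> mu N = 0%E ->
  mf fB -> (forall z, E z -> ~ N z -> fB z = f z) -> (forall z, ~ E z -> fB z = 0) ->
  (@leb R n).-integrable E (fun z => (f z)%:E) -> Iable fB.
Proof.
move=> mE mN N0 mB fE f0 /integrableP[_ h]; apply/IableP; split => //; apply: le_lt_trans h.
rewrite /II -(@integral_Borel_version E N (fun z => `|f z|) (fun z => `|fB z|)
  mE mN N0 (mfnorm mB)) //.
  by move=> z Ez Nz; rewrite fE.
by move=> z /f0 ->; rewrite normr0.
Qed.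

Lemma ae_mu_leb (P : 'rV[R]_n -> Prop) : (\forall z \ae mu, P z) -> \forall z \ae @leb R n, P z.
Proof.
move=> [N [mN N0 PN]]; exists N; split => //; first exact: measurable_Borel.
by rewrite -N0; exact: leb_Borel.
Qed.

Lemma ae_leb_null (P : 'rV[R]_n -> Prop) : (\forall z \ae @leb R n, P z) ->
  exists N, [/\ measurable (N : set X), mu N = 0%E & forall z, ~ N z -> P z].
Proof.
move=> [A [mA A0 PA]]; have [N [mN N0 AN]] := leb_null A0; exists N; split => // z Nz.
by apply: contrapT => Pz; apply: Nz; apply: AN; exact: PA.
Qed.

End lebesgue_borel.

(** * Reduction to Borel functions *)

Section reduction.
Context {R : realType} {n : nat}.
Variables d C0 : R.
Hypotheses (n0 : (0 < n)%N) (d0 : 0 < d) (dn : d < n%:R - 1) (C01 : 1 <= C0).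
Local Notation X := (bT R n).
Local Notation L := (lebT R n).
Local Notation mu := (@mu R n).
Variable Gamma : set 'rV[R]_n.
Hypotheses (G0 : Gamma !=set0) (cG : closed Gamma) (AR : ahlfors_regular d C0 Gamma).
Local Notation delta := (dist Gamma).
Local Notation w := (weight d Gamma).
Variable x0 : 'rV[R]_n.
Hypothesis Gx0 : Gamma x0.
Implicit Types (r s : R) (phi chi psi : 'rV[R]_n -> R).

(** A compact exhaustion of 2B minus [Gamma], through which local integrability becomes
    integrability on the supports of [adm] functions. *)
Definition cptE r (e : R) : set 'rV[R]_n := [set z | enorm (z - x0) <= 2 * r - e] `&` [set z |
  e <= delta z].
Definition setE0 r : set 'rV[R]_n := eball x0 (2 * r) `\` Gamma.

Lemma compact_cptE r (e : R) : compact (cptE r e).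
Proof.
apply: compact_closedI; first exact: compact_cball.
rewrite (_ : [set _ | _] = ~` [set z | delta z < e]); last by apply/seteqP; split => z /=;
  rewrite leNgt => /negP.
by apply: open_closedC; apply: open_lt_cont; exact: continuous_dist.
Qed.

Lemma cptE_sub r (e : R) : 0 < e -> cptE r e `<=` setE0 r.
Proof.
move=> e0 z [z1 z2]; split; first by rewrite /eball/=; move: z1 e0 => /= ? ?; lra.
by move=> Gz; move: z2; rewrite /= dist_Gamma// leNgt e0.
Qed.

Lemma setE0_bigcup r : setE0 r = \bigcup_k cptE r (k.+1%:R^-1).
Proof.
apply/seteqP; split => [z [zr Gz]|z [k _ /cptE_sub]]; last by apply; rewrite invr_gt0.
have m0 : 0 < Num.min (2 * r - enorm (z - x0)) (delta z).
  by rewrite lt_min subr_gt0 zr/=; apply: dist_gt0.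
have [k hk] : exists k : nat, k.+1%:R^-1 <= Num.min (2 * r - enorm (z - x0)) (delta z).
  exists (Num.truncn (Num.min (2 * r - enorm (z - x0)) (delta z))^-1); rewrite invf_ple ?posrE//.
  by apply/ltW; rewrite truncnS_gt.
exists k => //; move: hk; rewrite le_min => /andP[]; move: (k.+1%:R^-1) => e h1 h2; split => //=;
  lra.
Qed.

Lemma measurable_setE0 r : measurable (setE0 r : set X).
Proof. by apply: measurableD; [exact: measurable_eball|exact: measurable_closed]. Qed.

Lemma measurable_cptE r (e : R) : measurable (cptE r e : set X).
Proof. by apply: measurableI; [apply: mf_setle; exact: mf_enorm|apply: mf_setge;
  exact: mf_dist]. Qed.

Lemma L1loc_measurable r (f : 'rV[R]_n -> R) : L1loc (setE0 r) f ->
  measurable_fun (setE0 r : set L) f.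
Proof.
move=> Hf; rewrite [X in measurable_fun X](_ : _ = \bigcup_k (cptE r k.+1%:R^-1 : set L));
  last exact: setE0_bigcup.
apply/measurable_fun_bigcup => [k|k]; first by apply: measurable_Borel; exact: measurable_cptE.
have /integrableP[h _] : (@leb R n).-integrable (cptE r k.+1%:R^-1) (fun z => (f z)%:E).
  by apply: Hf; [exact: compact_cptE|apply: cptE_sub; rewrite invr_gt0].
exact/measurable_EFinP.
Qed.

Lemma L1locS (E E' : set 'rV[R]_n) (f : 'rV[R]_n -> R) : E `<=` E' -> L1loc E' f -> L1loc E f.
Proof. by move=> EE Hf K cK KE; apply: Hf => //; exact: subset_trans EE. Qed.

Lemma adm_test r chi : adm Gamma x0 r chi -> test_fun (setE0 r) chi.
Proof.
move=> [cchi [e e0 He]]; apply: (@test_funI _ _ _ _ (cptE r e) (enorm x0 + 2 * r)).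
- exact: cchi.1.
- by apply: compact_closed; [exact: norm_hausdorff|exact: compact_cptE].
- exact: cptE_sub.
- move=> z [z1 _] /=; have := enorm_tri z x0 0; rewrite !subr0; move: z1 e0 => /= ? ? ?; lra.
- by move=> z zE; apply/eqP/negPn/negP => /He.
Qed.

Lemma adm0_test r phi : adm0 x0 r phi -> test_fun (eball x0 (2 * r)) phi.
Proof.
move=> [cphi [e e0 He]]; apply: (@test_funI _ _ _ _ [set z | enorm (z - x0)
  <= 2 * r - e] (enorm x0 + 2 * r)).
- exact: cphi.1.
- exact: closed_cball.
- by move=> z /= h; rewrite /eball/=; lra.
- by move=> z /= z1; have := enorm_tri z x0 0; rewrite !subr0; lra.
- by move=> z zE; apply/eqP/negPn/negP => /He.
Qed.

(** Translated kernels are among the test functions, so all mollifications of [f] vanish, while they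
    converge to [f] in L^1. *)
Lemma Iable_ae0 (f : 'rV[R]_n -> R) (s : R) : Iable f -> (forall z, s < enorm z -> f z = 0) ->
  (forall psi, cc psi -> RI (fun z => f z * psi z) = 0) -> exists N, [/\ measurable (N : set X),
    mu N = 0%E & forall z, ~ N z -> f z = 0].
Proof.
move=> If fs fpsi; have mff := Iable_mf If.
have f0 : II (fun z => `|f z|) = 0%E.
  apply/eqP; rewrite eq_le II_ge0// andbT; apply/lee_addgt0Pr => e e0; rewrite add0e.
  have [t t0 Ht] := conv_L1 n0 If fs e0.
  have t20 : 0 < t / 2 by rewrite divr_gt0.
  apply: le_trans (Ht (t / 2) t20 _); last by rewrite ltr_pdivrMr// ltr_pMr// ltr1n.
  rewrite le_eqVlt; apply/orP; left; apply/eqP; apply: II_eq => z;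
    rewrite /conv fpsi ?sub0r ?normrN//.
  have -> : (fun y => rho (t / 2) (y - z)) = (fun y => rho (t / 2) (y + - z)) by [].
  by apply: cc_shift; exact: cc_rho.
have : ae_eq mu setT (fun z : X => (f z)%:E) (cst 0%E).
  by apply/ae_eq_integral_abs => //; exact: mf_EFin.
move=> [N [mN N0 HN]]; exists N; split => // z Nz.
apply: contrapT => fz; apply: Nz; apply: HN => /= /(_ Logic.I) [] //.
Qed.

Variable u : 'rV[R]_n -> R.

Lemma adm0_cut r s : s < 2 * r -> exists2 phi, adm0 x0 r phi & forall z, enorm (z - x0) < s ->
  phi z = 1.
Proof.
move=> sr; have [C CC HC] := cutoff n0 (R := R).
pose e := (2 * r - s) / 4; have e0 : 0 < e by rewrite /e; lra.
have DM : eball x0 (s + e) `<=` eball 0 (enorm x0 + (s + e)).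
  by move=> z; rewrite /eball/= subr0; have := enorm_tri z x0 0; rewrite !subr0; lra.
have mD : measurable (eball x0 (s + e) : set X) by exact: measurable_eball.
have [eta [se e01 pe e1 ez]] := HC _ _ _ e0 mD DM.
have supp z : eta z != 0 -> enorm (z - x0) <= 2 * r - e.
  move=> tz; have [y yz ty] : exists2 y, eball z e y & eball x0 (s + e) y.
    apply: contrapT => H; move/eqP: tz; apply; apply: ez => y yz Dy; apply: H; by exists y.
  have := enorm_tri z y x0; rewrite (enorm_distC z y).
  by move: yz ty; rewrite /eball/= /e => ? ? ?; lra.
exists eta.
  split; last by exists e.
  split => //; exists (enorm x0 + 2 * r) => z zr; apply/eqP/negPn/negP => /supp h.
  by have := enorm_tri z x0 0; rewrite !subr0; move: zr h e0 => ? ? ? ?; lra.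
move=> z zr; apply: e1 => y yz; have := enorm_tri y z x0.
by move: yz zr; rewrite /eball/= => ? ? ?; lra.
Qed.

Variables (r : R) (N : set 'rV[R]_n).
Hypotheses (r0 : 0 < r) (mN : measurable (N : set X)) (N0 : mu N = 0%E) (GN : Gamma `<=` N).
Local Notation J := (\1_(setE0 r `\` N) : 'rV[R]_n -> R).

Lemma J1 z : setE0 r z -> ~ N z -> J z = 1.
Proof. by move=> h1 h2; rewrite indicE mem_set. Qed.

Lemma J0 z : ~ setE0 r z -> J z = 0.
Proof. by move=> h; rewrite indicE memNset// => -[]. Qed.

Lemma Iable_loc f chi : L1loc (setE0 r) f -> mf (fun z => f z * J z) -> adm Gamma x0 r chi ->
  Iable (fun z => chi z * (f z * J z)).
Proof.
move=> Lf mfJ achi; have [cchi [e e0 He]] := achi; have [P P0 pP] := cc_bounded cchi.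
have mK := measurable_cptE r e; have mchi := mf_smooth cchi.1.
have mIK : mf (\1_(cptE r e)) by exact: mf_indic.
have IK : Iable (fun z => f z * J z * \1_(cptE r e) z).
  apply: (@Iable_Borel_version _ _ (cptE r e) N f) => //.
  - by meas_auto.
  - by move=> z Kz Nz; rewrite J1//; [rewrite indicE mem_set// !mulr1|exact: cptE_sub e0 z Kz].
  - by move=> z Kz; rewrite (indicE _ (cptE r e)) memNset// mulr0.
  - by apply: Lf; [exact: compact_cptE|exact: cptE_sub].
have := Iable_mulb IK mchi pP; congr Iable; apply/funext => z.
have [->|cz] := eqVneq (chi z) 0; first by rewrite mulr0 mul0r.
by rewrite (indicE _ (cptE r e)) mem_set ?mulr1 1?mulrC//; exact: He.
Qed.

Lemma RI_test f E phi : setE0 r `<=` E -> measurable (E : set X) -> mf (fun z => f z * J z) ->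
  mf phi -> (forall z, ~ setE0 r z -> phi z = 0) ->
  \int[@leb R n]_(z in E) (f z * phi z) = RI (fun z => f z * J z * phi z).
Proof.
move=> EE mE mfJ mphi phi0; apply: (@Rintegral_Borel_version _ _ E N) => //; first by meas_auto.
  move=> z Ez Nz; have [zE|zE] := pselect (setE0 r z); first by rewrite J1// mulr1.
  by rewrite phi0// !mulr0.
by move=> z zE; rewrite J0 ?mulr0 ?mul0r// => /EE.
Qed.

(** The distributional identity for [u] is tested with [psi * chi]: the factor [chi] makes it
    admissible, whatever the support of [psi]. *)
Lemma wg_of_weak (g : 'rV[R]_n -> 'rV[R]_n) chi : weak_grad (setE0 r) u g ->
  mf (fun z => u z * J z) ->
  (forall i, mf (fun z => g z 0 i * J z)) -> adm Gamma x0 r chi ->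
  WG (fun z => chi z * (u z * J z)) (fun z => chi z *: (J z *: g z) + (u z * J z) *: grad chi z).
Proof.
move=> [Lu Lg Hw] muJ mgJ achi; have [cchi _] := achi.
have Ii i : Iable (fun z => chi z * (g z 0 i * J z)) by exact: Iable_loc.
have Ip i : Iable (fun z => partial i chi z * (u z * J z)) by apply: Iable_loc => //;
  exact: adm_partial.
have GE i : (fun z => (chi z *: (J z *: g z) + (u z * J z) *: grad chi z) 0 i)
  = fun z => chi z * (g z 0 i * J z) + partial i chi z * (u z * J z).
  by apply/funext => z; rewrite !mxE; ring.
split; [exact: Iable_loc|by move=> i; rewrite GE; exact: IableD|].
move=> psi cpsi i; rewrite (_ : (fun z => _ * psi z) = fun z => (chi z * (g z 0 i * J z)
  + partial i chi z * (u z * J z)) * psi z); last first.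
  by apply/funext => z; have /= -> := congr1 (@^~ z) (GE i).
have tst : test_fun (setE0 r) (fun z => psi z * chi z) by apply: test_funM;
  [case: cpsi|exact: adm_test].
have mm := mf_smooth (smooth_mul cpsi.1 cchi.1).
have mp : mf (partial i (fun z => psi z * chi z)).
  by apply: mf_smooth; apply: smooth_partial; apply: smooth_mul; [case: cpsi|case: cchi].
have := Hw _ tst i.
rewrite (@RI_test u (setE0 r) _ (fun z h => h) (measurable_setE0 r) muJ mp); last by move=> z zE;
  exact: test_fun_partial0 tst zE.
rewrite (@RI_test (fun z => g z 0 i) (setE0 r) _ (fun z h => h) (measurable_setE0 r) (mgJ i) mm);
  last by exact: test_fun_cont tst.
have [Q Q0 pQ] := cc_bounded cpsi; have [Q' Q'0 pQ'] := cc_bounded (cc_partial i cpsi).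
have mpsi : mf psi by apply: mf_smooth; case: cpsi.
have mppsi : mf (partial i psi) by apply: mf_smooth; apply: smooth_partial; case: cpsi.
have I1 := Iable_mulb (Iable_loc Lu muJ achi) mppsi pQ'.
have I2 := Iable_mulb (Ip i) mpsi pQ.
have I3 := Iable_mulb (Ii i) mpsi pQ.
rewrite (_ : (fun z => _ * partial i _ z) = fun z => chi z * (u z * J z)
  * partial i psi z + partial i chi z * (u z * J z) * psi z); last first.
  by apply/funext => z; rewrite (partial_mul _ _ cpsi.1 cchi.1); ring.
rewrite (_ : (fun z => g z 0 i * J z * _) = fun z => chi z * (g z 0 i * J z) * psi z);
  last by apply/funext => z; ring.
rewrite (_ : (fun z => (_ + _) * psi z) = fun z => chi z * (g z 0 i * J z)
  * psi z + partial i chi z * (u z * J z) * psi z); last by apply/funext => z; ring.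
by rewrite !RID// => h; rewrite opprD -h; ring.
Qed.

Lemma setE0_half s z : s <= 2 * r -> setE0 (s / 2) z -> setE0 r z.
Proof.
move=> sr [zs Gz]; split => //; move: zs; rewrite /eball/=.
by rewrite mulrC divfK// => h; exact: lt_le_trans sr.
Qed.

(* Only the product [phi * u] is assumed to have a gradient of finite energy, so this gradient
   has to be identified with the one of [u]. *)
Lemma grad_unique s (phi : 'rV[R]_n -> R) (g g' : 'rV[R]_n -> 'rV[R]_n) i : s <= 2 * r ->
  weak_grad (setE0 r) u g -> weak_grad (~` Gamma) (fun z => phi z * u z) g' ->
  mf phi -> mf (fun z => u z * J z) -> mf (fun z => g z 0 i * J z) -> mf (fun z => g' z 0 i * J z)
    ->
  (forall z, enorm (z - x0) < s -> phi z = 1) ->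
  exists N', [/\ measurable (N' : set X), mu N' = 0%E &
    forall z, ~ N' z -> enorm (z - x0) < s -> ~ Gamma z -> g z 0 i * J z = g' z 0 i * J z].
Proof.
move=> sr [Lu Lg Hw] [Lu' Lg' Hw'] mphi muJ mgJ mgJ' phi1.
have EG : setE0 r `<=` ~` Gamma by move=> z [].
have s2 : 2 * (s / 2) = s by rewrite mulrC divfK.
have sub z : setE0 (s / 2) z -> setE0 r z by exact: setE0_half.
have key chi : adm Gamma x0 (s / 2) chi -> exists N', [/\ measurable (N' : set X), mu N' = 0%E &
    forall z, ~ N' z -> chi z * (g z 0 i * J z - g' z 0 i * J z) = 0].
  move=> achi; have achi' : adm Gamma x0 r chi.
    have [cchi [e e0 He]] := achi; split => //; exists e => // z /He[]; rewrite s2 => h1 h2;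
      split => //.
    by apply: le_trans h1 _; rewrite lerD2r.
  have [cchi _] := achi.
  have I1 : Iable (fun z => chi z * (g z 0 i * J z)) by exact: Iable_loc.
  have I2 : Iable (fun z => chi z * (g' z 0 i * J z)).
    by apply: (@Iable_loc (fun z => g' z 0 i)) => //; apply: L1locS (Lg' i).
  have := @Iable_ae0 (fun z => chi z * (g z 0 i * J z - g' z 0 i * J z)) (enorm x0 + 2 * r).
  apply.
  - by have := IableB I1 I2; congr Iable; apply/funext => z; rewrite mulrBr.
  - by move=> z zr; rewrite (adm0_far (adm_adm0 achi') zr) mul0r.
  move=> psi cpsi.
  have tst : test_fun (setE0 (s / 2)) (fun z => psi z * chi z) by apply: test_funM;
    [case: cpsi|exact: adm_test].
  have tst1 := test_funW sub tst; have tst2 := test_funW EG tst1.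
  have mm := mf_smooth (smooth_mul cpsi.1 cchi.1).
  have mp : mf (partial i (fun z => psi z * chi z)).
    by apply: mf_smooth; apply: smooth_partial; apply: smooth_mul; [case: cpsi|case: cchi].
  have m0 z : ~ setE0 r z -> psi z * chi z = 0 by exact: test_fun_cont tst1 z.
  have p0 z : ~ setE0 r z -> partial i (fun z => psi z * chi z) z = 0 by move=> h;
    exact: test_fun_partial0 tst1 h.
  have mGc : measurable (~` Gamma : set X) by apply: measurableC; exact: measurable_closed.
  have mpu : mf (fun z => phi z * u z * J z).
    by have := mfM mphi muJ; congr mf; apply/funext => z; rewrite mulrA.
  have e1 := Hw _ tst1 i; have e2 := Hw' _ tst2 i.
  rewrite (@RI_test u _ _ (fun z h => h) (measurable_setE0 r) muJ mp p0) in e1.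
  rewrite (@RI_test (fun z => g z 0 i) _ _ (fun z h => h) (measurable_setE0 r) mgJ mm m0) in e1.
  rewrite (@RI_test (fun z => phi z * u z) _ _ EG mGc mpu mp p0) in e2.
  rewrite (@RI_test (fun z => g' z 0 i) _ _ EG mGc mgJ' mm m0) in e2.
  (* On the support of the test function [phi] is 1, so both distributional identities have the same
     left-hand side. *)
  have e3 : (fun z => phi z * u z * J z * partial i (fun z0 => psi z0 * chi z0) z)
    = (fun z => u z * J z * partial i (fun z0 => psi z0 * chi z0) z).
    apply/funext => z; have [zE|zE] := pselect (setE0 (s / 2) z).
      by rewrite phi1 ?mul1r//; case: zE; rewrite /eball/= s2.
    by rewrite (test_fun_partial0 i tst zE) !mulr0.
  rewrite e3 e1 in e2; have [Q Q0 pQ] := cc_bounded cpsi.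
  have mpsi : mf psi by apply: mf_smooth; case: cpsi.
  have J1 := Iable_mulb I1 mpsi pQ; have J2 := Iable_mulb I2 mpsi pQ.
  rewrite (_ : (fun z => _ * psi z) = fun z => chi z * (g z 0 i * J z)
    * psi z - chi z * (g' z 0 i * J z) * psi z); last by apply/funext => z; ring.
  rewrite RIB//; move: e2 => /oppr_inj.
  rewrite (_ : (fun z => g z 0 i * J z * _) = fun z => chi z * (g z 0 i * J z) * psi z);
    last by apply/funext => z; ring.
  rewrite (_ : (fun z => g' z 0 i * J z * _) = fun z => chi z * (g' z 0 i * J z) * psi z);
    last by apply/funext => z; ring.
  by move=> ->; rewrite subrr.
(* Countably many cut-offs, equal to 1 on a compact exhaustion, so that their exceptional sets unite
   to one null set. *)
have [chi Hchi] : exists chi : nat -> 'rV[R]_n -> R, forall k, adm Gamma x0 (s / 2) (chi k) /\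
    forall z, enorm (z - x0) <= s - k.+1%:R^-1 -> k.+1%:R^-1 <= delta z -> chi k z = 1.
  have : forall k, exists chi, adm Gamma x0 (s / 2) chi /\ forall z, enorm (z - x0)
    <= s - k.+1%:R^-1 -> k.+1%:R^-1 <= delta z -> chi z = 1.
    move=> k; have e0 : 0 < k.+1%:R^-1 :> R by rewrite invr_gt0.
    have [c ac c1] := adm_cut n0 G0 x0 (s / 2) e0; exists c; split => // z h1 h2.
    by apply: c1 => //; rewrite s2.
  by move=> /choice[c Hc]; exists c.
have [Nk HN] := choice (fun k => key (chi k) (Hchi k).1).
exists (\bigcup_k Nk k); split.
- by apply: bigcupT_measurable => k; have [] := HN k.
- by apply: mu_bigcup0 => k; have [] := HN k.
move=> z Nz zs Gz.
have : setE0 (s / 2) z by split => //; rewrite /eball/= s2.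
rewrite setE0_bigcup => -[k _ [/= z1 z2]]; rewrite s2 in z1.
have [_ _ h] := HN k; have := h z; rewrite (Hchi k).2// mul1r => h2.
by apply/eqP; rewrite -subr_eq0; apply/eqP; apply: h2 => Nkz; apply: Nz; exists k.
Qed.

End reduction.

Section reduction2.
Context {R : realType} {n : nat}.
Variables d C0 C1 : R.
Hypotheses (n0 : (0 < n)%N) (d0 : 0 < d) (dn : d < n%:R - 1) (C01 : 1 <= C0) (C1_ge1 : 1 <= C1).
Local Notation X := (bT R n).
Local Notation L := (lebT R n).
Local Notation mu := (@mu R n).
Variable Gamma : set 'rV[R]_n.
Hypotheses (G0 : Gamma !=set0) (cG : closed Gamma) (AR : ahlfors_regular d C0 Gamma).
Local Notation delta := (dist Gamma).
Local Notation w := (weight d Gamma).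
Variable x0 : 'rV[R]_n.
Hypothesis Gx0 : Gamma x0.
Variables (u : 'rV[R]_n -> R) (g : 'rV[R]_n -> 'rV[R]_n) (A : 'rV[R]_n -> 'M[R]_n).
Variables (r : R) (N : set 'rV[R]_n).
Hypotheses (r0 : 0 < r) (mN : measurable (N : set X)) (N0 : mu N = 0%E) (GN : Gamma `<=` N).
Local Notation E0 := (setE0 Gamma x0 r).
Local Notation J := (\1_(E0 `\` N) : 'rV[R]_n -> R).
Hypotheses (HWr : Wr d Gamma (eball x0 (2 * r)) u) (Hw : weak_grad E0 u g).
Hypotheses (muJ : mf (fun z => u z * J z)) (mgJ : forall i, mf (fun z => g z 0 i * J z)).
Hypothesis mAJ : forall i j, mf (fun z => A z i j * J z).

Lemma mu_U0 (B B' : set 'rV[R]_n) : measurable (B : set X) -> measurable (B' : set X) ->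
  mu B = 0%E -> mu B' = 0%E -> mu (B `|` B') = 0%E.
Proof. by move=> mB mB' B0 B0'; apply/eqP; rewrite eq_le measure_ge0 andbT;
  apply: le_trans (mu_U2 mB mB') _; rewrite B0 B0' adde0. Qed.

(** For a cut-off [phi] equal to 1 on the ball of radius [s], [Wr] gives [phi * u] a gradient [g']
    of finite energy; [grad_unique] identifies it with [g] on that ball. *)
Lemma energy_loc s : s < 2 * r ->
  exists b : R, (II (fun z => Bl x0 s z * (enorm (J z *: g z) ^+ 2 * w z))%R <= b%:E)%E.
Proof.
move=> sr; have [_ HW] := HWr; have [phi aphi phi1] := adm0_cut n0 x0 sr.
have [g' [Hw' Ig']] := HW phi (adm0_test aphi).
have [_ Lg' _] := Hw'; have EG : E0 `<=` ~` Gamma by move=> z [].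
have mphi : mf phi by apply: mf_smooth; case: aphi => -[].
have mE0 := measurable_setE0 cG x0 r.
have HB i := Borel_version mE0 (L1loc_measurable G0 cG (L1locS EG (Lg' i))).
have [Nk HN] := choice HB.
have [N1 [mN1 N10 NN1]] : exists N1, [/\ measurable (N1 : set X), mu N1 = 0%E & forall i,
  Nk i `<=` N1].
  by apply: null_union => i; have [] := HN i.
pose N2 := N `|` N1; have mN2 : measurable (N2 : set X) by exact: measurableU.
have N20 : mu N2 = 0%E by exact: mu_U0.
have JJ z : \1_(E0 `\` N2) z = J z * \1_(~` N1) z :> R.
  have -> : E0 `\` N2 = (E0 `\` N) `&` ~` N1 by rewrite /N2 setDE setCU setIA -setDE.
  by rewrite indicI.
have m1 : mf (\1_(~` N1)) by apply: mf_indic; exact: measurableC.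
have muJ2 : mf (fun z => u z * \1_(E0 `\` N2) z).
  by have := mfM muJ m1; congr mf; apply/funext => z; rewrite JJ mulrA.
have mgJ2 i : mf (fun z => g z 0 i * \1_(E0 `\` N2) z).
  by have := mfM (mgJ i) m1; congr mf; apply/funext => z; rewrite JJ mulrA.
have mgJ2' i : mf (fun z => g' z 0 i * \1_(E0 `\` N2) z).
  by have [_ _ h] := HN i; apply: h => // z Nz; right; exact: NN1 Nz.
have U i := grad_unique n0 G0 cG mN2 N20 (ltW sr) Hw Hw' mphi muJ2 (mgJ2 i) (mgJ2' i) phi1.
have [Nu HNu] := choice U.
have [N3 [mN3 N30 NN3]] : exists N1, [/\ measurable (N1 : set X), mu N1 = 0%E & forall i,
  Nu i `<=` N1].
  by apply: null_union => i; have [] := HNu i.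
pose N4 := N2 `|` N3; have mN4 : measurable (N4 : set X) by exact: measurableU.
have N40 : mu N4 = 0%E by exact: mu_U0.
have mB := mf_Bl x0 s; have mw := mf_weight d G0.
have mgn : mf (fun z => enorm (J z *: g z)).
  apply: mf_enormG => i; have := mgJ i; congr mf; apply/funext => z; rewrite mxE mulrC//.
have IB : Iable (fun z => Bl x0 s z * (enorm (J z *: g z) ^+ 2 * w z)).
  have mEs := measurable_setE0 cG x0 (s / 2).
  have s2 : 2 * (s / 2) = s by rewrite mulrC divfK.
  apply: (@Iable_Borel_version _ _ (setE0 Gamma x0 (s / 2)) N4 (fun z => enorm (g' z) ^+ 2 * w z))
    => //.
  - by meas_auto.
  - move=> z [zs Gz] Nz; move: zs; rewrite /eball/= s2 => zs.
    rewrite /Bl zs mul1r; congr (enorm _ ^+ 2 * _); apply/rowP => i; rewrite mxE.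
    have zE : E0 z by apply: (setE0_half (s := s)); [exact: ltW|split => //; rewrite /eball/= s2].
    have [_ _ h] := HNu i; have := h z (fun Nz' => Nz (or_intror (NN3 i z Nz'))) zs Gz.
    have nN2 : ~ N2 z by move=> h2; apply: Nz; left.
    by rewrite !indicE !mem_set ?mulr1 ?mul1r//; split => // h2; apply: nN2; left.
  - move=> z zE; have [Gz|Gz] := pselect (Gamma z).
      by rewrite (weight_Gamma _ dn)// !mulr0 || rewrite J0 ?scale0r ?enorm0 ?expr0n ?mul0r
        ?mulr0// => -[].
    rewrite /Bl; case: ltP => [zs|_]; last by rewrite mul0r.
    by exfalso; apply: zE; split => //; rewrite /eball/= s2.
  - apply: (integrableS (measurable_Borel _) (measurable_Borel _) _ Ig') => //.
      by apply: measurableC; exact: measurable_closed.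
    by move=> z [].
exists (RI (fun z => Bl x0 s z * (enorm (J z *: g z) ^+ 2 * w z))); apply: II_le_RI => // z; nonneg.
Qed.

(** Small balls around [xi] stay inside 2B, where [u] and its Borel version agree off a null set, so
    the averages coincide. *)
Lemma trace_loc xi : enorm (xi - x0) < 2 * r -> has_trace u xi 0 -> trace0 (fun z => u z * J z) xi.
Proof.
move=> xr Htr e e0; have := (cvgrPdist_le _ _).1 Htr e e0.
move=> [s1 /= s10 H]; exists (Num.min s1 (2 * r - enorm (xi - x0)));
  first by rewrite lt_min s10 subr_gt0.
move=> s s0; rewrite lt_min => /andP[ss1 sr].
have := H s; rewrite /= sub0r normrN gtr0_norm// => /(_ ss1 s0); rewrite sub0r normrN.
congr (`|_| <= _); rewrite /avg /ballavg.
have mE := measurable_eball xi s; have mB := mf_Bl xi s.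
have -> : @leb R n (eball xi s) = (@ball_vol R n s)%:E.
  rewrite -(II_Bl xi (ltW s0)) /Bl II_bool; last exact: mE.
  exact: leb_Borel.
congr (_ * _); apply: (@Rintegral_Borel_version _ _ _ N) => //; first by meas_auto.
  move=> z zs Nz; rewrite /Bl zs mulr1 J1 ?mulr1//; split; last by move=> /GN.
  by have := enorm_tri z xi x0; move: zs sr; rewrite /eball/= => ? ? ?; lra.
by move=> z zs; rewrite /Bl (negbTE (introN idP zs)) mulr0.
Qed.

Lemma trace_null : zero_trace d Gamma (eball x0 (2 * r)) u ->
  hausdorff d [set xi | [/\ Gamma xi, enorm (xi - x0) < 2 * r & ~ trace0 (fun z => u z * J z)
    xi]] = 0%E.
Proof.
move=> H; apply/eqP; rewrite eq_le hausdorff_ge0// andbT -H /sigma;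
  apply: hausdorffS => // xi [Gxi xr ntr].
by split => //; split => // Ht; apply: ntr; exact: trace_loc.
Qed.

(** Set to 0 off the domain and on [N]: this makes it Borel and extends the bounds [flux_le] and
    [flux_ge] to the whole space. *)
Definition flux z : 'rV[R]_n := J z *: mxapp (A z) (g z).

Hypothesis HA : elliptic d Gamma C1 A.

Lemma mf_flux i : mf (fun z => flux z 0 i).
Proof.
rewrite (_ : (fun z => _) = fun z => \sum_j (g z 0 j * J z) * (A z i j * J z)).
  apply: mf_sum => j; exact: mfM.
apply/funext => z; rewrite /flux /mxapp !mxE mulr_sumr; apply: eq_bigr => j _; rewrite mxE.
have [zE|zE] := pselect ((E0 `\` N) z); first by rewrite indicE mem_set// !mulr1 mul1r.
by rewrite indicE memNset// !(mulr0, mul0r).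
Qed.

Lemma flux_out z : ~ (E0 `\` N) z -> flux z = 0 /\ J z *: g z = 0.
Proof. by move=> h; rewrite /flux indicE memNset// !scale0r. Qed.

Lemma flux_in z : (E0 `\` N) z -> flux z = mxapp (A z) (g z) /\ J z *: g z = g z.
Proof. by move=> h; rewrite /flux indicE mem_set// !scale1r. Qed.

(** Take the vector A g itself as [zeta] in the ellipticity bound and divide by its norm. *)
Lemma flux_le z : enorm (flux z) <= C1 * w z * enorm (J z *: g z).
Proof.
have [zE|/flux_out[-> ->]] := pselect ((E0 `\` N) z); last by rewrite enorm0 mulr0.
have [-> ->] := flux_in zE; have [[_ Gz] _] := zE; have [_ h _] := HA.
set v := mxapp _ _; have := h z (g z) v Gz; rewrite -/v -enorm_sqr.
rewrite ger0_norm ?sqr_ge0// expr2; have [->|v0] := eqVneq (enorm v) 0.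
  by move=> _; rewrite mulr_ge0 ?enorm_ge0// mulr_ge0 ?weight_ge0// (le_trans ler01).
by rewrite ler_pM2r// lt_neqAle eq_sym v0 enorm_ge0.
Qed.

Lemma flux_ge z : C1^-1 * w z * enorm (J z *: g z) ^+ 2 <= dot (flux z) (J z *: g z).
Proof.
have [zE|/flux_out[-> ->]] := pselect ((E0 `\` N) z); last first.
  by rewrite enorm0 expr0n mulr0 /dot big1// => i _; rewrite !mxE mul0r.
by have [-> ->] := flux_in zE; have [[_ Gz] _] := zE; have [_ _ h] := HA; exact: h.
Qed.

Lemma flux_sub chi : (forall phi, test_fun E0 phi -> (forall z, 0 <= phi z) ->
      \int[@leb R n]_(z in ~` Gamma) dot (mxapp (A z) (g z)) (grad phi z) <= 0) ->
  adm Gamma x0 r chi -> (forall z, 0 <= chi z) -> RI (fun z => dot (flux z) (grad chi z)) <= 0.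
Proof.
move=> H achi chi0; have tst := adm_test G0 achi; have [cchi _] := achi.
have := H chi tst chi0; congr (_ <= _).
have mGc : measurable (~` Gamma : set X) by apply: measurableC; exact: measurable_closed.
apply: (@Rintegral_Borel_version _ _ _ N) => //.
- by apply: mf_sum => i; apply: mfM; [exact: mf_flux|exact: mf_grad].
- move=> z Gz Nz; have [zE|zE] := pselect (E0 z); first by have [] := flux_in (conj zE Nz) => -> _.
  rewrite /dot; apply: eq_bigr => i _; by rewrite [grad _ _ _ _]mxE (test_fun_partial0 i tst zE)
    !mulr0.
- by move=> z zG; have [|-> _] := @flux_out z; [move=> [[]]|rewrite /dot big1// => i _;
  rewrite mxE mul0r].
Qed.

End reduction2.

(** Finite by [weight_integral]; positive because [Gamma] is a null set and [w] is bounded below on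
    the rest of the ball. *)
Lemma wmeas_bounds (R : realType) (n : nat) (d C0 : R) (Gamma : set 'rV[R]_n) x (r : R)
  : (0 < n)%N -> 0 < d -> d < n%:R - 1 -> 1 <= C0 ->
  Gamma !=set0 -> closed Gamma -> ahlfors_regular d C0 Gamma -> Gamma x -> 0 < r ->
  exists2 m, wmeas d Gamma (eball x (2 * r)) = m%:E & 0 < m <= @wint_cst R n d C0 * (2 * r)
    `^ (d + 1).
Proof.
move=> n0 d0 dn C01 G0 cG AR Gx r0; have r20 : 0 < 2 * r by rewrite mulr_gt0.
have mB := mf_Bl x (2 * r); have mw := mf_weight d G0; have mE := measurable_eball x (2 * r).
have mu00 : mu (set0 : set 'rV[R]_n) = 0%E by exact: measure0.
have eI : wmeas d Gamma (eball x (2 * r)) = II (fun z => Bl x (2 * r) z * weight d Gamma z).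
  apply: (integral_Borel_version mE (N := set0)) => //; first by meas_auto.
    by move=> z zr _; rewrite /Bl zr mul1r.
  by move=> z zr; rewrite /Bl (negbTE (introN idP zr)) mul0r.
have ub := weight_integral d0 dn C01 G0 cG AR Gx r20.
have I0 : (0 <= II (fun z => Bl x (2 * r) z * weight d Gamma z)%R)%E by apply: II_ge0 => z; nonneg.
have lb : (0 < II (fun z => Bl x (2 * r) z * weight d Gamma z)%R)%E.
  have mE0 := measurable_setE0 cG x r; have mI : mf (\1_(setE0 Gamma x r)) by exact: mf_indic.
  have p0 : 0 < (2 * r) `^ (d + 1 - n%:R) by rewrite powR_gt0.
  apply: (@lt_le_trans _ _ (II (fun z => (2 * r) `^ (d + 1 - n%:R) * \1_(setE0 Gamma x r) z))).
    rewrite II_scale ?(ltW p0)//.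
    rewrite mule_gt0 ?lte_fin// II_indic//.
    apply: (@lt_le_trans _ _ (mu (eball x (2 * r)))).
      have -> : mu (eball x (2 * r)) = (@ball_vol R n (2 * r))%:E.
        by rewrite -(II_Bl x (ltW r20)) /Bl II_bool; last exact: mE.
      by rewrite lte_fin; exact: ball_vol_gt0.
    have mG : measurable (Gamma : set (bT R n)) by exact: measurable_closed.
    apply: le_trans (_ : mu (setE0 Gamma x r `|` Gamma) <= _)%E.
      apply: mu_le => //; last exact: measurableU.
      by move=> z zr; have [Gz|Gz] := pselect (Gamma z); [right|left].
    by apply: le_trans (mu_U2 mE0 mG) _; rewrite (mu_Gamma d0 dn C01 G0 cG AR) adde0.
  apply: II_le; [by meas_auto|by meas_auto|by move=> z; apply: mulr_ge0;
    [exact: ltW|rewrite indicE]|move=> z].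
  have [zE|zE] := pselect (setE0 Gamma x r z); last by rewrite indicE memNset// mulr0; nonneg.
  rewrite indicE mem_set// mulr1 /Bl; have [-> _] := zE; rewrite mul1r.
  exact: (weight_lbE dn G0 cG Gx zE).
move: ub lb I0 eI; rewrite -/(Bl x (2 * r)); case: (II _) => [m ub lb _ eI| |] //.
by exists m => //; rewrite -!lte_fin -lee_fin lb.
Qed.

Theorem lemma8p12 (R : realType) (n : nat) (d C0 C1 : R) (hn : (2 <= n)%N)
    (hd0 : 0 < d) (hdn : d < n%:R - 1) (hC0 : 1 <= C0) (hC1 : 1 <= C1) :
  exists C : R, 0 < C /\
    forall (Gamma : set 'rV[R]_n) (A : 'rV[R]_n -> 'M[R]_n)
           (x : 'rV[R]_n) (r : R) (u : 'rV[R]_n -> R),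
      Gamma !=set0 -> closed Gamma -> ahlfors_regular d C0 Gamma ->
      elliptic d Gamma C1 A ->
      Gamma x -> 0 < r ->
      Wr d Gamma (eball x (2 * r)) u ->
      (\forall z \ae @leb R n, eball x (2 * r) z -> 0 <= u z) ->
      subsolution d Gamma A (eball x (2 * r) `\` Gamma) u ->
      zero_trace d Gamma (eball x (2 * r)) u ->
      (ess_sup_on (eball x r) u <=
        C%:E * ((wmeas d Gamma (eball x (2 * r)))^-1 *
                \int[@leb R n]_(z in eball x (2 * r))
                  (u z ^+ 2 * weight d Gamma z)%:E) `^ 2^-1)%E.
Proof.
have n0 : (0 < n)%N by exact: ltnW.
have [Cc Cc0 Hcut] := cutoff n0 (R := R).
(* Both constants are fixed before [Gamma] and the ball. Up to a small surplus the iteration gives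
   K^2 = a r^(-(d+1)) I with I the weighted energy, and m(2B) <= b r^(d+1); the powers of r cancel
   and leave a b I / m(2B). *)
pose a := @dg_A R n d C0 C1 Cc; have a0 : 0 < a by exact: dg_A_gt0.
pose b := @wint_cst R n d C0 * 2 `^ (d + 1).
have b0 : 0 < b by rewrite mulr_gt0// ?powR_gt0//; exact: wint_cst_gt0.
exists (Num.sqrt (a * b)); split; first by rewrite sqrtr_gt0 mulr_gt0.
move=> Gamma A x r u G0 cG AR HA Gx r0 HWr u0 [_ [g [Hw Hsub]]] Htr.
have EG : setE0 Gamma x r `<=` ~` Gamma by move=> z [].
have mE0 := measurable_setE0 cG x r; have [Lu Lg _] := Hw; have [mA _ _] := HA.
have mG : measurable (Gamma : set (bT R n)) by exact: measurable_closed.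
have [Nu [mNu Nu0 HNu]] := Borel_version mE0 (L1loc_measurable G0 cG Lu).
have [Ng HNg] := choice (fun i => Borel_version mE0 (L1loc_measurable G0 cG (Lg i))).
have mA0 ij : measurable_fun (setE0 Gamma x r : set (lebT R n)) (fun z => A z ij.1 ij.2).
  apply: measurable_funS (mA ij.1 ij.2) => //; apply: measurable_Borel; exact: measurableC.
have [NA HNA] := choice (fun ij => Borel_version mE0 (mA0 ij)).
have [Ng' [mNg' Ng0 HNg']] : exists N, [/\ measurable (N : set (bT R n)), mu N = 0%E & forall i,
  Ng i `<=` N].
  by apply: null_union => i; have [] := HNg i.
have [NA' [mNA' NA0 HNA']] : exists N, [/\ measurable (N : set (bT R n)), mu N = 0%E & forall i,
  NA i `<=` N].
  by apply: null_union => i; have [] := HNA i.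
have [Np [mNp Np0 HNp]] := ae_leb_null u0.
(* One null set for everything: [Gamma], the exceptional sets of [u], the gradient and [A], and the
   points where nonnegativity of [u] may fail. *)
pose N := Gamma `|` (Nu `|` (Ng' `|` (NA' `|` Np))).
have mN : measurable (N : set (bT R n)) by do 4! (apply: measurableU => //).
have N0 : mu N = 0%E.
  have muG := mu_Gamma hd0 hdn hC0 G0 cG AR.
  by do 4! (apply: mu_U0 => //; do ?(apply: measurableU => //)).
have GN : Gamma `<=` N by move=> z; left.
pose J : 'rV[R]_n -> R := \1_(setE0 Gamma x r `\` N).
have muJ : mf (fun z => u z * J z) by apply: HNu => // z ?; right; left.
have mgJ i : mf (fun z => g z 0 i * J z).
  by have [_ _ h] := HNg i; apply: h => // z /HNg' ?; right; right; left.
have mAJ i j : mf (fun z => A z i j * J z).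
  by have [_ _ h] := HNA (i, j); apply: h => // z /HNA' ?; right; right; right; left.
have uJ0 z : 0 <= u z * J z.
  rewrite /J indicE; have [zE|zE] := pselect ((setE0 Gamma x r `\` N) z);
    last by rewrite memNset// mulr0.
  rewrite mem_set// mulr1; have [[zx _] zN] := zE; apply: HNp => // h; apply: zN; by do 4! right.
have JE z : ~ in_domain Gamma x r z -> J z = 0 by move=> h; rewrite /J indicE memNset// => -[].
have [m -> /andP[m0 mb]] := wmeas_bounds n0 hd0 hdn hC0 G0 cG AR Gx r0.
have mw := mf_weight d G0.
have -> : (\int[@leb R n]_(z in eball x (2 * r)) (u z ^+ 2 * weight d Gamma z)%:E = II (fun z =>
  (u z * J z) ^+ 2 * weight d Gamma z)%R)%E.
  apply: (integral_Borel_version (measurable_eball _ _) mN N0); first by meas_auto.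
    move=> z zr zN; rewrite /J indicE mem_set ?mulr1//; split => //; split => // Gz; exact/zN/GN.
  by move=> z zr; rewrite JE ?mulr0 ?expr0n ?mul0r// => -[].
have : (0 <= II (fun z => (u z * J z) ^+ 2 * weight d Gamma z)%R)%E by apply: II_ge0 => z; nonneg.
(* If the energy is infinite so is the right-hand side, because m(2B) is finite and positive. *)
case EI : (II _) => [I| |] // I0; last first.
  rewrite inver gt_eqF// gt0_muley ?lte_fin ?invr_gt0// poweRyr ?invr_eq0//.
  by rewrite gt0_muley ?leey// lte_fin sqrtr_gt0 mulr_gt0.
rewrite lee_fin in I0.
have -> : (m%:E^-1 * I%:E)%E = (m^-1 * I)%:E by rewrite inver gt_eqF.
rewrite poweR_EFin -EFinM powR12_sqrt; last by rewrite mulr_ge0// invr_ge0 ltW.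
apply/lee_addgt0Pr => e e0; rewrite -EFinD.
pose p := a * r `^ (- (d + 1)); have p0 : 0 < p by rewrite mulr_gt0// powR_gt0.
(* The surplus [e] keeps [K] and the energy bound [K ^+ 2 / p] positive even when [I = 0], as the
   iteration demands; that bound is defined so that [KE] is an equality. *)
pose K := Num.sqrt (p * I) + e.
have pI0 : 0 <= p * I by rewrite mulr_ge0// ltW.
have K0 : 0 < K by rewrite /K ltr_wpDl// sqrtr_ge0.
have K2 : p * I <= K ^+ 2.
  by rewrite -(sqr_sqrtr pI0) ler_sqr ?nnegrE ?sqrtr_ge0 ?(ltW K0)// lerDl ltW.
have KE : K ^+ 2 = a * r `^ (- (d + 1)) * (K ^+ 2 / p) by rewrite -/p mulrCA divff ?mulr1// gt_eqF.
have Y0 : 0 < K ^+ 2 / p by rewrite divr_gt0// exprn_gt0.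
have HY : (II (fun z => (u z * J z) ^+ 2 * weight d Gamma z)%R <= (K ^+ 2 / p)%:E)%E.
  by rewrite EI lee_fin ler_pdivlMr// mulrC.
have mgB i : mf (fun z => (J z *: g z) 0 i).
  by have := mgJ i; congr mf; apply/funext => z; rewrite mxE mulrC.
have uE z : ~ in_domain Gamma x r z -> u z * J z = 0 by move=> h; rewrite JE// mulr0.
have gE z : ~ in_domain Gamma x r z -> J z *: g z = 0 by move=> h; rewrite JE// scale0r.
have HWG chi : adm Gamma x r chi -> WG (fun z => chi z * (u z * J z))
  (fun z => chi z *: (J z *: g z) + (u z * J z) *: grad chi z).
  exact: (wg_of_weak G0 cG mN N0 Hw muJ mgJ).
have Hg s : s < 2 * r -> exists b : R, (II (fun z => Bl x s z * (enorm (J z *: g z)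
  ^+ 2 * weight d Gamma z))%R <= b%:E)%E.
  exact: (energy_loc n0 G0 cG mN N0 HWr Hw muJ mgJ).
have dG := de_giorgi n0 hd0 hdn hC0 G0 cG AR Gx r0 muJ mgB uJ0 uE gE HWG Hg HY.
have {}dG := dG (flux Gamma x g A r N) C1 (trace_null mN N0 GN muJ Htr).
have {}dG := dG (mf_flux mgJ mAJ) hC1 (flux_le hC1 x g r N HA) (flux_ge x g r N HA).
have {}dG := dG (fun chi achi chi0 => flux_sub G0 cG mN N0 mgJ mAJ Hsub achi chi0)
  Cc Cc0 Hcut Y0 K K0 KE.
apply: (@le_trans _ _ K%:E); last first.
  have ab0 : 0 <= a * b by rewrite mulr_ge0// ltW.
  rewrite lee_fin /K lerD2r -(sqrtrM _ ab0); apply: ler_wsqrtr.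
  have -> : a * b * (m^-1 * I) = a * (b / m) * I by ring.
  rewrite /p ler_wpM2r// ler_wpM2l ?(ltW a0)// ler_pdivlMr// mulrC powRN -ler_pdivlMr ?invr_gt0
    ?powR_gt0// invrK.
  by move: mb; rewrite /b powRM ?(ltW r0)// mulrA.
apply: ereal_inf_lbound => /=; apply: ae_mu_leb.
have aeN : \forall z \ae @mu R n, ~ N z by exists N; split => // z /contrapT.
apply: filterS2 dG aeN => z h zN zr; rewrite lee_fin.
have zE : (setE0 Gamma x r `\` N) z.
  split => //; split; last by move=> Gz; exact/zN/GN.
  by move: zr; rewrite /eball/= => zr; move: zr r0 => ? ?; lra.
by have := h zr; rewrite /J indicE mem_set// mulr1.
Qed.
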